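(* Let $X_n$ be the final altitude of a random meander with catastrophes of length $n$, i.e. $\Pr(X_n=k)=[z^nu^k]F(z,u)/[z^n]F(z,1)$ with $F(z,u)=D(z)M(z,u)$. Then $X_n$ admits a discrete limit distribution: $\lim_{n\to\infty}\Pr(X_n=k)=[u^k]\,\omega(u)$, where \[ \omega(u)=\begin{cases}\displaystyle\prod_{\ell=1}^d\frac{1-v_\ell(\rho_0)}{u-v_\ell(\rho_0)} & \text{if } \rho_0\le\rho,\\[3mm] \displaystyle\frac{\eta D(\rho)+\frac{C}{\tau-u}}{\eta D(\rho)+\frac{C}{\tau-1}}\prod_{\ell=1}^d\frac{1-v_\ell(\rho)}{u-v_\ell(\rho)} & \text{if } \rho_0 \text{ does not exist},\end{cases} \] with $C=\sqrt{2P(\tau)/P''(\tau)}$.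
   Context: Fix integers $c,d\ge1$ and non-negative real weights $p_{-c},\dots,p_d$ with $p_{-c}\neq0\neq p_d$; jump set $\mathcal J=\{i: p_i\neq0\}$, jump polynomial $P(u)=\sum_{i=-c}^dp_iu^i$. Standing assumption: $P$ is aperiodic (there are no integer $b$, integer $p\ge2$ and Laurent polynomial $H$ with $P(u)=u^bH(u^p)$). A catastrophe is a step from an altitude $h>0$ with $-h\notin\mathcal J$ directly to altitude $0$, of weight $q>0$. Paths start at altitude $0$; each step is a jump $i\in\mathcal J$ (weight $p_i$) or a catastrophe; the weight of a path is the product of its step weights. Meanders never go below $0$; excursions are meanders ending at $0$. Let $M(z,u)=\sum m_{n,k}z^nu^k$, with $m_{n,k}$ the total weight of catastrophe-free meanders of length $n$ ending at altitude $k$; $M_k(z)=[u^k]M(z,u)$, $M(z)=M(z,1)$, $E(z)=M_0(z)$. Let $Q(z)=zq\big(M(z)-E(z)-\sum_{j>0,-j\in\mathcal J}M_j(z)\big)$ and $D(z)=1/(1-Q(z))$. The large roots $v_1(z),\dots,v_d(z)$ are the $d$ solutions of $1-zP(u)=0$ with $|v_\ell(z)|\to\infty$ as $z\to0$. Let $\tau>0$ be the minimal positive real solution of $P'(\tau)=0$ and $\rho=1/P(\tau)$. Let $\rho_0$ be the smallest positive real zero of $1-Q(z)$ satisfying $\rho_0\le\rho$, if it exists (''$\rho_0$ does not exist'' otherwise). When $\rho_0$ does not exist, $\eta$ is defined by $Q(z)=Q(\rho)-\eta\sqrt{1-z/\rho}+O(1-z/\rho)$ as $z\to\rho$. *)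

(* Defs.v *)
From HB Require Import structures.
From mathcomp Require Import all_boot all_order all_algebra.
From mathcomp Require Import all_classical all_reals all_analysis.
From mathcomp Require Import complex.

Set Implicit Arguments.
Unset Strict Implicit.
Unset Printing Implicit Defensive.

Import Order.TTheory GRing.Theory Num.Theory numFieldNormedType.Exports.
Local Open Scope ring_scope.
Local Open Scope classical_set_scope.

Section Catastrophes.

Variable R : realType.
(* c, d >= 1 ; weights p_{-c}, ..., p_d given by p : int -> R (only the values
   on [-c, d] are ever used) ; q the catastrophe weight. *)
Variables (c d : nat) (p : int -> R) (q : R).

Definition jumpv (j : 'I_(c + d).+1) : int := (j : nat)%:Z - c%:Z.

Definition in_J (j : 'I_(c + d).+1) : bool := p (jumpv j) != 0.

Definition alt_after (s : seq 'I_(c + d).+1) (m : nat) : int :=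
  \sum_(j <- take m s) jumpv j.

Definition is_path (s : seq 'I_(c + d).+1) : bool := all in_J s.

Definition is_meander (s : seq 'I_(c + d).+1) : bool :=
  is_path s && all (fun m => 0 <= alt_after s m) (iota 0 (size s).+1).

Definition path_weight (s : seq 'I_(c + d).+1) : R :=
  \prod_(j <- s) p (jumpv j).

Definition mcoef (n k : nat) : R :=
  \sum_(t : n.-tuple 'I_(c + d).+1 |
        is_meander t && (alt_after t n == k%:Z)) path_weight t.

Definition Mcoef1 (n : nat) : R :=
  \sum_(t : n.-tuple 'I_(c + d).+1 | is_meander t) path_weight t.

(* [z^n] Q(z), Q(z) = z q (M(z) - E(z) - sum_{j>0, -j in J} M_j(z)) *)
Definition Qcoef (n : nat) : R :=
  match n with
  | 0 => 0
  | n'.+1 => q * (Mcoef1 n' - mcoef n' 0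
                  - \sum_(1 <= j < c.+1 | p (- (j%:Z)) != 0) mcoef n' j)
  end.

(* coefficients of D(z) = 1/(1 - Q(z)) as a formal power series, i.e. the
   unique series with D_0 = 1 and D_n = sum_{k=1}^n Q_k D_{n-k} (n >= 1);
   Dseq n = [:: D_0; ...; D_n]. *)
Fixpoint Dseq (n : nat) : seq R :=
  match n with
  | 0 => [:: 1]
  | n'.+1 => rcons (Dseq n')
               (\sum_(k < n'.+1) Qcoef k.+1 * nth 0 (Dseq n') (n' - k))
  end.

Definition Dcoef (n : nat) : R := nth 0 (Dseq n) n.

Definition Fcoef (n k : nat) : R := \sum_(i < n.+1) Dcoef i * mcoef (n - i) k.
Definition Fcoef1 (n : nat) : R := \sum_(i < n.+1) Dcoef i * Mcoef1 (n - i).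

Definition prob_X (n k : nat) : R := Fcoef n k / Fcoef1 n.

Definition Pval (u : R) : R := \sum_(j < (c + d).+1) p (jumpv j) * u ^ jumpv j.
Definition Pder (u : R) : R :=
  \sum_(j < (c + d).+1) p (jumpv j) * (jumpv j)%:~R * u ^ (jumpv j - 1).
Definition Pder2 (u : R) : R :=
  \sum_(j < (c + d).+1)
     p (jumpv j) * (jumpv j)%:~R * (jumpv j - 1)%:~R * u ^ (jumpv j - 2).

(* aperiodicity: there are no integer b, integer m >= 2 and Laurent polynomial
   H with P(u) = u^b H(u^m); written out on coefficients: no b, m >= 2 such
   that every exponent i with p_i <> 0 satisfies i = b (mod m). *)
Definition aperiodic : Prop :=
  ~ (exists (b : int) (m : nat), (2 <= m)%N /\
       forall j : 'I_(c + d).+1, p (jumpv j) != 0 -> (m%:Z %| jumpv j - b)%Z).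

(* u^c (1 - z P(u)) as a polynomial function of complex u (degree c + d) *)
Definition kernel_poly (z : R) (u : R[i]) : R[i] :=
  u ^+ c - (z%:C)%C * \sum_(j < (c + d).+1) ((p (jumpv j))%:C)%C * u ^+ j.

Definition cnorm (x : R[i]) : R := ComplexField.Normc.normc x.

(* v : 'I_d -> R -> R[i] is a labelling of the d large roots on the real
   interval (0, z0]: for each z in (0, z0] the v_l(z) are, with multiplicity,
   d of the c + d roots of 1 - zP(u) = 0 (i.e. of u^c (1 - zP(u))), each v_l
   is continuous on (0, z0], and |v_l(z)| -> +oo as z -> 0+. *)
Definition large_roots (z0 : R) (v : 'I_d -> R -> R[i]) : Prop :=
  [/\ forall z, 0 < z <= z0 ->
        exists s : 'I_c -> R[i], forall u : R[i],
          kernel_poly z u =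
            - ((z * p d%:Z)%:C)%C * (\prod_(l < d) (u - v l z))
              * \prod_(i < c) (u - s i),
      forall l z, 0 < z <= z0 -> forall e : R, 0 < e ->
        exists2 del : R, 0 < del & forall z', 0 < z' <= z0 ->
          `|z - z'| < del -> cnorm (v l z - v l z') < e
    & forall l (K : R), exists2 del : R, 0 < del & forall z, 0 < z < del ->
        z <= z0 -> K < cnorm (v l z)].

Definition Q_sums (z l : R) : Prop :=
  (fun N => \sum_(n < N) Qcoef n * z ^+ n) @ \oo --> l.

Definition is_tau (tau : R) : Prop :=
  [/\ 0 < tau, Pder tau = 0 & forall t, 0 < t < tau -> Pder t != 0].

Definition is_rho0 (rho rho0 : R) : Prop :=
  [/\ 0 < rho0 <= rho, Q_sums rho0 1 &
      forall z, 0 < z < rho0 -> ~ Q_sums z 1].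

Definition no_rho0 (rho : R) : Prop :=
  ~ exists z, 0 < z <= rho /\ Q_sums z 1.

Definition is_eta (rho Qrho eta : R) : Prop :=
  Q_sums rho Qrho /\
  exists (K del : R), 0 < del /\
    forall z, rho - del < z < rho ->
      exists Qz, Q_sums z Qz /\
        `|Qz - Qrho + eta * Num.sqrt (1 - z / rho)| <= K * (1 - z / rho).

Definition root_prod (v : 'I_d -> R -> R[i]) (z0 : R) (u : R) : R[i] :=
  \prod_(l < d) ((1 - v l z0) / ((u%:C)%C - v l z0)).

Definition taylor_coefs (w : nat -> R) (omega : R -> R[i]) : Prop :=
  exists2 r : R, 0 < r & forall u : R, `|u| < r ->
    exists s : R, (fun N => \sum_(k < N) w k * u ^+ k) @ \oo --> s
                  /\ (s%:C)%C = omega u.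

End Catastrophes.

(* Main.v *)
Require Import Defs.
From HB Require Import structures.
From mathcomp Require Import all_boot all_order all_algebra.
From mathcomp Require Import all_classical all_reals all_analysis.
From mathcomp Require Import complex.
From mathcomp Require Import cyclic separable cyclotomic.
From mathcomp Require Import zify ring lra.
Import Order.TTheory GRing.Theory Num.Theory numFieldNormedType.Exports.
Local Open Scope ring_scope.
Local Open Scope classical_set_scope.

Set Implicit Arguments.
Unset Strict Implicit.
Unset Printing Implicit Defensive.

(** The kernel K = u^c (1 - zP(u)) times M(z,u) is a polynomial of degree c in u,
    and a domination argument puts its roots inside the disc |u| < tau while the
    large roots stay outside; cancelling the small roots leaves
    M(z,u) prod_l (u - v_l(z)) constant in u, so that the product in omega is
    M(z,u)/M(z,1).

    The asymptotics in n use no complex analysis in z.  The jump law tilted at tau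
    is centred and aperiodic, and a local limit theorem (by discrete Fourier
    transform) gives [z^n u^k] (zP)^n ~ const n^(-1/2); Spitzer's identity
    z dM/dz = M * sum_n z^n [P^n]_(>=0) turns this into rho^n m_(n,k) ~ const n^(-3/2)
    when tau > 1.  The coefficients of D are the renewal sequence of those of Q,
    and conditioning on the last catastrophe makes Pr(X_n = k) a quotient of
    convolutions of D with the m_(n,k).
    - If Q(rho) < 1 the renewal sequence is transient and inherits the n^(-3/2)
      decay; eta is identified by comparing Q with a multiple of 1 - sqrt(1 - z/rho).
    - If Q(rho0) = 1 with exponentially small tails, the renewal theorem applies.
    - If Q(rho) = 1, the return times have tail n^(-1/2): the renewal sequence u_n
      is squeezed between multiples of n^(-1/2), and n^(1/2) (u_(n+1) - u_n) -> 0,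
      which is enough for u * y ~ u_n sum y.
    The case tau <= 1 is harmless because summability of z^n M_n(1) then forces
    zP(1) < 1. *)

(** * Sequences and series *)

(** The constant 1/sqrt(pi) is never evaluated. The limit [b] of sqrt(n) binomial(2n,n)/4^n scales
    both the local limit theorem and the coefficients of 1 - sqrt(1 - x), and it cancels between eta
    and the meander asymptotics. C arises in the same way: the tilted walk has variance tau^2
    P''(tau)/P(tau), and 2/b times its local limit constant is C/tau. The factor 1/(tau - u) is the
    geometric series of the weights tau^(-k) that undo the tilt.

    The domination behind the kernel method is also Spitzer's identity: M = exp L with L of
    nonnegative coefficients, so 1/M = exp(- L) is dominated by M. Hence the kernel is bounded by a
    multiple of kernel times M on the disc, and every root of that product is a root of the kernel.
    This needs z < rho; z = rho is reached by continuity.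

    When Q(rho) = 1, the scaled increments of u nearly satisfy an averaging equation, and their sums
    over windows nearly telescope, with a bound independent of the window length. A limsup other
    than 0 would contradict that bound. *)

Definition sums_to (R : realType) (y : nat -> R) (Y : R) : Prop :=
  (fun n => \sum_(i < n) y i) @ \oo --> Y.

Section RealSequences.
Variable R : realType.
Implicit Types (u v x y f g : nat -> R) (a b l e : R).

Lemma cvg_eps u l : u @ \oo --> l ->
  forall e, 0 < e -> exists N, forall n, (N <= n)%N -> `|u n - l| <= e.
Proof.
move=> /cvgrPdist_le h e e0; have [N _ hN] := h e e0.
by exists N => n Nn; rewrite distrC; apply: hN.
Qed.

Lemma eps_cvg u l :
  (forall e, 0 < e -> exists N, forall n, (N <= n)%N -> `|u n - l| <= e) ->
  u @ \oo --> l.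
Proof.
move=> h; apply/cvgrPdist_le => e e0; have [N hN] := h e e0.
by exists N => // n Nn; rewrite distrC; apply: hN.
Qed.

Lemma cvg_squeeze0 u v : (forall n, `|u n| <= v n) -> v @ \oo --> (0 : R) ->
  u @ \oo --> (0 : R).
Proof.
move=> h hv; apply: eps_cvg => e e0; have [N hN] := cvg_eps hv e0.
exists N => n Nn; have := hN n Nn; rewrite !subr0 => h1.
by apply: le_trans h1; apply: le_trans (ler_norm _).
Qed.

Lemma cvg_uniq u l1 l2 : u @ \oo --> l1 -> u @ \oo --> l2 -> l1 = l2.
Proof. by move=> h1 h2; apply: (cvg_unique _ h1 h2). Qed.

Lemma cvg_reindex u l (s : nat -> nat) : (forall n, (n <= s n)%N) ->
  u @ \oo --> l -> (u \o s) @ \oo --> l.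
Proof.
move=> hs hu; apply: eps_cvg => e e0; have [N hN] := cvg_eps hu e0.
by exists N => n Nn; apply: hN; apply: leq_trans Nn (hs n).
Qed.

Lemma cvg_eventually_eq u v l N : (forall n, (N <= n)%N -> u n = v n) ->
  u @ \oo --> l -> v @ \oo --> l.
Proof.
move=> huv hu; apply: eps_cvg => e e0; have [N' hN] := cvg_eps hu e0.
exists (maxn N N') => n; rewrite geq_max => /andP[h1 h2].
by rewrite -huv // hN.
Qed.

Lemma cvg_ext u v l : (forall n, u n = v n) -> u @ \oo --> l -> v @ \oo --> l.
Proof. by move=> h; apply: (@cvg_eventually_eq _ _ _ 0). Qed.

Lemma cvg_le u v l1 l2 : (forall n, u n <= v n) ->
  u @ \oo --> l1 -> v @ \oo --> l2 -> l1 <= l2.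
Proof.
move=> huv hu hv; rewrite leNgt; apply/negP => hlt.
have e0 : 0 < (l1 - l2) / 3 by rewrite divr_gt0 // subr_gt0.
have [N1 h1] := cvg_eps hu e0; have [N2 h2] := cvg_eps hv e0.
have := h1 (maxn N1 N2) (leq_maxl _ _).
have := h2 (maxn N1 N2) (leq_maxr _ _).
have := huv (maxn N1 N2).
rewrite !ler_norml => ? /andP[? ?] /andP[? ?]; lra.
Qed.

Lemma seqD u v a b : u @ \oo --> a -> v @ \oo --> b ->
  (fun n => u n + v n) @ \oo --> a + b.
Proof. exact: cvgD. Qed.

Lemma seqB u v a b : u @ \oo --> a -> v @ \oo --> b ->
  (fun n => u n - v n) @ \oo --> a - b.
Proof. exact: cvgB. Qed.

Lemma seqM u v a b : u @ \oo --> a -> v @ \oo --> b ->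
  (fun n => u n * v n) @ \oo --> a * b.
Proof. exact: cvgM. Qed.

Lemma seqZ u a b : u @ \oo --> b -> (fun n => a * u n) @ \oo --> a * b.
Proof. by move=> h; apply: cvgM h; apply: cvg_cst. Qed.

Lemma seqV u a : a != 0 -> u @ \oo --> a -> (fun n => (u n)^-1) @ \oo --> a^-1.
Proof. by move=> a0 h; apply: cvgV. Qed.

Lemma cvg_ord_sum (F : nat -> nat -> R) (l : nat -> R) K :
  (forall i, (i < K)%N -> F i @ \oo --> l i) ->
  (fun n => \sum_(i < K) F i n) @ \oo --> \sum_(i < K) l i.
Proof.
elim: K => [|K IH] h.
  under eq_fun do rewrite big_ord0; rewrite big_ord0; exact: cvg_cst.
under eq_fun do rewrite big_ord_recr /=; rewrite big_ord_recr /=.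
apply: cvgD; last exact: h.
by apply: IH => i iK; apply: h; apply: ltnW.
Qed.

Lemma sums_bounded y B : (forall n, 0 <= y n) ->
  (forall n, \sum_(i < n) y i <= B) -> exists Y, sums_to y Y.
Proof.
move=> y0 hB; exists (sup (range (fun n => \sum_(i < n) y i))).
apply: nondecreasing_cvgn.
  apply/nondecreasing_seqP => n; rewrite big_ord_recr /= lerDl; exact: y0.
by exists B => _ [n _ <-]; apply: hB.
Qed.

Lemma sums_ge y Y n : (forall n, 0 <= y n) -> sums_to y Y ->
  \sum_(i < n) y i <= Y.
Proof.
move=> y0 hY.
have mono m k : \sum_(i < m) y i <= \sum_(i < m + k) y i.
  rewrite big_split_ord /= lerDl; apply: sumr_ge0 => i _; exact: y0.
rewrite leNgt; apply/negP => hlt.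
have e0 : 0 < (\sum_(i < n) y i - Y) / 2 by rewrite divr_gt0 // subr_gt0.
have [N hN] := cvg_eps hY e0.
have := hN (n + N)%N (leq_addl _ _); have := mono n N.
rewrite ler_norml => ? /andP[? ?]; lra.
Qed.

Lemma sums_le y Y B : (forall n, \sum_(i < n) y i <= B) -> sums_to y Y -> Y <= B.
Proof. by move=> h hY; apply: (cvg_le (u := fun n => \sum_(i < n) y i)(v := fun=> B)) hY (cvg_cst _). Qed.

Lemma sums_ge0 y Y : (forall n, 0 <= y n) -> sums_to y Y -> 0 <= Y.
Proof. by move=> y0 /(sums_ge 0 y0); rewrite big_ord0. Qed.

Lemma sums_tail y Y n : (forall n, 0 <= y n) -> sums_to y Y ->
  sums_to (fun i => y (n + i)%N) (Y - \sum_(i < n) y i).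
Proof.
move=> y0 hY; rewrite /sums_to.
have -> : (fun m => \sum_(i < m) y (n + i)%N) =
  (fun m => \sum_(i < n + m) y i - \sum_(i < n) y i).
  by apply/funext => m; rewrite [in RHS]big_split_ord /=; ring.
apply: cvgB; last exact: cvg_cst.
by apply: (cvg_reindex (s := fun m => (n + m)%N)) hY => m; apply: leq_addl.
Qed.

Lemma sumsZ y Y a : sums_to y Y -> sums_to (fun n => a * y n) (a * Y).
Proof.
move=> h; rewrite /sums_to.
under eq_fun do rewrite -mulr_sumr.
apply: cvgM h; exact: cvg_cst.
Qed.

Lemma sumsD x y X Y : sums_to x X -> sums_to y Y ->
  sums_to (fun n => x n + y n) (X + Y).
Proof.
move=> hx hy; rewrite /sums_to.
under eq_fun do rewrite big_split /=.
exact: cvgD.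
Qed.

Lemma sums_shift y Y : sums_to (fun n => y n.+1) Y -> sums_to y (y 0%N + Y).
Proof.
move=> h; have h2 : (fun n => y 0%N + \sum_(i < n) y i.+1) @ \oo --> y 0%N + Y.
  by apply: cvgD h; apply: cvg_cst.
apply: eps_cvg => e e0; have [N hN] := cvg_eps h2 e0.
by exists N.+1 => -[//|n] Nn; rewrite big_ord_recl /=; apply: hN.
Qed.

Lemma sums_unshift y Y : sums_to y Y -> sums_to (fun n => y n.+1) (Y - y 0%N).
Proof.
move=> h; rewrite /sums_to.
have -> : (fun m => \sum_(i < m) y i.+1) = (fun m => \sum_(i < m.+1) y i - y 0%N).
  by apply/funext => m; rewrite [in RHS]big_ord_recl /=; ring.
apply: cvgB; last exact: cvg_cst.
by apply: (cvg_reindex (s := fun m => m.+1)) h => m.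
Qed.

Lemma sums_comp x y Y : (forall n, 0 <= x n <= y n) -> sums_to y Y ->
  exists2 X, sums_to x X & X <= Y.
Proof.
move=> hxy hY.
have y0 n : 0 <= y n by case/andP: (hxy n) => ? ?; lra.
have hb n : \sum_(i < n) x i <= Y.
  apply: le_trans (sums_ge n y0 hY); apply: ler_sum => i _.
  by case/andP: (hxy i).
have x0 n : 0 <= x n by case/andP: (hxy n).
have [X hX] := sums_bounded x0 hb.
by exists X => //; apply: sums_le hb hX.
Qed.

Lemma sums_small y Y : (forall n, 0 <= y n) -> sums_to y Y ->
  forall e, 0 < e -> exists N, forall n m, (N <= n)%N ->
    \sum_(i < m) y (n + i)%N <= e.
Proof.
move=> y0 hY e e0; have [N hN] := cvg_eps hY e0.
exists N => n m Nn.
have h1 := sums_ge (n + m) y0 hY.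
have := hN n Nn; rewrite ler_norml => /andP[h2 h3].
rewrite big_split_ord /= in h1; lra.
Qed.

Lemma ord_sum_splitP (V : nmodType) (F : nat -> V) K n : (K <= n)%N ->
  \sum_(i < n) F i = \sum_(i < K) F i + \sum_(i < n - K) F (K + i)%N.
Proof.
move=> Kn; have [m ->] : exists m, n = (K + m)%N by exists (n - K)%N; lia.
by rewrite big_split_ord /= addKn.
Qed.

(* Dominated convergence for series whose number of terms grows with n. *)
Lemma tannery (F : nat -> nat -> R) (l b : nat -> R) B L (s : nat -> nat) :
  (forall k, F ^~ k @ \oo --> l k) -> (forall n k, `|F n k| <= b k) ->
  sums_to b B -> sums_to l L -> (forall n, (n <= s n)%N) ->
  (fun n => \sum_(k < s n) F n k) @ \oo --> L.
Proof.
move=> hF hb hB hL hs; apply: eps_cvg => e e0.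
have b0 k : 0 <= b k by apply: le_trans (hb 0%N k).
have e3 : 0 < e / 3 by rewrite divr_gt0.
have [N1 h1] := sums_small b0 hB e3.
have [N2 h2] := cvg_eps hL e3.
pose K := maxn N1 N2.
have hK : (fun n => \sum_(k < K) F n k) @ \oo --> \sum_(k < K) l k.
  by apply: (cvg_ord_sum (F := fun i n => F n i)) => i _.
have [N3 h3] := cvg_eps hK e3.
exists (maxn N3 K) => n; rewrite geq_max => /andP[n3 nK].
rewrite (@ord_sum_splitP R (F n) K); last exact: leq_trans nK (hs n).
have t1 : `|\sum_(i < s n - K) F n (K + i)%N| <= e / 3.
  apply: le_trans (ler_norm_sum _ _ _) _.
  by apply: le_trans (h1 K (s n - K)%N (leq_maxl _ _)); apply: ler_sum => i _.
have t2 := h2 K (leq_maxr _ _).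
have t3 := h3 n n3.
move: t1 t2 t3; rewrite !ler_norml => /andP[? ?] /andP[? ?] /andP[? ?].
apply/andP; split; lra.
Qed.

(** Adding [b] makes the terms nonnegative and at most twice [b], so comparison applies; the series
    of [b] is then subtracted. *)
Lemma sums_abs x (b : nat -> R) B : (forall k, `|x k| <= b k) -> sums_to b B ->
  exists X, sums_to x X.
Proof.
move=> hb hB.
have b0 k : 0 <= b k by apply: le_trans (hb k).
have [| |X1 h1 _] := @sums_comp (fun k => x k + b k) (fun k => 2 * b k) (2 * B).
- move=> n; move: (hb n); rewrite ler_norml => /andP[? ?]; lra.
- exact: sumsZ.
exists (X1 + (-1) * B).
have := sumsD h1 (sumsZ (a := -1) hB).
by congr (sums_to _ _); apply/funext => n; lra.
Qed.

Lemma sums_norm_le x (b : nat -> R) X B : (forall k, `|x k| <= b k) -> sums_to x X ->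
  sums_to b B -> `|X| <= B.
Proof.
move=> hb hX hB; rewrite ler_norml; apply/andP; split.
- have h : (fun n => - \sum_(i < n) b i) @ \oo --> - B by exact: cvgN.
  apply: (cvg_le _ h hX) => n.
  rewrite lerNl; apply: le_trans (_ : `|\sum_(i < n) x i| <= _).
    by rewrite -normrN ler_norm.
  by apply: le_trans (ler_norm_sum _ _ _) _; apply: ler_sum.
- apply: (cvg_le _ hX hB) => n.
  apply: le_trans (ler_norm _) _.
  by apply: le_trans (ler_norm_sum _ _ _) _; apply: ler_sum.
Qed.

Lemma sums_geometric a : 0 <= a < 1 -> sums_to (fun n => a ^+ n) (1 - a)^-1.
Proof.
move=> /andP[a0 a1].
have h : (fun n => (1 - a)^-1 - (1 - a)^-1 * a ^+ n) @ \oo --> (1 - a)^-1 - (1 - a)^-1 * 0.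
  apply: cvgB; first exact: cvg_cst.
  apply: cvgM; first exact: cvg_cst.
  by apply: cvg_expr; rewrite ger0_norm.
rewrite mulr0 subr0 in h; rewrite /sums_to.
apply: cvg_trans h; apply: near_eq_cvg; apply: nearW => n.
have ha : 1 - a != 0 by rewrite subr_eq0 eq_sym; apply/negP => /eqP; lra.
elim: n => [|n IH]; first by rewrite big_ord0 expr0 mulr1 subrr.
by rewrite big_ord_recr /= -IH exprSr; field.
Qed.

End RealSequences.

(** * Cauchy products and the scale sqrt n *)

Definition conv (R : nzRingType) (f g : nat -> R) (n : nat) : R :=
  \sum_(i < n.+1) f i * g (n - i)%N.

Definition delta0 (R : nzRingType) (n : nat) : R := (n == 0)%:R.

(** The operator z d/dz on coefficients. It lifts the scale n^(-3/2) to n^(-1/2), where convolutions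
    are easier to estimate. *)
Definition theta (R : nzRingType) (f : nat -> R) (n : nat) : R := n%:R * f n.

Section CauchyProduct.
Variable R : comNzRingType.
Implicit Types f g h : nat -> R.

(** Truncation leaves the coefficients below N unchanged, so commutativity and associativity of
    [conv] come from the polynomial ring. *)
Lemma conv_poly f g n N : (n < N)%N ->
  conv f g n = ((\poly_(i < N) f i) * (\poly_(i < N) g i))`_n.
Proof.
move=> nN; rewrite coefM; apply: eq_bigr => i _.
rewrite !coef_poly; have -> : (i < N)%N by apply: leq_ltn_trans nN; rewrite -ltnS.
by have -> : (n - i < N)%N by apply: leq_ltn_trans nN; apply: leq_subr.
Qed.

Lemma eq_conv f f' g g' n : (forall i, (i <= n)%N -> f i = f' i) ->
  (forall i, (i <= n)%N -> g i = g' i) -> conv f g n = conv f' g' n.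
Proof.
move=> hf hg; apply: eq_bigr => i _.
by rewrite hf ?hg ?leq_subr // -ltnS.
Qed.

Lemma convC f g : conv f g = conv g f.
Proof.
by apply/funext => n; rewrite !(@conv_poly _ _ n n.+1) // mulrC.
Qed.

Lemma convA f g h : conv f (conv g h) = conv (conv f g) h.
Proof.
apply/funext => n.
transitivity ((\poly_(i < n.+1) f i * (\poly_(i < n.+1) g i * \poly_(i < n.+1) h i))`_n).
  rewrite coefM; apply: eq_bigr => i _; rewrite coef_poly ltn_ord.
  by rewrite (@conv_poly _ _ _ n.+1) // ltnS leq_subr.
rewrite mulrA coefM; apply: eq_bigr => i _; rewrite coef_poly ltnS leq_subr.
by rewrite (@conv_poly _ _ _ n.+1).
Qed.

Lemma convDl f g h n : conv (fun i => f i + g i) h n = conv f h n + conv g h n.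
Proof. by rewrite -big_split /=; apply: eq_bigr => i _; rewrite mulrDl. Qed.

Lemma convDr f g h n : conv h (fun i => f i + g i) n = conv h f n + conv h g n.
Proof. by rewrite -big_split /=; apply: eq_bigr => i _; rewrite mulrDr. Qed.

Lemma convNr f g n : conv f (fun i => - g i) n = - conv f g n.
Proof. by rewrite -sumrN; apply: eq_bigr => i _; rewrite mulrN. Qed.

Lemma conv1l f : conv (@delta0 R) f = f.
Proof.
apply/funext => n; rewrite /conv big_ord_recl /= subn0 /delta0 eqxx mul1r big1 ?addr0 //.
by move=> i _; rewrite /= mul0r.
Qed.

Lemma conv1r f : conv f (@delta0 R) = f.
Proof. by rewrite convC conv1l. Qed.

Lemma conv0 f g : conv f g 0%N = f 0%N * g 0%N.
Proof. by rewrite /conv big_ord1. Qed.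

Lemma conv_recl f g n : f 0%N = 0 ->
  conv f g n = \sum_(i < n) f i.+1 * g (n - i.+1)%N.
Proof. by move=> f0; rewrite /conv big_ord_recl f0 mul0r add0r. Qed.

Lemma theta_conv f g n :
  theta (conv f g) n = conv (theta f) g n + conv f (theta g) n.
Proof.
rewrite /theta /conv mulr_sumr -big_split /=; apply: eq_bigr => i _.
have ile : (i <= n)%N by rewrite -ltnS.
rewrite -{1}(subnKC ile) natrD; ring.
Qed.

(** Uniqueness for the renewal equation: later identities are proved by feeding it the difference of
    their two sides. *)
Lemma conv_fix0 f g : f 0%N = 0 -> (forall n, g n = conv f g n) -> forall n, g n = 0.
Proof.
move=> f0 hg; elim/ltn_ind => n IH; rewrite hg conv_recl // big1 // => i _.
by rewrite IH ?mulr0 //; have := ltn_ord i; lia.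
Qed.

Lemma conv_sum f g N :
  \sum_(n < N) conv f g n = \sum_(i < N) f i * \sum_(j < N - i) g j.
Proof.
elim: N => [|N IH]; first by rewrite !big_ord0.
rewrite big_ord_recr /= IH big_ord_recr /= subSn // subnn big_ord1.
rewrite /conv big_ord_recr /= subnn addrA; congr (_ + _).
rewrite -big_split /=; apply: eq_bigr => i _.
by rewrite -mulrDr subSn ?big_ord_recr //=; apply: ltnW.
Qed.

(* For u = 1/(1 - f), differentiation gives theta u = u^2 theta f. *)
Lemma renewal_theta f (u : nat -> R) : f 0%N = 0 ->
  (forall n, u n = delta0 R n + conv f u n) ->
  forall n, theta u n = conv (theta f) (conv u u) n.
Proof.
move=> f0 hu n; apply/eqP; rewrite -subr_eq0; apply/eqP.
move: n; apply: (@conv_fix0 f) => // n.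
have h1 m : theta u m = conv (theta f) u m + conv f (theta u) m.
  rewrite -theta_conv /theta hu mulrDr /delta0; case: m => [|m]; first by rewrite !mul0r addr0.
  by rewrite mulr0 add0r.
have hu' : u = (fun n => delta0 R n + conv f u n) by apply/funext.
have h2 m : conv (theta f) (conv u u) m =
   conv (theta f) u m + conv f (conv (theta f) (conv u u)) m.
  have hU : conv u u = (fun n => u n + conv f (conv u u) n).
    transitivity (conv (fun n => delta0 R n + conv f u n) u); first by rewrite -hu'.
    by apply/funext => k; rewrite convDl conv1l convA.
  transitivity (conv (theta f) (fun n => u n + conv f (conv u u) n) m).
    by rewrite -hU.
  by rewrite convDr !convA (convC (theta f) f).
by rewrite convDr convNr h1 h2; ring.
Qed.

End CauchyProduct.

(** * The scale sqrt(n + 1) and convolutions on it *)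

Section SquareRootScale.
Variable R : realType.
Implicit Types (u v x y f g W : nat -> R) (a b l e K B Y : R).

(** The shift by one keeps [rt n] nonzero, also at n = 0. *)
Definition rt (n : nat) : R := Num.sqrt n.+1%:R.

Lemma rt_gt0 n : 0 < rt n. Proof. by rewrite sqrtr_gt0 ltr0Sn. Qed.
Lemma rt_ge0 n : 0 <= rt n. Proof. exact/ltW/rt_gt0. Qed.
Lemma rt_neq0 n : rt n != 0. Proof. by rewrite gt_eqF // rt_gt0. Qed.
Lemma rt_sqr n : rt n ^+ 2 = n.+1%:R. Proof. by rewrite sqr_sqrtr // ler0n. Qed.
Lemma rt_ge1 n : 1 <= rt n.
Proof. by rewrite -[1](@sqrtr1 R) ler_wsqrtr // ler1n. Qed.
Lemma rt_le m n : (m <= n)%N -> rt m <= rt n.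
Proof. by move=> h; rewrite ler_wsqrtr // ler_nat. Qed.
Lemma rt_leM k m n : (n.+1 <= k ^ 2 * m.+1)%N -> rt n <= k%:R * rt m.
Proof.
move=> h; have := rt_ge0 m => h0.
rewrite -(@ler_pXn2r _ 2) ?nnegrE ?rt_ge0 ?mulr_ge0 ?ler0n //.
by rewrite exprMn !rt_sqr -natrX -natrM ler_nat.
Qed.

Lemma rtV_ge0 n : 0 <= (rt n)^-1. Proof. by rewrite invr_ge0 rt_ge0. Qed.

Lemma rtV_cvg0 : (fun n => (rt n)^-1) @ \oo --> (0 : R).
Proof.
apply: eps_cvg => e e0.
have [N hN] : exists N, (e ^- 2) < N%:R.
  by exists (Num.bound (e ^- 2)); apply: archi_boundP; rewrite invr_ge0 exprn_ge0 // ltW.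
exists N => n Nn; rewrite subr0 ger0_norm ?rtV_ge0 //.
rewrite -[e]invrK lef_pV2 ?posrE ?rt_gt0 ?invr_gt0 //.
rewrite -(@ler_pXn2r _ 2) ?nnegrE ?rt_ge0 ?invr_ge0 ?(ltW e0) // rt_sqr exprVn.
apply: ltW; apply: lt_le_trans hN _; rewrite ler_nat; lia.
Qed.

Lemma rtVZ_cvg0 K : (fun n => K / rt n) @ \oo --> (0 : R).
Proof.
rewrite -[X in _ --> X](mulr0 K); apply: cvgM; [exact: cvg_cst|exact: rtV_cvg0].
Qed.

(** The right side telescopes in n; the default 0 stands for the square root of 0 at the start of
    the telescope. *)
Lemma rtV_sub n : (rt n)^-1 <= 2 * (rt n - if n is m.+1 then rt m else 0).
Proof.
case: n => [|n].
  have r0 : rt 0 = 1 by rewrite /rt sqrtr1.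
  rewrite r0 invr1; lra.
have h1 := rt_gt0 n; have h2 := rt_gt0 n.+1.
have h3 : rt n <= rt n.+1 by apply: rt_le.
have e1 := rt_sqr n; have e2 := rt_sqr n.+1.
have e3 : rt n.+1 ^+ 2 - rt n ^+ 2 = 1 by rewrite e1 e2 -[n.+2]addn1 natrD; ring.
rewrite -(ler_pM2r h2) mulVf ?rt_neq0 //; nra.
Qed.

Lemma sum_rtV n : \sum_(i < n) (rt i)^-1 <= 2 * rt n.
Proof.
suff h : forall n, \sum_(i < n) (rt i)^-1 <= 2 * (if n is m.+1 then rt m else 0).
  apply: le_trans (h n) _; case: n => [|n]; first by rewrite /= mulr0 mulr_ge0 ?rt_ge0.
  by rewrite ler_pM2l //; apply: rt_le.
elim=> [|m IH]; first by rewrite big_ord0 mulr0.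
rewrite big_ord_recr /=; have := rtV_sub m; move: IH; set t := (if m is k.+1 then rt k else 0); lra.
Qed.

Lemma rtV3_sub n : (rt n.+1) ^- 3 <= 2 * ((rt n)^-1 - (rt n.+1)^-1).
Proof.
have h1 := rt_gt0 n; have h2 := rt_gt0 n.+1.
have h3 : rt n <= rt n.+1 by apply: rt_le.
have e3 : rt n.+1 ^+ 2 - rt n ^+ 2 = 1.
  by rewrite !rt_sqr -[n.+2]addn1 natrD; ring.
have e4 : (rt n)^-1 - (rt n.+1)^-1 = (rt n.+1 - rt n) / (rt n * rt n.+1).
  by field; rewrite !rt_neq0.
rewrite e4 -[leLHS]mul1r mulrA ler_pdivrMr ?exprn_gt0 //.
rewrite [leRHS](_ : _ = 2 * (rt n.+1 - rt n) * rt n.+1 ^+ 2 / rt n); last by field; rewrite !rt_neq0.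
rewrite ler_pdivlMr // mul1r; nra.
Qed.

Lemma sum_rtV3 n m : \sum_(i < m) (rt (n.+1 + i)) ^- 3 <= 2 / rt n.
Proof.
suff : \sum_(i < m) (rt (n.+1 + i)) ^- 3 <= 2 * ((rt n)^-1 - (rt (n + m))^-1).
  have := rtV_ge0 (n + m); lra.
elim: m => [|m IH]; first by rewrite big_ord0 addn0 subrr mulr0.
rewrite big_ord_recr /=; have := rtV3_sub (n + m); rewrite addnS addSn; lra.
Qed.

Lemma rtV3_sum_le n : \sum_(i < n) (rt i) ^- 3 <= 3.
Proof.
have r0 : rt 0 = 1 by rewrite /rt sqrtr1.
case: n => [|n]; first by rewrite big_ord0.
rewrite big_ord_recl /= r0 expr1n invr1.
have h := sum_rtV3 0 n; rewrite r0 divr1 in h.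
by apply: le_trans (lerD (lexx 1) h) _; lra.
Qed.

Lemma rtV3_summable : exists Y, sums_to (fun n => (rt n) ^- 3) Y.
Proof.
apply: (@sums_bounded _ _ 3); last exact: rtV3_sum_le.
by move=> n; rewrite invr_ge0 exprn_ge0 // rt_ge0.
Qed.

(** No equivalent of [W] is assumed, only increments o(n^(-1/2)): for each fixed k, W(n - k) may
    then be replaced by W(n). The terms with 2k <= n are dominated by a multiple of [y k]. For the
    others [y k] is O(n^(-3/2)) and the sum of |W| is O(sqrt n), which leaves O(n^(-1/2)) after
    multiplication by [rt n]. *)
Lemma conv_sqrt_decay W y K B Y : (forall n, `|W n| <= K / rt n) ->
  (fun n => rt n * (W n.+1 - W n)) @ \oo --> (0 : R) ->
  (forall n, 0 <= y n <= B / rt n ^+ 3) -> sums_to y Y ->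
  (fun n => rt n * conv W y n - rt n * W n * Y) @ \oo --> (0 : R).
Proof.
move=> hW hd hy hY.
have y0 n : 0 <= y n by case/andP: (hy n).
have K0 : 0 <= K.
  have := hW 0%N; have -> : rt 0 = 1 by rewrite /rt sqrtr1.
  by rewrite divr1; apply: le_trans.
have B0 : 0 <= B.
  have := hy 0%N; have -> : rt 0 = 1 by rewrite /rt sqrtr1.
  by rewrite expr1n divr1 => /andP[]; apply: le_trans.
have rW n : `|rt n * W n| <= K.
  rewrite normrM gtr0_norm ?rt_gt0 // mulrC.
  by rewrite -ler_pdivlMr ?rt_gt0.
have rW2 n k : (2 * k <= n)%N -> `|rt n * W (n - k)%N| <= 2 * K.
  move=> kn; rewrite normrM (gtr0_norm (rt_gt0 _)).
  have h1 : rt n <= 2%:R * rt (n - k) by apply: rt_leM; lia.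
  have := rW (n - k)%N; rewrite normrM (gtr0_norm (rt_gt0 _)).
  have := normr_ge0 (W (n-k)%N); have := rt_gt0 (n - k); nra.
pose D n k := rt n * (W (n - k)%N - W n).
have D0 k : D ^~ k @ \oo --> (0 : R).
  elim: k => [|k IH].
    rewrite (_ : D ^~ 0%N = fun=> 0); first exact: cvg_cst.
    by apply/funext => n; rewrite /D subn0 subrr mulr0.
  apply: eps_cvg => e e0; have e4 : 0 < e / 4 by rewrite divr_gt0.
  have [N1 h1] := cvg_eps IH e4; have [N2 h2] := cvg_eps hd e4.
  exists (maxn N1 (N2 + k.+1 + k.+1)) => n; rewrite geq_max => /andP[n1 n2].
  have := h1 n n1; have := h2 (n - k.+1)%N ltac:(lia).
  rewrite !subr0 /D.
  have -> : (n - k.+1).+1 = (n - k)%N by lia.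
  have h3 : rt n <= 2%:R * rt (n - k.+1) by apply: rt_leM; lia.
  have r1 := rt_gt0 n; have r2 := rt_gt0 (n - k.+1).
  pose a := W (n - k)%N - W (n - k.+1)%N.
  rewrite -/a => ha.
  have -> : W (n - k.+1)%N - W n = W (n - k)%N - W n - a by rewrite /a; ring.
  have : `|rt n * a| <= e / 2.
    move: ha; rewrite !normrM (gtr0_norm r1) (gtr0_norm r2).
    have := normr_ge0 a; nra.
  move=> h4 h5; rewrite mulrBr; apply: le_trans (ler_normB _ _) _.
  by rewrite [leRHS]splitr; apply: lerD h4; apply: le_trans h5 _; lra.
pose F n k := if (2 * k <= n)%N then y k * D n k else 0.
pose G n k := if (2 * k <= n)%N then 0 else y k * D n k.
have E n : rt n * conv W y n - rt n * W n * Y =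
   \sum_(k < n.+1) F n k + \sum_(k < n.+1) G n k -
   rt n * W n * (Y - \sum_(k < n.+1) y k).
  have -> : \sum_(k < n.+1) F n k + \sum_(k < n.+1) G n k =
     \sum_(k < n.+1) (rt n * (y k * W (n - k)%N) - rt n * W n * y k).
    rewrite -big_split /=; apply: eq_bigr => k _; rewrite /F /G /D.
    case: ifP => _; ring.
  by rewrite sumrB -!mulr_sumr -/(conv y W n) (convC W); ring.
have tF : (fun n => \sum_(k < n.+1) F n k) @ \oo --> (0 : R).
  apply: (@tannery _ F (fun=> 0) (fun k => (3 * K) * y k) ((3 * K) * Y) 0 (fun n => n.+1)).
  - move=> k; have h : (fun n => y k * D n k) @ \oo --> (0 : R).
      by rewrite -[X in _ --> X](mulr0 (y k)); apply: cvgM; [exact: cvg_cst|exact: D0].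
    apply: cvg_squeeze0 (_ : (fun n => `|y k * D n k|) @ \oo --> (0 : R)).
      by move=> n; rewrite /F; case: ifP => _ //; rewrite normr0.
    by rewrite -[X in _ --> X](@normr0 R R); apply: (cvg_norm h).
  - move=> n k; rewrite /F; case: ifP => kn; last by rewrite normr0 mulr_ge0 // mulr_ge0.
    rewrite normrM (ger0_norm (y0 k)) mulrC ler_wpM2r // /D mulrBr.
    apply: le_trans (ler_normB _ _) _; have := rW2 n k kn; have := rW n; lra.
  - exact: sumsZ.
  - have -> : sums_to (fun=> 0 : R) 0 = ((fun n : nat => \sum_(i < n) (0 : R)) @ \oo --> (0 : R)) by [].
    by under eq_fun do rewrite big1 //; apply: cvg_cst.
  - by [].
have tG : (fun n => \sum_(k < n.+1) G n k) @ \oo --> (0 : R).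
  (* 40 = 8 * 4 + 8: the inverse square roots over the n + 1 indices sum to at most 4 [rt n], and
     the constant term is counted n + 1 times. *)
  apply: cvg_squeeze0 (rtVZ_cvg0 (40 * B * K)) => n.
  apply: le_trans (ler_norm_sum _ _ _) _.
  have rn := rt_gt0 n.
  have hG k : (k < n.+1)%N -> `|G n k| <= 8 * B * K / rt n ^+ 2 * (rt (n - k))^-1 + 8 * B * K / rt n ^+ 3.
    move=> kn; rewrite /G; case: ifP => [_|/negbT].
      rewrite normr0 addr_ge0 // ?mulr_ge0 ?rtV_ge0 ?invr_ge0 ?exprn_ge0 //; exact: ltW.
    rewrite -ltnNge => nk.
    have hyk : y k <= 8 * B / rt n ^+ 3.
      case/andP: (hy k) => _ h; apply: le_trans h _.
      rewrite -mulrA (mulrCA 8) ler_wpM2l //.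
      have h3 : rt n <= 2%:R * rt k by apply: rt_leM; lia.
      rewrite -[8 / _]invrK lef_pV2 ?posrE ?exprn_gt0 ?rt_gt0 ?invr_gt0 ?divr_gt0 ?exprn_gt0 //.
      rewrite invfM invrK mulrC ler_pdivrMr // -[8](_ : 2 ^+ 3 = _); last by rewrite -natrX.
      by rewrite mulrC -exprMn ler_pXn2r ?nnegrE ?mulr_ge0 ?rt_ge0.
    rewrite normrM (ger0_norm (y0 k)).
    have hD : `|D n k| <= K * (rt n / rt (n - k) + 1).
      rewrite /D mulrBr mulrDr mulr1; apply: le_trans (ler_normB _ _) _.
      apply: lerD => //; rewrite normrM (gtr0_norm rn) [leRHS]mulrCA ler_pM2l //.
    apply: le_trans (ler_pM (y0 k) (normr_ge0 _) hyk hD) _.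
    rewrite le_eqVlt; apply/orP; left; apply/eqP; field; by rewrite !rt_neq0.
  apply: le_trans (_ : \sum_(k < n.+1) (8 * B * K / rt n ^+ 2 * (rt (n - k))^-1 + 8 * B * K / rt n ^+ 3) <= _).
    by apply: ler_sum => k _; apply: hG.
  rewrite big_split /= -mulr_sumr sumr_const card_ord -[X in _ + X]mulr_natl -(rt_sqr n).
  have -> : \sum_(i < n.+1) (rt (n - i))^-1 = \sum_(i < n.+1) (rt i)^-1.
    rewrite (reindex_inj rev_ord_inj) /=; apply: eq_bigr => i _.
    by rewrite subSS subKn // -ltnS.
  have hs : \sum_(i < n.+1) (rt i)^-1 <= 4 * rt n.
    apply: le_trans (sum_rtV _) _.
    have : rt n.+1 <= 2%:R * rt n by apply: rt_leM; lia.
    lra.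
  have h8 : 0 <= 8 * B * K / rt n ^+ 2.
    by rewrite !mulr_ge0 // invr_ge0 exprn_ge0 // ltW.
  apply: le_trans (lerD (ler_wpM2l h8 hs) (lexx _)) _.
  rewrite le_eqVlt; apply/orP; left; apply/eqP; field; by rewrite !rt_neq0.
have tY : (fun n => rt n * W n * (Y - \sum_(k < n.+1) y k)) @ \oo --> (0 : R).
  apply: (@cvg_squeeze0 _ _ (fun n => K * (Y - \sum_(k < n.+1) y k))).
    move=> n; rewrite normrM [X in _ * X]ger0_norm; last by rewrite subr_ge0; apply: sums_ge.
    by apply: ler_wpM2r => //; rewrite subr_ge0; apply: sums_ge.
  rewrite -[X in _ --> X](mulr0 K); apply: cvgM; first exact: cvg_cst.
  rewrite -[X in _ --> X](subrr Y); apply: cvgB; first exact: cvg_cst.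
  by apply: (cvg_reindex (s := fun n => n.+1)) hY.
under eq_fun do rewrite E.
have h := cvgB (cvgD tF tG) tY; rewrite addr0 subr0 in h; exact: h.
Qed.

End SquareRootScale.

Section DecayingSequences.
Variable R : realType.
Implicit Types (u x y f g W : nat -> R) (a b l e K B X Y : R).

Definition decay3 x a : Prop := (fun n => rt R n ^+ 3 * x n) @ \oo --> a.

Lemma cvg_bounded u l : u @ \oo --> l -> exists2 K, 0 <= K & forall n, `|u n| <= K.
Proof.
move=> /cvg_eps /(_ 1 ltr01) [N hN].
have [K K0 hK] : exists2 K, 0 <= K & forall n, (n < N)%N -> `|u n| <= K.
  elim: N {hN} => [|N [K K0 hK]]; first by exists 0.
  exists (K + `|u N|); first by rewrite addr_ge0.
  move=> n; rewrite ltnS leq_eqVlt => /orP[/eqP ->|/hK h]; first by rewrite lerDr.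
  by apply: le_trans h _; rewrite lerDl.
exists (K + (`|l| + 1)); first by rewrite !addr_ge0.
move=> n; case: (ltnP n N) => [/hK h|/hN h].
  by apply: le_trans h _; rewrite lerDl addr_ge0.
have : `|u n| <= `|l| + `|u n - l|.
  by rewrite -{1}(subrKC l (u n)); apply: ler_normD.
move: K0 h; lra.
Qed.

Lemma sums_conv x y X Y : (forall n, 0 <= x n) -> (forall n, 0 <= y n) ->
  sums_to x X -> sums_to y Y -> sums_to (conv x y) (X * Y).
Proof.
move=> x0 y0 hX hY; rewrite /sums_to.
under eq_fun do rewrite conv_sum.
apply: (@tannery _ (fun n i => x i * \sum_(j < n - i) y j) (fun i => x i * Y)
  (fun i => x i * Y) (X * Y) _ id) => //.
- move=> k; apply: cvgM; first exact: cvg_cst.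
  apply: eps_cvg => e e0; have [N hN] := cvg_eps hY e0.
  by exists (N + k)%N => n nN; apply: hN; lia.
- move=> n k; rewrite normrM !ger0_norm ?sumr_ge0 //.
  by apply: ler_wpM2l => //; apply: sums_ge.
- by under eq_fun do rewrite mulrC; rewrite mulrC; apply: sumsZ.
- by under eq_fun do rewrite mulrC; rewrite mulrC; apply: sumsZ.
Qed.

Lemma conv_ge0 x y n : (forall n, 0 <= x n) -> (forall n, 0 <= y n) ->
  0 <= conv x y n.
Proof. by move=> x0 y0; apply: sumr_ge0 => i _; rewrite mulr_ge0. Qed.

Lemma rt_step n : rt R n.+1 - rt R n <= 1.
Proof.
have e3 : rt R n.+1 ^+ 2 - rt R n ^+ 2 = 1.
  by rewrite !rt_sqr -[n.+2]addn1 natrD; ring.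
have := rt_ge1 R n; have := rt_ge1 R n.+1; nra.
Qed.

Lemma sqrt_decay_bound W l : (fun n => rt R n * W n) @ \oo --> l ->
  exists2 K, 0 <= K & forall n, `|W n| <= K / rt R n.
Proof.
move=> /cvg_bounded[K K0 hK]; exists K => // n.
rewrite ler_pdivlMr ?rt_gt0 // mulrC; have := hK n.
by rewrite normrM (gtr0_norm (rt_gt0 _ _)).
Qed.

(** An exact n^(-1/2) equivalent already gives the increments that [conv_sqrt_decay] asks for. The
    critical renewal sequence has to reach them by another way. *)
Lemma sqrt_decay_step W l : (fun n => rt R n * W n) @ \oo --> l ->
  (fun n => rt R n * (W n.+1 - W n)) @ \oo --> (0 : R).
Proof.
move=> h; have [K K0 hK] := sqrt_decay_bound h.
have h1 : (fun n => rt R n.+1 * W n.+1) @ \oo --> l.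
  by apply: (cvg_reindex (s := fun n => n.+1)) h.
have h2 : (fun n => (rt R n.+1 - rt R n) * W n.+1) @ \oo --> (0 : R).
  apply: cvg_squeeze0 (rtVZ_cvg0 K) => n.
  rewrite normrM -[leRHS]mul1r ler_pM //.
    by rewrite ger0_norm ?rt_step // subr_ge0 rt_le.
  apply: le_trans (hK n.+1) _; apply: ler_wpM2l => //.
  by rewrite lef_pV2 ?posrE ?rt_gt0 // rt_le.
have := seqB (seqB h1 h) h2; rewrite subrr subr0.
by move=> h'; apply: (cvg_ext _ h') => n /=; ring.
Qed.

Lemma conv_sqrt_limit W y l B Y : (fun n => rt R n * W n) @ \oo --> l ->
  (forall n, 0 <= y n <= B / rt R n ^+ 3) -> sums_to y Y ->
  (fun n => rt R n * conv W y n) @ \oo --> l * Y.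
Proof.
move=> hW hy hY; have [K K0 hK] := sqrt_decay_bound hW.
have h1 := conv_sqrt_decay hK (sqrt_decay_step hW) hy hY.
have h2 : (fun n => rt R n * W n * Y) @ \oo --> l * Y.
  by apply: cvgM hW _; apply: cvg_cst.
have := seqD h1 h2; rewrite add0r.
by move=> h'; apply: (cvg_ext _ h') => n /=; ring.
Qed.

Lemma decay3_bound x a : decay3 x a ->
  exists2 B, 0 <= B & forall n, `|x n| <= B / rt R n ^+ 3.
Proof.
move=> /cvg_bounded[K K0 hK]; exists K => // n.
have r3 : 0 < rt R n ^+ 3 by rewrite exprn_gt0 // rt_gt0.
rewrite ler_pdivlMr // mulrC; have := hK n.
by rewrite normrM (gtr0_norm r3).
Qed.

Lemma decay3_bound_ge0 x a : (forall n, 0 <= x n) -> decay3 x a ->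
  exists2 B, 0 <= B & forall n, 0 <= x n <= B / rt R n ^+ 3.
Proof.
move=> x0 /decay3_bound[B B0 hB]; exists B => // n.
by rewrite x0 /=; apply: le_trans (ler_norm _) (hB n).
Qed.

Lemma bound3_sums x B : (forall n, 0 <= x n <= B / rt R n ^+ 3) ->
  exists X, sums_to x X.
Proof.
move=> hx; have [Y hY] := rtV3_summable R.
by have [X hX _] := sums_comp hx (sumsZ (a := B) hY); exists X.
Qed.

Lemma cvg_pred_ratio : (fun n => n%:R / n.+1%:R : R) @ \oo --> (1 : R).
Proof.
have h : (fun n => 1 - (n.+1%:R : R)^-1) @ \oo --> (1 : R).
  rewrite -[X in _ --> X]subr0; apply: cvgB; first exact: cvg_cst.
  exact: cvg_harmonic.
apply: (cvg_ext _ h) => n.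
have -> : n%:R = n.+1%:R - 1 :> R by rewrite -natr1 addrK.
by rewrite mulrBl mul1r divff // pnatr_eq0.
Qed.

Lemma decay3_theta x a : decay3 x a -> (fun n => rt R n * theta x n) @ \oo --> a.
Proof.
move=> h; have := seqM h cvg_pred_ratio; rewrite mulr1 => h'; apply: (cvg_ext _ h') => n; rewrite /theta -(rt_sqr R n).
by field; rewrite rt_neq0.
Qed.

Lemma theta_decay3 x a : (fun n => rt R n * theta x n) @ \oo --> a -> decay3 x a.
Proof.
move=> h.
have hi : (fun n => (n%:R / n.+1%:R : R)^-1) @ \oo --> (1 : R)^-1.
  by apply: seqV cvg_pred_ratio; rewrite oner_neq0.
have := seqM h hi; rewrite invr1 mulr1; move=> h'; apply: (@cvg_eventually_eq _ _ _ _ 1 _ h').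
move=> [//|n] _; rewrite /theta -(rt_sqr R n.+1).
by field; rewrite rt_neq0 /= ?nat1r ?natr1 pnatr_eq0.
Qed.

(** [theta] is a derivation: each of the two terms of theta(x y) is an n^(-1/2) sequence convolved
    with a summable n^(-3/2) one. *)
Lemma decay3_conv x y a b X Y : (forall n, 0 <= x n) -> (forall n, 0 <= y n) ->
  decay3 x a -> decay3 y b -> sums_to x X -> sums_to y Y ->
  decay3 (conv x y) (a * Y + b * X).
Proof.
move=> x0 y0 hx hy hX hY.
have [Bx _ hBx] := decay3_bound_ge0 x0 hx.
have [By _ hBy] := decay3_bound_ge0 y0 hy.
apply: theta_decay3.
have h1 := conv_sqrt_limit (decay3_theta hx) hBy hY.
have h2 := conv_sqrt_limit (decay3_theta hy) hBx hX.
apply: (cvg_ext _ (seqD h1 h2)) => n.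
by rewrite theta_conv (convC x) mulrDr.
Qed.

(** Removing a small enough fraction 1/L of n changes its square root by a factor at most l.
    Inductive bounds use it to lose only a factor close to 1. *)
Lemma rt_ratio l : 1 < l ->
  exists2 L, (0 < L)%N & forall n i, (L * i <= n)%N -> rt R n <= l * rt R (n - i).
Proof.
move=> l1; pose t := l - 1.
have t0 : 0 < t by rewrite subr_gt0.
have h0 : 0 <= (1 + 2 * t) / (2 * t) by rewrite divr_ge0 //; lra.
have hL := archi_boundP h0; set L := Num.bound _ in hL.
have L0 : (0 < L)%N.
  by rewrite -(ltr0n R); apply: le_lt_trans hL.
exists L => // n i hi.
rewrite -(@ler_pXn2r _ 2) ?nnegrE ?mulr_ge0 ?rt_ge0 //; last lra.
rewrite exprMn !rt_sqr.
have ile : (i <= n)%N by nia.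
have -> : n.+1%:R = (n - i).+1%:R + i%:R :> R by rewrite -natrD; congr (_%:R); lia.
have hL2 : 1 + 2 * t < L%:R * (2 * t).
  by rewrite -ltr_pdivrMr //; lra.
have hi2 : L%:R * i%:R <= (n - i).+1%:R + i%:R :> R.
  by rewrite -natrM -natrD ler_nat; lia.
have i0 : 0 <= i%:R :> R by apply: ler0n.
set N : R := (n - i).+1%:R in hi2 *; set I : R := i%:R in hi2 i0 *.
have N0 : 0 <= N by apply: ler0n.
have -> : l ^+ 2 = 1 + 2 * t + t ^+ 2 by rewrite /t; ring.
suff : I <= 2 * t * N by nra.
have : (1 + 2 * t) * I <= 2 * t * (N + I) by nra.
nra.
Qed.

Lemma rt_large L n i : (n < L * i)%N -> rt R n <= L%:R * rt R i.
Proof. by move=> h; apply: rt_leM; case: L h => [|L] h; nia. Qed.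

(** One of the two indices of each term is at least n/2, where the n^(-3/2) bound costs a factor 8 =
    2^3; the other factor is summed. *)
Lemma conv_bound3 x y Bx By : (forall n, 0 <= x n <= Bx / rt R n ^+ 3) ->
  (forall n, 0 <= y n <= By / rt R n ^+ 3) ->
  exists B, forall n, 0 <= conv x y n <= B / rt R n ^+ 3.
Proof.
move=> hx hy.
have [X hX] := bound3_sums hx; have [Y hY] := bound3_sums hy.
have x0 n : 0 <= x n by case/andP: (hx n).
have y0 n : 0 <= y n by case/andP: (hy n).
have half f B n i : (forall n, 0 <= f n <= B / rt R n ^+ 3) -> (n <= 2 * i)%N ->
    f i <= 8 * B / rt R n ^+ 3.
  move=> hf hi; case/andP: (hf i) => f0 h; apply: le_trans h _.
  have B0 : 0 <= B.
    have /andP[h1 h2] := hf 0%N; have := le_trans h1 h2.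
    by rewrite /rt sqrtr1 expr1n divr1.
  have r1 := rt_gt0 R i; have r2 := rt_gt0 R n.
  have h3 : rt R n <= 2%:R * rt R i by apply: rt_leM; lia.
  rewrite ler_pdivrMr ?exprn_gt0 // mulrAC ler_pdivlMr ?exprn_gt0 //.
  rewrite (mulrC 8) -mulrA; apply: ler_wpM2l => //.
  have -> : 8 * rt R i ^+ 3 = (2%:R * rt R i) ^+ 3 by ring.
  by rewrite ler_pXn2r ?nnegrE ?mulr_ge0 ?rt_ge0 ?ler0n.
exists (8 * Bx * Y + 8 * By * X) => n; rewrite conv_ge0 //=.
have r3 : 0 < rt R n ^+ 3 by rewrite exprn_gt0 // rt_gt0.
apply: le_trans (_ : \sum_(i < n.+1) (8 * Bx / rt R n ^+ 3 * y (n - i)%N + 8 * By / rt R n ^+ 3 * x i) <= _).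
  apply: ler_sum => i _.
  have B1 : 0 <= 8 * Bx / rt R n ^+ 3.
    by apply: le_trans (x0 n) (half x Bx n n hx _); lia.
  have B2 : 0 <= 8 * By / rt R n ^+ 3.
    by apply: le_trans (y0 n) (half y By n n hy _); lia.
  case: (leqP n (2 * i)%N) => hi.
    apply: ler_wpDr; first by rewrite mulr_ge0.
    by apply: ler_wpM2r => //; apply: half.
  apply: ler_wpDl; first by rewrite mulr_ge0.
  by rewrite mulrC; apply: ler_wpM2r => //; apply: half => //; lia.
rewrite big_split /= -!mulr_sumr.
have -> : \sum_(i < n.+1) y (n - i)%N = \sum_(i < n.+1) y i.
  rewrite (reindex_inj rev_ord_inj) /=; apply: eq_bigr => i _.
  by rewrite subSS subKn // -ltnS.
have B1 : 0 <= 8 * Bx / rt R n ^+ 3.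
  by apply: le_trans (x0 n) (half x Bx n n hx _); lia.
have B2 : 0 <= 8 * By / rt R n ^+ 3.
  by apply: le_trans (y0 n) (half y By n n hy _); lia.
have := ler_wpM2l B1 (sums_ge n.+1 y0 hY).
have := ler_wpM2l B2 (sums_ge n.+1 x0 hX).
move=> h1 h2; apply: le_trans (lerD h2 h1) _.
by rewrite le_eqVlt; apply/orP; left; apply/eqP; field; rewrite rt_neq0.
Qed.

End DecayingSequences.

(** * Renewal sequences *)

Section Renewal.
Variable R : realType.
Variables f u : nat -> R.
Hypothesis f0 : f 0%N = 0.
Hypothesis f_ge0 : forall n, 0 <= f n.
Hypothesis u_eq : forall n, u n = delta0 R n + conv f u n.

Lemma renewal_u0 : u 0%N = 1.
Proof. by rewrite u_eq conv0 f0 mul0r addr0. Qed.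

Lemma renewal_uS n : u n.+1 = conv f u n.+1.
Proof. by rewrite u_eq /delta0 add0r. Qed.

Lemma renewal_ge0 n : 0 <= u n.
Proof.
elim/ltn_ind: n => -[|n] IH; first by rewrite renewal_u0.
rewrite renewal_uS conv_recl // sumr_ge0 // => i _.
by rewrite mulr_ge0 // IH //; have := ltn_ord i; lia.
Qed.

Lemma renewal_sum N : \sum_(n < N.+1) u n =
  1 + \sum_(i < N.+1) f i * \sum_(j < N.+1 - i) u j.
Proof.
rewrite -conv_sum; under eq_bigr do rewrite u_eq; rewrite big_split /=; congr (_ + _).
by rewrite big_ord_recl /= big1 ?addr0.
Qed.

Lemma renewal_mono m n : (m <= n)%N -> \sum_(i < m) u i <= \sum_(i < n) u i.
Proof.
move=> mn; rewrite (@ord_sum_splitP _ u m n mn) lerDl; apply: sumr_ge0 => i _.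
exact: renewal_ge0.
Qed.

(** The partial sums satisfy T <= 1 + phi T, hence converge, and the limit solves U = 1 + phi U. *)
Lemma renewal_bounded_sub phi : sums_to f phi -> phi < 1 ->
  sums_to u (1 - phi)^-1.
Proof.
move=> hphi phi1.
have phi0 : 0 <= phi by apply: sums_ge0 hphi.
have hb N : \sum_(n < N) u n <= (1 - phi)^-1.
  case: N => [|N]; first by rewrite big_ord0 invr_ge0; lra.
  have h : \sum_(n < N.+1) u n <= 1 + phi * \sum_(n < N.+1) u n.
    rewrite {1}renewal_sum lerD2l.
    apply: le_trans (_ : \sum_(i < N.+1) f i * \sum_(j < N.+1) u j <= _).
      by apply: ler_sum => i _; apply: ler_wpM2l => //; apply: renewal_mono; apply: leq_subr.
    rewrite -mulr_suml; apply: ler_wpM2r; last exact: sums_ge.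
    by apply: sumr_ge0 => i _; apply: renewal_ge0.
  rewrite -[leRHS]mul1r ler_pdivlMr; lra.
have [U hU] := sums_bounded renewal_ge0 hb.
have hd : sums_to (delta0 R) 1.
  apply: eps_cvg => e e0; exists 1%N => -[//|n] _.
  by rewrite big_ord_recl big1 //= addr0 subrr normr0 ltW.
have h := sumsD hd (sums_conv f_ge0 renewal_ge0 hphi hU).
have e : U = 1 + phi * U.
  apply: cvg_uniq hU _; apply: cvg_ext h => n.
  by apply: eq_bigr => i _; rewrite -u_eq.
suff <- : U = (1 - phi)^-1 by [].
have h1 : 1 - phi != 0 by apply/negP => /eqP; lra.
by apply: (mulIf h1); rewrite mulVf // mulrBr mulr1 [X in X - _]e; ring.
Qed.

(** Induction on u_n <= X n^(-3/2). A first return i <= n/L passes the bound on with total factor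
    g^3 phi < 1. A longer one costs [f i] = O(n^(-3/2)) against the finite mass T of u, which gives
    the constant [X0]. *)
Lemma renewal_decay3_bound phi l : sums_to f phi -> phi < 1 -> decay3 f l ->
  exists B, forall n, 0 <= u n <= B / rt R n ^+ 3.
Proof.
move=> hphi phi1 hf.
have phi0 : 0 <= phi by apply: sums_ge0 hphi.
have hU := renewal_bounded_sub hphi phi1; set T := (1 - phi)^-1 in hU.
have T0 : 0 <= T by apply: sums_ge0 hU => n; apply: renewal_ge0.
have [C C0 hC] := decay3_bound_ge0 f_ge0 hf.
(* For t <= 1, (1 + t)^3 <= 1 + 7 t = 1 + (1 - phi)/2, whose product with phi is below 1. *)
pose t := (1 - phi) / 14.
have t0 : 0 < t by rewrite divr_gt0 //; lra.
pose g := 1 + t.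
have [L L0 hL] : exists2 L, (0 < L)%N & forall n i, (L * i <= n)%N -> rt R n <= g * rt R (n - i).
  by apply: rt_ratio; rewrite /g; lra.
have g3 : g ^+ 3 * phi < 1.
  have t1 : t <= 1 by rewrite /t; lra.
  have : g ^+ 3 <= 1 + 7 * t.
    have -> : g ^+ 3 = 1 + 3 * t + 3 * (t * t) + t * t * t by rewrite /g; ring.
    have : t * t <= t by nra.
    have : t * t * t <= t by nra.
    lra.
  have -> : 7 * t = (1 - phi) / 2 by rewrite /t; field.
  nra.
pose X0 := C * L%:R ^+ 3 * T.
have X00 : 0 <= X0 by rewrite !mulr_ge0 // exprn_ge0.
have D0 : 0 < 1 - g ^+ 3 * phi by rewrite subr_gt0.
(* Chosen so that X0 + g^3 phi X <= X; the summand 1 covers u_0 = 1. *)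
pose X := 1 + X0 / (1 - g ^+ 3 * phi).
have hX0 : X0 / (1 - g ^+ 3 * phi) >= 0 by rewrite divr_ge0 // ltW.
exists X => n; rewrite renewal_ge0 /=.
have r3 m : 0 < rt R m ^+ 3 by rewrite exprn_gt0 // rt_gt0.
rewrite ler_pdivlMr //.
elim/ltn_ind: n => -[|n] IH.
  by rewrite renewal_u0 /rt sqrtr1 expr1n mulr1 /X lerDl.
rewrite renewal_uS.
have X1 : 0 <= X by rewrite /X; lra.
apply: le_trans (_ : \sum_(i < n.+2) (C * L%:R ^+ 3 * u (n.+1 - i)%N + g ^+ 3 * X * f i) <= _).
  rewrite /conv mulr_suml; apply: ler_sum => i _.
  have ui := renewal_ge0 (n.+1 - i).
  have g0 : 0 <= g by rewrite /g; lra.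
  case: (leqP (L * i) n.+1) => hi.
    apply: ler_wpDl; first by rewrite !mulr_ge0 // exprn_ge0.
    case: (posnP i) => [->|i0]; first by rewrite f0 mul0r mul0r mulr0.
    rewrite -[leLHS]mulrA [leLHS]mulrC; apply: ler_wpM2r => //.
    have lt_i : (n.+1 - i < n.+1)%N by rewrite ltn_subrL i0.
    have h := IH _ lt_i.
    have h2 : rt R n.+1 ^+ 3 <= g ^+ 3 * rt R (n.+1 - i) ^+ 3.
      rewrite -exprMn ler_pXn2r ?nnegrE ?mulr_ge0 ?rt_ge0 //; exact: hL.
    apply: le_trans (ler_wpM2l ui h2) _.
    rewrite mulrCA; apply: ler_wpM2l => //; exact: exprn_ge0.
  apply: ler_wpDr; first by rewrite !mulr_ge0 // exprn_ge0.
  rewrite [leLHS]mulrAC; apply: ler_wpM2r => //.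
  case/andP: (hC i) => _ h; apply: le_trans (ler_wpM2r (ltW (r3 _)) h) _.
  rewrite mulrAC ler_pdivrMr // -mulrA ler_wpM2l // -exprMn.
  by rewrite ler_pXn2r ?nnegrE ?mulr_ge0 ?rt_ge0 ?ler0n //; apply: rt_large.
rewrite big_split /= -!mulr_sumr.
have -> : \sum_(i < n.+2) u (n.+1 - i)%N = \sum_(i < n.+2) u i.
  rewrite (reindex_inj rev_ord_inj) /=; apply: eq_bigr => i _.
  by rewrite subSS subKn // -ltnS.
have h1 : C * L%:R ^+ 3 * \sum_(i < n.+2) u i <= X0.
  rewrite /X0; apply: ler_wpM2l; first by rewrite mulr_ge0 // exprn_ge0.
  by apply: sums_ge hU => m; apply: renewal_ge0.
have h2 : g ^+ 3 * X * \sum_(i < n.+2) f i <= g ^+ 3 * X * phi.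
  apply: ler_wpM2l; last exact: sums_ge.
  by rewrite mulr_ge0 // exprn_ge0 // /g; lra.
apply: le_trans (lerD h1 h2) _.
have e : X0 = (X - 1) * (1 - g ^+ 3 * phi).
  by rewrite /X addrAC subrr add0r mulfVK // gt_eqF.
rewrite e; nra.
Qed.

(** By [renewal_theta], theta u is theta f convolved with u * u, a sequence O(n^(-3/2)) of sum (1 -
    phi)^(-2). *)
Lemma renewal_decay3 phi l : sums_to f phi -> phi < 1 -> decay3 f l ->
  decay3 u (l / (1 - phi) ^+ 2).
Proof.
move=> hphi phi1 hf.
have hU := renewal_bounded_sub hphi phi1.
have [B hB] := renewal_decay3_bound hphi phi1 hf.
have [B2 hB2] := conv_bound3 hB hB.
apply: theta_decay3.
have h := conv_sqrt_limit (decay3_theta hf) hB2 (sums_conv renewal_ge0 renewal_ge0 hU hU).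
rewrite -exprVn -[_ ^+ 2]/(_ * _).
by apply: cvg_ext h => n; rewrite -renewal_theta.
Qed.

End Renewal.

(** * Sequences that nearly reproduce their own averages *)

Section AveragingWindow.
Variable R : realType.

(* The Erdos-Feller-Pollard argument: a value of a close to its limsup forces
   every preceding value at a distance in the support of f to be close to it
   too, so long windows of a are all close to the limsup. *)
Lemma averaging_limsup_le0 (f a : nat -> R) (B B' : R) (n0 : nat) :
  (forall n, 0 <= f n) -> (forall n, \sum_(i < n) f i <= 1) ->
  (forall n, (n0 <= n)%N -> 0 < f n) -> (forall n, `|a n| <= B) ->
  (forall e M, 0 < e -> exists N, forall n, (N <= n)%N ->
     exists K, [/\ (K + M <= n)%N, (M <= K)%N &
       `|a n - \sum_(j < K) f j * a (n - j)%N| <= e]) ->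
  (forall L, exists N, forall n, (N <= n)%N -> \sum_(j < L) a (n + j)%N <= B') ->
  forall e, 0 < e -> exists N, forall n, (N <= n)%N -> a n <= e.
Proof.
move=> f0 f1 fpos aB Have Hwin.
pose S := [set l : R | exists N, forall n, (N <= n)%N -> a n <= l].
have SB : S B by exists 0%N => n _; apply: le_trans (ler_norm _) (aB n).
have lbS : lbound S (- B).
  move=> l [N hN]; apply: le_trans (hN N (leqnn _)).
  by have := aB N; rewrite ler_norml => /andP[].
have infS : has_inf S by split; [exists B | exists (- B)].
pose lam := inf S.
have above e : 0 < e -> exists N, forall n, (N <= n)%N -> a n <= lam + e.
  move=> e0; have [l [N hN] hl] := inf_adherent e0 infS.
  by exists N => n Nn; apply: le_trans (hN n Nn) (ltW hl).
have below e N : 0 < e -> exists2 n, (N <= n)%N & lam - e < a n.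
  move=> e0; apply: contrapT => hn.
  have : S (lam - e).
    exists N => n Nn; rewrite leNgt; apply/negP => h; apply: hn.
    by exists n.
  move=> /(ge_inf (proj2 infS)); rewrite -/lam; lra.
suff lam0 : lam <= 0.
  move=> e e0; have [N hN] := above e e0; exists N => n Nn.
  by apply: le_trans (hN n Nn) _; lra.
rewrite leNgt; apply/negP => lam_gt0.
(* A window of L values all at least lam/2 would exceed the window bound B'. *)
have [L hL] : exists L : nat, B' < L%:R * (lam / 2).
  exists (Num.bound (`|B'| / (lam / 2))).
  rewrite -ltr_pdivrMr ?divr_gt0 //.
  apply: le_lt_trans (archi_boundP _); last by rewrite divr_ge0 // divr_ge0 // ltW.
  by rewrite ler_pM2r ?ler_norm // invr_gt0 divr_gt0.
have [m m0 hm] : exists2 m, 0 < m & forall j, (n0 <= j < n0 + L)%N -> m <= f j.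
  elim: L {hL} => [|L [m m0 hm]].
    by exists 1 => // j; rewrite addn0; case: ltnP => //; lia.
  exists (Num.min m (f (n0 + L)%N)); first by rewrite lt_min m0 fpos // leq_addr.
  move=> j hj; case: (eqVneq j (n0 + L)%N) => [->|ne]; first by rewrite ge_min lexx orbT.
  by rewrite ge_min hm //; lia.
(* With a_n >= lam - e and all other values at most lam + e, the term of index j keeps f_j a_(n-j)
   >= f_j lam - 3 e. As f_j >= m, the loss 3 e is at most f_j lam / 2. *)
pose e := m * lam / 6.
have e0 : 0 < e by rewrite /e !divr_gt0 ?mulr_gt0.
have [N1 h1] := above e e0.
have [N2 h2] := Hwin L.
(* K + M <= n keeps every n - j with j < K beyond N1, where a <= lam + e; M <= K makes the whole
   window of indices fall below K. *)
have [N3 h3] := Have e (N1 + n0 + L)%N e0.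
have [n Nn an] := below e (N3 + N2 + n0 + L)%N e0.
have [K [K1 K2 hK]] := h3 n ltac:(lia).
have key j : (n0 <= j < n0 + L)%N -> lam / 2 <= a (n - j)%N.
  move=> hj; have jK : (j < K)%N by lia.
  have hle i : (i < K)%N -> a (n - i)%N <= lam + e by move=> iK; apply: h1; lia.
  have hs : \sum_(i < K) f i * a (n - i)%N <= f j * a (n - j)%N + (1 - f j) * (lam + e).
    rewrite (bigD1 (Ordinal jK)) //= lerD2l.
    apply: le_trans (_ : \sum_(i < K | i != Ordinal jK) f i * (lam + e) <= _).
      by apply: ler_sum => i _; apply: ler_wpM2l => //; apply: hle.
    rewrite -mulr_suml; apply: ler_wpM2r; first lra.
    have := f1 K; rewrite (bigD1 (Ordinal jK)) //=; lra.
  have mj := hm j hj.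
  have fj1 : f j <= 1.
    have := f1 K; rewrite (bigD1 (Ordinal jK)) //=.
    have : 0 <= \sum_(i < K | i != Ordinal jK) f i by apply: sumr_ge0.
    lra.
  move: hK; rewrite ler_norml => /andP[_ hK].
  have h4 : f j * lam - 3 * e <= f j * a (n - j)%N by nra.
  have h5 : 3 * e <= f j * (lam / 2) by rewrite /e; nra.
  have fj0 : 0 < f j by apply: lt_le_trans mj.
  rewrite -(ler_pM2l fj0); lra.
have hw := h2 (n - n0 - L).+1 ltac:(lia).
have : \sum_(j < L) (lam / 2) <= \sum_(j < L) a ((n - n0 - L).+1 + j)%N.
  apply: ler_sum => j _; have jL := ltn_ord j.
  have -> : ((n - n0 - L).+1 + j = n - (n0 + (L - j.+1)))%N by lia.
  by apply: key; lia.
rewrite sumr_const card_ord -mulr_natl; lra.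
Qed.

(** The one-sided bound is applied to a and to -a. That B' does not depend on L is the heart of the
    hypothesis on windows. *)
Lemma averaging_cvg0 (f a : nat -> R) (B B' : R) (n0 : nat) :
  (forall n, 0 <= f n) -> (forall n, \sum_(i < n) f i <= 1) ->
  (forall n, (n0 <= n)%N -> 0 < f n) -> (forall n, `|a n| <= B) ->
  (forall e M, 0 < e -> exists N, forall n, (N <= n)%N ->
     exists K, [/\ (K + M <= n)%N, (M <= K)%N &
       `|a n - \sum_(j < K) f j * a (n - j)%N| <= e]) ->
  (forall L, exists N, forall n, (N <= n)%N -> `|\sum_(j < L) a (n + j)%N| <= B') ->
  a @ \oo --> (0 : R).
Proof.
move=> f0 f1 fpos aB Have Hwin; apply: eps_cvg => e e0.
have [|N1 h1] := @averaging_limsup_le0 f a B B' n0 f0 f1 fpos aB Have _ e e0.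
  move=> L; have [N hN] := Hwin L; exists N => n Nn.
  by apply: le_trans (ler_norm _) (hN n Nn).
have [|||N2 h2] := @averaging_limsup_le0 f (fun n => - a n) B B' n0 f0 f1 fpos _ _ _ e e0.
- by move=> n; rewrite normrN.
- move=> e' M e'0; have [N hN] := Have e' M e'0; exists N => n Nn.
  have [K [K1 K2 hK]] := hN n Nn; exists K; split => //.
  rewrite (eq_bigr (fun j : 'I_K => - (f j * a (n - j)%N))); last by move=> j _; rewrite mulrN.
  by rewrite sumrN opprK -normrN opprD opprK.
- move=> L; have [N hN] := Hwin L; exists N => n Nn.
  by apply: le_trans (hN n Nn); rewrite sumrN -normrN ler_norm.
exists (maxn N1 N2) => n; rewrite geq_max => /andP[n1 n2].
by rewrite subr0 ler_norml h1 // andbT lerNl h2.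
Qed.

End AveragingWindow.

(** With r = n / (3 L), the level m = n - r - 1 is so close to n that every index within r of m
    differs from n by at most n/L, while r stays comparable with n. *)
Lemma level_choice L n : (0 < L)%N -> (12 * L <= n)%N ->
  exists r m, [/\ n = (m.+1 + r)%N, (r <= m)%N,
    forall i, (m - r < i)%N -> (L * (n - i) <= n)%N &
    (n.+1 <= (12 * L) ^ 2 * r.+1)%N].
Proof.
move=> L0 hn; exists (n %/ (3 * L))%N; set r := (n %/ _)%N.
have r3L : (r * (3 * L) <= n)%N by apply: leq_trunc_div.
have r3U : (n < r.+1 * (3 * L))%N by rewrite /r; apply: ltn_ceil; rewrite muln_gt0.
move: r r3L r3U => r r3L r3U.
have Lr : (L * (2 * r + 1) <= n)%N.
  have -> : (L * (2 * r + 1) = 2 * (r * L) + L)%N by rewrite mulnDr muln1 mulnCA (mulnC L).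
  by move: r3L; rewrite mulnCA; move: (r * L)%N => k; lia.
have rn : (2 * r + 1 <= n)%N by apply: leq_trans Lr; rewrite leq_pmull.
have hr : (n.+1 <= (12 * L) ^ 2 * r.+1)%N.
  apply: leq_trans r3U _; rewrite mulnC leq_mul2r /=.
  apply: leq_trans (_ : (12 * L <= _)%N); first by rewrite leq_mul2r orbT.
  by rewrite -mulnn leq_pmulr // muln_gt0.
exists (n - r.+1)%N; split => //; [by clear -rn; lia|by clear -rn; lia|].
move=> i hi; apply: leq_trans Lr; rewrite leq_mul2l; apply/orP; right.
by clear -rn hi; lia.
Qed.

(** * Renewal sequences of a probability law *)

Section RecurrentRenewal.
Variable R : realType.
Variables f u : nat -> R.
Hypothesis f0 : f 0%N = 0.
Hypothesis f_ge0 : forall n, 0 <= f n.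
Hypothesis u_eq : forall n, u n = delta0 R n + conv f u n.
Hypothesis f_sum1 : sums_to f 1.
Variable n0 : nat.
Hypothesis f_gt0 : forall n, (n0 <= n)%N -> 0 < f n.

Let u0 := renewal_u0 f0 u_eq.
Let uS := renewal_uS u_eq.
Let u_ge0 := renewal_ge0 f0 f_ge0 u_eq.

(** With f read as the law of the time between renewals, the probability that this time exceeds
    n. *)
Definition ftail n : R := 1 - \sum_(i < n.+1) f i.

Lemma ftail_ge0 n : 0 <= ftail n.
Proof. by rewrite subr_ge0; apply: sums_ge f_sum1. Qed.

Lemma ftail0 : ftail 0 = 1.
Proof. by rewrite /ftail big_ord1 f0 subr0. Qed.

Lemma ftailS n : ftail n = ftail n.+1 + f n.+1.
Proof. by rewrite /ftail [in RHS]big_ord_recr /=; ring. Qed.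

Lemma ftail_le m n : (m <= n)%N -> ftail n <= ftail m.
Proof.
move=> /subnKC <-; elim: (n - m)%N => [|k IH]; first by rewrite addn0.
by apply: le_trans IH; rewrite addnS (ftailS (m + k)) lerDl.
Qed.

Lemma ftail_diff m k : \sum_(i < k) f (m.+1 + i)%N = ftail m - ftail (m + k).
Proof.
elim: k => [|k IH]; first by rewrite big_ord0 addn0 subrr.
by rewrite big_ord_recr /= IH addnS (ftailS (m + k)) addSn; ring.
Qed.

(* Some renewal must be the last one before n. *)
Lemma renewal_ftail n : conv u ftail n = 1.
Proof.
elim: n => [|n IH]; first by rewrite conv0 u0 ftail0 mulr1.
transitivity (conv u ftail n) => //.
have e : u n.+1 = \sum_(i < n.+1) u i * f (n.+1 - i)%N.
  by rewrite uS convC {1}/conv big_ord_recr /= subnn f0 mulr0 addr0.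
rewrite {1}/conv big_ord_recr /= subnn ftail0 mulr1 e -big_split /=.
apply: eq_bigr => i _.
by rewrite subSn; [rewrite (ftailS (n - i)); ring | rewrite -ltnS].
Qed.

Lemma renewal_le1 n : u n <= 1.
Proof.
have := renewal_ftail n; rewrite /conv big_ord_recr /= subnn ftail0 mulr1 => <-.
rewrite lerDr; apply: sumr_ge0 => i _; apply: mulr_ge0 (ftail_ge0 _).
exact: u_ge0.
Qed.

Lemma f_sum_le1 n : \sum_(i < n) f i <= 1.
Proof. exact: sums_ge. Qed.

Definition uinc n : R := u n.+1 - u n.

Lemma uinc_bound n : `|uinc n| <= 1.
Proof.
rewrite ler_norml /uinc; have := renewal_le1 n; have := renewal_le1 n.+1.
have := u_ge0 n; have := u_ge0 n.+1.
by move=> ? ? ? ?; apply/andP; split; lra.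
Qed.

Lemma uinc_eq n : (0 < n)%N -> uinc n = conv f uinc n + f n.+1.
Proof.
case: n => // n _; rewrite /uinc !uS {1}/conv big_ord_recr /= subnn u0 mulr1.
rewrite addrAC; congr (_ + _).
rewrite /conv -sumrB; apply: eq_bigr => i _.
by rewrite -mulrBr subSn // -ltnS.
Qed.

Lemma sum_uinc n L : \sum_(j < L) uinc (n + j)%N = u (n + L)%N - u n.
Proof.
elim: L => [|L IH]; first by rewrite big_ord0 addn0 subrr.
by rewrite big_ord_recr /= IH /uinc addnS; ring.
Qed.

(** The increments satisfy the renewal equation up to the vanishing term f(n+1), and their window
    sums telescope, hence stay below 1 for every window length. *)
Lemma renewal_increments_cvg0 : uinc @ \oo --> (0 : R).
Proof.
apply: (@averaging_cvg0 R f uinc 1 1 n0 f_ge0 f_sum_le1 f_gt0 uinc_bound); last first.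
  move=> L; exists 0%N => n _; rewrite sum_uinc ler_norml.
  have := renewal_le1 n; have := renewal_le1 (n + L); have := u_ge0 n; have := u_ge0 (n + L).
  by move=> ? ? ? ?; apply/andP; split; lra.
move=> e M e0.
have [N hN] := sums_small f_ge0 f_sum1 e0.
exists ((N + M).+1 + M)%N => n hn; exists (N + M)%N; split; [lia|lia|].
have Kn : (N + M <= n.+1)%N by lia.
rewrite uinc_eq; last lia.
rewrite /conv (@ord_sum_splitP R (fun j => f j * uinc (n - j)%N) _ _ Kn).
set A := \sum_(i < N + M) _; set C := \sum_(i < _) _.
have -> : A + C + f n.+1 - A = C + f n.+1 by ring.
have := hN (N + M)%N (n.+1 - (N + M)).+1%N ltac:(lia).
rewrite big_ord_recr /= subnKC // => h; apply: le_trans h.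
apply: le_trans (ler_normD _ _) _; rewrite (ger0_norm (f_ge0 n.+1)) lerD2r.
apply: le_trans (ler_norm_sum _ _ _) _; apply: ler_sum => i _.
by rewrite normrM ger0_norm // ler_piMr // uinc_bound.
Qed.

(** In the identity [renewal_ftail], vanishing increments allow u(n - k) to be replaced by u(n)
    under the summable weights [ftail], so mu u(n) tends to 1. *)
Lemma renewal_theorem mu : sums_to ftail mu -> u @ \oo --> mu^-1.
Proof.
move=> hmu.
have mu1 : 1 <= mu.
  by have := sums_ge 1 ftail_ge0 hmu; rewrite big_ord1 ftail0.
have d0 k : (fun n => u (n - k)%N - u n) @ \oo --> (0 : R).
  elim: k => [|k IH].
    by apply: cvg_ext (cvg_cst 0) => n; rewrite subn0 subrr.
  apply: eps_cvg => e e0; have e2 : 0 < e / 2 by rewrite divr_gt0.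
  have [N1 h1] := cvg_eps IH e2; have [N2 h2] := cvg_eps renewal_increments_cvg0 e2.
  exists (maxn N1 (N2 + k.+1)) => n; rewrite geq_max => /andP[n1 n2].
  have := h1 n n1; have := h2 (n - k.+1)%N ltac:(lia); rewrite !subr0 /uinc.
  have -> : (n - k.+1).+1 = (n - k)%N by lia.
  rewrite !ler_norml => /andP[? ?] /andP[? ?]; apply/andP; split; lra.
have h : (fun n => \sum_(k < n.+1) ftail k * (u (n - k)%N - u n)) @ \oo --> (0 : R).
  apply: (@tannery R (fun n k => ftail k * (u (n - k)%N - u n)) (fun=> 0) ftail mu 0 (fun n => n.+1)) => //.
  - by move=> k; rewrite -[X in _ --> X](mulr0 (ftail k)); apply: seqZ.
  - move=> n k; rewrite normrM ger0_norm ?ftail_ge0 // ler_piMr ?ftail_ge0 // ler_norml.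
    have := renewal_le1 n; have := renewal_le1 (n - k); have := u_ge0 n; have := u_ge0 (n - k).
    by move=> ? ? ? ?; apply/andP; split; lra.
  - by rewrite /sums_to; under eq_fun do rewrite big1 //; apply: cvg_cst.
have h2 : (fun n => u n * (mu - \sum_(k < n.+1) ftail k)) @ \oo --> (0 : R).
  apply: (@cvg_squeeze0 _ _ (fun n => mu - \sum_(k < n.+1) ftail k)).
    move=> n; have hp : 0 <= mu - \sum_(k < n.+1) ftail k.
      by rewrite subr_ge0; apply: sums_ge hmu; apply: ftail_ge0.
    by rewrite normrM (ger0_norm hp) (ger0_norm (u_ge0 n)) ler_piMl // renewal_le1.
  rewrite -[X in _ --> X](subrr mu); apply: seqB; first exact: cvg_cst.
  by apply: (cvg_reindex (s := fun n => n.+1)) hmu.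
have mu0 : mu != 0 by apply/negP => /eqP; lra.
have h3 : (fun=> 1 : R) @ \oo --> (1 : R) by apply: cvg_cst.
have := seqZ (a := mu^-1) (seqB h3 (seqB h h2)).
rewrite !subr0 mulr1 => h'; apply: (cvg_ext _ h') => n.
apply: (mulfI mu0); rewrite mulrA mulfV // mul1r.
have := renewal_ftail n; rewrite convC /conv => e.
have -> : \sum_(k < n.+1) ftail k * (u (n - k)%N - u n) = 1 - u n * \sum_(k < n.+1) ftail k.
  rewrite -{1}e mulr_sumr -sumrB; apply: eq_bigr => i _; ring.
ring.
Qed.

(* Decomposition at the renewal-free gap straddling level m: the last renewal
   at or before m is i, and the next one is at m + 1 + s. *)
Definition first_after m s : R := \sum_(i < m.+1) u i * f (m.+1 + s - i)%N.

(** As functions of r, both sides solve the renewal equation with forcing term [first_after m]. *)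
Lemma renewal_level m r : u (m.+1 + r)%N = conv (first_after m) u r.
Proof.
set G := first_after m.
have h1 k : u (m.+1 + k)%N = G k + conv f (fun r => u (m.+1 + r)%N) k.
  rewrite addSn uS convC /conv -addSn -addnS big_split_ord /=; congr (_ + _).
  rewrite -[RHS]/(conv f (fun r => u (m.+1 + r)%N) k) convC; apply: eq_bigr => i _.
  by congr (_ * f _); lia.
have h2 k : conv G u k = G k + conv f (conv G u) k.
  rewrite convA (convC f) -convA.
  have {1}-> : u = (fun n => delta0 R n + conv f u n) by apply/funext.
  by rewrite convDr conv1r.
apply/eqP; rewrite -subr_eq0; apply/eqP; move: r.
apply: (@conv_fix0 _ f) => // n; rewrite convDr convNr h1 h2; ring.
Qed.

Variable l : R.
Hypothesis l_gt0 : 0 < l.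
Hypothesis f_decay : decay3 f l.

Let T n := \sum_(i < n) u i.

Lemma f_lower : exists2 c, 0 < c & exists N, forall n, (N <= n)%N -> c / rt R n ^+ 3 <= f n.
Proof.
have l2 : 0 < l / 2 by rewrite divr_gt0.
exists (l / 2) => //; have [N hN] := cvg_eps f_decay l2.
exists N => n /hN; rewrite ler_norml => /andP[h _].
rewrite ler_pdivrMr ?exprn_gt0 ?rt_gt0 // mulrC; lra.
Qed.

Lemma ftail_upper : exists2 C, 0 < C & forall n, ftail n <= C / rt R n.
Proof.
have [B B0 hB] := decay3_bound_ge0 f_ge0 f_decay.
exists (2 * B + 1) => [|n]; first lra.
have h := sums_tail (n := n.+1) f_ge0 f_sum1.
apply: le_trans (_ : 2 * B / rt R n <= _); last first.
  by rewrite ler_pM2r ?invr_gt0 ?rt_gt0 //; lra.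
apply: sums_le h => m.
apply: le_trans (_ : B * \sum_(i < m) (rt R (n.+1 + i)) ^- 3 <= _).
  by rewrite mulr_sumr; apply: ler_sum => i _; case/andP: (hB (n.+1 + i)%N).
have -> : 2 * B / rt R n = B * (2 / rt R n) by ring.
by apply: ler_wpM2l => //; apply: sum_rtV3.
Qed.

(** The values of f on a block of length about n, starting near n, already have mass of order
    n^(-1/2). The block starts beyond n + N so that the bound holds at every n. *)
Lemma ftail_lower : exists2 c, 0 < c & forall n, c / rt R n <= ftail n.
Proof.
have [c c0 [N hN]] := f_lower.
exists (c / 8 / N.+1%:R) => [|n]; first by rewrite !divr_gt0.
apply: le_trans (ftail_le (leq_addr N n)).
have h := ftail_diff (n + N) (n + N).+1.
have ht := ftail_ge0 (n + N + (n + N).+1).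
apply: le_trans (_ : \sum_(i < (n + N).+1) f ((n + N).+1 + i)%N <= _); last by rewrite h; lra.
have r1 := rt_gt0 R (n + N); have r2 := rt_gt0 R n.
apply: le_trans (_ : \sum_(i < (n + N).+1) c / (8 * rt R (n + N) ^+ 3) <= _); last first.
  apply: ler_sum => i _; apply: le_trans (hN _ _); last lia.
  apply: ler_wpM2l; first exact: ltW.
  rewrite lef_pV2 ?posrE ?exprn_gt0 ?mulr_gt0 ?exprn_gt0 ?rt_gt0 //.
  have h3 : rt R ((n + N).+1 + i) <= 2%:R * rt R (n + N) by apply: rt_leM; have := ltn_ord i; lia.
  have -> : 8 * rt R (n + N) ^+ 3 = (2%:R * rt R (n + N)) ^+ 3 by ring.
  by rewrite ler_pXn2r ?nnegrE ?mulr_ge0 ?rt_ge0 ?ler0n.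
rewrite sumr_const card_ord -[leRHS]mulr_natl -(rt_sqr R (n + N)).
have h3 : rt R (n + N) <= N.+1%:R * rt R n by apply: rt_leM; nia.
have -> : rt R (n + N) ^+ 2 * (c / (8 * rt R (n + N) ^+ 3)) = c / 8 / rt R (n + N).
  by field; rewrite rt_neq0.
have -> : c / 8 / N.+1%:R / rt R n = c / 8 / (N.+1%:R * rt R n).
  by rewrite invfM mulrA.
apply: ler_wpM2l; first by rewrite divr_ge0 // ltW.
by rewrite lef_pV2 ?posrE ?mulr_gt0.
Qed.

Lemma T_ge0 n : 0 <= T n.
Proof. by apply: sumr_ge0 => i _; apply: u_ge0. Qed.

(** Summing [renewal_ftail] over k < 2n gives T(n) times the sum of n tails <= 2n, and that sum is
    at least of order sqrt n. [T_lower] reads the same identity in the other direction. *)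
Lemma T_upper : exists2 C, 0 < C & forall n, T n <= C * rt R n.
Proof.
have [c c0 hc] := ftail_lower.
exists (2 / c) => [|n]; first by rewrite divr_gt0.
case: n => [|n]; first by rewrite /T big_ord0 mulr_ge0 ?rt_ge0 // divr_ge0 // ltW.
have r1 := rt_gt0 R n.+1.
have h1 : T n.+1 * (n.+1%:R * (c / rt R n.+1)) <= (n.+1 + n.+1)%:R.
  have <- : \sum_(k < n.+1 + n.+1) conv u ftail k = (n.+1 + n.+1)%:R :> R.
    by rewrite (eq_bigr (fun=> 1)) ?sumr_const ?card_ord // => i _; apply: renewal_ftail.
  rewrite conv_sum big_split_ord /=.
  apply: ler_wpDr.
    apply: sumr_ge0 => i _; rewrite mulr_ge0 ?u_ge0 // sumr_ge0 // => j _; exact: ftail_ge0.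
  rewrite /T mulr_suml; apply: ler_sum => i _; apply: ler_wpM2l; first exact: u_ge0.
  have in1 : (n.+1 <= n.+1 + n.+1 - i)%N by have := ltn_ord i; lia.
  rewrite (@ord_sum_splitP R ftail _ _ in1); apply: ler_wpDr.
    apply: sumr_ge0 => j _; exact: ftail_ge0.
  apply: le_trans (_ : \sum_(j < n.+1) c / rt R n.+1 <= _).
    by rewrite sumr_const card_ord mulr_natl.
  apply: ler_sum => j _; apply: le_trans (hc j); apply: ler_wpM2l; first exact: ltW.
  by rewrite lef_pV2 ?posrE ?rt_gt0 // rt_le // ltnW // ltnW // ltnS.
have n1 : 0 < n.+1%:R :> R by rewrite ltr0n.
rewrite -(ler_pM2r (_ : 0 < n.+1%:R * (c / rt R n.+1))); last by rewrite mulr_gt0 // divr_gt0.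
apply: le_trans h1 _; rewrite natrD le_eqVlt; apply/orP; left; apply/eqP.
field; by rewrite rt_neq0 gt_eqF.
Qed.

Lemma T_lower : exists2 c, 0 < c & forall n, c * rt R n <= T n.+1.
Proof.
have [C C0 hC] := ftail_upper.
exists (4 * C)^-1 => [|n]; first by rewrite invr_gt0 mulr_gt0.
have r1 := rt_gt0 R n.
rewrite mulrC ler_pdivrMr ?mulr_gt0 // -(ler_pM2r r1) -expr2 rt_sqr.
have <- : \sum_(k < n.+1) conv u ftail k = n.+1%:R :> R.
  by rewrite (eq_bigr (fun=> 1)) ?sumr_const ?card_ord // => i _; apply: renewal_ftail.
rewrite conv_sum -mulrA /T mulr_suml; apply: ler_sum => i _.
apply: ler_wpM2l; first exact: u_ge0.
apply: le_trans (_ : C * \sum_(j < n.+1 - i) (rt R j)^-1 <= _).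
  by rewrite mulr_sumr; apply: ler_sum => j _.
have h : \sum_(j < n.+1 - i) (rt R j)^-1 <= 4 * rt R n.
  apply: le_trans (sum_rtV R _) _.
  have : rt R (n.+1 - i) <= 2%:R * rt R n by apply: rt_leM; lia.
  lra.
have := ler_wpM2l (ltW C0) h; lra.
Qed.

(** One long return of length n - i - j links a renewal at j < k to the last i < k steps, with k =
    n/4. The choices of i and j weigh T(k)^2, of order n, and each return costs n^(-3/2). *)
Lemma renewal_lower : exists2 c, 0 < c & exists N, forall n, (N <= n)%N -> c / rt R n <= u n.
Proof.
have [c c0 [N hN]] := f_lower; have [c2 c20 hT] := T_lower.
exists (c * c2 ^+ 2 / 64); first by rewrite divr_gt0 // mulr_gt0 // exprn_gt0.
exists (4 * N + 8)%N => n nN.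
have [k [k1 k2 k3]] : exists k, [/\ (0 < k)%N, (n.+1 <= 8 * k)%N & (2 * k + N <= n)%N].
  by exists (n %/ 4)%N; split; lia.
have r1 := rt_gt0 R n; have rk := rt_gt0 R k.
have hu : T k * T k * (c / rt R n ^+ 3) <= u n.
  have -> : n = ((k.-1).+1 + (n - k))%N by lia.
  rewrite renewal_level convC /conv.
  have kk : (k <= (n - k).+1)%N by lia.
  rewrite (@ord_sum_splitP R (fun i => u i * first_after k.-1 (n - k - i)) _ _ kk).
  apply: ler_wpDr.
    by apply: sumr_ge0 => i _; rewrite mulr_ge0 ?u_ge0 // sumr_ge0 // => j _; rewrite mulr_ge0.
  rewrite -mulrA {1}/T mulr_suml; apply: ler_sum => i _.
  apply: ler_wpM2l; first exact: u_ge0.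
  rewrite /first_after prednK // /T mulr_suml; apply: ler_sum => j _.
  apply: ler_wpM2l; first exact: u_ge0.
  have := ltn_ord i; have := ltn_ord j => jk ik.
  apply: le_trans (hN _ _); last lia.
  apply: ler_wpM2l; first exact: ltW.
  rewrite lef_pV2 ?posrE ?exprn_gt0 ?rt_gt0 // ler_pXn2r ?nnegrE ?rt_ge0 //.
  by apply: rt_le; lia.
apply: le_trans hu.
have h1 : c2 ^+ 2 * (n.+1%:R / 16) <= T k * T k.
  have hTk := hT k.-1; rewrite prednK // in hTk.
  have p0 : 0 <= c2 * rt R k.-1 by rewrite mulr_ge0 ?rt_ge0 // ltW.
  apply: le_trans (ler_pM p0 p0 hTk hTk).
  have -> : c2 * rt R k.-1 * (c2 * rt R k.-1) = c2 ^+ 2 * rt R k.-1 ^+ 2 by ring.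
  apply: ler_wpM2l; first by rewrite exprn_ge0 // ltW.
  rewrite rt_sqr prednK // ler_pdivrMr // -natrM ler_nat; lia.
apply: le_trans (ler_wpM2r (_ : 0 <= c / rt R n ^+ 3) h1); last first.
  by rewrite divr_ge0 ?exprn_ge0 // ltW.
rewrite -(rt_sqr R n).
have -> : c2 ^+ 2 * (rt R n ^+ 2 / 16) * (c / rt R n ^+ 3) = c * c2 ^+ 2 / 16 / rt R n.
  by field; rewrite rt_neq0.
rewrite ler_pM2r ?invr_gt0 //.
have : 0 <= c * c2 ^+ 2 by rewrite mulr_ge0 ?exprn_ge0 // ltW.
lra.
Qed.

(** Induction on u_n sqrt(n) <= X through the renewals around a level m. Returns across m that start
    at least r before it contribute a constant Y. For shorter ones the induction hypothesis gives
    the factor X g, and their total weight is at most 1 - th, since longer returns always keep a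
    share th. The strict gain g (1 - th) < 1 absorbs Y. *)
Lemma renewal_upper : exists2 C, 0 <= C & forall n, u n <= C / rt R n.
Proof.
have [B B0 hB] := decay3_bound_ge0 f_ge0 f_decay.
have [c1 c10 hT1] := T_lower; have [C1 C10 hT2] := T_upper.
have [c2 c20 hF] := ftail_lower.
(* c1 c2 / 2 is what [T_lower] and [ftail_lower] give for the share of the long returns. *)
pose th := Num.min (c1 * c2 / 2) 2^-1.
have th0 : 0 < th by rewrite lt_min invr_gt0 ltr0n andbT divr_gt0 // mulr_gt0.
have th12 : th <= 2^-1 by rewrite ge_min lexx orbT.
have thc : th <= c1 * c2 / 2 by rewrite ge_min lexx.
pose g := 1 + th / 2.
have [L L0 hL] : exists2 L, (0 < L)%N & forall n i, (L * i <= n)%N -> rt R n <= g * rt R (n - i).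
  by apply: rt_ratio; rewrite /g; lra.
have g1 : g * (1 - th) <= 1 - th / 2 by rewrite /g; nra.
have L1 : 0 <= L%:R :> R by apply: ler0n.
pose Y := B * (12 * L%:R) ^+ 3 * (C1 * C1).
have Y0 : 0 <= Y by rewrite !mulr_ge0 // ?exprn_ge0 ?mulr_ge0 // ltW.
(* The first term settles n < 12 L, where u_n <= 1; the second satisfies Y = (X - 12 L) th/2. *)
pose X := (12 * L%:R) + Y / (th / 2).
have Yth : 0 <= Y / (th / 2) by rewrite divr_ge0 // ltW // divr_gt0.
have X0 : 0 <= X by rewrite /X addr_ge0 // mulr_ge0.
exists X => // n; have r1 := rt_gt0 R n.
rewrite ler_pdivlMr //; elim/ltn_ind: n r1 => n IH r1.
case: (ltnP n (12 * L)%N) => hn.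
  apply: le_trans (_ : rt R n <= _).
    by rewrite ler_piMl ?rt_ge0 ?renewal_le1.
  apply: le_trans (_ : 12 * L%:R <= _); last first.
    by rewrite /X lerDl divr_ge0 // ltW // divr_gt0.
  apply: le_trans (_ : rt R n ^+ 2 <= _).
    by rewrite expr2 ler_peMr ?rt_ge0 ?rt_ge1.
  by rewrite rt_sqr -natrM ler_nat.
have [r [m [em rm hLi hr]]] := level_choice L0 hn.
have hrt : rt R n <= (12 * L)%:R * rt R r by apply: rt_leM.
clear hr hn.
have rr0 := rt_gt0 R r.
(* the window of last renewals at distance less than r from m *)
have hshort i : (m - r < i <= m)%N -> u i * rt R n <= X * g.
  move=> hi; have hi2 : rt R n <= g * rt R i.
    rewrite (_ : i = (n - (n - i))%N); last by clear -em hi; lia.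
    by apply: hL; apply: hLi; case/andP: hi.
  apply: le_trans (ler_wpM2l (u_ge0 i) hi2) _.
  rewrite mulrCA mulrC ler_wpM2r //; first by rewrite /g; lra.
  by apply: IH; [clear -em hi; lia | apply: rt_gt0].
have hG s : (s <= r)%N -> first_after m s * rt R n <=
    B / rt R r ^+ 3 * T n * rt R n + X * g * (ftail s - ftail (s + r)%N).
  move=> sr; rewrite /first_after.
  have mr : ((m - r).+1 <= m.+1)%N by rewrite ltnS leq_subr.
  rewrite (@ord_sum_splitP R (fun i => u i * f (m.+1 + s - i)%N) (m - r).+1 m.+1) // mulrDl.
  apply: lerD.
    apply: ler_wpM2r; first exact: ltW.
    apply: le_trans (_ : \sum_(i < (m - r).+1) u i * (B / rt R r ^+ 3) <= _).
      apply: ler_sum => i _; apply: ler_wpM2l; first exact: u_ge0.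
      have := ltn_ord i => ir; case/andP: (hB (m.+1 + s - i)%N) => _ h; apply: le_trans h _.
      apply: ler_wpM2l => //; rewrite lef_pV2 ?posrE ?exprn_gt0 ?rt_gt0 //.
      by rewrite ler_pXn2r ?nnegrE ?rt_ge0 // rt_le //; clear -ir rm; lia.
    rewrite -mulr_suml mulrC; apply: ler_wpM2l; first by rewrite divr_ge0 // exprn_ge0 // ltW.
    by apply: (renewal_mono f0 f_ge0 u_eq); clear -em; lia.
  rewrite -ftail_diff mulr_suml mulr_sumr.
  rewrite (_ : (m.+1 - (m - r).+1 = r)%N); last by clear -rm; lia.
  rewrite [leRHS](reindex_inj rev_ord_inj) /=.
  apply: ler_sum => i _; have := ltn_ord i => ir.
  rewrite mulrAC.
  rewrite (_ : (m.+1 + s - ((m - r).+1 + i) = s.+1 + (r - i.+1))%N); last by clear -ir rm; lia.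
  by apply: ler_wpM2r => //; apply: hshort; clear -ir rm; lia.
rewrite {1}em renewal_level /conv mulr_suml.
apply: le_trans (_ : \sum_(s < r.+1) u (r - s)%N * (B / rt R r ^+ 3 * T n * rt R n + X * g * (ftail s - ftail (s + r)%N)) <= _).
  apply: ler_sum => s _; rewrite mulrAC mulrC; apply: ler_wpM2l; first exact: u_ge0.
  by apply: hG; rewrite -ltnS.
have hrev : \sum_(s < r.+1) u (r - s)%N = T r.+1.
  rewrite /T (reindex_inj rev_ord_inj) /=; apply: eq_bigr => i _.
  by rewrite subSS subKn // -ltnS.
have hone : \sum_(s < r.+1) u (r - s)%N * ftail s = 1.
  rewrite -(renewal_ftail r) convC; apply: eq_bigr => i _; by rewrite mulrC.
have hlow : th <= \sum_(s < r.+1) u (r - s)%N * ftail (s + r)%N.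
  apply: le_trans (_ : T r.+1 * (c2 / (2 * rt R r)) <= _).
    apply: le_trans thc _.
    have -> : c1 * c2 / 2 = c1 * rt R r * (c2 / (2 * rt R r)) by field; rewrite rt_neq0.
    by rewrite ler_pM2r ?divr_gt0 ?mulr_gt0.
  rewrite -hrev mulr_suml; apply: ler_sum => s _; apply: ler_wpM2l; first exact: u_ge0.
  apply: le_trans (hF _); apply: ler_wpM2l; first exact: ltW.
  rewrite lef_pV2 ?posrE ?mulr_gt0 ?rt_gt0 //; apply: rt_leM; have := ltn_ord s; clear; lia.
have e1 : \sum_(s < r.+1) u (r - s)%N * (B / rt R r ^+ 3 * T n * rt R n + X * g * (ftail s - ftail (s + r)%N)) =
    B / rt R r ^+ 3 * T n * rt R n * T r.+1 + X * g * (1 - \sum_(s < r.+1) u (r - s)%N * ftail (s + r)%N).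
  rewrite -hone -hrev -sumrB !mulr_sumr -big_split /=; apply: eq_bigr => s _; ring.
rewrite e1.
have hY : B / rt R r ^+ 3 * T n * rt R n * T r.+1 <= Y.
  apply: le_trans (_ : B / rt R r ^+ 3 * (C1 * rt R n) * rt R n * (C1 * rt R n) <= _).
    have b0 : 0 <= B / rt R r ^+ 3 by rewrite divr_ge0 // exprn_ge0 // ltW.
    have rw0 := ltW r1.
    have t1 : B / rt R r ^+ 3 * T n * rt R n <= B / rt R r ^+ 3 * (C1 * rt R n) * rt R n.
      by apply: ler_wpM2r => //; apply: ler_wpM2l.
    have t2 : T r.+1 <= C1 * rt R n.
      by apply: le_trans (hT2 _) _; rewrite ler_pM2l // rt_le //; clear -em; lia.
    by apply: ler_pM t1 t2; [apply: mulr_ge0 rw0; apply: mulr_ge0 b0 (T_ge0 n)|exact: T_ge0].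
  have -> : B / rt R r ^+ 3 * (C1 * rt R n) * rt R n * (C1 * rt R n) =
     B * (rt R n / rt R r) ^+ 3 * (C1 * C1) by field; rewrite rt_neq0.
  apply: ler_wpM2r; first by rewrite mulr_ge0 // ltW.
  apply: ler_wpM2l => //; rewrite ler_pXn2r ?nnegrE ?divr_ge0 ?mulr_ge0 ?rt_ge0 //.
  by rewrite ler_pdivrMr // -natrM.
have g0 : 0 <= g by rewrite /g; lra.
set S := \sum_(s < r.+1) _ in hlow *.
have h2 : X * g * (1 - S) <= X * (1 - th / 2).
  rewrite -mulrA ler_wpM2l //; apply: le_trans g1; rewrite ler_wpM2l //; lra.
apply: le_trans (lerD hY h2) _.
have -> : Y = (X - 12 * L%:R) * (th / 2).
  by rewrite /X addrAC subrr add0r mulfVK // gt_eqF // divr_gt0.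
nra.
Qed.

End RecurrentRenewal.

(** * Square-root singularities *)

Section CentralBinomial.
Variable R : realType.

(* cbin n = binomial(2n, n) / 4^n, the coefficients of (1 - x)^(-1/2). *)
Definition cbin (n : nat) : R := \prod_(i < n) ((2 * i + 1)%:R / (2 * i + 2)%:R).

Lemma cbin0 : cbin 0 = 1. Proof. by rewrite /cbin big_ord0. Qed.

Lemma cbinS n : (2 * n + 2)%:R * cbin n.+1 = (2 * n + 1)%:R * cbin n.
Proof.
rewrite /cbin big_ord_recr /= mulrCA mulrC; congr (_ * _).
by rewrite mulrC mulfVK // pnatr_eq0 addn2.
Qed.

Lemma cbin_gt0 n : 0 < cbin n.
Proof. by apply: prodr_gt0 => i _; rewrite divr_gt0 // ltr0n; lia. Qed.

Lemma cbin_binomial n : cbin n = 'C(2 * n, n)%:R / 4 ^+ n.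
Proof.
elim: n => [|n IH]; first by rewrite cbin0 bin0 expr0 divr1.
have h := cbinS n.
have n2 : (2 * n + 2)%:R != 0 :> R by rewrite pnatr_eq0 addn2.
apply: (mulfI n2); rewrite h IH exprS.
have e : ((n.+1 * 'C(2 * n.+1, n.+1)) = 2 * ((2 * n + 1) * 'C(2 * n, n)))%N.
  have e1 := mul_bin_diag (2 * n).+2 n.
  have e3 := mul_bin_down (2 * n).+1 n.
  have -> : (2 * n.+1 = (2 * n).+2)%N by lia.
  rewrite -e1 /=.
  have e4 : ((2 * n).+1 - n = n.+1)%N by clear; lia.
  rewrite e4 /= in e3.
  have : (n.+1 * ((2 * n).+2 * 'C((2 * n).+1, n)) = n.+1 * (2 * ((2 * n + 1) * 'C(2 * n, n))))%N.
    rewrite mulnCA -e3; clear; lia.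
  by move/eqP; rewrite eqn_pmul2l // => /eqP.
have e' : (n.+1%:R * 'C(2 * n.+1, n.+1)%:R = 2 * ((2 * n + 1)%:R * 'C(2 * n, n)%:R) :> R).
  by rewrite -!natrM e.
have -> : (2 * n + 2)%:R = 2 * n.+1%:R :> R by rewrite -natrM; congr (_%:R); lia.
have f4 : (4 : R) ^+ n != 0 by rewrite expf_neq0 // pnatr_eq0.
apply: (mulIf f4); apply: (mulfI (_ : (4 : R) != 0)); first by rewrite pnatr_eq0.
have -> : 4 * ((2 * n + 1)%:R * ('C(2 * n, n)%:R / 4 ^+ n) * 4 ^+ n) = 2 * (2 * ((2 * n + 1)%:R * 'C(2 * n, n)%:R)) :> R.
  by field.
by rewrite -e'; field.
Qed.

(** The square of (1 - x)^(-1/2) is 1/(1 - x). Here the first-order differential equation, in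
    coefficients the recursion [cbinS], shows that theta of the square increases by the square
    itself. *)
Lemma conv_cbin n : conv cbin cbin n = 1.
Proof.
elim: n => [|n IH]; first by rewrite conv0 cbin0 mulr1.
have th m : 2 * theta cbin m.+1 = 2 * theta cbin m + cbin m.
  rewrite /theta !mulrA -!natrM; have := cbinS m.
  have -> : (2 * m.+1 = 2 * m + 2)%N by lia.
  by move=> ->; rewrite natrD mulrDl mul1r.
have dbl m : theta (conv cbin cbin) m = 2 * conv (theta cbin) cbin m.
  by rewrite theta_conv (convC cbin (theta cbin)); ring.
have h : theta (conv cbin cbin) n.+1 = theta (conv cbin cbin) n + conv cbin cbin n.
  rewrite !dbl /conv big_ord_recl {1}/theta mul0r mul0r add0r !mulr_sumr -big_split /=.
  apply: eq_bigr => i _; rewrite subSS.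
  by rewrite -[bump 0 i]/(i.+1) mulrA th; ring.
move: h; rewrite /theta IH mulr1 natr1 => h.
by apply: (mulfI (_ : n.+1%:R != 0 :> R)); rewrite ?pnatr_eq0 // h mulr1.
Qed.

Lemma rt_cbin_decr n : rt R n.+1 * cbin n.+1 <= rt R n * cbin n.
Proof.
have h := cbinS n; have c0 := cbin_gt0 n; have c1 := cbin_gt0 n.+1.
rewrite -(@ler_pXn2r _ 2) ?nnegrE ?mulr_ge0 ?rt_ge0 ?(ltW c0) ?(ltW c1) // !exprMn !rt_sqr.
have e : cbin n.+1 = (2 * n + 1)%:R / (2 * n + 2)%:R * cbin n.
  by rewrite /cbin big_ord_recr /= mulrC.
have -> : n.+2%:R = n.+1%:R + 1 :> R by rewrite natr1.
rewrite e; set N : R := n.+1%:R.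
have -> : (2 * n + 1)%:R = 2 * N - 1 :> R.
  by rewrite /N -natr1 natrD natrM; ring.
have -> : (2 * n + 2)%:R = 2 * N :> R.
  by rewrite /N -natr1 natrD natrM; ring.
have N1 : 1 <= N by rewrite ler1n.
rewrite exprMn mulrA; apply: ler_wpM2r; first by rewrite exprn_ge0 // ltW.
rewrite expr_div_n mulrA ler_pdivrMr; last by rewrite exprn_gt0; lra.
nra.
Qed.

Lemma n_cbin_incr n : (0 < n)%N -> 2^-1 <= rt R n * cbin n.
Proof.
move=> n0; suff h : 4^-1 <= n%:R * cbin n ^+ 2.
  rewrite -(@ler_pXn2r _ 2) ?nnegrE ?mulr_ge0 ?rt_ge0 ?invr_ge0 ?(ltW (cbin_gt0 _)) //.
  rewrite exprMn rt_sqr exprVn -natrX; apply: le_trans h _.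
  by apply: ler_wpM2r; rewrite ?exprn_ge0 ?(ltW (cbin_gt0 _)) // ler_nat.
case: n n0 => // n _; elim: n => [|n IH].
  have -> : cbin 1 = 1 / 2 by rewrite /cbin big_ord1.
  by lra.
apply: le_trans IH _; set m := n.+1.
have e : cbin m.+1 = (2 * m + 1)%:R / (2 * m + 2)%:R * cbin m.
  by rewrite /cbin big_ord_recr /= mulrC.
rewrite e; set N : R := m%:R.
have -> : m.+1%:R = N + 1 :> R by rewrite natr1.
have -> : (2 * m + 1)%:R = 2 * N + 1 :> R by rewrite natrD natrM.
have -> : (2 * m + 2)%:R = 2 * (N + 1) :> R by rewrite natrD natrM; ring.
have N1 : 1 <= N by rewrite ler1n.
rewrite exprMn [leRHS]mulrA; apply: ler_wpM2r; first by rewrite exprn_ge0 // ltW // cbin_gt0.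
rewrite expr_div_n mulrA ler_pdivlMr; last by rewrite exprn_gt0; lra.
nra.
Qed.

(** sqrt(n+1) c_n decreases while n c_n^2 increases, so the limit is positive. Its value is
    irrelevant, since it cancels from every final formula. *)
Lemma cbin_limit : exists2 b : R, 0 < b & (fun n => rt R n * cbin n) @ \oo --> b.
Proof.
have lb n : 2^-1 <= rt R n * cbin n.
  case: n => [|n]; last exact: n_cbin_incr.
  by rewrite cbin0 mulr1 /rt sqrtr1 invf_le1 // ler1n.
have hc : (fun n => rt R n * cbin n) @ \oo --> inf (range (fun n => rt R n * cbin n)).
  apply: nonincreasing_cvgn.
    by apply/nonincreasing_seqP => n; apply: rt_cbin_decr.
  by exists 2^-1 => _ [n _ <-]; apply: lb.
exists (inf (range (fun n => rt R n * cbin n))) => //.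
apply: lt_le_trans (_ : 2^-1 <= _); first by rewrite invr_gt0.
by apply: (cvg_le _ (cvg_cst (2^-1 : R)) hc).
Qed.

(** The coefficients of 1 - sqrt(1 - x), which is 1 - (1 - x) times the series of [cbin]. *)
Definition sqrt_coef (n : nat) : R := if n is m.+1 then cbin m - cbin m.+1 else 0.

Lemma sqrt_coefS n : sqrt_coef n.+1 = cbin n / (2 * n + 2)%:R.
Proof.
have n2 : (2 * n + 2)%:R != 0 :> R by rewrite pnatr_eq0 addn2.
apply: (mulfI n2); rewrite /= mulrBr cbinS mulrCA mulfV // mulr1 -mulrBl -natrB.
  by rewrite (_ : (2 * n + 2 - (2 * n + 1) = 1)%N) ?mul1r //; lia.
lia.
Qed.

Lemma sqrt_coef_ge0 n : 0 <= sqrt_coef n.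
Proof. by case: n => // n; rewrite sqrt_coefS divr_ge0 // ltW // cbin_gt0. Qed.

Lemma cbin_le1 n : cbin n <= 1.
Proof.
elim: n => [|n IH]; first by rewrite cbin0.
by have := sqrt_coef_ge0 n.+1; rewrite /= ; lra.
Qed.

Lemma cbin_series x : 0 <= x < 1 ->
  sums_to (fun n => cbin n * x ^+ n) (Num.sqrt (1 - x))^-1.
Proof.
move=> /andP[x0 x1].
have c0 n : 0 <= cbin n * x ^+ n by rewrite mulr_ge0 ?exprn_ge0 // ltW // cbin_gt0.
have hg : sums_to (fun n => x ^+ n) (1 - x)^-1 by apply: sums_geometric; rewrite x0.
have [|Y hY _] := @sums_comp R (fun n => cbin n * x ^+ n) (fun n => x ^+ n) (1 - x)^-1 _ hg.
  by move=> n; rewrite c0 /= ler_piMl ?exprn_ge0 // cbin_le1.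
have h : sums_to (fun n => x ^+ n) (Y * Y).
  apply: cvg_ext (sums_conv c0 c0 hY hY) => n; apply: eq_bigr => i _.
  rewrite -[RHS]mul1r -(conv_cbin i) /conv mulr_suml; apply: eq_bigr => j _.
  have ji : (j <= i)%N by rewrite -ltnS.
  have -> : x ^+ i = x ^+ j * x ^+ (i - j) by rewrite -exprD subnKC.
  by ring.
have e := cvg_uniq h hg.
have Y0 : 0 <= Y by apply: sums_ge0 hY.
suff -> : (Num.sqrt (1 - x))^-1 = Y by [].
by rewrite -sqrtrV ?subr_ge0 ?ltW // -e -expr2 sqrtr_sqr ger0_norm.
Qed.

Lemma sqrt_coef_series x : 0 <= x < 1 ->
  sums_to (fun n => sqrt_coef n * x ^+ n) (1 - Num.sqrt (1 - x)).
Proof.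
move=> xx; have h := cbin_series xx; set Y := (_)^-1 in h.
case/andP: xx => x0 x1.
have s0 : 0 < Num.sqrt (1 - x) by rewrite sqrtr_gt0 subr_gt0.
set s := Num.sqrt (1 - x) in Y h s0 *.
have e : 1 - s = sqrt_coef 0 * x ^+ 0 + (x * Y + (-1) * (Y - 1)).
  rewrite mul0r add0r.
  have -> : x = 1 - s ^+ 2 by rewrite sqr_sqrtr ?subr_ge0 ?ltW //; ring.
  by rewrite /Y; field; rewrite gt_eqF.
rewrite e; apply: (@sums_shift R (fun n => sqrt_coef n * x ^+ n)).
have h1 := sums_unshift h; rewrite cbin0 expr0 mulr1 in h1.
apply: cvg_ext (sumsD (sumsZ (a := x) h) (sumsZ (a := -1) h1)) => n.
by apply: eq_bigr => i _; rewrite /= exprS; ring.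
Qed.

Lemma cbin_cvg0 : cbin @ \oo --> (0 : R).
Proof.
have [b _ hb] := cbin_limit; have [K K0 hK] := sqrt_decay_bound hb.
exact: cvg_squeeze0 hK (rtVZ_cvg0 K).
Qed.

Lemma sqrt_coef_sum : sums_to sqrt_coef 1.
Proof.
have h : (fun n => 1 - cbin n) @ \oo --> (1 : R).
  rewrite -[X in _ --> X]subr0; apply: seqB; [exact: cvg_cst|exact: cbin_cvg0].
rewrite -[1]add0r; apply: (@sums_shift R sqrt_coef); apply: cvg_ext h => n.
elim: n => [|n IH]; first by rewrite big_ord0 cbin0 subrr.
by rewrite big_ord_recr /= -IH; ring.
Qed.

Lemma sqrt_coef_decay3 (b : R) : (fun n => rt R n * cbin n) @ \oo --> b ->
  decay3 sqrt_coef (b / 2).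
Proof.
move=> hb; apply: theta_decay3.
have h1 : (fun n => rt R n.+1 * cbin n) @ \oo --> b.
  have h := sqrt_decay_step hb; have h2 := cvg_reindex (s := fun n => n.+1) (fun n => leqnSn n) hb.
  have h3 : (fun n => (rt R n.+1 - rt R n) * cbin n) @ \oo --> (0 : R).
    apply: (@cvg_squeeze0 _ _ cbin _ cbin_cvg0) => n.
    rewrite normrM (gtr0_norm (cbin_gt0 n)) ger0_norm; last by rewrite subr_ge0 rt_le.
    by rewrite ler_piMl ?rt_step // ltW // cbin_gt0.
  have := seqD hb h3; rewrite addr0 => h'; apply: (cvg_ext _ h') => n; ring.
have h2 : (fun n => rt R n.+1 * theta sqrt_coef n.+1) @ \oo --> b / 2.
  have := seqZ (a := 2^-1) h1; rewrite mulrC => h'; apply: (cvg_ext _ h') => n.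
  rewrite /theta sqrt_coefS.
  have -> : (2 * n + 2)%:R = 2 * n.+1%:R :> R by rewrite -natrM; congr (_%:R); lia.
  have n1 : n.+1%:R != 0 :> R by rewrite pnatr_eq0.
  by move: (n.+1%:R : R) n1 => N n1; field.
apply: eps_cvg => e e0; have [N hN] := cvg_eps h2 e0.
by exists N.+1 => -[//|n] Nn; apply: hN.
Qed.

(* Subtracting the matching multiple of 1 - sqrt(1 - x) leaves a series whose
   increments near x = 1 are o(sqrt(1 - x)). *)
Lemma decay3_abel (f : nat -> R) (l b phi : R) : (forall n, 0 <= f n) ->
  decay3 f l -> sums_to f phi -> 0 < b ->
  (fun n => rt R n * cbin n) @ \oo --> b ->
  forall e, 0 < e -> exists C, forall x S, 0 <= x < 1 ->
    sums_to (fun n => f n * x ^+ n) S ->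
    `|phi - S - (2 * l / b) * Num.sqrt (1 - x)| <=
      e * Num.sqrt (1 - x) + C * (1 - x).
Proof.
move=> f0 hf hphi b0 hb e e0.
have ha := sqrt_coef_decay3 hb.
(* [sqrt_coef] has n^(-3/2) constant b/2, so this multiple cancels the leading term of f. Beyond
   some N the difference is at most e times [sqrt_coef]; the finitely many earlier terms vary by O(1
   - x). *)
pose k := 2 * l / b.
pose g n := f n + (- k) * sqrt_coef n.
have hg : decay3 g 0.
  have := seqD hf (seqZ (a := - k) ha).
  have -> : l + - k * (b / 2) = 0 by rewrite /k; field; rewrite gt_eqF.
  by move=> h'; apply: (cvg_ext _ h') => n; rewrite /g; ring.
have [N hN] : exists N, forall n, (N <= n)%N -> `|g n| <= e * sqrt_coef n.
  have e1 : 0 < e * b / (4 * (1 + e)) by rewrite divr_gt0 ?mulr_gt0 //; lra.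
  have b4 : 0 < b / 4 by rewrite divr_gt0.
  have [N1 h1] := cvg_eps hg e1; have [N2 h2] := cvg_eps ha b4.
  exists (maxn N1 N2) => n; rewrite geq_max => /andP[n1 n2].
  have r3 : 0 < rt R n ^+ 3 by rewrite exprn_gt0 // rt_gt0.
  have := h1 n n1; have := h2 n n2; rewrite subr0 normrM (gtr0_norm r3).
  rewrite ler_norml => /andP[h3 _] h4.
  rewrite -(ler_pM2l r3); apply: le_trans h4 _.
  apply: le_trans (_ : e * (b / 4) <= _).
    rewrite -mulrA ler_pM2l // ler_pM2l // lef_pV2 ?posrE //; lra.
  by rewrite [leRHS]mulrCA ler_pM2l //; lra.
have [C C0 hC] : exists2 C, 0 <= C & forall n, (n < N)%N -> `|g n| * n%:R <= C.
  elim: N {hN} => [|N [C C0 hC]]; first by exists 0.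
  exists (C + `|g N| * N%:R); first by rewrite addr_ge0 // mulr_ge0.
  move=> n; rewrite ltnS leq_eqVlt => /orP[/eqP ->|/hC h]; first by rewrite lerDr.
  by apply: le_trans h _; rewrite lerDl mulr_ge0.
exists (C * N%:R) => x S xx hS.
case/andP: (xx) => x0 x1.
have pw n : 0 <= 1 - x ^+ n <= n%:R * (1 - x).
  elim: n => [|n IH]; first by rewrite expr0 subrr mul0r lexx.
  case/andP: IH => i1 i2; rewrite exprS -natr1.
  have : 0 <= x ^+ n by rewrite exprn_ge0.
  move=> i3; apply/andP; split; nra.
have h1 : sums_to (fun n => g n * (1 - x ^+ n)) (phi - S - k * Num.sqrt (1 - x)).
  have -> : phi - S - k * Num.sqrt (1 - x) =
     (phi + (-1) * S) + (- k) * (1 + (-1) * (1 - Num.sqrt (1 - x))) by ring.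
  have t1 := sumsD hphi (sumsZ (a := -1) hS).
  have t2 := sumsD sqrt_coef_sum (sumsZ (a := -1) (sqrt_coef_series xx)).
  apply: cvg_ext (sumsD t1 (sumsZ (a := - k) t2)) => n.
  by apply: eq_bigr => i _; rewrite /g; ring.
have h2 : sums_to (fun n => e * (sqrt_coef n * (1 - x ^+ n))) (e * Num.sqrt (1 - x)).
  have t2 := sumsD sqrt_coef_sum (sumsZ (a := -1) (sqrt_coef_series xx)).
  have -> : e * Num.sqrt (1 - x) = e * (1 + -1 * (1 - Num.sqrt (1 - x))) by ring.
  apply: sumsZ; apply: cvg_ext t2 => n; apply: eq_bigr => i _; ring.
have h3 : sums_to (fun n => if (n < N)%N then C * (1 - x) else 0) (C * N%:R * (1 - x)).
  apply: (@cvg_eventually_eq _ (fun=> C * N%:R * (1 - x)) _ _ N); last exact: cvg_cst.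
  move=> n Nn; rewrite (@ord_sum_splitP R (fun n => if (n < N)%N then C * (1 - x) else 0) N n Nn).
  rewrite [X in _ = _ + X]big1 ?addr0; last by move=> i _; rewrite ltnNge leq_addr.
  rewrite (eq_bigr (fun=> C * (1 - x))); last by move=> i _; rewrite ltn_ord.
  by rewrite sumr_const card_ord -[RHS]mulr_natl; ring.
apply: sums_norm_le h1 (sumsD h2 h3) => n.
case/andP: (pw n) => p1 p2; rewrite normrM (ger0_norm p1).
case: ltnP => nN.
  apply: ler_wpDl; first by rewrite !mulr_ge0 // ?sqrt_coef_ge0 // ltW.
  apply: le_trans (ler_wpM2l (normr_ge0 _) p2) _.
  by rewrite mulrA; apply: ler_wpM2r; [rewrite subr_ge0 ltW|apply: hC].
by rewrite addr0 mulrA; apply: ler_wpM2r => //; apply: hN.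
Qed.

(** The given expansion and the one of [decay3_abel] hold at the same x; their difference, divided
    by sqrt(1 - x), bounds |eta - 2 l / b| by any e > 0. *)
Lemma sqrt_singularity_unique (f : nat -> R) (l b phi eta : R) :
  (forall n, 0 <= f n) ->
  decay3 f l -> sums_to f phi -> 0 < b ->
  (fun n => rt R n * cbin n) @ \oo --> b ->
  (exists K del, 0 < del /\ forall x, 1 - del < x < 1 ->
     exists S, sums_to (fun n => f n * x ^+ n) S /\
       `|S - phi + eta * Num.sqrt (1 - x)| <= K * (1 - x)) ->
  eta = 2 * l / b.
Proof.
move=> f0 hf hphi b0 hb [K [del [del0 hK]]].
apply/eqP; rewrite -subr_eq0 -normr_eq0 eq_le normr_ge0 andbT.
apply/ler_addgt0Pr => e e0; rewrite add0r.
have e2 : 0 < e / 2 by rewrite divr_gt0.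
have [C hC] := decay3_abel f0 hf hphi b0 hb e2.
pose D := `|K| + `|C| + 1.
have D0 : 0 < D by rewrite ltr_wpDl // addr_ge0.
(* The test point is x = 1 - s^2, so that sqrt(1 - x) = s. s <= 1/2 keeps x in [0, 1), s D <= e/2
   absorbs the O(1 - x) terms, and s <= del/2 keeps x within del of 1. *)
pose s := Num.min (Num.min 2^-1 (e / 2 / D)) (Num.min 1 del / 2).
have s0 : 0 < s.
  by rewrite !lt_min invr_gt0 ltr0n !divr_gt0 //= lt_min ltr01 del0.
have s1 : s <= 2^-1 by rewrite !ge_min lexx.
have s2 : s * D <= e / 2.
  by rewrite -ler_pdivlMr // !ge_min lexx orbT.
have s3 : s <= del / 2.
  apply: le_trans (_ : Num.min 1 del / 2 <= _); first by rewrite !ge_min lexx !orbT.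
  by rewrite ler_pM2r ?invr_gt0 // ge_min lexx orbT.
pose x := 1 - s ^+ 2.
have ss : s ^+ 2 <= s by rewrite expr2 ler_piMl ?ltW //; lra.
have s20 : 0 < s ^+ 2 by rewrite exprn_gt0.
have hs : Num.sqrt (1 - x) = s.
  by rewrite /x opprB addrC subrK sqrtr_sqr gtr0_norm.
have h1x : 1 - x = s * s by rewrite /x; ring.
have x01 : 0 <= x < 1 by rewrite /x; apply/andP; split; lra.
have [S [hS hSb]] := hK x ltac:(rewrite /x; apply/andP; split; lra).
have hb2 := hC x S x01 hS.
rewrite hs h1x in hSb hb2.
have h : `|(eta - 2 * l / b) * s| <= e / 2 * s + D * (s * s).
  have -> : (eta - 2 * l / b) * s = (S - phi + eta * s) + (phi - S - 2 * l / b * s) by ring.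
  apply: le_trans (ler_normD _ _) _.
  have k1 : K * (s * s) <= `|K| * (s * s) by rewrite ler_wpM2r ?ler_norm // mulr_ge0 // ltW.
  have k2 : C * (s * s) <= `|C| * (s * s) by rewrite ler_wpM2r ?ler_norm // mulr_ge0 // ltW.
  have k3 : 0 <= s * s by rewrite mulr_ge0 // ltW.
  rewrite /D; move: hSb hb2 k1 k2 k3; rewrite !mulrDl; lra.
rewrite normrM (gtr0_norm s0) in h.
rewrite -(ler_pM2r s0); apply: le_trans h _.
rewrite mulrA -mulrDl ler_pM2r // mulrC; lra.
Qed.

End CentralBinomial.

(** * Local limit theorem *)

Section ComplexNorm.
Variable R : realType.
Implicit Types (z w : R[i]) (a : R).

Local Notation cr a := (a%:C)%C.

Lemma cnorm_ge0 z : 0 <= cnorm z.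
Proof. by case: z => a b; apply: sqrtr_ge0. Qed.

Lemma cnormM z w : cnorm (z * w) = cnorm z * cnorm w.
Proof. exact: ComplexField.Normc.normcM. Qed.

Lemma cnorm1 : cnorm (1 : R[i]) = 1.
Proof. by rewrite /cnorm -[1 in LHS]/((1 : R)%:C)%C ComplexField.Normc.normc1. Qed.

Lemma cnorm0 : cnorm (0 : R[i]) = 0.
Proof. by rewrite /cnorm -[0 in LHS]/((0 : R)%:C)%C ComplexField.Normc.normc0. Qed.

Lemma cnormX z n : cnorm (z ^+ n) = cnorm z ^+ n.
Proof. by elim: n => [|n IH]; rewrite ?cnorm1 // !exprS cnormM IH. Qed.

Lemma cnormV z : cnorm z^-1 = (cnorm z)^-1.
Proof. exact: ComplexField.Normc.normcV. Qed.

Lemma cnormD z w : cnorm (z + w) <= cnorm z + cnorm w.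
Proof. exact: le_normcD. Qed.

Lemma cnormN z : cnorm (- z) = cnorm z.
Proof. exact: normcN. Qed.

Lemma cnormB z w : cnorm (z - w) <= cnorm z + cnorm w.
Proof. by rewrite -(cnormN w) cnormD. Qed.

Lemma cnorm_distC z w : cnorm (z - w) = cnorm (w - z).
Proof. by rewrite -cnormN opprB. Qed.

Lemma cnorm_real a : cnorm (cr a) = `|a|.
Proof. by rewrite /cnorm /= expr0n addr0 sqrtr_sqr. Qed.

Lemma cnorm_eq0 z : cnorm z = 0 -> z = 0.
Proof. exact: ComplexField.Normc.eq0_normc. Qed.

Lemma cnorm_sum I (r : seq I) (P : pred I) (F : I -> R[i]) :
  cnorm (\sum_(i <- r | P i) F i) <= \sum_(i <- r | P i) cnorm (F i).
Proof.
elim/big_rec2: _ => [|i y1 y2 _ h]; first by rewrite cnorm0.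
by apply: le_trans (cnormD _ _) _; rewrite lerD2l.
Qed.

Lemma cnorm_le_dist z w : cnorm z <= cnorm w + cnorm (z - w).
Proof. by rewrite -{1}(subrKC w z) cnormD. Qed.

Lemma cnorm_sqr z : cnorm z ^+ 2 = complex.Re z ^+ 2 + complex.Im z ^+ 2.
Proof. by case: z => a b; rewrite /cnorm /= sqr_sqrtr // addr_ge0 // sqr_ge0. Qed.

Lemma cnorm_expB z w n : cnorm z <= 1 -> cnorm w <= 1 ->
  cnorm (z ^+ n - w ^+ n) <= n%:R * cnorm (z - w).
Proof.
move=> hz hw; elim: n => [|n IH]; first by rewrite !expr0 subrr cnorm0 mul0r.
have -> : z ^+ n.+1 - w ^+ n.+1 = z * (z ^+ n - w ^+ n) + (z - w) * w ^+ n.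
  by rewrite !exprS; ring.
apply: le_trans (cnormD _ _) _.
have -> : n.+1%:R = n%:R + 1 :> R by rewrite natr1.
rewrite [leRHS]mulrDl mul1r !cnormM; apply: lerD.
  by apply: le_trans IH; rewrite ler_piMl // cnorm_ge0.
by rewrite ler_piMr ?cnorm_ge0 // cnormX exprn_ile1 // cnorm_ge0.
Qed.

Lemma prim_root_exists n : (0 < n)%N -> exists z : R[i], n.-primitive_root z.
Proof.
move=> n0; pose p : {poly R[i]} := 'X^n - 1.
have [r Dp] := closed_field_poly_normal p.
rewrite (monicP _) ?monicXnsubC // scale1r in Dp.
have rn1 : all n.-unity_root r by apply/allP=> z; rewrite -root_prod_XsubC -Dp.
have sz_r : (n < (size r).+1)%N.
  by rewrite -(size_prod_XsubC r id) -Dp size_XnsubC.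
have [|z] := hasP (has_prim_root n0 rn1 _ sz_r); last by exists z.
by rewrite -separable_prod_XsubC -Dp separable_Xn_sub_1 // pnatr_eq0 -lt0n.
Qed.

Lemma prim_root_sum n (z : R[i]) k : n.-primitive_root z ->
  \sum_(j < n) (z ^+ j) ^+ k = if (n %| k)%N then n%:R else 0.
Proof.
move=> hz.
have e (j : nat) : (z ^+ j) ^+ k = (z ^+ k) ^+ j by rewrite -!exprM mulnC.
under eq_bigr do rewrite e.
have hk : (n %| k)%N = (z ^+ k == 1) by rewrite (prim_order_dvd hz).
rewrite hk; case: eqP => [->|zk].
  under eq_bigr do rewrite expr1n.
  by rewrite sumr_const card_ord.
have h := subrX1 (z ^+ k) n.
have e1 : (z ^+ k) ^+ n = 1 by rewrite -exprM mulnC exprM (prim_expr_order hz) expr1n.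
move: h; rewrite e1 subrr => /esym/eqP; rewrite mulf_eq0 subr_eq0 => /orP[/eqP/zk //|/eqP h]; exact: h.
Qed.

(** Averages over roots of unity take the place of the Cauchy integral; [size G <= n] excludes
    aliasing, and n - k plays the exponent -k. *)
Lemma dft_coef (G : {poly R[i]}) n z k : n.-primitive_root z ->
  (size G <= n)%N -> (k < n)%N ->
  n%:R * G`_k = \sum_(j < n) G.[z ^+ j] * (z ^+ j) ^+ (n - k).
Proof.
move=> hz sG kn.
transitivity (\sum_(i < size G) G`_i * \sum_(j < n) (z ^+ j) ^+ (i + (n - k))%N); last first.
  rewrite (eq_bigr (fun i : 'I_(size G) => \sum_(j < n) G`_i * (z ^+ j) ^+ (i + (n - k))%N)); last first.
    by move=> i _; rewrite mulr_sumr.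
  rewrite exchange_big /=; apply: eq_bigr => j _.
  rewrite horner_coef mulr_suml; apply: eq_bigr => i _.
  by rewrite exprD mulrA.
under eq_bigr do rewrite (prim_root_sum _ hz).
have hdiv (i : nat) : (i < n)%N -> (n %| i + (n - k))%N = (i == k).
  move=> ilt; apply/idP/eqP => [/dvdnP[q hq]|->]; last by rewrite subnKC // ltnW.
  by clear -hq ilt kn; case: q hq => [|[|q]]; nia.
case: (ltnP k (size G)) => hk.
  rewrite (bigD1 (Ordinal hk)) //= hdiv // eqxx big1 ?addr0 1?mulrC //.
  move=> i ik; rewrite hdiv; last exact: leq_trans (ltn_ord i) sG.
  by rewrite (negbTE (_ : (i : nat) != k)) ?mulr0.
rewrite nth_default // mulr0 big1 // => i _; rewrite hdiv; last exact: leq_trans (ltn_ord i) sG.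
by rewrite (negbTE (_ : (i : nat) != k)) ?mulr0 // ltn_eqF // (leq_trans (ltn_ord i)).
Qed.

Lemma prim_root_cnorm n z j : n.-primitive_root z -> cnorm (z ^+ j) = 1.
Proof.
move=> hz; have h : cnorm z ^+ n = 1 by rewrite -cnormX (prim_expr_order hz) cnorm1.
have n0 := prim_order_gt0 hz.
have : cnorm z = 1 by apply/eqP; rewrite -(@eqrXn2 _ n) ?cnorm_ge0 // h expr1n.
by rewrite cnormX => ->; rewrite expr1n.
Qed.

End ComplexNorm.

(** * Characteristic functions on the unit circle *)

Section LocalLimit.
Variable R : realType.
Implicit Types z w : R[i].

Local Notation cr a := ((a : R)%:C)%C.
Local Notation pC := (map_poly (real_complex R)).

(** On the unit circle the conjugate of z is 1/z, so |1 - z|^2 = (1 - z)(1 - 1/z). This makes a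
    squared modulus algebraic in z. *)
Lemma unit_dist z : cnorm z = 1 -> cr (cnorm (1 - z) ^+ 2) * z = - (1 - z) ^+ 2.
Proof.
move=> h; have := cnorm_sqr z; rewrite h cnorm_sqr expr1n.
case: z {h} => a b /= h.
rewrite [LHS](_ : _ = (((1 - a) ^+ 2 + (0 - b) ^+ 2) * a +i* (((1 - a) ^+ 2 + (0 - b) ^+ 2) * b))%C); last first.
  by rewrite /GRing.mul /= !mul0r subr0 addr0.
rewrite [RHS](_ : _ = (- ((1 - a) ^+ 2 - (0 - b) ^+ 2) +i* (- ((1 - a) * (0 - b) + (0 - b) * (1 - a))))%C); last first.
  by rewrite expr2 /GRing.mul /=.
have hb : b ^+ 2 = 1 - a ^+ 2 by rewrite h; ring.
have e : (1 - a) ^+ 2 + (0 - b) ^+ 2 = 2 - 2 * a.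
  transitivity (1 - 2 * a + a ^+ 2 + b ^+ 2); [ring|rewrite hb; ring].
rewrite e; congr Complex; last by ring.
transitivity (b ^+ 2 - 1 + 2 * a - a ^+ 2); [rewrite hb; ring|ring].
Qed.

Lemma cnorm1B_sqr z : cnorm z = 1 -> cnorm (1 - z) ^+ 2 = 2 - 2 * complex.Re z.
Proof.
move=> h; have := cnorm_sqr z; rewrite h cnorm_sqr expr1n.
case: z {h} => a b /= h.
by transitivity (1 - 2 * a + (a ^+ 2 + b ^+ 2)); [ring|rewrite -h; ring].
Qed.

(** |a + b w|^2 = (a + b)^2 - a b |1 - w|^2; a + b <= 1 lets the loss survive the square root. *)
Lemma two_term_cnorm (a b : R) w : 0 <= a -> 0 <= b -> a + b <= 1 -> cnorm w = 1 ->
  cnorm (cr a + cr b * w) <= a + b - a * b / 2 * cnorm (1 - w) ^+ 2.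
Proof.
move=> a0 b0 ab1 hw; rewrite (cnorm1B_sqr hw).
have := cnorm_sqr w; rewrite hw expr1n => h1.
have hx : -1 <= complex.Re w <= 1.
  have := sqr_ge0 (complex.Im w); have := sqr_ge0 (complex.Re w).
  move: h1; set x := complex.Re w; set y := complex.Im w => h1 h2 h3.
  by apply/andP; split; nra.
have h2 : cnorm (cr a + cr b * w) ^+ 2 = (a + b) ^+ 2 - a * b * (2 - 2 * complex.Re w).
  rewrite cnorm_sqr; case: w hw h1 hx => x y /= _ h1 _.
  transitivity (a ^+ 2 + 2 * (a * b) * x + b ^+ 2 * (x ^+ 2 + y ^+ 2)); first by ring.
  by rewrite -h1; ring.
move: hx h2; set x := complex.Re w => /andP[x1 x2] h2.
have ab0 : 0 <= a * b by rewrite mulr_ge0.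
have t1 : a * b * (2 - 2 * x) <= 4 * (a * b).
  by rewrite (mulrC 4); apply: ler_wpM2l => //; lra.
have t2 : 4 * (a * b) <= (a + b) ^+ 2.
  have := sqr_ge0 (a - b); rewrite sqrrB sqrrD; lra.
have t3 : (a + b) ^+ 2 <= a + b by rewrite expr2 ler_piMl // addr_ge0.
set t := a * b * (2 - 2 * x) in t1 h2.
have t0 : 0 <= t by rewrite /t mulr_ge0 //; lra.
have -> : a * b / 2 * (2 - 2 * x) = t / 2 by rewrite /t; ring.
have s0 : 0 <= a + b - t / 2 by lra.
rewrite -(@ler_pXn2r _ 2) ?nnegrE ?cnorm_ge0 // h2; nra.
Qed.

Section Walk.
Variables (A : {poly R}) (c : nat) (s : R).
Hypothesis A_ge0 : forall j, 0 <= A`_j.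
Hypothesis A_sum1 : A.[1] = 1.
Hypothesis A_mean : (deriv A).[1] = c%:R.
Hypothesis A_var : (deriv (deriv A)).[1] = s + c%:R * (c%:R - 1).
Hypothesis s_gt0 : 0 < s.
Hypothesis c_gt0 : (0 < c)%N.
Hypothesis A0_gt0 : 0 < A`_0.
Hypothesis A_gcd : forall m, (forall j, A`_j != 0 -> (m %| j)%N) -> m = 1%N.

Lemma A_coef_sum : \sum_(i < size A) A`_i = 1.
Proof.
rewrite -A_sum1 horner_coef; apply: eq_bigr => i _; by rewrite expr1n mulr1.
Qed.

Lemma hornerC_expand z : (pC A).[z] = \sum_(i < size A) cr A`_i * z ^+ i.
Proof.
rewrite horner_coef size_map_poly; apply: eq_bigr => i _; by rewrite coef_map.
Qed.

Lemma cnorm_A_le1 z : cnorm z = 1 -> cnorm (pC A).[z] <= 1.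
Proof.
move=> hz; rewrite hornerC_expand; apply: le_trans (cnorm_sum _ _ _) _.
rewrite -A_coef_sum; apply: ler_sum => i _.
by rewrite cnormM cnormX hz expr1n mulr1 cnorm_real ger0_norm.
Qed.

Lemma size_A_gt0 : (0 < size A)%N.
Proof.
by rewrite lt0n size_poly_eq0; apply/eqP => h; move: A0_gt0; rewrite h coef0 ltxx.
Qed.

Lemma cnorm_A_support j z : cnorm z = 1 -> (0 < j)%N ->
  A`_0 * A`_j / 2 * cnorm (1 - z ^+ j) ^+ 2 <= 1 - cnorm (pC A).[z].
Proof.
move=> hz j0; case: (ltnP j (size A)) => hj; last first.
  by rewrite (nth_default _ hj) mulr0 mul0r mul0r subr_ge0 cnorm_A_le1.
have n0j : Ordinal hj != Ordinal size_A_gt0 by rewrite -val_eqE /= -lt0n.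
have e1 := A_coef_sum; rewrite (bigD1 (Ordinal size_A_gt0)) //= (bigD1 (Ordinal hj)) //= in e1.
set r := (X in _ + (_ + X)) in e1.
have r0 : 0 <= r by apply: sumr_ge0.
have hzj : cnorm (z ^+ j) = 1 by rewrite cnormX hz expr1n.
have ab1 : A`_0 + A`_j <= 1 by lra.
have h2 := two_term_cnorm (A_ge0 0) (A_ge0 j) ab1 hzj.
suff h3 : cnorm (pC A).[z] <= cnorm (cr A`_0 + cr A`_j * z ^+ j) + r by lra.
rewrite hornerC_expand (bigD1 (Ordinal size_A_gt0)) //= (bigD1 (Ordinal hj)) //=.
rewrite expr0 mulr1 addrA; apply: le_trans (cnormD _ _) _; rewrite lerD2l.
apply: le_trans (cnorm_sum _ _ _) _; apply: ler_sum => i _.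
by rewrite cnormM cnormX hz expr1n mulr1 cnorm_real ger0_norm.
Qed.

(** The exponents k for which |A(z)| near 1 forces z^k near 1, with a rate. They include the support
    of A and are closed under gcd by Bezout, so aperiodicity yields k = 1. *)
Definition controlled k := exists2 C, 0 <= C & forall z, cnorm z = 1 ->
  cnorm (1 - z ^+ k) <= C * Num.sqrt (1 - cnorm (pC A).[z]).

Lemma controlled_gcd k l : controlled k -> controlled l -> controlled (gcdn k l).
Proof.
move=> [C1 C10 h1] [C2 C20 h2].
case: (posnP k) => [->|k0]; first by rewrite gcd0n; exists C2.
have mult m n C z : cnorm z = 1 -> cnorm (1 - z ^+ m) <= C -> cnorm (1 - z ^+ (n * m)) <= n%:R * C.
  move=> hz h; rewrite mulnC exprM.
  have := @cnorm_expB R 1 (z ^+ m) n; rewrite expr1n cnorm1 cnormX hz expr1n => /(_ (lexx _) (lexx _)).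
  by move/le_trans; apply; apply: ler_wpM2l.
case: (egcdnP l k0) => km kn e _.
exists (km%:R * C1 + kn%:R * C2); first by rewrite addr_ge0 // mulr_ge0.
move=> z hz; set S := Num.sqrt _.
have t1 := mult k km _ z hz (h1 z hz); have t2 := mult l kn _ z hz (h2 z hz).
have -> : cnorm (1 - z ^+ gcdn k l) = cnorm (z ^+ (kn * l) * (1 - z ^+ gcdn k l)).
  by rewrite cnormM cnormX hz expr1n mul1r.
have -> : z ^+ (kn * l) * (1 - z ^+ gcdn k l) = (1 - z ^+ (km * k)) - (1 - z ^+ (kn * l)).
  by rewrite mulrBr mulr1 -exprD -e; ring.
apply: le_trans (cnormB _ _) _; rewrite mulrDl -!mulrA; exact: lerD.
Qed.

Lemma controlled1 : controlled 1.
Proof.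
pose g := \big[gcdn/0%N]_(j < size A | A`_j != 0) (j : nat).
have hg : controlled g.
  apply: (big_ind controlled); last first.
  - move=> j hj; case: (posnP j) => [->|j0].
      by exists 0 => // z _; rewrite expr0 subrr cnorm0 mul0r.
    have aj : 0 < A`_j by rewrite lt_neqAle eq_sym hj A_ge0.
    have a0j : 0 < A`_0 * A`_j / 2 by rewrite divr_gt0 // mulr_gt0.
    exists (Num.sqrt (A`_0 * A`_j / 2))^-1; first by rewrite invr_ge0 sqrtr_ge0.
    move=> z hz; rewrite mulrC ler_pdivlMr ?sqrtr_gt0 // mulrC.
    have h := cnorm_A_support hz j0.
    rewrite -(ger0_norm (cnorm_ge0 (1 - z ^+ j))) -sqrtr_sqr -sqrtrM ?(ltW a0j) //.
    by apply: ler_wsqrtr.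
  - exact: controlled_gcd.
  - by exists 0 => // z _; rewrite expr0 subrr cnorm0 mul0r.
suff <- : g = 1%N by [].
apply: A_gcd => j hj; case: (ltnP j (size A)) => hj2; last by rewrite nth_default // eqxx in hj.
by rewrite /g (bigD1 (Ordinal hj2)) //= dvdn_gcdl.
Qed.

(** The bound for k = 1, squared. The 4 in D = C^2 + 4 gives c0 <= 1/4, which keeps 1 - c0 |1 - z|^2
    nonnegative since |1 - z| <= 2. *)
Lemma char_decay : exists2 c0, 0 < c0 <= 4^-1 & forall z, cnorm z = 1 ->
  cnorm (pC A).[z] <= 1 - c0 * cnorm (1 - z) ^+ 2.
Proof.
have [C C0 hC] := controlled1.
pose D := C ^+ 2 + 4.
have C2 : 0 <= C ^+ 2 by rewrite exprn_ge0.
have D0 : 0 < D by rewrite /D; lra.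
exists D^-1 => [|z hz]; first by rewrite invr_gt0 D0 /= lef_pV2 ?posrE // /D; lra.
have h := hC z hz; rewrite expr1 in h.
have n1 := cnorm_A_le1 hz.
have h2 : cnorm (1 - z) ^+ 2 <= C ^+ 2 * (1 - cnorm (pC A).[z]).
  rewrite -[X in _ <= _ * X]sqr_sqrtr ?subr_ge0 // -exprMn.
  by rewrite ler_pXn2r ?nnegrE ?mulr_ge0 ?cnorm_ge0 ?sqrtr_ge0.
have h3 : cnorm (1 - z) ^+ 2 <= D * (1 - cnorm (pC A).[z]).
  by apply: le_trans h2 _; apply: ler_wpM2r; rewrite ?subr_ge0 // /D; lra.
have : D^-1 * cnorm (1 - z) ^+ 2 <= 1 - cnorm (pC A).[z].
  by rewrite mulrC ler_pdivrMr // mulrC.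
lra.
Qed.

Lemma poly_root_factor (F : fieldType) (p : {poly F}) a : p.[a] = 0 ->
  exists q, p = q * ('X - a%:P).
Proof. by move=> h; apply/factor_theorem/eqP. Qed.

(** The drift being zero, u^c - A(u) vanishes twice at 1, and the second quotient takes the value
    -s/2 there. Dividing by u - 1 replaces a Taylor expansion, and [unit_dist] turns (z - 1)^2 into
    -|1 - z|^2 z. Comparing the second quotient with its value at 1 times u^(c-1) allows a third
    division, which is the cubic error. *)
Lemma char_expansion : exists2 C, 0 <= C & forall z, cnorm z = 1 ->
  cnorm ((pC A).[z] / z ^+ c - cr (1 - s / 2 * cnorm (1 - z) ^+ 2)) <=
    C * cnorm (1 - z) ^+ 3.
Proof.
pose K : {poly R} := 'X^c - A.
have [q1 e1] : exists q, K = q * ('X - 1%:P).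
  by apply: poly_root_factor; rewrite /K hornerD hornerN hornerXn expr1n A_sum1 subrr.
have dK : deriv K = 'X^(c.-1) *+ c - deriv A by rewrite /K derivB derivXn.
have q11 : q1.[1] = 0.
  have : (deriv K).[1] = q1.[1].
    by rewrite e1 derivM derivXsubC mulr1 hornerD hornerM !hornerXsubC subrr mulr0 add0r.
  by rewrite dK hornerD hornerN hornerMn hornerXn expr1n A_mean subrr.
have [q2 e2] := poly_root_factor q11.
have q21 : q2.[1] = - s / 2.
  have d2 : (deriv (deriv K)).[1] = - s.
    rewrite dK derivB derivMn derivXn hornerD hornerN !hornerMn hornerXn expr1n A_var.
    case: c c_gt0 => // k _ /=; rewrite -[X in X - _]mulr_natl -natr1; ring.
  have : (deriv (deriv K)).[1] = 2 * q2.[1].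
    have dq a : deriv (a * ('X - 1%:P)) = deriv a * ('X - 1%:P) + a :> {poly R}.
      by rewrite derivM derivXsubC mulr1.
    have dd : (deriv q1).[1] = q2.[1].
      by rewrite e2 dq hornerD hornerM hornerXsubC subrr mulr0 add0r.
    rewrite e1 dq derivD dq !hornerE dd; ring.
  by rewrite d2 => ->; field.
pose q3 := q2 - (q2.[1])%:P * 'X^(c.-1).
have [q4 e4] : exists q, q3 = q * ('X - 1%:P).
  apply: poly_root_factor; by rewrite /q3 hornerD hornerN hornerM hornerC hornerXn expr1n mulr1 subrr.
pose C := \sum_(i < size q4) `|q4`_i|.
exists C => [|z hz]; first by apply: sumr_ge0.
have z0 : z != 0 by apply/eqP => h; move: hz; rewrite h cnorm0 => /eqP; rewrite eq_sym oner_eq0.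
have hA : (pC A).[z] = z ^+ c - (z - 1) ^+ 2 * (pC q2).[z].
  have -> : A = 'X^c - q2 * ('X - 1%:P) * ('X - 1%:P) by rewrite -e2 -e1 /K; ring.
  rewrite !(rmorphB, rmorphM) /= map_polyXn map_polyX map_polyC /=.
  by rewrite !(hornerD, hornerN, hornerM, hornerXn, hornerX, hornerC) rmorph1; ring.
have hq : (pC q2).[z] = cr (q2.[1]) * z ^+ c.-1 + (pC q4).[z] * (z - 1).
  have e5 : q2 = (q2.[1])%:P * 'X^(c.-1) + q4 * ('X - 1%:P) by rewrite -e4 /q3; ring.
  rewrite [in LHS]e5 !(rmorphB, rmorphM, rmorphD) /= map_polyXn map_polyX !map_polyC /=.
  by rewrite !(hornerD, hornerN, hornerM, hornerXn, hornerX, hornerC) rmorph1.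
have hu := unit_dist hz; set Y := cr (cnorm (1 - z) ^+ 2) in hu.
have hq4 : cnorm (pC q4).[z] <= C.
  rewrite horner_coef size_map_poly; apply: le_trans (cnorm_sum _ _ _) _.
  by apply: ler_sum => i _; rewrite cnormM cnormX hz expr1n mulr1 coef_map cnorm_real.
have -> : (pC A).[z] / z ^+ c - cr (1 - s / 2 * cnorm (1 - z) ^+ 2) =
   Y * (pC q4).[z] * (z - 1) / z ^+ c.-1.
  have -> : cr (1 - s / 2 * cnorm (1 - z) ^+ 2) = 1 + cr (- s / 2) * Y.
    by rewrite /Y -rmorphM -(rmorph1 (real_complex R)) -rmorphD /=; congr (cr _); ring.
  rewrite -q21 hA hq.
  have -> : (z - 1) ^+ 2 = - (Y * z) by rewrite hu; ring.
  have -> : z ^+ c = z * z ^+ c.-1 by rewrite -exprS prednK.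
  field; by rewrite expf_neq0.
rewrite !cnormM cnormV cnormX hz expr1n invr1 mulr1 /Y cnorm_real.
rewrite ger0_norm ?exprn_ge0 ?cnorm_ge0 // (cnorm_distC z); set r := cnorm (1 - z).
have -> : r ^+ 2 * cnorm (pC q4).[z] * r = cnorm (pC q4).[z] * r ^+ 3 by ring.
by apply: ler_wpM2r => //; rewrite exprn_ge0 ?cnorm_ge0.
Qed.

End Walk.
End LocalLimit.

(** * Averages over roots of unity *)

Section LocalLimitTheorem.
Variable R : realType.
Implicit Types z w : R[i].

Local Notation cr a := ((a : R)%:C)%C.
Local Notation pC := (map_poly (real_complex R)).

(** At z = exp(i t) this is 4 sin(t/2)^2, which plays the part of t^2. *)
Definition dist2 z : R := cnorm (1 - z) ^+ 2.

Lemma dist2_ge0 z : 0 <= dist2 z.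
Proof. by rewrite exprn_ge0 // cnorm_ge0. Qed.

Lemma cnorm1B_le2 z : cnorm z = 1 -> cnorm (1 - z) <= 2.
Proof. by move=> h; apply: le_trans (cnormB _ _) _; rewrite cnorm1 h. Qed.

Lemma dist2_le4 z : cnorm z = 1 -> dist2 z <= 4.
Proof.
move=> h; rewrite /dist2; have := cnorm1B_le2 h; have := cnorm_ge0 (1 - z).
by rewrite expr2; nra.
Qed.

Lemma cr_inj : injective (fun a : R => cr a).
Proof. by move=> a b []. Qed.

Lemma bernoulli_upper (t : R) n : 0 <= t <= 1 -> (1 - t) ^+ n <= (1 + n%:R * t)^-1.
Proof.
move=> /andP[t0 t1].
have p m : 0 < 1 + m%:R * t by rewrite ltr_pwDl // mulr_ge0.
rewrite -[leRHS]mul1r ler_pdivlMr //.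
elim: n => [|n IH]; first by rewrite expr0 mul0r addr0 mul1r.
apply: le_trans IH; rewrite exprS (mulrC (1 - t)) -mulrA; apply: ler_wpM2l.
  by rewrite exprn_ge0 // subr_ge0.
have -> : n.+1%:R = n%:R + 1 :> R by rewrite natr1.
have : 0 <= (n%:R : R) by [].
by nra.
Qed.

Lemma bernoulli_lower (t : R) n : 0 <= t <= 1 -> 1 - n%:R * t <= (1 - t) ^+ n.
Proof.
move=> /andP[t0 t1]; elim: n => [|n IH]; first by rewrite mul0r subr0.
have -> : n.+1%:R = n%:R + 1 :> R by rewrite natr1.
rewrite exprS; apply: le_trans (ler_wpM2l (_ : 0 <= 1 - t) IH); last by rewrite subr_ge0.
have : 0 <= (n%:R : R) by [].
by nra.
Qed.

Lemma expR_quadratic (x : R) : 0 <= x -> `|1 - x - expR (- x)| <= x ^+ 2.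
Proof.
move=> x0; have h1 := expR_ge1Dx (- x); have h2 := expR_ge1Dx x.
have h3 : expR (- x) <= 1 - x + x ^+ 2.
  rewrite expRN; apply: le_trans (_ : (1 + x)^-1 <= _).
    by rewrite lef_pV2 ?posrE ?expR_gt0 //; lra.
  rewrite -[leLHS]mul1r ler_pdivrMr; last lra.
  by have : 0 <= x ^+ 3 by [rewrite exprn_ge0]; rewrite !exprS expr0; nra.
rewrite ler_norml; apply/andP; split; lra.
Qed.

Lemma expRN_lip (x y : R) : 0 <= x -> 0 <= y -> `|expR (- x) - expR (- y)| <= `|x - y|.
Proof.
wlog xy : x y / x <= y => [hw x0 y0|x0 y0].
  case: (leP x y) => [h|/ltW h]; first exact: hw.
  by rewrite distrC (distrC x); apply: hw.
have e : expR (- y) = expR (- x) * expR (- (y - x)) by rewrite -expRD; congr expR; ring.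
have h1 := expR_ge1Dx (- (y - x)).
have h2 : expR (- x) <= 1 by rewrite -expR0 ler_expR oppr_le0.
have h3 : expR (- y) <= expR (- x) by rewrite ler_expR lerN2.
have h4 := expR_gt0 (- x).
rewrite ger0_norm ?subr_ge0 // distrC ger0_norm ?subr_ge0 // e; nra.
Qed.

Lemma expR_pow_dist (x : R) n : 0 <= x <= 1 ->
  `|(1 - x) ^+ n - expR (- (n%:R * x))| <= n%:R * x ^+ 2.
Proof.
move=> /andP[x0 x1].
have -> : expR (- (n%:R * x)) = expR (- x) ^+ n by rewrite -mulrN expRM_natl.
have h := @cnorm_expB R (cr (1 - x)) (cr (expR (- x))) n.
rewrite -!rmorphXn -!rmorphB !cnorm_real in h.
apply: le_trans (h _ _) _.
- by rewrite ger0_norm; lra.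
- by rewrite gtr0_norm ?expR_gt0 // -expR0 ler_expR oppr_le0.
by apply: ler_wpM2l => //; apply: expR_quadratic.
Qed.

(** 1 - |1 - w|^2/4 = (1 + w)^2/(4 w) is the characteristic function of the lazy walk with steps -1,
    0, 1, and [cbin m] is its probability of return at time m. This walk is the reference of the
    local limit theorem. *)
Lemma cbin_avg N z m : N.-primitive_root z -> (2 * m < N)%N ->
  N%:R * cbin R m = \sum_(j < N) (1 - dist2 (z ^+ j) / 4) ^+ m.
Proof.
move=> hz mN; pose G : {poly R[i]} := \poly_(i < (2 * m).+1) cr ('C(2 * m, i)%:R / 4 ^+ m).
have sG : (size G <= N)%N by apply: leq_trans (size_poly _ _) mN.
have mN' : (m < N)%N by apply: leq_ltn_trans mN; rewrite leq_pmull.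
have := dft_coef hz sG mN'; rewrite coef_poly ltnS leq_pmull // -cbin_binomial => e.
apply: cr_inj; rewrite rmorphM rmorph_nat /= e rmorph_sum /=; apply: eq_bigr => j _.
set w := z ^+ j; have hw : cnorm w = 1 by apply: prim_root_cnorm hz.
have w0 : w != 0 by apply/eqP => h; move: hw; rewrite h cnorm0 => /eqP; rewrite eq_sym oner_eq0.
have wN : w ^+ N = 1 by rewrite /w -exprM mulnC exprM (prim_expr_order hz) expr1n.
have -> : w ^+ (N - m) = (w ^+ m)^-1.
  by apply: (mulIf (expf_neq0 m w0)); rewrite -exprD subnK ?(ltnW mN') // wN mulVf // expf_neq0.
have four0 : (4 : R[i]) != 0 by rewrite pnatr_eq0.
have -> : G.[w] = ((1 + w) ^+ 2 / 4) ^+ m.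
  rewrite horner_poly expr_div_n -exprM (exprDn 1 w) mulr_suml; apply: eq_bigr => i _.
  rewrite expr1n mul1r rmorphM fmorphV rmorphXn /= !rmorph_nat.
  by rewrite -[X in _ = X / _]mulr_natl; ring.
rewrite -exprVn -exprMn rmorphXn /=; congr (_ ^+ m).
have h := unit_dist hw; rewrite -/(dist2 w) in h.
rewrite rmorphB rmorphM fmorphV rmorph_nat rmorph1 /=.
have -> : cr (dist2 w) = - (1 - w) ^+ 2 / w by rewrite -h mulfK.
by field; rewrite w0.
Qed.

Lemma rt_le_div K n : (0 < K)%N -> rt R n <= K%:R * rt R (n %/ K).
Proof.
move=> K0; apply: rt_leM; apply: leq_trans (ltn_ceil n K0) _.
by rewrite mulnC leq_mul2r /= -mulnn leq_pmull.
Qed.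

Lemma cbin_upper : exists2 K, 0 < K & forall n, cbin R n <= K / rt R n.
Proof.
have [b b0 hb] := cbin_limit R; have [K K0 hK] := sqrt_decay_bound hb.
exists (K + 1) => [|n]; first lra.
have := hK n; rewrite ger0_norm ?(ltW (cbin_gt0 _ _)) // => h; apply: le_trans h _.
by rewrite ler_pM2r ?invr_gt0 ?rt_gt0 //; lra.
Qed.

(** For y = |1 - w|^2 <= 2, a power K with K c0 >= 1/2 gives (1 - c0 y)^K <= 1/(1 + y/2) <= 1 - y/4,
    so the average is that of the lazy walk at time n/K, known to be O(n^(-1/2)). For y > 2 the
    terms decay geometrically. *)
Lemma avg_decay (c0 : R) : 0 < c0 <= 4^-1 -> exists2 H, 0 <= H &
  forall n N z, N.-primitive_root z -> (2 * n < N)%N ->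
    \sum_(j < N) (1 - c0 * dist2 (z ^+ j)) ^+ n <= N%:R * (H / rt R n).
Proof.
move=> /andP[c00 c04]; have [Kb Kb0 hKb] := cbin_upper.
have i0 : 0 <= (2 * c0)^-1 by rewrite invr_ge0; lra.
pose K := Num.bound (2 * c0)^-1.
have hK : (2 * c0)^-1 < K%:R by apply: archi_boundP.
have K0 : (0 < K)%N by rewrite -(ltr0n R); apply: le_lt_trans hK.
have hK2 : 1 <= K%:R * (2 * c0).
  by rewrite -ler_pdivrMr ?mul1r ?ltW // mulr_gt0.
exists (Kb * K%:R + (2 * c0)^-1); first by rewrite addr_ge0 // mulr_ge0 // ltW.
move=> n N z hz nN; pose p := (n %/ K)%N.
have pn : (p <= n)%N by apply: leq_div.
apply: le_trans (_ : \sum_(j < N) ((1 - dist2 (z ^+ j) / 4) ^+ p + (1 - 2 * c0) ^+ n) <= _).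
  apply: ler_sum => j _; set w := z ^+ j.
  have hw : cnorm w = 1 by apply: prim_root_cnorm hz.
  have y0 := dist2_ge0 w; have y4 := dist2_le4 hw; set y := dist2 w in y0 y4 *.
  have cy : 0 <= c0 * y <= 1.
    apply/andP; split; first by rewrite mulr_ge0 // ltW.
    by nra.
  case/andP: (cy) => cy0 cy1.
  case: (leP y 2) => y2.
    apply: ler_wpDr; first by rewrite exprn_ge0 //; lra.
    apply: le_trans (_ : (1 - c0 * y) ^+ (K * p) <= _).
      apply: ler_wiXn2l; rewrite ?subr_ge0 // ?gerBl //.
      by rewrite mulnC; apply: leq_trunc_div.
    rewrite exprM; apply: lerXn2r; rewrite ?nnegrE ?exprn_ge0 ?subr_ge0 //; first lra.
    apply: le_trans (bernoulli_upper K cy) _.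
    have p1 : 0 < 1 + K%:R * (c0 * y) by rewrite ltr_pwDl // mulr_ge0.
    rewrite -[leLHS]mul1r ler_pdivrMr //.
    have : y / 2 <= K%:R * (c0 * y).
      by rewrite mulrA; have := ler_wpM2r y0 hK2; lra.
    by nra.
  apply: ler_wpDl; first by rewrite exprn_ge0 //; lra.
  apply: lerXn2r; rewrite ?nnegrE ?subr_ge0 //; first lra.
  by rewrite lerD2l lerN2 mulrC ler_pM2l // ltW.
rewrite big_split /= -(cbin_avg hz); last by apply: leq_ltn_trans nN; rewrite leq_mul2l.
rewrite sumr_const card_ord -[X in _ + X <= _]mulr_natl -mulrDr; apply: ler_wpM2l => //.
rewrite [leRHS]mulrDl; apply: lerD.
  apply: le_trans (hKb p) _; rewrite -mulrA; apply: ler_wpM2l; first exact: ltW.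
  rewrite -[leLHS]mul1r ler_pdivrMr ?rt_gt0 // mulrAC ler_pdivlMr ?rt_gt0 // mul1r.
  exact: rt_le_div.
have c21 : 0 <= 2 * c0 <= 1 by apply/andP; split; lra.
apply: le_trans (bernoulli_upper n c21) _.
have r1 := rt_ge1 R n; have r2 := rt_sqr R n; have r0 := rt_gt0 R n.
rewrite -invfM lef_pV2 ?posrE ?mulr_gt0 //; last by rewrite ltr_pwDl // mulr_ge0 //; lra.
have -> : n%:R = rt R n ^+ 2 - 1 by rewrite r2 -natr1 addrK.
have h : rt R n <= rt R n * rt R n by rewrite ler_peMr // ltW.
have c2 : 0 <= 2 * c0 by lra.
have := ler_wpM2l c2 h; rewrite expr2; lra.
Qed.

End LocalLimitTheorem.

(** A generates the jump shifted up by c, so mean c is zero drift. [walk_var] is the second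
    factorial moment, with s the variance. As A has a constant term, [walk_gcd] says that no proper
    sublattice carries the jumps. *)
Record centred_walk (R : realType) (A : {poly R}) (c : nat) (s : R) : Prop :=
  CentredWalk {
    walk_ge0 : forall j, 0 <= A`_j;
    walk_sum1 : A.[1] = 1;
    walk_mean : (deriv A).[1] = c%:R;
    walk_var : (deriv (deriv A)).[1] = s + c%:R * (c%:R - 1);
    walk_var_gt0 : 0 < s;
    walk_down : (0 < c)%N;
    walk_bottom : 0 < A`_0;
    walk_gcd : forall m, (forall j, A`_j != 0 -> (m %| j)%N) -> m = 1%N }.

Section LocalLimitForWalk.
Variable R : realType.
Implicit Types z w : R[i].

Local Notation cr a := ((a : R)%:C)%C.
Local Notation pC := (map_poly (real_complex R)).

Variables (A : {poly R}) (c : nat) (s : R).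
Hypothesis HA : centred_walk A c s.

Definition char z : R[i] := (pC A).[z] / z ^+ c.

Lemma cnorm_char z : cnorm z = 1 -> cnorm (char z) = cnorm (pC A).[z].
Proof. by move=> h; rewrite /char cnormM cnormV cnormX h expr1n invr1 mulr1. Qed.

Lemma cnorm_char_le1 z : cnorm z = 1 -> cnorm (char z) <= 1.
Proof. by move=> h; rewrite cnorm_char // (cnorm_A_le1 (walk_ge0 HA) (walk_sum1 HA)). Qed.

(* Near 1 both characteristic functions are compared with exp(- s y / 2). *)
Lemma near_bound k : exists2 C, 0 <= C & forall z n m (a : R), cnorm z = 1 -> 1 <= a ->
  m%:R <= 2 * s * n%:R < m%:R + 1 -> n.+1%:R * dist2 z <= a ->
  rt R n * cnorm (char z ^+ n / z ^+ k - cr ((1 - dist2 z / 4) ^+ m)) <= C * a ^+ 2.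
Proof.
have [C C0 hC] := char_expansion (walk_sum1 HA) (walk_mean HA) (walk_var HA) (walk_down HA).
have s0 := walk_var_gt0 HA.
exists (k%:R + C + s ^+ 2 + s + 1) => [|z n m a hz a1 hm hy].
  by rewrite !addr_ge0 // ?exprn_ge0 // ltW.
have y0 := dist2_ge0 z; have y4 := dist2_le4 hz.
have h3 := hC z hz; rewrite -/(char z) -/(dist2 z) in h3.
set r := cnorm (1 - z) in h3.
have r0 : 0 <= r by apply: cnorm_ge0.
have r2 : r <= 2 by apply: cnorm1B_le2.
have yr : dist2 z = r ^+ 2 by [].
set y := dist2 z in y0 y4 hy yr h3 *.
have g0 := rt_gt0 R n.
have gr : rt R n * r <= a.
  rewrite -(@ler_pXn2r _ 2) ?nnegrE ?mulr_ge0 ?(ltW g0) //; last lra.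
  rewrite exprMn rt_sqr -yr; apply: le_trans hy _; rewrite expr2 ler_peMr //; lra.
have n1 : n%:R * y <= a.
  apply: le_trans hy; apply: ler_wpM2r => //; rewrite ler_nat; exact: leqnSn.
have n0 : 0 <= n%:R :> R by [].
have x0 : 0 <= s * y / 2 by rewrite divr_ge0 // mulr_ge0 // ltW.
have phi1 := cnorm_char_le1 hz.
have e1 : cnorm (char z - cr (expR (- (s * y / 2)))) <= C * r ^+ 3 + (s * y / 2) ^+ 2.
  have -> : char z - cr (expR (- (s * y / 2))) =
     (char z - cr (1 - s / 2 * y)) + cr (1 - s * y / 2 - expR (- (s * y / 2))).
    have -> : s / 2 * y = s * y / 2 by ring.
    by rewrite !rmorphB /=; ring.
  apply: le_trans (cnormD _ _) _; apply: lerD => //.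
  by rewrite cnorm_real; apply: expR_quadratic.
have ex1 : cnorm (cr (expR (- (s * y / 2)))) <= 1.
  by rewrite cnorm_real gtr0_norm ?expR_gt0 // -[leRHS]expR0 ler_expR oppr_le0.
have t1 : cnorm (char z ^+ n - cr (expR (- (n%:R * (s * y / 2))))) <= n%:R * (C * r ^+ 3 + (s * y / 2) ^+ 2).
  rewrite -mulrN expRM_natl rmorphXn /=.
  by apply: le_trans (cnorm_expB _ phi1 ex1) _; apply: ler_wpM2l.
have t2 : cnorm (char z ^+ n / z ^+ k - char z ^+ n) <= k%:R * r.
  have z0 : z != 0 by apply/eqP => h; move: hz; rewrite h cnorm0 => /eqP; rewrite eq_sym oner_eq0.
  have -> : char z ^+ n / z ^+ k - char z ^+ n = char z ^+ n / z ^+ k * (1 ^+ k - z ^+ k).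
    by rewrite expr1n; field; rewrite expf_neq0.
  rewrite cnormM; apply: le_trans (_ : 1 * (k%:R * r) <= _); last by rewrite mul1r.
  apply: ler_pM; rewrite ?cnorm_ge0 //; last by apply: cnorm_expB; rewrite ?cnorm1 ?hz.
  by rewrite cnormM cnormV !cnormX hz expr1n invr1 mulr1 exprn_ile1 // cnorm_ge0.
have y41 : 0 <= y / 4 <= 1 by apply/andP; split; lra.
have t3 := expR_pow_dist m y41.
have t4 : `|expR (- (n%:R * (s * y / 2))) - expR (- (m%:R * (y / 4)))| <= y / 4.
  apply: le_trans (expRN_lip _ _) _; rewrite ?mulr_ge0 //; first lra.
  have -> : n%:R * (s * y / 2) - m%:R * (y / 4) = (2 * s * n%:R - m%:R) * (y / 4) by field.
  case/andP: hm => hm1 hm2.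
  rewrite normrM (ger0_norm (_ : 0 <= y / 4)); last lra.
  by rewrite ler_piMl ?ger0_norm ?subr_ge0 //; lra.
have key : cnorm (char z ^+ n / z ^+ k - cr ((1 - y / 4) ^+ m)) <=
   k%:R * r + n%:R * (C * r ^+ 3 + (s * y / 2) ^+ 2) + (y / 4 + m%:R * (y / 4) ^+ 2).
  have -> : char z ^+ n / z ^+ k - cr ((1 - y / 4) ^+ m) =
    (char z ^+ n / z ^+ k - char z ^+ n) + (char z ^+ n - cr (expR (- (n%:R * (s * y / 2)))))
    + cr (expR (- (n%:R * (s * y / 2))) - (1 - y / 4) ^+ m).
    by rewrite rmorphB /=; ring.
  apply: le_trans (cnormD _ _) _; apply: lerD.
    by apply: le_trans (cnormD _ _) _; apply: lerD.
  rewrite cnorm_real.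
  have -> : expR (- (n%:R * (s * y / 2))) - (1 - y / 4) ^+ m =
     (expR (- (n%:R * (s * y / 2))) - expR (- (m%:R * (y / 4)))) - ((1 - y / 4) ^+ m - expR (- (m%:R * (y / 4)))) by ring.
  by apply: le_trans (ler_normB _ _) _; apply: lerD.
apply: le_trans (ler_wpM2l (ltW g0) key) _.
case/andP: hm => hm1 _.
have a0 : 0 <= a by lra.
have aa : a <= a ^+ 2 by rewrite expr2 ler_peMr.
set g := rt R n in g0 gr *.
have gr0 : 0 <= g * r by rewrite mulr_ge0 // ltW.
have ny0 : 0 <= n%:R * y by rewrite mulr_ge0.
have b1 : g * r * (n%:R * y) <= a ^+ 2 by rewrite expr2; apply: ler_pM.
have b2 : g * y <= 2 * a.
  have -> : g * y = g * r * r by rewrite yr; ring.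
  by rewrite mulrC; apply: ler_pM.
have b3 : g * y * (n%:R * y) <= 2 * a ^+ 2.
  have -> : 2 * a ^+ 2 = 2 * a * a by ring.
  by apply: ler_pM; rewrite ?mulr_ge0 // ltW.
have -> : g * (k%:R * r + n%:R * (C * r ^+ 3 + (s * y / 2) ^+ 2) + (y / 4 + m%:R * (y / 4) ^+ 2)) =
   k%:R * (g * r) + C * (g * r * (n%:R * r ^+ 2)) + s ^+ 2 / 4 * (g * y * (n%:R * y)) + (g * y / 4 + m%:R * (g * y * y) / 16).
  by field.
rewrite -yr.
have c1 : k%:R * (g * r) <= k%:R * a ^+ 2 by apply: ler_wpM2l => //; apply: le_trans gr aa.
have c2 : C * (g * r * (n%:R * y)) <= C * a ^+ 2 by apply: ler_wpM2l.
have c3 : s ^+ 2 / 4 * (g * y * (n%:R * y)) <= s ^+ 2 * a ^+ 2.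
  apply: le_trans (_ : s ^+ 2 / 4 * (2 * a ^+ 2) <= _).
    by apply: ler_wpM2l => //; rewrite divr_ge0 // exprn_ge0 // ltW.
  have : 0 <= s ^+ 2 * a ^+ 2 by rewrite mulr_ge0 ?exprn_ge0 // ltW.
  lra.
have c4 : m%:R * (g * y * y) <= 2 * s * (2 * a ^+ 2).
  apply: le_trans (_ : 2 * s * n%:R * (g * y * y) <= _).
    by apply: ler_wpM2r => //; rewrite !mulr_ge0 // ltW.
  have -> : 2 * s * n%:R * (g * y * y) = 2 * s * (g * y * (n%:R * y)) by ring.
  by apply: ler_wpM2l => //; rewrite mulr_ge0 // ltW.
have c5 : 0 <= s * a ^+ 2 by rewrite mulr_ge0 ?exprn_ge0 // ltW.
rewrite !mulrDl mul1r; lra.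
Qed.

Lemma coef_pow_dft N z n k : N.-primitive_root z -> (size (A ^+ n) <= N)%N -> (c * n + k < N)%N ->
  N%:R * cr (A ^+ n)`_(c * n + k) = \sum_(j < N) char (z ^+ j) ^+ n / (z ^+ j) ^+ k.
Proof.
move=> hz hs hk.
have hs' : (size (pC (A ^+ n)) <= N)%N by rewrite size_map_poly.
have := dft_coef hz hs' hk; rewrite coef_map => ->; apply: eq_bigr => j _.
set w := z ^+ j; have hw : cnorm w = 1 by apply: prim_root_cnorm hz.
have w0 : w != 0 by apply/eqP => h; move: hw; rewrite h cnorm0 => /eqP; rewrite eq_sym oner_eq0.
have wN : w ^+ N = 1 by rewrite /w -exprM mulnC exprM (prim_expr_order hz) expr1n.
have -> : w ^+ (N - (c * n + k)) = (w ^+ (c * n + k))^-1.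
  by apply: (mulIf (expf_neq0 (c * n + k) w0)); rewrite -exprD subnK ?(ltnW hk) // wN mulVf // expf_neq0.
by rewrite rmorphXn /= horner_exp /char expr_div_n -(exprM w c n) (exprD w) invfM mulrA.
Qed.

(** Uniform in k because z^(-k) has modulus 1. This uniformity later dominates the sum over
    altitudes. *)
Lemma local_limit_bound : exists2 H, 0 <= H & forall n k,
  `|(A ^+ n)`_(c * n + k)| <= H / rt R n.
Proof.
have [c0 c0P hc0] := char_decay (walk_ge0 HA) (walk_sum1 HA) (walk_bottom HA) (walk_gcd HA).
have [H H0 hH] := avg_decay c0P.
exists H => // n k.
pose N := (size (A ^+ n) + (c * n + k) + 2 * n).+1.
have N0 : (0 < N)%N by [].
have [z hz] := prim_root_exists R N0.
have h1 : (size (A ^+ n) <= N)%N by rewrite /N -!addnA; apply: leq_trans (leq_addr _ _) (leqnSn _).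
have h2 : (c * n + k < N)%N by rewrite /N ltnS -addnA addnCA leq_addr.
have h3 : (2 * n < N)%N by rewrite /N ltnS leq_addl.
have Nr : 0 < N%:R :> R by rewrite ltr0n.
rewrite -(ler_pM2l Nr); apply: le_trans (hH n N z hz h3).
have -> : N%:R * `|(A ^+ n)`_(c * n + k)| = cnorm (N%:R * cr (A ^+ n)`_(c * n + k)).
  by rewrite -[N%:R in RHS](rmorph_nat (real_complex R)) -rmorphM cnorm_real normrM ger0_norm.
rewrite (coef_pow_dft hz h1 h2); apply: le_trans (cnorm_sum _ _ _) _.
apply: ler_sum => j _; have hw := prim_root_cnorm j hz.
move: (z ^+ j) hw => w hw.
rewrite cnormM cnormV !cnormX hw expr1n invr1 mulr1.
apply: lerXn2r; rewrite ?nnegrE ?cnorm_ge0 //.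
  by apply: le_trans (cnorm_ge0 _) (hc0 _ hw).
by rewrite cnorm_char // hc0.
Qed.

End LocalLimitForWalk.

Section LocalLimitTheoremProof.
Variable R : realType.
Implicit Types z w : R[i].

Local Notation cr a := ((a : R)%:C)%C.
Local Notation pC := (map_poly (real_complex R)).

Variables (A : {poly R}) (c : nat) (s : R).
Hypothesis HA : centred_walk A c s.

(** The lazy walk has variance 1/2 per step, so 2 s n of its steps match n steps of variance s. *)
Definition matched n : nat := Num.truncn (2 * s * n%:R).

Lemma matched_itv n : (matched n)%:R <= 2 * s * n%:R < (matched n)%:R + 1.
Proof.
have h : 0 <= 2 * s * n%:R by rewrite !mulr_ge0 // ltW // (walk_var_gt0 HA).
by have := truncn_itv h; rewrite natr1.
Qed.

Lemma far_bound (t : R) n n1 (e : R) : 0 <= t <= 1 -> (n1 <= n)%N -> 0 < e ->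
  e <= (n - n1)%:R * t -> (1 - t) ^+ n <= e^-1 * (1 - t) ^+ n1.
Proof.
move=> t01 n1n e0 he; case/andP: (t01) => t0 t1.
rewrite -{1}(subnK n1n) exprD; apply: ler_wpM2r; first by rewrite exprn_ge0 // subr_ge0.
apply: le_trans (bernoulli_upper _ t01) _; rewrite lef_pV2 ?posrE //; first lra.
by rewrite ltr_pwDl // mulr_ge0.
Qed.

(** The frequencies are cut at (n+1) |1 - z|^2 = a. Beyond the cut half of each power already gives
    a factor O(1/a); below it the two characteristic functions differ by O(a^2/sqrt n). First a is
    chosen, then n. *)
Lemma local_limit_compare k e : 0 < e -> exists N0, forall n, (N0 <= n)%N ->
  rt R n * `|(A ^+ n)`_(c * n + k) - cbin R (matched n)| <= e.
Proof.
move=> e0; have s0 := walk_var_gt0 HA.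
have [c0 c0P hc0] := char_decay (walk_ge0 HA) (walk_sum1 HA) (walk_bottom HA) (walk_gcd HA).
have [H H0 hH] := avg_decay c0P.
have q4 : 0 < (4^-1 : R) <= 4^-1 by rewrite invr_gt0 ltr0n lexx.
have [H4 H40 hH4] := avg_decay q4.
have [C C0 hC] := near_bound HA k.
case/andP: (c0P) => c00 c01.
pose L := (Num.bound s^-1).
have hL : s^-1 < L%:R by apply: archi_boundP; rewrite invr_ge0 ltW.
have sL : 1 <= s * L%:R.
  by have := ler_wpM2l (ltW s0) (ltW hL); rewrite mulfV // gt_eqF.
have L0 : (0 < L)%N by rewrite -(ltr0n R); apply: lt_trans hL; rewrite invr_gt0.
(* B/a is the total of the two far contributions, at most e/2 by the choice of a. *)
pose B := 8 * H / c0 + 16 * L%:R * H4 / s.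
have B0 : 0 <= B by rewrite addr_ge0 // divr_ge0 ?mulr_ge0 // ltW.
pose a := (Num.bound (2 * B / e)).+1.
have ha : 2 * B / e <= a%:R.
  apply: ltW; apply: lt_trans (archi_boundP _) _; last by rewrite ltr_nat.
  by rewrite divr_ge0 ?mulr_ge0 // ltW.
have a1 : 1 <= a%:R :> R by rewrite ler1n.
have a0 : 0 < a%:R :> R by rewrite ltr0n.
have e2 : 0 < e / 2 by rewrite divr_gt0.
have [N1 h1] := cvg_eps (rtVZ_cvg0 (4 / 3 * C * a%:R ^+ 3 * H4)) e2.
pose N2 := Num.bound (1 + s^-1).
have hN2 : 1 + s^-1 < N2%:R by apply: archi_boundP; rewrite addr_ge0 // invr_ge0 ltW.
exists (maxn N1 N2).+1 => n hn.
have n0 : (0 < n)%N by apply: leq_trans hn.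
have nN1 : (N1 <= n)%N by apply: leq_trans (ltnW hn); apply: leq_maxl.
have nN2 : (N2 <= n)%N by apply: leq_trans (ltnW hn); apply: leq_maxr.
set m := matched n; have hm := matched_itv n; rewrite -/m in hm.
pose n1 := (n %/ 2)%N; pose m1 := (m %/ 2)%N; pose p := (n %/ a)%N.
have n1n : (n1 <= n)%N by apply: leq_div.
have m1m : (m1 <= m)%N by apply: leq_div.
have ms : s * n.+1%:R <= m%:R.
  case/andP: hm => _ hm.
  have : 1 + s^-1 < n%:R by apply: lt_le_trans hN2 _; rewrite ler_nat.
  rewrite -(ltr_pM2l s0) mulrDr mulr1 mulfV ?gt_eqF // => h.
  by rewrite -natr1 mulrDr mulr1; lra.
have g0 := rt_gt0 R n.
pose N := (size (A ^+ n) + (c * n + k) + 2 * n + 2 * m).+1.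
have [z hz] := prim_root_exists R (ltn0Sn _ : (0 < N)%N).
have hs1 : (size (A ^+ n) <= N)%N by rewrite /N; clear; lia.
have hs2 : (c * n + k < N)%N by rewrite /N; move: (c * n)%N => q; clear; lia.
have hsn : (2 * n < N)%N by rewrite /N; clear; lia.
have hsm : (2 * m < N)%N by rewrite /N; clear; lia.
have Nr : 0 < N%:R :> R by rewrite ltr0n.
have pn : (p <= n)%N by apply: leq_div.
pose D1 := 4 / (c0 * a%:R); pose D2 := 8 / (s * a%:R); pose D3 := C * a%:R ^+ 2 / rt R n.
have D10 : 0 <= D1 by rewrite divr_ge0 // mulr_ge0 // ltW.
have D20 : 0 <= D2 by rewrite divr_ge0 // mulr_ge0 // ltW.
have D30 : 0 <= D3 by rewrite divr_ge0 ?mulr_ge0 ?exprn_ge0 // ltW.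
have pw w : cnorm w = 1 -> cnorm (char A c w ^+ n / w ^+ k - cr ((1 - dist2 w / 4) ^+ m)) <=
   D1 * (1 - c0 * dist2 w) ^+ n1 + D2 * (1 - 4^-1 * dist2 w) ^+ m1 + 4 / 3 * D3 * (1 - 4^-1 * dist2 w) ^+ p.
  move=> hw; have y0 := dist2_ge0 w; have y4 := dist2_le4 hw.
  have near := hC w n m a%:R hw a1 hm.
  have hcw := hc0 w hw; rewrite -/(dist2 w) in hcw.
  have cw1 := cnorm_ge0 (pC A).[w].
  set y := dist2 w in y0 y4 near hcw *.
  have cy : 0 <= c0 * y <= 1 by apply/andP; split; [rewrite mulr_ge0 // ltW|clear -hcw cw1; lra].
  have y41 : 0 <= 4^-1 * y <= 1 by apply/andP; split; clear -y0 y4; lra.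
  have p1 : 0 <= (1 - c0 * y) ^+ n1 by rewrite exprn_ge0 // subr_ge0; case/andP: cy.
  have p2 j : 0 <= (1 - 4^-1 * y) ^+ j by rewrite exprn_ge0 // subr_ge0; case/andP: y41.
  case: (leP (n.+1%:R * y) a%:R) => hy.
    apply: ler_wpDl; first by apply: addr_ge0; apply: mulr_ge0.
    (* Below the cut, (1 - y/4)^p with p = n/a is at least 3/4. Inserting it into the near error
       restricts the average to the relevant frequencies without counting them. *)
    have hp : 3 / 4 <= (1 - 4^-1 * y) ^+ p.
      apply: le_trans (bernoulli_lower p y41).
      have : p%:R * y <= 1.
        rewrite -(ler_pM2l a0) mulr1 mulrA -natrM; apply: le_trans hy.
        by apply: ler_wpM2r => //; rewrite ler_nat mulnC; apply: leq_trans (leq_trunc_div _ _) _.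
      by clear; lra.
    apply: le_trans (_ : D3 <= _).
      by rewrite /D3 ler_pdivlMr // mulrC near.
    have : D3 * (3 / 4) <= D3 * (1 - 4^-1 * y) ^+ p by apply: ler_wpM2l.
    have -> : 4 / 3 * D3 * (1 - 4^-1 * y) ^+ p = 4 / 3 * (D3 * (1 - 4^-1 * y) ^+ p) by ring.
    by clear; lra.
  apply: ler_wpDr; first by apply: mulr_ge0 (p2 _); apply: mulr_ge0.
  apply: le_trans (cnormB _ _) _; apply: lerD.
    rewrite cnormM cnormV !cnormX hw expr1n invr1 mulr1 cnorm_char //.
    apply: le_trans (_ : (1 - c0 * y) ^+ n <= _).
      by apply: lerXn2r; rewrite ?nnegrE //; clear -hcw cw1; lra.
    rewrite /D1 -invf_div; apply: far_bound => //; first by rewrite divr_gt0 // mulr_gt0.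
    have h2 : n.+1%:R / 4 <= (n - n1)%:R :> R.
      rewrite ler_pdivrMr // -natrM ler_nat /n1; clear -n0; lia.
    rewrite mulrCA -mulrA ler_pM2l //.
    by have := ler_wpM2r y0 h2; clear -hy; lra.
  rewrite cnorm_real ger0_norm; last by rewrite (mulrC y) p2.
  have -> : D2 = (s * a%:R / 8)^-1 by rewrite /D2 invf_div.
  rewrite (mulrC y); apply: far_bound => //; first by rewrite divr_gt0 // mulr_gt0.
  have h2 : m%:R / 2 <= (m - m1)%:R :> R.
    rewrite ler_pdivrMr // -natrM ler_nat /m1; clear; lia.
  have h3 : s * n.+1%:R / 2 <= (m - m1)%:R by clear -ms h2; lra.
  have h4 := ler_wpM2r y0 h3.
  have h5 : s * a%:R <= s * (n.+1%:R * y) by rewrite ler_pM2l // ltW.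
  have -> : (m - m1)%:R * (4^-1 * y) = (m - m1)%:R * y / 4 by ring.
  have h6 : s * n.+1%:R / 2 * y = s * (n.+1%:R * y) / 2 by ring.
  by rewrite h6 in h4; clear -h4 h5; lra.
have sum_bound : `|(A ^+ n)`_(c * n + k) - cbin R m| <=
   D1 * (H / rt R n1) + D2 * (H4 / rt R m1) + 4 / 3 * D3 * (H4 / rt R p).
  rewrite -(ler_pM2l Nr).
  have -> : N%:R * `|(A ^+ n)`_(c * n + k) - cbin R m| =
     cnorm (N%:R * cr (A ^+ n)`_(c * n + k) - cr (N%:R * cbin R m)).
    rewrite -[X in _ = cnorm (X * _ - _)](rmorph_nat (real_complex R)) -rmorphM -rmorphB cnorm_real.
    by rewrite -mulrBr normrM (ger0_norm (ltW Nr)).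
  rewrite (coef_pow_dft hz hs1 hs2) (cbin_avg hz hsm) rmorph_sum -sumrB.
  apply: le_trans (cnorm_sum _ _ _) _.
  apply: le_trans (_ : \sum_(j < N) (D1 * (1 - c0 * dist2 (z ^+ j)) ^+ n1 +
      D2 * (1 - 4^-1 * dist2 (z ^+ j)) ^+ m1 + 4 / 3 * D3 * (1 - 4^-1 * dist2 (z ^+ j)) ^+ p) <= _).
    by apply: ler_sum => j _; apply: pw; apply: prim_root_cnorm hz.
  rewrite !big_split /= -!mulr_sumr.
  have -> : N%:R * (D1 * (H / rt R n1) + D2 * (H4 / rt R m1) + 4 / 3 * D3 * (H4 / rt R p)) =
     D1 * (N%:R * (H / rt R n1)) + D2 * (N%:R * (H4 / rt R m1)) + 4 / 3 * D3 * (N%:R * (H4 / rt R p)) by ring.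
  apply: lerD; first apply: lerD.
  - by apply: ler_wpM2l => //; apply: hH => //; apply: leq_ltn_trans hsn; rewrite leq_mul2l.
  - by apply: ler_wpM2l => //; apply: hH4 => //; apply: leq_ltn_trans hsm; rewrite leq_mul2l.
  - apply: ler_wpM2l; first by rewrite mulr_ge0.
    by apply: hH4 => //; apply: leq_ltn_trans hsn; rewrite leq_mul2l.
apply: le_trans (ler_wpM2l (ltW g0) sum_bound) _.
have r1 : rt R n / rt R n1 <= 2 by rewrite ler_pdivrMr ?rt_gt0 //; apply: (@rt_le_div R 2).
have r2 : rt R n / rt R m1 <= 2 * L%:R.
  rewrite ler_pdivrMr ?rt_gt0 //; apply: le_trans (_ : L%:R * rt R m <= _).
    apply: rt_leM; rewrite -(ler_nat R) natrM.
    apply: le_trans (_ : L%:R * m.+1%:R <= _); last first.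
      by rewrite -!natrM ler_nat leq_mul2r -mulnn leq_pmulr // orbT.
    rewrite -(ler_pM2l s0); apply: le_trans ms _.
    rewrite mulrA; apply: le_trans (_ : 1 * m.+1%:R <= _); first by rewrite mul1r ler_nat.
    by apply: ler_wpM2r.
  have -> : 2 * L%:R * rt R m1 = L%:R * (2 * rt R m1) by ring.
  by apply: ler_wpM2l => //; apply: (@rt_le_div R 2).
have r3 : rt R n / rt R p <= a%:R by rewrite ler_pdivrMr ?rt_gt0 //; apply: rt_le_div.
have -> : rt R n * (D1 * (H / rt R n1) + D2 * (H4 / rt R m1) + 4 / 3 * D3 * (H4 / rt R p)) =
  D1 * H * (rt R n / rt R n1) + D2 * H4 * (rt R n / rt R m1) + 4 / 3 * D3 * H4 * (rt R n / rt R p).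
  ring.
have t1 := ler_wpM2l (mulr_ge0 D10 H0) r1.
have t2 := ler_wpM2l (mulr_ge0 D20 H40) r2.
have D3' : 0 <= 4 / 3 * D3 * H4 by apply: mulr_ge0 H40; apply: mulr_ge0 D30; rewrite divr_ge0.
have t3 := ler_wpM2l D3' r3.
have t4 : D1 * H * 2 + D2 * H4 * (2 * L%:R) <= e / 2.
  have -> : D1 * H * 2 + D2 * H4 * (2 * L%:R) = B / a%:R.
    by rewrite /D1 /D2 /B; field; rewrite !gt_eqF.
  by rewrite ler_pdivrMr // mulrC; move: ha; rewrite ler_pdivrMr //; clear; lra.
have t5 : 4 / 3 * D3 * H4 * a%:R <= e / 2.
  have := h1 n nN1; rewrite subr0; apply: le_trans; apply: le_trans (ler_norm _).
  rewrite le_eqVlt; apply/orP; left; apply/eqP; rewrite /D3; field; by rewrite rt_neq0.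
apply: le_trans (lerD (lerD t1 t2) t3) _.
by rewrite [leRHS]splitr; exact: lerD t4 t5.
Qed.

Lemma local_limit b k : (fun n => rt R n * cbin R n) @ \oo --> (b : R) ->
  (fun n => rt R n * (A ^+ n)`_(c * n + k)) @ \oo --> b / Num.sqrt (2 * s).
Proof.
move=> hb; have s0 := walk_var_gt0 HA.
have h1 : (fun n => rt R n * ((A ^+ n)`_(c * n + k) - cbin R (matched n))) @ \oo --> (0 : R).
  apply: eps_cvg => e e0; have [N hN] := local_limit_compare k e0.
  by exists N => n /hN; rewrite subr0 normrM (gtr0_norm (rt_gt0 _ _)).
have h2 : (fun n => rt R (matched n) * cbin R (matched n)) @ \oo --> b.
  apply: eps_cvg => e e0; have [N hN] := cvg_eps hb e0.
  exists (Num.bound ((N.+1%:R) / (2 * s))) => n hn; apply: hN.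
  have q : 0 <= N.+1%:R / (2 * s) by rewrite divr_ge0 // mulr_ge0 // ltW.
  have : N.+1%:R / (2 * s) < n%:R.
    by apply: lt_le_trans (archi_boundP q) _; rewrite ler_nat.
  rewrite ltr_pdivrMr ?mulr_gt0 // mulrC => h.
  case/andP: (matched_itv n) => _ h3; have := lt_trans h h3.
  by rewrite natr1 ltr_nat ltnS => /ltnW.
have h3 : (fun n => (matched n).+1%:R / n.+1%:R) @ \oo --> 2 * s.
  apply: eps_cvg => e e0.
  have h : (fun n => (1 + 2 * s) * (n.+1%:R : R)^-1) @ \oo --> (1 + 2 * s) * 0.
    by apply: seqZ; apply: cvg_harmonic.
  rewrite mulr0 in h; have [N hN] := cvg_eps h e0.
  exists N => n /hN; rewrite subr0; apply: le_trans; apply: le_trans (ler_norm _).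
  have n0 : 0 < n.+1%:R :> R by rewrite ltr0n.
  have -> : (matched n).+1%:R / n.+1%:R - 2 * s = ((matched n).+1%:R - 2 * s * n.+1%:R) / n.+1%:R.
    by rewrite mulrBl mulfK // gt_eqF.
  rewrite normrM [X in _ * X]ger0_norm ?invr_ge0 // ler_pM2r ?invr_gt0 //.
  case/andP: (matched_itv n) => i1 i2.
  rewrite -!natr1 ler_norml mulrDr mulr1; apply/andP; split; lra.
have h4 : (fun n => (rt R n / rt R (matched n))) @ \oo --> (Num.sqrt (2 * s))^-1.
  have h5 : (fun n => Num.sqrt ((matched n).+1%:R / n.+1%:R)) @ \oo --> Num.sqrt (2 * s).
    by apply: (continuous_cvg _ (@sqrt_continuous R (2 * s)) h3).
  have sq0 : Num.sqrt (2 * s) != 0 by rewrite gt_eqF // sqrtr_gt0 mulr_gt0.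
  apply: cvg_ext (seqV sq0 h5) => n.
  by rewrite sqrtrM // sqrtrV // invfM invrK mulrC.
have := seqD h1 (seqM h4 h2); rewrite add0r mulrC => h'; apply: (cvg_ext _ h') => n.
by rewrite mulrA mulfVK ?rt_neq0 // mulrBr subrK.
Qed.

End LocalLimitTheoremProof.

(** * Spitzer's identity and meander asymptotics *)

Section FormalInverse.
Variable R : comNzRingType.

(** The recursion of [Dseq] over any commutative ring, so that it also inverts M(z,u) over
    polynomials in u. *)
Fixpoint renew_seq (f : nat -> R) (n : nat) : seq R :=
  match n with
  | 0 => [:: 1]
  | n'.+1 => rcons (renew_seq f n')
               (\sum_(k < n'.+1) f k.+1 * nth 0 (renew_seq f n') (n' - k))
  end.

Definition renew f n : R := nth 0 (renew_seq f n) n.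

Lemma size_renew_seq f n : size (renew_seq f n) = n.+1.
Proof. by elim: n => // n IH; rewrite /= size_rcons IH. Qed.

Lemma nth_renew_seq f n i : (i <= n)%N -> nth 0 (renew_seq f n) i = renew f i.
Proof.
elim: n => [|n IH]; first by rewrite leqn0 => /eqP ->.
rewrite leq_eqVlt => /orP[/eqP -> //|]; rewrite ltnS => h.
by rewrite /= nth_rcons size_renew_seq ltnS h IH.
Qed.

Lemma renew_eq f n : f 0%N = 0 -> renew f n = delta0 R n + conv f (renew f) n.
Proof.
move=> f0; rewrite conv_recl //; case: n => [|n]; first by rewrite big_ord0 addr0.
rewrite /delta0 add0r /renew /= nth_rcons size_renew_seq ltnn eqxx.
apply: eq_bigr => i _; rewrite nth_renew_seq ?leq_subr //.
Qed.

End FormalInverse.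

Section Spitzer.
Variable R : idomainType.
Variables (A : {poly R}) (c : nat).

(* [z^n u^k] M(z, u) is the k-th coefficient of meander n; A is u^c P(u). *)
Fixpoint meander (n : nat) : {poly R} :=
  if n is m.+1 then drop_poly c (A * meander m) else 1.

(** The part of P^n with nonnegative powers of u. The value 0 at n = 0 leaves the series without
    constant term, as the logarithmic derivative of M requires. *)
Definition posW (n : nat) : {poly R} :=
  if n is 0 then 0 else drop_poly (c * n) (A ^+ n).

Lemma take_drop_eq (p : {poly R}) n : p = take_poly n p + drop_poly n p * 'X^n.
Proof. by rewrite poly_take_drop. Qed.

Lemma drop_small (p q : {poly R}) n : (size (p * 'X^n + q)%R <= n)%N -> (size q <= n)%N -> p = 0.
Proof.
move=> h hq; have h2 : (size (p * 'X^n)%R <= n)%N.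
  have -> : p * 'X^n = (p * 'X^n + q) - q by rewrite addrK.
  apply: leq_trans (size_polyD _ _) _; rewrite size_polyN geq_max; exact/andP.
apply/eqP; apply/negPn/negP => p0; move: h2.
by rewrite size_mulXn // -{2}[n]addn0 leq_add2l leqn0 size_poly_eq0 (negbTE p0).
Qed.

(** Multiplying the coefficient of z^n by u^(c n) clears the negative powers of u. In this scaling
    [kk] is 1 - zP, [W] the sum of the (zP)^n with n >= 1, [Xm] its negative part and [XX] its
    nonnegative part. *)
Let AA n : {poly R} := meander n * 'X^(c * n).
Let p1 (n : nat) : {poly R} := if n == 1%N then A else 0.
Let kk n : {poly R} := delta0 {poly R} n - p1 n.
Let W (n : nat) : {poly R} := if n is 0 then 0 else A ^+ n.
Let Xm n : {poly R} := take_poly (c * n) (W n).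
Let XX n : {poly R} := posW n * 'X^(c * n).

Lemma conv_p1 (f : nat -> {poly R}) n : conv p1 f n = if n is m.+1 then A * f m else 0.
Proof.
rewrite conv_recl //; case: n => [|n]; first by rewrite big_ord0.
by rewrite big_ord_recl /= subSS subn0 big1 ?addr0 // => i _; rewrite mul0r.
Qed.

Lemma conv_kk f n : conv kk f n = f n - (if n is m.+1 then A * f m else 0).
Proof. by rewrite -conv_p1 /kk (convDl (delta0 _) (fun n => - p1 n)) conv1l (convC (fun n => - p1 n)) convNr convC. Qed.

Lemma W_split n : W n = Xm n + XX n.
Proof. by rewrite /Xm /XX; case: n => [|n]; [rewrite /= take_poly0r mul0r addr0|apply: take_drop_eq]. Qed.

Lemma size_Nh n : (size (conv kk AA n) <= c * n + (n == 0))%N.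
Proof.
rewrite conv_kk; case: n => [|n]; first by rewrite /AA /= muln0 expr0 mulr1 subr0 size_poly1.
have -> : AA n.+1 - A * AA n = - (take_poly c (A * meander n) * 'X^(c * n)).
  rewrite /AA /= mulnS exprD mulrA [in X in _ - X]mulrA [A * meander n in X in _ - X](take_drop_eq _ c).
  by ring.
rewrite size_polyN addn0; apply: leq_trans (size_polyMleq _ _) _.
rewrite size_polyXn addnS /= mulnS leq_add2r; exact: size_take_poly.
Qed.

Lemma conv_kkW n : conv kk W n = p1 n.
Proof.
rewrite conv_kk /p1; case: n => [|[|n]] /=; first by rewrite subr0.
  by rewrite expr1 mulr0 subr0.
by rewrite -exprS subrr.
Qed.

(* theta M = M (sum_n z^n [P^n]_{>= 0}): multiplied by 1 - zP, the difference
   of the two sides has only negative powers of u, hence vanishes. *)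
Lemma spitzer n : theta meander n = conv posW meander n.
Proof.
pose Z n := theta AA n - conv AA XX n.
have ZE m : Z m = (theta meander m - conv posW meander m) * 'X^(c * m).
  rewrite /Z mulrBl; congr (_ - _); first by rewrite /theta /AA mulrA.
  rewrite convC /conv mulr_suml; apply: eq_bigr => i _.
  have im : (i <= m)%N by rewrite -ltnS.
  rewrite /XX /AA; have -> : (c * m = c * i + c * (m - i))%N by rewrite -mulnDr subnKC.
  by rewrite exprD; ring.
have kZ m : conv kk Z m = theta (conv kk AA) m + conv (conv kk AA) Xm m.
  have tk j : theta kk j = - p1 j.
    rewrite /theta /kk /delta0 /p1; case: j => [|[|j]] /=; rewrite ?mul0r ?subr0 ?mulr0 ?oppr0 //.
    by rewrite mul1r sub0r.
  have e1 : conv kk (theta AA) m = theta (conv kk AA) m + conv p1 AA m.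
    rewrite theta_conv; have -> : theta kk = (fun j => - p1 j) by apply/funext.
    by rewrite (convC _ AA) convNr (convC AA) addrAC addNr add0r.
  have hX : XX = (fun j => W j + - Xm j) by apply/funext => j; rewrite W_split addrC addKr.
  have e2 : conv kk (conv AA XX) m = conv p1 AA m - conv (conv kk AA) Xm m.
    rewrite convA hX (convDr W (fun j => - Xm j)) convNr; congr (_ - _).
    rewrite (convC kk) -convA; have -> : conv kk W = p1 by apply/funext => j; apply: conv_kkW.
    by rewrite convC.
  by rewrite /Z (convDr (theta AA) (fun j => - conv AA XX j)) convNr e1 e2; ring.
(* Degree below c m means strictly negative powers of u before the scaling. *)
have sZ m : (size (conv kk Z m) <= c * m)%N.
  rewrite kZ; apply: leq_trans (size_polyD _ _) _; rewrite geq_max; apply/andP; split.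
    rewrite /theta; case: m => [|m]; first by rewrite mul0r size_poly0.
    rewrite mulr_natl -scaler_nat; apply: leq_trans (size_scale_leq _ _) _.
    by apply: leq_trans (size_Nh _) _; rewrite addn0.
  apply: leq_trans (size_sum _ _ _) _; apply/bigmax_leqP => i _.
  have im : (i <= m)%N by rewrite -ltnS.
  have [->|nz] := eqVneq (Xm (m - i)%N) 0; first by rewrite mulr0 size_poly0.
  apply: leq_trans (size_polyMleq _ _) _.
  have h1 := size_Nh i; have h2 : (size (Xm (m - i)) <= c * (m - i))%N by apply: size_take_poly.
  have h3 : (0 < size (Xm (m - i)))%N by rewrite lt0n size_poly_eq0.
  have -> : (c * m = c * i + c * (m - i))%N by rewrite -mulnDr subnKC.
  move: h1 h2 h3; case: (_ == 0%N); move: (c * i)%N (c * (m - i))%N (size _) (size _); clear; lia.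
(* Since [kk] has degree 1 in z, once Z vanishes at m its value at m + 1 is the product with [kk]: a
   multiple of u^(c(m+1)) of smaller degree, hence zero. *)
have D0 m : theta meander m - conv posW meander m = 0.
  elim: m => [|m IH].
    by rewrite /theta mul0r conv0 /posW mul0r subr0.
  have := sZ m.+1; rewrite conv_kk (ZE m) IH mul0r mulr0 subr0 ZE => h.
  by apply: (@drop_small _ 0 (c * m.+1)); rewrite ?addr0 ?size_poly0.
by apply/eqP; rewrite -subr_eq0 D0.
Qed.

Definition imeander : nat -> {poly R} := renew (fun n => delta0 _ n - meander n).

Lemma conv_imeander : conv meander imeander = delta0 {poly R}.
Proof.
apply/funext => n.
have f0 : delta0 {poly R} 0 - meander 0 = 0 by rewrite /delta0 subrr.
have := @renew_eq _ (fun n => delta0 {poly R} n - meander n) n f0; rewrite -/imeander (convDl (delta0 _) (fun n => - meander n)) conv1l.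
rewrite (convC (fun n => - meander n)) convNr (convC imeander) addrCA => /eqP.
by rewrite eq_sym -subr_eq0 addrAC subrr add0r subr_eq0 => /eqP ->.
Qed.

(** The logarithmic derivative of 1/M is the opposite of that of M. *)
Lemma theta_imeander n : theta imeander n = - conv posW imeander n.
Proof.
have hs : theta meander = conv posW meander by apply/funext => k; apply: spitzer.
have h k : conv meander (theta imeander) k = - posW k.
  have := theta_conv meander imeander k.
  rewrite conv_imeander hs -convA conv_imeander conv1r.
  have -> : theta (delta0 {poly R}) k = 0 by rewrite /theta /delta0; case: k => [|k]; rewrite ?mul0r ?mulr0.
  by move/esym/eqP; rewrite addr_eq0 => /eqP e; rewrite e opprK.
rewrite -[theta imeander]conv1l -conv_imeander (convC meander) -convA.
have -> : conv meander (theta imeander) = (fun k => - posW k) by apply/funext.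
by rewrite convNr (convC imeander).
Qed.

End Spitzer.

(** * The n^(-3/2) asymptotics of meanders *)

Section MeanderAsymptotics.
Variable R : realType.

Lemma horner_ge0 (p : {poly R}) x : (forall j, 0 <= p`_j) -> 0 <= x -> 0 <= p.[x].
Proof. by move=> h x0; rewrite horner_coef; apply: sumr_ge0 => i _; rewrite mulr_ge0 // exprn_ge0. Qed.

Lemma coef_le_horner (p : {poly R}) x k : (forall j, 0 <= p`_j) -> 0 <= x ->
  p`_k * x ^+ k <= p.[x].
Proof.
move=> h x0; case: (ltnP k (size p)) => hk; last by rewrite nth_default // mul0r horner_ge0.
rewrite horner_coef (bigD1 (Ordinal hk)) //= lerDl; apply: sumr_ge0 => i _.
by rewrite mulr_ge0 // exprn_ge0.
Qed.

Lemma horner_coef_trunc (p : {poly R}) x K : (forall j, 0 <= p`_j) -> 0 <= x ->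
  \sum_(k < K) p`_k * x ^+ k <= p.[x].
Proof.
move=> h x0; rewrite (@horner_coef_wide _ (K + size p)) ?leq_addl // big_split_ord /= lerDl.
by apply: sumr_ge0 => i _; rewrite mulr_ge0 // exprn_ge0.
Qed.

Lemma poly_mul_ge0 (p q : {poly R}) : (forall j, 0 <= p`_j) -> (forall j, 0 <= q`_j) ->
  forall j, 0 <= (p * q)`_j.
Proof. by move=> hp hq j; rewrite coefM; apply: sumr_ge0 => i _; rewrite mulr_ge0. Qed.

Lemma poly_exp_ge0 (p : {poly R}) n : (forall j, 0 <= p`_j) -> forall j, 0 <= (p ^+ n)`_j.
Proof.
move=> hp; elim: n => [|n IH] j; first by rewrite expr0 coef1 ler0n.
by rewrite exprS; apply: poly_mul_ge0.
Qed.

Variables (A : {poly R}) (c : nat).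
Hypothesis A_ge0 : forall j, 0 <= A`_j.

Lemma meander_ge0 n j : 0 <= (meander A c n)`_j.
Proof.
elim: n j => [|n IH] j /=; first by rewrite coef1 ler0n.
by rewrite coef_drop_poly; apply: poly_mul_ge0.
Qed.

Lemma posW_ge0 n j : 0 <= (posW A c n)`_j.
Proof.
by case: n => [|n] /=; rewrite ?coef0 // coef_drop_poly; apply: poly_exp_ge0.
Qed.

Lemma posWE n k : (0 < n)%N -> (posW A c n)`_k = (A ^+ n)`_(c * n + k).
Proof. by case: n => // n _; rewrite /= coef_drop_poly addnC. Qed.

Lemma horner_conv (f g : nat -> {poly R}) x y n :
  x ^+ n * (conv f g n).[y] = conv (fun n => x ^+ n * (f n).[y]) (fun n => x ^+ n * (g n).[y]) n.
Proof.
rewrite /conv horner_sum mulr_sumr; apply: eq_bigr => i _; rewrite hornerM.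
have im : (i <= n)%N by rewrite -ltnS.
have -> : x ^+ n = x ^+ i * x ^+ (n - i) by rewrite -exprD subnKC.
by ring.
Qed.

Lemma theta_meander_eval x y n : theta (fun n => x ^+ n * (meander A c n).[y]) n =
  conv (fun n => x ^+ n * (posW A c n).[y]) (fun n => x ^+ n * (meander A c n).[y]) n.
Proof.
rewrite -horner_conv -spitzer /theta [in RHS]mulr_natl hornerMn -[in RHS]mulr_natl.
by ring.
Qed.

Lemma theta_meander_coef x k n : theta (fun n => x ^+ n * (meander A c n)`_k) n =
  \sum_(i < k.+1) conv (fun n => x ^+ n * (posW A c n)`_i)
     (fun n => x ^+ n * (meander A c n)`_(k - i)) n.
Proof.
have h : n%:R * (meander A c n)`_k = \sum_(j < n.+1) \sum_(i < k.+1) (posW A c j)`_i * (meander A c (n - j))`_(k - i).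
  have := congr1 (fun p : {poly R} => p`_k) (spitzer A c n).
  rewrite /theta mulr_natl coefMn => hh; rewrite mulr_natl hh.
  by rewrite /conv coef_sum; apply: eq_bigr => j _; rewrite coefM.
rewrite /theta mulrCA h exchange_big /= mulr_sumr; apply: eq_bigr => i _.
rewrite /conv mulr_sumr; apply: eq_bigr => j _.
have jn : (j <= n)%N by rewrite -ltnS.
have -> : x ^+ n = x ^+ j * x ^+ (n - j) by rewrite -exprD subnKC.
by ring.
Qed.

(* Bootstrapping n x_n <= sum_j K j^(-1/2) x_(n-j) with x summable. *)
Lemma sqrt_recursion_bound (x V : nat -> R) K S : 0 <= K -> (forall n, 0 <= x n) ->
  V 0%N = 0 -> (forall n, `|V n| <= K / rt R n) -> sums_to x S ->
  (forall n, theta x n = conv V x n) ->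
  exists B, forall n, 0 <= x n <= B / rt R n ^+ 3.
Proof.
move=> K0 x0 V0 hV hS hx.
have S0 : 0 <= S by apply: sums_ge0 hS.
have k128 : 0 <= (128 * K) ^+ 2 by rewrite exprn_ge0 // mulr_ge0.
pose N0 := Num.bound ((128 * K) ^+ 2).
have hN0 n : (N0 <= n)%N -> 128 * K <= rt R n.
  move=> h; rewrite -(@ler_pXn2r _ 2) ?nnegrE ?rt_ge0 ?mulr_ge0 // rt_sqr.
  apply: ltW; apply: lt_le_trans (archi_boundP k128) _; rewrite ler_nat; exact: leqW.
(* The inductive step yields 4 K S + 64 K B / sqrt(n+1). This is at most B/2 + B/2, by 8 K S <= B
   and, beyond N0, 128 K <= sqrt(n+1). The finite sum settles the indices up to N0. *)
pose B := 8 * K * S + \sum_(i < N0.+1) rt R i ^+ 3 * x i.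
have r3 n : 0 < rt R n ^+ 3 by rewrite exprn_gt0 // rt_gt0.
have B0 : 0 <= B.
  by rewrite addr_ge0 ?mulr_ge0 // sumr_ge0 // => i _; rewrite mulr_ge0 // ltW.
exists B => n; rewrite x0 /= ler_pdivlMr // mulrC.
elim/ltn_ind: n => n IH.
case: (leqP n N0) => hn.
  rewrite /B; apply: ler_wpDl; first by rewrite !mulr_ge0.
  have hn' : (n < N0.+1)%N by [].
  rewrite (bigD1 (Ordinal hn')) //= lerDl; apply: sumr_ge0 => i _.
  by rewrite mulr_ge0 // ltW.
have n0 : (0 < n)%N by apply: leq_ltn_trans hn.
have rn := rt_gt0 R n.
have hth : theta x n <= 2 * K * S / rt R n + 32 * K * B / rt R n ^+ 2.
  rewrite hx /conv.
  apply: le_trans (_ : \sum_(j < n.+1) (2 * K / rt R n * x (n - j)%N + 8 * K * B / rt R n ^+ 3 * (rt R j)^-1) <= _).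
    apply: ler_sum => j _.
    case: (posnP j) => [->|j0].
      by rewrite V0 mul0r; apply: addr_ge0; rewrite ?mulr_ge0 ?invr_ge0 ?rt_ge0 // ?exprn_ge0 // rt_ge0.
    apply: le_trans (_ : K / rt R j * x (n - j)%N <= _).
      by apply: ler_wpM2r => //; apply: le_trans (ler_norm _) (hV j).
    have rj := rt_gt0 R j.
    case: (leqP n (2 * j)%N) => hj.
      apply: ler_wpDr; first by rewrite !mulr_ge0 ?invr_ge0 ?exprn_ge0 ?rt_ge0.
      apply: ler_wpM2r => //; rewrite (mulrC 2) -mulrA; apply: ler_wpM2l => //.
      rewrite -[leLHS]mul1r ler_pdivrMr // mulrAC ler_pdivlMr // mul1r.
      by apply: rt_leM; lia.
    apply: ler_wpDl; first by rewrite !mulr_ge0 ?invr_ge0 ?rt_ge0.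
    have hnj := IH (n - j)%N ltac:(lia).
    have h2 : rt R n <= 2%:R * rt R (n - j) by apply: rt_leM; lia.
    have h3 : rt R n ^+ 3 <= 8 * rt R (n - j) ^+ 3.
      have -> : 8 * rt R (n - j) ^+ 3 = (2%:R * rt R (n - j)) ^+ 3 by ring.
      by apply: lerXn2r h2; rewrite nnegrE ?mulr_ge0 ?rt_ge0.
    have h4 : rt R n ^+ 3 * x (n - j)%N <= 8 * B.
      apply: le_trans (ler_wpM2r (x0 _) h3) _; rewrite -mulrA; exact: ler_wpM2l.
    have h5 : x (n - j)%N <= 8 * B / rt R n ^+ 3 by rewrite ler_pdivlMr // mulrC.
    apply: le_trans (ler_wpM2l _ h5) _; first by rewrite divr_ge0 // ltW.
    by rewrite le_eqVlt; apply/orP; left; apply/eqP; field; rewrite !rt_neq0.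
  rewrite big_split /= -!mulr_sumr; apply: lerD.
    rewrite [leRHS]mulrAC; apply: ler_wpM2l; first by rewrite !mulr_ge0 // invr_ge0 ltW.
    rewrite (reindex_inj rev_ord_inj) /=.
    under eq_bigr => i _ do rewrite subSS subKn -1?ltnS //.
    exact: sums_ge.
  have hs : \sum_(i < n.+1) (rt R i)^-1 <= 4 * rt R n.
    apply: le_trans (sum_rtV R _) _.
    have : rt R n.+1 <= 2%:R * rt R n by apply: rt_leM; lia.
    lra.
  have b0 : 0 <= 8 * K * B / rt R n ^+ 3 by rewrite divr_ge0 ?mulr_ge0 // ltW.
  apply: le_trans (ler_wpM2l b0 hs) _.
  by rewrite le_eqVlt; apply/orP; left; apply/eqP; field; rewrite rt_neq0.
have nr0 : 0 < n%:R :> R by rewrite ltr0n.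
have e : rt R n ^+ 3 * x n = (n.+1%:R / n%:R) * (rt R n * theta x n).
  by rewrite /theta exprSr rt_sqr; field; rewrite gt_eqF.
have th0 : 0 <= theta x n by rewrite mulr_ge0.
have h2 : n.+1%:R / n%:R <= 2 :> R by rewrite ler_pdivrMr // -natrM ler_nat; lia.
rewrite e; apply: le_trans (ler_wpM2r _ h2) _; first by rewrite mulr_ge0 // ltW.
apply: le_trans (ler_wpM2l _ (ler_wpM2l (ltW rn) hth)) _ => //.
have -> : 2 * (rt R n * (2 * K * S / rt R n + 32 * K * B / rt R n ^+ 2)) = 4 * K * S + 64 * (K * B / rt R n).
  by field; rewrite rt_neq0.
have h128 := hN0 n (ltnW hn).
have h5 : 128 * (K * B / rt R n) <= B.
  rewrite mulrA ler_pdivrMr // mulrA mulrC; exact: ler_wpM2l.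
have h6 : 8 * K * S <= B by rewrite /B lerDl sumr_ge0 // => i _; rewrite mulr_ge0 // ltW.
lra.
Qed.

Variables (rho tau k0 H : R).
Hypothesis rho_gt0 : 0 < rho.
Hypothesis tau_gt1 : 1 < tau.
Hypothesis W_bound : forall n k, `|rho ^+ n * tau ^+ k * (A ^+ n)`_(c * n + k)| <= H / rt R n.
Hypothesis W_limit : forall k,
  (fun n => rt R n * (rho ^+ n * tau ^+ k * (A ^+ n)`_(c * n + k))) @ \oo --> k0.

Let tau_gt0 : 0 < tau. Proof. by apply: lt_trans tau_gt1. Qed.

Lemma H_ge0 : 0 <= H.
Proof.
have := W_bound 0 0; rewrite /rt sqrtr1 divr1; exact: le_trans.
Qed.

Lemma posW_coef_limit k : (fun n => rt R n * (rho ^+ n * (posW A c n)`_k)) @ \oo --> k0 * tau ^- k.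
Proof.
have := seqZ (a := tau ^- k) (W_limit k); rewrite mulrC => h.
apply: (@cvg_eventually_eq _ _ _ _ 1%N _ h) => n n0; rewrite posWE //.
by field; rewrite expf_neq0 // gt_eqF.
Qed.

Lemma posW_coef_bound n k : `|rho ^+ n * (posW A c n)`_k| <= H * (tau ^-1) ^+ k / rt R n.
Proof.
have t0 : 0 < tau ^+ k by rewrite exprn_gt0.
case: (posnP n) => [->|n0].
  rewrite /= coef0 mulr0 normr0 divr_ge0 ?rt_ge0 // mulr_ge0 ?H_ge0 //.
  by rewrite exprn_ge0 // invr_ge0 ltW.
have := W_bound n k; rewrite posWE // exprVn => h.
rewrite mulrAC ler_pdivlMr // mulrC -{1}(gtr0_norm t0) -normrM.
by rewrite mulrA (mulrC (tau ^+ k)).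
Qed.

Lemma tauV_lt1 : 0 <= tau^-1 < 1.
Proof. by rewrite invr_ge0 ltW //= invf_lt1. Qed.

(** Undoing the tilt weighs altitude k by tau^(-k), so tau > 1 makes the uniform local bound
    summable in k and the limit is a geometric series. *)
Lemma posW_total_limit :
  (fun n => rt R n * (rho ^+ n * (posW A c n).[1])) @ \oo --> k0 / (1 - tau^-1).
Proof.
have hg := sums_geometric tauV_lt1.
(* Enough terms to cover the degree, and at least n of them as [tannery] asks. *)
pose s n := (n + size (posW A c n))%N.
have := @tannery R (fun n k => rt R n * (rho ^+ n * (posW A c n)`_k)) (fun k => k0 * tau ^- k)
  (fun k => H * (tau^-1) ^+ k) (H / (1 - tau^-1)) (k0 / (1 - tau^-1)) s.
move=> h; apply: cvg_ext (h _ _ _ _ _).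
- move=> n; rewrite -!mulr_sumr (@horner_coef_wide _ (s n)) ?leq_addl //.
  by congr (_ * (_ * _)); apply: eq_bigr => i _; rewrite expr1n mulr1.
- exact: posW_coef_limit.
- move=> n k; rewrite normrM (gtr0_norm (rt_gt0 _ _)) mulrC -ler_pdivlMr ?rt_gt0 //.
  exact: posW_coef_bound.
- exact: sumsZ.
- by apply: cvg_ext (sumsZ (a := k0) hg) => n; apply: eq_bigr => i _; rewrite exprVn.
- by move=> n; apply: leq_addr.
Qed.

Variable S : R.
Hypothesis S_sum : sums_to (fun n => rho ^+ n * (meander A c n).[1]) S.

Let x n := rho ^+ n * (meander A c n).[1].

Lemma meander_total_ge0 n : 0 <= x n.
Proof. by rewrite mulr_ge0 ?exprn_ge0 ?(ltW rho_gt0) // horner_ge0 // => j; apply: meander_ge0. Qed.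

Lemma meander_total_bound : exists B, forall n, 0 <= x n <= B / rt R n ^+ 3.
Proof.
have [K K0 hK] := sqrt_decay_bound posW_total_limit.
apply: (sqrt_recursion_bound K0 meander_total_ge0 _ hK S_sum (theta_meander_eval rho 1)).
by rewrite /= horner0 mulr0.
Qed.

Lemma meander_total_decay3 : decay3 x (k0 / (1 - tau^-1) * S).
Proof.
have [B hB] := meander_total_bound.
apply: theta_decay3; apply: cvg_ext (conv_sqrt_limit posW_total_limit hB S_sum) => n.
by rewrite /x theta_meander_eval.
Qed.

Let xk k n := rho ^+ n * (meander A c n)`_k.

Lemma meander_coef_le k n : 0 <= xk k n <= x n.
Proof.
have r0 : 0 <= rho ^+ n by rewrite exprn_ge0 // ltW.
rewrite mulr_ge0 ?meander_ge0 //=; apply: ler_wpM2l => //.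
by have := coef_le_horner k (meander_ge0 n) ler01; rewrite expr1n mulr1.
Qed.

Lemma meander_coef_decay3 (s : nat -> R) k : (forall i, sums_to (xk i) (s i)) ->
  decay3 (xk k) (\sum_(i < k.+1) k0 * tau ^- i * s (k - i)%N).
Proof.
move=> hs; have [B hB] := meander_total_bound.
apply: theta_decay3.
have h : (fun n => \sum_(i < k.+1) rt R n * conv (fun n => rho ^+ n * (posW A c n)`_i) (xk (k - i)) n)
   @ \oo --> \sum_(i < k.+1) k0 * tau ^- i * s (k - i)%N.
  apply: (@cvg_ord_sum R (fun i n => rt R n * conv (fun n => rho ^+ n * (posW A c n)`_i) (xk (k - i)) n)
     (fun i => k0 * tau ^- i * s (k - i)%N)) => i _.
  apply: (@conv_sqrt_limit R (fun n => rho ^+ n * (posW A c n)`_i) (xk (k - i)) _ B _ (posW_coef_limit (k := i)) _ (hs (k - i)%N)) => n.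
  case/andP: (meander_coef_le (k - i) n) => -> h1; apply: le_trans h1 _.
  by case/andP: (hB n).
apply: cvg_ext h => n; rewrite /xk theta_meander_coef mulr_sumr; exact: eq_bigr.
Qed.

End MeanderAsymptotics.

(** * The kernel method *)

Section ComplexPolynomials.
Variable R : realType.
Implicit Types (p q : {poly R[i]}) (u a : R[i]).

Local Notation cr a := ((a : R)%:C)%C.
Local Notation pC := (map_poly (real_complex R)).

Lemma cnorm_horner_le p u (B : R) : cnorm u <= B ->
  cnorm p.[u] <= \sum_(i < size p) cnorm p`_i * B ^+ i.
Proof.
move=> hu; rewrite horner_coef; apply: le_trans (cnorm_sum _ _ _) _.
apply: ler_sum => i _; rewrite cnormM cnormX; apply: ler_wpM2l; first exact: cnorm_ge0.
by apply: lerXn2r; rewrite ?nnegrE ?cnorm_ge0 //; apply: le_trans (cnorm_ge0 _) hu.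
Qed.

Lemma cnorm_pC_horner (p : {poly R}) u : (forall j, 0 <= p`_j) ->
  cnorm (pC p).[u] <= p.[cnorm u].
Proof.
move=> p0; apply: le_trans (cnorm_horner_le _ (lexx _)) _.
rewrite size_map_poly horner_coef; apply: ler_sum => i _.
by rewrite coef_map cnorm_real ger0_norm.
Qed.

Lemma horner_lipschitz p a : exists2 L, 0 <= L & forall u, cnorm (u - a) <= 1 ->
  cnorm (p.[u] - p.[a]) <= L * cnorm (u - a).
Proof.
have [q e] := @poly_root_factor _ (p - (p.[a])%:P) a ltac:(by rewrite hornerD hornerN hornerC subrr).
exists (\sum_(i < size q) cnorm q`_i * (cnorm a + 1) ^+ i).
  apply: sumr_ge0 => i _; rewrite mulr_ge0 ?cnorm_ge0 // exprn_ge0 // addr_ge0 //.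
  exact: cnorm_ge0.
move=> u hu.
have -> : p.[u] - p.[a] = q.[u] * (u - a).
  have := congr1 (fun p => p.[u]) e.
  by rewrite hornerM hornerXsubC hornerD hornerN hornerC.
rewrite cnormM; apply: ler_wpM2r; first exact: cnorm_ge0.
apply: cnorm_horner_le; apply: le_trans (cnorm_le_dist u a) _; by rewrite lerD2l.
Qed.

Lemma dominated_at_point p q a (C r : R) : 0 <= C -> 0 < r ->
  (forall u, u != a -> cnorm (u - a) <= r -> cnorm p.[u] <= C * cnorm q.[u]) ->
  cnorm p.[a] <= C * cnorm q.[a].
Proof.
move=> C0 r0 h; apply/ler_addgt0Pr => e e0.
have [L1 L10 h1] := horner_lipschitz p a; have [L2 L20 h2] := horner_lipschitz q a.
pose D := L1 + C * L2 + 1.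
have D0 : 0 < D by rewrite ltr_wpDl // addr_ge0 // mulr_ge0.
pose t := Num.min (Num.min 1 r) (e / D).
have t0 : 0 < t by rewrite !lt_min ltr01 r0 divr_gt0.
have t1 : t <= 1 by rewrite !ge_min lexx.
have tr : t <= r by rewrite !ge_min lexx orbT.
have tD : t * D <= e by rewrite -ler_pdivlMr // !ge_min lexx orbT.
pose u := a + cr t.
have hu : cnorm (u - a) = t by rewrite /u addrC addKr cnorm_real gtr0_norm.
have ua : u != a.
  by apply/eqP => ua; move: hu; rewrite ua subrr cnorm0 => t00; move: t0; rewrite -t00 ltxx.
have h3 := h u ua ltac:(by rewrite hu).
have h4 := h1 u ltac:(by rewrite hu); have h5 := h2 u ltac:(by rewrite hu).
rewrite hu in h4 h5.
have h6 := cnorm_le_dist p.[a] p.[u]; have h7 := cnorm_le_dist q.[u] q.[a].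
rewrite (cnorm_distC p.[a]) in h6.
have h8 : C * cnorm q.[u] <= C * (cnorm q.[a] + L2 * t).
  by apply: ler_wpM2l => //; apply: le_trans h7 _; rewrite lerD2l.
move: tD; rewrite /D; lra.
Qed.

(** At a root of the product the domination forces p to vanish. Dividing both sides by X - a keeps
    it off a, and continuity restores it at a, so multiplicities are respected. *)
Lemma dominated_dvdp (r : seq R[i]) p (C tau : R) : 0 <= C ->
  (forall a, a \in r -> cnorm a < tau) ->
  (forall u, cnorm u <= tau -> cnorm p.[u] <= C * cnorm (\prod_(a <- r) ('X - a%:P)).[u]) ->
  \prod_(a <- r) ('X - a%:P) %| p.
Proof.
move=> C0; elim: r p => [|a r IH] p hr hp; first by rewrite big_nil dvd1p.
have ha : cnorm a < tau by apply: hr; rewrite mem_head.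
have pa : p.[a] = 0.
  apply: cnorm_eq0; apply/eqP; rewrite eq_le cnorm_ge0 andbT.
  by apply: le_trans (hp a (ltW ha)) _; rewrite big_cons hornerM hornerXsubC subrr mul0r cnorm0 mulr0.
have [q e] := poly_root_factor pa.
rewrite big_cons mulrC e dvdp_mul2r ?polyXsubC_eq0 //.
apply: IH => [b hb|u hu]; first by apply: hr; rewrite in_cons hb orbT.
have away w : w != a -> cnorm w <= tau -> cnorm q.[w] <= C * cnorm (\prod_(a <- r) ('X - a%:P)).[w].
  move=> wa hw; have := hp w hw.
  rewrite big_cons e !hornerM hornerXsubC !cnormM.
  have wa0 : 0 < cnorm (w - a).
    rewrite lt_neqAle cnorm_ge0 andbT eq_sym; apply/eqP => /cnorm_eq0/eqP.
    by rewrite subr_eq0 (negbTE wa).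
  by rewrite mulrCA mulrC ler_pM2l.
have [->|ua] := eqVneq u a; last exact: away.
apply: (@dominated_at_point _ _ _ C (tau - cnorm a)) => //; first by rewrite subr_gt0.
move=> w wa hw; apply: away => //.
by apply: le_trans (cnorm_le_dist w a) _; lra.
Qed.

Lemma conv_eq0 (F : idomainType) (f g : nat -> F) : f 0%N != 0 ->
  (forall n, conv f g n = 0) -> forall n, g n = 0.
Proof.
move=> f0 h; elim/ltn_ind => n IH.
have := h n; rewrite /conv big_ord_recl subn0 big1.
  by rewrite addr0 => /eqP; rewrite mulf_eq0 (negbTE f0) => /eqP.
by move=> i _; rewrite /= -[bump 0 i]/(i.+1) IH ?mulr0 //; have := ltn_ord i; lia.
Qed.

End ComplexPolynomials.

Section Kernel.
Variable R : realType.
Implicit Types (u : R[i]).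

Local Notation cr a := ((a : R)%:C)%C.
Local Notation pC := (map_poly (real_complex R)).

Variables (A : {poly R}) (c : nat).
Hypothesis A_ge0 : forall j, 0 <= A`_j.

Let Mn := meander A c.
(** The steps that would end below altitude 0, subtracted in the kernel equation. *)
Definition lowpart n : {poly R} := take_poly c (A * Mn n).

Lemma meander_step n : A * Mn n = lowpart n + 'X^c * Mn n.+1.
Proof. by rewrite /lowpart /Mn /= {1}(take_drop_eq (A * meander A c n) c) (mulrC 'X^c). Qed.

Definition kernel z : {poly R} := 'X^c - z *: A.

(** The kernel equation stopped at z^N; the sum telescopes through [meander_step] and leaves the
    remainder z^N u^c M_N. *)
Lemma kernel_partial z N : kernel z * (\sum_(n < N) z ^+ n *: Mn n) =
  'X^c - z *: (\sum_(n < N) z ^+ n *: lowpart n) - z ^+ N *: ('X^c * Mn N).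
Proof.
elim: N => [|N IH]; first by rewrite !big_ord0 scaler0 mulr0 subr0 expr0 scale1r mulr1 subrr.
have e : lowpart N = A * Mn N - 'X^c * Mn N.+1 by rewrite meander_step addrK.
have rec (F : nat -> {poly R}) : \sum_(n < N.+1) F n = \sum_(n < N) F n + F N.
  by rewrite big_ord_recr.
rewrite (rec (fun n => z ^+ n *: Mn n)) (rec (fun n => z ^+ n *: lowpart n)) mulrDr IH e.
move: (Mn N) (Mn N.+1) (\sum_(n < N) z ^+ n *: lowpart n) => m0 m1 S0.
by rewrite /kernel -!mul_polyC exprS polyCM; ring.
Qed.

Lemma lowpart_ge0 n j : 0 <= (lowpart n)`_j.
Proof.
rewrite coef_take_poly; case: ifP => // _; apply: poly_mul_ge0 => // i; exact: meander_ge0.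
Qed.

Variables (z tau : R).
Hypothesis z_gt0 : 0 < z.
Hypothesis tau_gt0 : 0 < tau.
Hypothesis subcritical : z * A.[tau] < tau ^+ c.

Let theta0 := z * A.[tau] / tau ^+ c.

Let tc_gt0 : 0 < tau ^+ c. Proof. by rewrite exprn_gt0. Qed.

Lemma theta0_itv : 0 <= theta0 < 1.
Proof.
apply/andP; split; last by rewrite ltr_pdivrMr // mul1r.
by rewrite divr_ge0 ?(ltW tc_gt0) // mulr_ge0 ?(ltW z_gt0) // horner_ge0 // ltW.
Qed.

Lemma meander_tau_le n : z ^+ n * (Mn n).[tau] <= theta0 ^+ n.
Proof.
elim: n => [|n IH]; first by rewrite !expr0 hornerC mulr1.
have h : tau ^+ c * (Mn n.+1).[tau] <= A.[tau] * (Mn n).[tau].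
  rewrite -!hornerM meander_step hornerD !hornerM hornerXn lerDr.
  by apply: horner_ge0 (ltW tau_gt0) => j; apply: lowpart_ge0.
have A0 : 0 <= A.[tau] by apply: horner_ge0 (ltW tau_gt0).
rewrite exprS -(ler_pM2l tc_gt0).
apply: le_trans (_ : z * A.[tau] * (z ^+ n * (Mn n).[tau]) <= _).
  have -> : tau ^+ c * (z * z ^+ n * (Mn n.+1).[tau]) = z * z ^+ n * (tau ^+ c * (Mn n.+1).[tau]) by ring.
  have -> : z * A.[tau] * (z ^+ n * (Mn n).[tau]) = z * z ^+ n * (A.[tau] * (Mn n).[tau]) by ring.
  by apply: ler_wpM2l => //; rewrite mulr_ge0 ?exprn_ge0 // ltW.
apply: le_trans (ler_wpM2l _ IH) _; first by rewrite mulr_ge0 // ltW.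
by rewrite exprS mulrA {2}/theta0 mulrCA mulfV ?gt_eqF // mulr1.
Qed.

Let at_ n := z ^+ n * (Mn n).[tau].

Lemma at_ge0 n : 0 <= at_ n.
Proof.
rewrite mulr_ge0 ?exprn_ge0 ?(ltW z_gt0) //; apply: horner_ge0 (ltW tau_gt0) => j.
exact: meander_ge0.
Qed.

Lemma at_sums : exists2 S, sums_to at_ S & 1 <= S.
Proof.
have [||S hS _] := @sums_comp R at_ (fun n => theta0 ^+ n) (1 - theta0)^-1.
- by move=> n; rewrite at_ge0 meander_tau_le.
- exact: sums_geometric theta0_itv.
exists S => //; have := sums_ge 1 at_ge0 hS.
by rewrite big_ord1 /at_ expr0 mul1r hornerC.
Qed.

Lemma at_cvg0 : at_ @ \oo --> (0 : R).
Proof.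
case/andP: theta0_itv => t0 t1.
apply: (@cvg_squeeze0 _ _ (fun n => theta0 ^+ n)).
  by move=> n; rewrite ger0_norm ?at_ge0 // meander_tau_le.
by apply: cvg_expr; rewrite ger0_norm.
Qed.

Variable s : nat -> R.
Hypothesis s_sums : forall k, sums_to (fun n => z ^+ n * (Mn n)`_k) (s k).

Arguments s_sums : clear implicits.

Lemma s_ge0 k : 0 <= s k.
Proof.
by apply: (sums_ge0 _ (s_sums k)) => n; rewrite mulr_ge0 ?exprn_ge0 ?(ltW z_gt0) // meander_ge0.
Qed.

Lemma s0_ge1 : 1 <= s 0%N.
Proof.
have h n : 0 <= z ^+ n * (Mn n)`_0 by rewrite mulr_ge0 ?exprn_ge0 ?(ltW z_gt0) // meander_ge0.
by have := sums_ge 1 h (s_sums 0); rewrite big_ord1 expr0 mul1r coef1.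
Qed.

(** The limit of the truncated low parts. A step goes down by at most c, so only the series [s k]
    with k < c occur. *)
Definition lowlim : {poly R} := take_poly c (A * \poly_(k < c) s k).
Definition numer : {poly R} := 'X^c - z *: lowlim.

Lemma lowlim_coef j : (fun N => (\sum_(n < N) z ^+ n *: lowpart n)`_j) @ \oo --> lowlim`_j.
Proof.
rewrite coef_take_poly; case: ifP => hj; last first.
  apply: cvg_ext (cvg_cst 0) => N; rewrite coef_sum big1 // => i _.
  by rewrite coefZ coef_take_poly hj mulr0.
rewrite coefM.
have h : (fun N => \sum_(i < j.+1) A`_i * \sum_(n < N) z ^+ n * (Mn n)`_(j - i)) @ \oo -->
   \sum_(i < j.+1) A`_i * (\poly_(k < c) s k)`_(j - i).
  apply: (@cvg_ord_sum R (fun i N => A`_i * \sum_(n < N) z ^+ n * (Mn n)`_(j - i))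
    (fun i => A`_i * (\poly_(k < c) s k)`_(j - i))) => i _.
  rewrite coef_poly (leq_ltn_trans (leq_subr _ _) hj); apply: seqZ; exact: s_sums.
apply: cvg_ext h => N.
rewrite coef_sum (eq_bigr (fun i : 'I_j.+1 => \sum_(n < N) A`_i * (z ^+ n * (Mn n)`_(j - i)))); last first.
  by move=> i _; rewrite mulr_sumr.
rewrite exchange_big /=; apply: eq_bigr => n _.
rewrite coefZ coef_take_poly hj coefM mulr_sumr; apply: eq_bigr => i _; ring.
Qed.

Lemma lowlim_ge0 j : 0 <= lowlim`_j.
Proof.
rewrite coef_take_poly; case: ifP => // _; apply: poly_mul_ge0 => // k.
by rewrite coef_poly; case: ifP => // _; apply: s_ge0.
Qed.

Lemma size_lowlim : (size lowlim <= c)%N.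
Proof. exact: size_take_poly. Qed.

Lemma coef_partial_small k : (fun N => (z ^+ N *: ('X^c * Mn N))`_k) @ \oo --> (0 : R).
Proof.
have h : (fun N => z ^+ N * (Mn N)`_(k - c)) @ \oo --> (0 : R).
  have := seqB (cvg_reindex (s := fun n => n.+1) (fun n => leqnSn n) (s_sums (k - c))) (s_sums (k - c)).
  rewrite subrr => h; apply: (cvg_ext _ h) => n /=.
  by rewrite big_ord_recr /=; ring.
apply: cvg_squeeze0 (_ : (fun N => `|z ^+ N * (Mn N)`_(k - c)|) @ \oo --> (0 : R)).
  move=> N; rewrite coefZ coefXnM; case: ifP => _ //; by rewrite mulr0 normr0.
by rewrite -[X in _ --> X](@normr0 R R); apply: (cvg_norm h).
Qed.

Lemma kernel_series k : conv (fun i => (kernel z)`_i) s k = numer`_k.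
Proof.
have h1 : (fun N => (kernel z * (\sum_(n < N) z ^+ n *: Mn n))`_k) @ \oo -->
   conv (fun i => (kernel z)`_i) s k.
  have h : (fun N => \sum_(i < k.+1) (kernel z)`_i * \sum_(n < N) z ^+ n * (Mn n)`_(k - i)) @ \oo -->
     \sum_(i < k.+1) (kernel z)`_i * s (k - i)%N.
    apply: (@cvg_ord_sum R (fun i N => (kernel z)`_i * \sum_(n < N) z ^+ n * (Mn n)`_(k - i))
      (fun i => (kernel z)`_i * s (k - i)%N)) => i _.
    by apply: seqZ; apply: s_sums.
  apply: cvg_ext h => N; rewrite coefM; apply: eq_bigr => i _.
  by rewrite coef_sum; congr (_ * _); apply: eq_bigr => n _; rewrite coefZ.
have h2 : (fun N => (kernel z * (\sum_(n < N) z ^+ n *: Mn n))`_k) @ \oo --> numer`_k - 0.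
  have h3 : (fun N => ('X^c : {poly R})`_k - z * (\sum_(n < N) z ^+ n *: lowpart n)`_k) @ \oo --> numer`_k.
    rewrite /numer coefB coefZ; apply: seqB; first exact: cvg_cst.
    by apply: seqZ; apply: lowlim_coef.
  apply: cvg_ext (seqB h3 (coef_partial_small k)) => N.
  by rewrite kernel_partial !coefB (coefZ z).
by rewrite subr0 in h2; apply: cvg_uniq h1 h2.
Qed.

(* numer has no root outside the disc because its non-leading part is dominated
   at tau by (1 - K(tau) M(tau)) tau^c. *)
Lemma lowlim_tau : z * lowlim.[tau] < tau ^+ c.
Proof.
have [S hS S1] := at_sums.
have K0 : 0 < (kernel z).[tau].
  by rewrite /kernel hornerD hornerN hornerZ hornerXn subr_gt0.
have h1 : (fun N => (kernel z).[tau] * \sum_(n < N) at_ n) @ \oo --> (kernel z).[tau] * S.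
  exact: seqZ.
have h2 : (fun N => (kernel z).[tau] * \sum_(n < N) at_ n) @ \oo --> tau ^+ c - z * lowlim.[tau] - tau ^+ c * 0.
  have h3 : (fun N => (\sum_(n < N) z ^+ n *: lowpart n).[tau]) @ \oo --> lowlim.[tau].
    have h : (fun N => \sum_(j < c) (\sum_(n < N) z ^+ n *: lowpart n)`_j * tau ^+ j) @ \oo -->
       \sum_(j < c) lowlim`_j * tau ^+ j.
      apply: (@cvg_ord_sum R (fun j N => (\sum_(n < N) z ^+ n *: lowpart n)`_j * tau ^+ j)
         (fun j => lowlim`_j * tau ^+ j)) => j _.
      by apply: seqM; [apply: lowlim_coef|apply: cvg_cst].
    rewrite (horner_coef_wide _ size_lowlim); apply: cvg_ext h => N.
    rewrite (@horner_coef_wide _ c) //; apply: leq_trans (size_sum _ _ _) _.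
    apply/bigmax_leqP => i _; apply: leq_trans (size_scale_leq _ _) _; exact: size_take_poly.
  have h4 : (fun N => tau ^+ c - z * (\sum_(n < N) z ^+ n *: lowpart n).[tau] - tau ^+ c * at_ N)
      @ \oo --> tau ^+ c - z * lowlim.[tau] - tau ^+ c * 0.
    apply: seqB; last by apply: seqZ; apply: at_cvg0.
    by apply: seqB; [apply: cvg_cst|apply: seqZ].
  apply: cvg_ext h4 => N; rewrite /at_.
  have := congr1 (fun p : {poly R} => p.[tau]) (kernel_partial z N).
  rewrite hornerM !hornerD !hornerN !hornerZ hornerM hornerXn horner_sum.
  under eq_bigr do rewrite hornerZ.
  by move=> ->; ring.
have := cvg_uniq h1 h2; rewrite mulr0 subr0 => e.
have : 0 < (kernel z).[tau] * S by rewrite mulr_gt0 //; lra.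
by rewrite e subr_gt0.
Qed.

Lemma numer_root_inside u : (pC numer).[u] = 0 -> cnorm u < tau.
Proof.
move=> h; rewrite ltNge; apply/negP => hu.
have e : u ^+ c = cr z * (pC lowlim).[u].
  apply/eqP; rewrite -subr_eq0 -h /numer rmorphB /= map_polyXn map_polyZ.
  by rewrite hornerD hornerN hornerZ hornerXn.
have un0 : 0 < cnorm u by apply: lt_le_trans hu.
have h2 : cnorm u ^+ c <= z * lowlim.[cnorm u].
  rewrite -cnormX e cnormM cnorm_real (gtr0_norm z_gt0); apply: ler_wpM2l; first exact: ltW.
  by apply: cnorm_pC_horner; apply: lowlim_ge0.
(* Since [lowlim] has degree below c and nonnegative coefficients, t^(-c) lowlim(t) decreases, so
   the strict inequality at tau persists for t = |u| >= tau. *)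
suff h3 : tau ^+ c * (z * lowlim.[cnorm u]) <= cnorm u ^+ c * (z * lowlim.[tau]).
  have h4 : tau ^+ c * cnorm u ^+ c <= cnorm u ^+ c * (z * lowlim.[tau]).
    by apply: le_trans h3; apply: ler_wpM2l => //; apply: ltW.
  rewrite mulrC ler_pM2l ?exprn_gt0 // in h4.
  by have := lowlim_tau; rewrite ltNge h4.
rewrite !(mulrCA _ z); apply: ler_wpM2l; first exact: ltW.
rewrite !(horner_coef_wide _ size_lowlim) !mulr_sumr; apply: ler_sum => i _.
rewrite !(mulrCA _ lowlim`_i); apply: ler_wpM2l; first exact: lowlim_ge0.
have ic : (i <= c)%N by apply: ltnW.
move: (nat_of_ord i) ic => j jc; rewrite -(subnK jc) !exprD -mulrA [leRHS]mulrAC -[leRHS]mulrA.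
apply: ler_wpM2r; first by rewrite mulr_ge0 ?exprn_ge0 ?(ltW tau_gt0) ?cnorm_ge0.
by apply: lerXn2r; rewrite ?nnegrE ?(ltW tau_gt0) ?cnorm_ge0.
Qed.

Lemma numer_monic : numer \is monic.
Proof.
rewrite monicE lead_coefE.
have sz : size numer = c.+1.
  rewrite /numer size_polyDl ?size_polyXn // size_polyN ltnS.
  by apply: leq_trans (size_scale_leq _ _) size_lowlim.
by rewrite sz /numer coefB coefXn eqxx coefZ (nth_default _ size_lowlim) mulr0 subr0.
Qed.

Lemma size_numer : size numer = c.+1.
Proof.
rewrite /numer size_polyDl ?size_polyXn // size_polyN ltnS.
by apply: leq_trans (size_scale_leq _ _) size_lowlim.
Qed.

End Kernel.

(** * Cancellation of the small roots *)

Section KernelFactorisation.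
Variable R : realType.
Implicit Types (u : R[i]).

Local Notation cr a := ((a : R)%:C)%C.
Local Notation pC := (map_poly (real_complex R)).

Variables (A : {poly R}) (c : nat).
Hypothesis A_ge0 : forall j, 0 <= A`_j.
Hypothesis A0_gt0 : 0 < A`_0.
Hypothesis c_gt0 : (0 < c)%N.
Variables (z tau : R).
Hypothesis z_gt0 : 0 < z.
Hypothesis tau_gt0 : 0 < tau.
Hypothesis subcritical : z * A.[tau] < tau ^+ c.
Variable s : nat -> R.
Hypothesis s_sums : forall k, sums_to (fun n => z ^+ n * (meander A c n)`_k) (s k).
Arguments s_sums : clear implicits.

Let Mn := meander A c.
Let Hn := imeander A c.
Let at_ n := z ^+ n * (Mn n).[tau].

Lemma pC_le_tau (p : {poly R}) u : (forall j, 0 <= p`_j) -> cnorm u <= tau ->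
  cnorm (pC p).[u] <= p.[tau].
Proof.
move=> p0 hu; apply: le_trans (cnorm_horner_le _ hu) _.
rewrite size_map_poly horner_coef; apply: ler_sum => i _.
by rewrite coef_map cnorm_real ger0_norm.
Qed.

(* 1/M = exp(- L) is dominated by M = exp L, L having nonnegative coefficients. *)
Lemma imeander_le n u : cnorm u <= tau -> cnorm (pC (Hn n)).[u] <= (Mn n).[tau].
Proof.
move=> hu; elim/ltn_ind: n => n IH.
case: (posnP n) => [->|n0].
  by rewrite /Hn /imeander /renew /= rmorph1 !hornerC cnorm1.
have nr : 0 < n%:R :> R by rewrite ltr0n.
rewrite -(ler_pM2l nr).
have e1 : n%:R * (Mn n).[tau] = \sum_(j < n.+1) (posW A c j).[tau] * (Mn (n - j)).[tau].
  have := congr1 (fun p : {poly R} => p.[tau]) (spitzer A c n).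
  rewrite /theta mulr_natl hornerMn -mulr_natl => ->.
  by rewrite /conv horner_sum; apply: eq_bigr => j _; rewrite hornerM.
have e2 : n%:R * (pC (Hn n)).[u] = - \sum_(j < n.+1) (pC (posW A c j)).[u] * (pC (Hn (n - j))).[u].
  have := congr1 (fun p : {poly R} => (pC p).[u]) (theta_imeander A c n).
  rewrite /theta mulr_natl rmorphMn hornerMn -mulr_natl => ->.
  rewrite /conv rmorphN hornerN rmorph_sum horner_sum; congr (- _).
  by apply: eq_bigr => j _; rewrite rmorphM hornerM.
have -> : n%:R * cnorm (pC (Hn n)).[u] = cnorm (n%:R * (pC (Hn n)).[u]).
  by rewrite cnormM -(rmorph_nat (real_complex R)) cnorm_real ger0_norm.
rewrite e2 cnormN e1; apply: le_trans (cnorm_sum _ _ _) _; apply: ler_sum => j _.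
rewrite cnormM; case: (posnP j) => [->|j0].
  by rewrite /= rmorph0 !horner0 cnorm0 !mul0r.
apply: ler_pM; rewrite ?cnorm_ge0 //; last by apply: IH; rewrite ltn_subrL j0.
by apply: pC_le_tau => // i; apply: posW_ge0.
Qed.

(** On the disc the kernel is numer times 1/M, and |1/M| <= M(z,tau) = S by [imeander_le]. Partial
    sums replace complex series: the product of those of M and 1/M differs from 1 by at most E,
    which tends to 0. *)
Lemma kernel_dominated : exists2 C, 0 <= C & forall u, cnorm u <= tau ->
  cnorm (pC (kernel A c z)).[u] <= C * cnorm (pC (numer A c z s)).[u].
Proof.
have [S hS S1] := at_sums A_ge0 z_gt0 tau_gt0 subcritical.
have a0 n : 0 <= at_ n by apply: at_ge0.
have tauw := ltW tau_gt0; have zw := ltW z_gt0.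
exists S => [|u hu]; first by apply: le_trans S1.
pose m n := cr (z ^+ n) * (pC (Mn n)).[u].
pose h n := cr (z ^+ n) * (pC (Hn n)).[u].
have mle n : cnorm (m n) <= at_ n.
  rewrite cnormM cnorm_real ger0_norm ?exprn_ge0 //; apply: ler_wpM2l; first exact: exprn_ge0.
  by apply: pC_le_tau => // j; apply: meander_ge0.
have hle n : cnorm (h n) <= at_ n.
  rewrite cnormM cnorm_real ger0_norm ?exprn_ge0 //; apply: ler_wpM2l; first exact: exprn_ge0.
  exact: imeander_le.
have mh n : conv m h n = delta0 _ n.
  transitivity (cr (z ^+ n) * (pC (conv Mn Hn n)).[u]).
    rewrite /conv rmorph_sum horner_sum mulr_sumr; apply: eq_bigr => i _.
    have im : (i <= n)%N by rewrite -ltnS.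
    have -> : z ^+ n = z ^+ i * z ^+ (n - i) by rewrite -exprD subnKC.
    by rewrite !rmorphM hornerM /m /h /=; ring.
  rewrite conv_imeander /delta0 rmorph_nat -polyC_natr hornerC.
  by case: n => [|n]; rewrite ?mulr0 // expr0 rmorph1 mul1r.
pose E N := (\sum_(n < N) at_ n) * (\sum_(n < N) at_ n) - \sum_(n < N) conv at_ at_ n.
have E0 : E @ \oo --> (0 : R).
  have := seqB (seqM hS hS) (sums_conv a0 a0 hS hS); rewrite subrr => hh.
  exact: (cvg_ext _ hh).
have hE N : (0 < N)%N -> cnorm ((\sum_(n < N) m n) * (\sum_(n < N) h n) - 1) <= E N.
  move=> N0.
  have -> : (\sum_(n < N) m n) * (\sum_(n < N) h n) - 1 =
     \sum_(i < N) m i * (\sum_(j < N) h j - \sum_(j < N - i) h j).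
    have -> : (1 : R[i]) = \sum_(n < N) conv m h n.
      rewrite (eq_bigr (fun n : 'I_N => delta0 _ (n : nat))); last by move=> i _; apply: mh.
      by case: N N0 => // N _; rewrite big_ord_recl big1 //= addr0.
    by rewrite conv_sum mulr_suml -sumrB; apply: eq_bigr => i _; rewrite mulrBr.
  have -> : E N = \sum_(i < N) at_ i * (\sum_(j < N) at_ j - \sum_(j < N - i) at_ j).
    by rewrite /E conv_sum mulr_suml -sumrB; apply: eq_bigr => i _; rewrite mulrBr.
  apply: le_trans (cnorm_sum _ _ _) _; apply: ler_sum => i _; rewrite cnormM.
  apply: ler_pM; rewrite ?cnorm_ge0 //.
  have iN : (N - i <= N)%N by apply: leq_subr.
  rewrite (@ord_sum_splitP R at_ _ _ iN) [X in _ <= X]addrC addKr.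
  have -> : \sum_(j < N) h j = \sum_(j < N - i) h j + \sum_(j < N - (N - i)) h ((N - i) + j)%N.
    exact: ord_sum_splitP.
  rewrite [X in cnorm X]addrC addKr; apply: le_trans (cnorm_sum _ _ _) _; exact: ler_sum.
set K := (pC (kernel A c z)).[u].
pose low N : {poly R} := \sum_(n < N) z ^+ n *: lowpart A c n.
pose num N : {poly R} := 'X^c - z *: low N.
have hK N : K * \sum_(n < N) m n = (pC (num N)).[u] - cr (z ^+ N) * (u ^+ c * (pC (Mn N)).[u]).
  have e3 : kernel A c z * (\sum_(n < N) z ^+ n *: Mn n) = num N - z ^+ N *: ('X^c * Mn N).
    exact: kernel_partial.
  have := congr1 (fun p : {poly R} => (pC p).[u]) e3.
  rewrite (rmorphM _ (kernel A c z)) hornerM (rmorphB _ (num N)) hornerD hornerN -/K => e4.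
  have e5 : (pC (z ^+ N *: ('X^c * Mn N))).[u] = cr (z ^+ N) * (u ^+ c * (pC (Mn N)).[u]).
    by rewrite map_polyZ hornerZ rmorphM hornerM /= map_polyXn hornerXn.
  rewrite -e5 -e4; congr (_ * _); rewrite rmorph_sum horner_sum; apply: eq_bigr => n _.
  by rewrite /= map_polyZ hornerZ.
pose diff N := \sum_(j < c) `|(low N)`_j - (lowlim A c s)`_j| * tau ^+ j.
have diff0 : diff @ \oo --> (0 : R).
  have hd : (fun N => \sum_(j < c) `|(low N)`_j - (lowlim A c s)`_j| * tau ^+ j) @ \oo --> \sum_(j < c) (0 : R).
    apply: (@cvg_ord_sum R (fun j N => `|(low N)`_j - (lowlim A c s)`_j| * tau ^+ j) (fun=> 0)) => j _.
    rewrite -[X in _ --> X](mul0r (tau ^+ j)); apply: seqM; last exact: cvg_cst.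
    have hl : (fun N => (low N)`_j - (lowlim A c s)`_j) @ \oo --> (0 : R).
      rewrite -[X in _ --> X](subrr (lowlim A c s)`_j); apply: seqB; last exact: cvg_cst.
      exact: lowlim_coef.
    by rewrite -[X in _ --> X](@normr0 R R); apply: (cvg_norm hl).
  by rewrite big1 in hd.
have hnum N : cnorm (pC (num N)).[u] <= cnorm (pC (numer A c z s)).[u] + z * diff N.
  apply: le_trans (cnorm_le_dist _ (pC (numer A c z s)).[u]) _; rewrite lerD2l.
  have -> : (pC (num N)).[u] - (pC (numer A c z s)).[u] = - (cr z * (pC (low N - lowlim A c s)).[u]).
    rewrite /num /numer !rmorphB /= !hornerD !hornerN !map_polyZ !hornerZ /=; ring.
  rewrite cnormN cnormM cnorm_real ger0_norm //; apply: ler_wpM2l => //.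
  have sz : (size (low N - lowlim A c s)%R <= c)%N.
    apply: leq_trans (size_polyD _ _) _; rewrite size_polyN geq_max size_lowlim andbT.
    apply: leq_trans (size_sum _ _ _) _; apply/bigmax_leqP => i _.
    by apply: leq_trans (size_scale_leq _ _) _; apply: size_take_poly.
  rewrite (@horner_coef_wide _ c); last by rewrite size_map_poly.
  apply: le_trans (cnorm_sum _ _ _) _; apply: ler_sum => j _.
  rewrite cnormM cnormX coef_map cnorm_real coefB; apply: ler_wpM2l => //.
  by apply: lerXn2r; rewrite ?nnegrE ?cnorm_ge0.
pose G N := cnorm K * E N + (cnorm (pC (numer A c z s)).[u] + z * diff N + tau ^+ c * at_ N) * S.
have hG N : cnorm K <= G N.+1.
  have e : K = K * (\sum_(n < N.+1) m n) * (\sum_(n < N.+1) h n) -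
     K * ((\sum_(n < N.+1) m n) * (\sum_(n < N.+1) h n) - 1) by ring.
  rewrite {1}e; apply: le_trans (cnormB _ _) _; rewrite addrC; apply: lerD.
    by rewrite cnormM; apply: ler_wpM2l; [apply: cnorm_ge0|apply: hE].
  rewrite cnormM; apply: ler_pM; rewrite ?cnorm_ge0 //.
    rewrite hK; apply: le_trans (cnormB _ _) _; apply: lerD; first exact: hnum.
    rewrite !cnormM cnormX cnorm_real ger0_norm ?exprn_ge0 // mulrCA.
    apply: ler_pM; rewrite ?exprn_ge0 ?mulr_ge0 ?exprn_ge0 ?cnorm_ge0 //.
      by apply: lerXn2r; rewrite ?nnegrE ?cnorm_ge0.
    apply: ler_wpM2l; first exact: exprn_ge0.
    by apply: pC_le_tau => // j; apply: meander_ge0.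
  apply: le_trans (cnorm_sum _ _ _) _; apply: le_trans (_ : \sum_(n < N.+1) at_ n <= _).
    by apply: ler_sum.
  exact: sums_ge.
have G0 : G @ \oo --> cnorm K * 0 + (cnorm (pC (numer A c z s)).[u] + z * 0 + tau ^+ c * 0) * S.
  apply: seqD; first exact: seqZ.
  apply: seqM; last exact: cvg_cst.
  apply: seqD; last by apply: seqZ; apply: at_cvg0.
  by apply: seqD; [exact: cvg_cst|exact: seqZ].
rewrite !mulr0 !addr0 add0r mulrC in G0.
have G1 := cvg_reindex (s := fun n => n.+1) (fun n => leqnSn n) G0.
by apply: (cvg_le (u := fun=> cnorm K) _ (cvg_cst (cnorm K)) G1).
Qed.

Lemma numer_dvd_kernel : pC (numer A c z s) %| pC (kernel A c z).
Proof.
have [r e] := closed_field_poly_normal (pC (numer A c z s)).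
have mon : pC (numer A c z s) \is monic by rewrite map_monic numer_monic.
rewrite (monicP mon) scale1r in e.
have [C C0 hC] := kernel_dominated.
rewrite e; apply: (@dominated_dvdp R r _ C tau C0) => [a ar|u hu]; last by rewrite -e; apply: hC.
apply: (numer_root_inside A_ge0 z_gt0 tau_gt0 subcritical s_sums).
by apply/eqP; rewrite -/(root _ _) e root_prod_XsubC.
Qed.

Variables (V Sm : {poly R[i]}) (b : R[i]).
Hypothesis b_neq0 : b != 0.
Hypothesis V_monic : V \is monic.
Hypothesis Sm_monic : Sm \is monic.
Hypothesis Sm_size : size Sm = c.+1.
Hypothesis V_outside : forall u, root V u -> tau < cnorm u.
Hypothesis kernel_roots : pC (kernel A c z) = b%:P * V * Sm.

(** V has its roots outside the disc and numer inside, so they are coprime and V divides the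
    cofactor of numer. Counting degrees leaves only a constant. *)
Lemma kernel_factor : pC (kernel A c z) = b%:P * V * pC (numer A c z s).
Proof.
have mon : pC (numer A c z s) \is monic by rewrite map_monic numer_monic.
have /dvdpP[T eT] := numer_dvd_kernel.
have cop : coprimep V (pC (numer A c z s)).
  apply/Pdiv.ClosedField.coprimepP => u hu; apply/negP => hn.
  have h1 := V_outside hu.
  have h2 : cnorm u < tau by apply: (numer_root_inside A_ge0 z_gt0 tau_gt0 subcritical s_sums); apply/eqP.
  by move: (lt_trans h1 h2); rewrite ltxx.
have VT : V %| T.
  rewrite -(Gauss_dvdpl _ cop) -eT kernel_roots; apply: dvdp_mulr; exact: dvdp_mull.
have /dvdpP[W eW] := VT.
have V0 : V != 0 by rewrite monic_neq0.
have e2 : W * pC (numer A c z s) = b%:P * Sm.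
  apply: (mulfI V0); have := eT; rewrite kernel_roots eW => e3.
  by rewrite mulrA (mulrC V) -e3; ring.
have W0 : W != 0.
  apply/eqP => W0; move: e2; rewrite W0 mul0r => /esym/eqP.
  by rewrite mulf_eq0 polyC_eq0 (negbTE b_neq0) (negbTE (monic_neq0 Sm_monic)).
have sW : size W = 1%N.
  have := congr1 (fun p : {poly R[i]} => size p) e2.
  rewrite size_Mmonic // size_map_poly size_numer mul_polyC size_scale // Sm_size addnS /=.
  by move=> h; apply: (@addIn c); rewrite h.
have [w _ ew] := size_poly1P _ (introT eqP sW).
have ewb : w = b.
  have := congr1 (fun p : {poly R[i]} => lead_coef p) e2.
  by rewrite ew !lead_coefM !lead_coefC (monicP mon) (monicP Sm_monic) !mulr1.
by rewrite eT eW ew ewb.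
Qed.

(** In kernel times M = numer the factor numer cancels, its constant term -z A_0 s_0 being nonzero.
    What remains says that b V is the inverse of M in u. *)
Lemma root_series k : conv (fun i => (b%:P * V)`_i) (fun i => cr (s i)) k = delta0 _ k.
Proof.
pose num := pC (numer A c z s).
pose T := b%:P * V.
have e1 n : conv (fun i => (pC (kernel A c z))`_i) (fun i => cr (s i)) n = num`_n.
  rewrite /num coef_map /= -(kernel_series s_sums) /conv rmorph_sum; apply: eq_bigr => i _.
  by rewrite coef_map rmorphM.
have e2 : (fun i => (pC (kernel A c z))`_i) = conv (fun i => num`_i) (fun i => T`_i).
  by apply/funext => i; rewrite kernel_factor -/T mulrC coefM.
have num0 : num`_0 != 0.
  rewrite /num coef_map /numer coefB coefXn (ltn_eqF c_gt0) coefZ coef_take_poly c_gt0 coef0M coef_poly c_gt0.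
  rewrite /= sub0r fmorph_eq0 oppr_eq0 !mulf_neq0 ?gt_eqF //.
  by apply: lt_le_trans (s0_ge1 A_ge0 z_gt0 s_sums).
apply/eqP; rewrite -subr_eq0; apply/eqP; move: k.
apply: (@conv_eq0 _ (fun i => num`_i) _ num0) => n.
rewrite (convDr (conv (fun i => T`_i) (fun i => cr (s i))) (fun i => - delta0 _ i)) convNr conv1r.
by rewrite convA -e2 e1 subrr.
Qed.

End KernelFactorisation.

(** * Lattice paths and the tilted walk *)

Section MeanderCounting.
Variable R : realType.
Variables (c d : nat) (p : int -> R).

Local Notation J := 'I_(c + d).+1.

Definition jump_poly : {poly R} := \poly_(j < (c + d).+1) p (j%:Z - c%:Z).

Lemma jump_polyE (j : J) : jump_poly`_j = p (jumpv j).
Proof. by rewrite coef_poly ltn_ord. Qed.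

Lemma big_tuple_rcons n (F : seq J -> R) :
  \sum_(t : n.+1.-tuple J) F t = \sum_(t : n.-tuple J) \sum_(j : J) F (rcons t j).
Proof.
rewrite pair_big /=.
rewrite (reindex (fun q : n.-tuple J * J => [tuple of rcons q.1 q.2])) //=.
exists (fun t : n.+1.-tuple J => ([tuple of belast (thead t) (behead_tuple t)], last (thead t) (behead_tuple t))).
  move=> [t j] _; congr pair; [apply: val_inj|]; rewrite /= /thead (tnth_nth j) /=.
    by case: t => -[|x s] hs //=; rewrite belast_rcons.
  by case: t => -[|x s] hs //=; rewrite last_rcons.
move=> t _; apply: val_inj; rewrite /= -lastI.
by case/tupleP: t => x s; rewrite theadE.
Qed.

Lemma alt_after_rcons (s : seq J) j m : (m <= size s)%N ->
  alt_after (rcons s j) m = alt_after s m.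
Proof. by move=> h; rewrite /alt_after -cats1 takel_cat. Qed.

Lemma alt_after_rcons_size (s : seq J) j :
  alt_after (rcons s j) (size s).+1 = alt_after s (size s) + jumpv j.
Proof.
rewrite /alt_after take_size -(size_rcons s j) take_size.
by rewrite -cats1 big_cat big_seq1.
Qed.

Lemma is_meander_rcons (s : seq J) j : is_meander p (rcons s j) =
  [&& is_meander p s, in_J p j & (0 <= alt_after s (size s) + jumpv j)%R].
Proof.
have rec (P : pred nat) m : all P (iota 0 m.+1) = all P (iota 0 m) && P m.
  by rewrite -addn1 iotaD all_cat add0n; congr (_ && _); rewrite /= andbT.
rewrite /is_meander /is_path all_rcons size_rcons (rec _ (size s).+1) alt_after_rcons_size.
have -> : all (fun m => 0 <= alt_after (rcons s j) m) (iota 0 (size s).+1) =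
  all (fun m => 0 <= alt_after s m) (iota 0 (size s).+1).
  apply: eq_in_all => m; rewrite mem_iota add0n => /andP[_ h].
  by rewrite alt_after_rcons.
case: (in_J p j); rewrite ?andbF //.
by rewrite !andTb andbA.
Qed.

Lemma path_weight_rcons (s : seq J) j : path_weight p (rcons s j) = path_weight p s * p (jumpv j).
Proof. by rewrite /path_weight -cats1 big_cat big_seq1. Qed.

Lemma is_meander_alt_ge0 (s : seq J) : is_meander p s -> 0 <= alt_after s (size s).
Proof.
move=> /andP[_ /allP h]; apply: h; by rewrite mem_iota add0n leq0n ltnS leqnn.
Qed.

Lemma mcoef_meander n k : mcoef c d p n k = (meander jump_poly c n)`_k.
Proof.
elim: n k => [|n IH] k.
  rewrite /mcoef coef1 (big_rem [tuple]) ?mem_index_enum //= big1_seq; last first.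
    move=> t /andP[_ ht]; exfalso; move: ht; rewrite (tuple0 t).
    by rewrite mem_rem_uniq ?index_enum_uniq // inE eqxx.
  rewrite addr0 /is_meander /is_path /= /alt_after big_nil /path_weight big_nil lexx /=.
  by rewrite eqz_nat eq_sym; case: eqP.
rewrite /= coef_drop_poly coefM /mcoef big_mkcond.
rewrite (big_tuple_rcons n (fun t => if is_meander p t && (alt_after t n.+1 == k%:Z) then path_weight p t else 0)).
rewrite exchange_big /=.
have key (j : J) : \sum_(t : n.-tuple J) (if is_meander p (rcons t j) && (alt_after (rcons t j) n.+1 == k%:Z)
    then path_weight p (rcons t j) else 0) =
   if (j <= k + c)%N then p (jumpv j) * mcoef c d p n (k + c - j) else 0.
  case: ifP => hj.
    rewrite /mcoef mulr_sumr [RHS]big_mkcond; apply: eq_bigr => t _.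
    rewrite is_meander_rcons path_weight_rcons size_tuple.
    have e : alt_after (rcons t j) n.+1 = alt_after t n + jumpv j.
      by have := alt_after_rcons_size t j; rewrite size_tuple.
    rewrite e; have e2 : (alt_after t n + jumpv j == k%:Z) = (alt_after t n == (k + c - j)%N%:Z).
      rewrite /jumpv -subzn // PoszD; apply/eqP/eqP; clear; lia.
    rewrite e2; case: (is_meander p t) => //=.
    case: eqP => e3; rewrite ?andbF // andbT.
    have -> : (0 <= alt_after t n + jumpv j) = true.
      by move: e2; rewrite e3 eqxx => /eqP ->.
    rewrite andbT /in_J; case: eqP => [->|_] /=; last by rewrite mulrC.
    by rewrite mul0r.
  apply: big1 => t _; case: ifP => // /andP[].
  rewrite is_meander_rcons => /and3P[ht _ _].
  have e : alt_after (rcons t j) n.+1 = alt_after t n + jumpv j.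
    by have := alt_after_rcons_size t j; rewrite size_tuple.
  rewrite e => /eqP e1; have := is_meander_alt_ge0 ht; rewrite size_tuple => a0.
  by exfalso; move: e1 hj a0; rewrite /jumpv; move: (alt_after t n) => a; clear; lia.
rewrite (eq_bigr (fun j : J => if (j <= k + c)%N then p (jumpv j) * mcoef c d p n (k + c - j) else 0)); last first.
  by move=> j _; apply: key.
have h1 : \sum_(j < (c + d).+1) (if (j <= k + c)%N then p (jumpv j) * mcoef c d p n (k + c - j) else 0) =
  \sum_(j < (c + d).+1 + (k + c).+1) (if (j <= k + c)%N then jump_poly`_j * (meander jump_poly c n)`_(k + c - j) else 0).
  rewrite [RHS]big_split_ord /= [X in _ = _ + X]big1 ?addr0; last first.
    by move=> i _; rewrite coef_poly ltnNge leq_addr mul0r if_same.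
  by apply: eq_bigr => j _; rewrite jump_polyE IH.
rewrite h1 addnC big_split_ord /= [X in _ + X]big1 ?addr0; last first.
  by move=> i _; rewrite leqNgt ltnS leq_addr.
by apply: eq_bigr => j _; rewrite -ltnS ltn_ord.
Qed.

Lemma Mcoef1_meander n : Mcoef1 c d p n = (meander jump_poly c n).[1].
Proof.
(* Large enough to exceed every final altitude; K also exceeds the degree of the polynomial. *)
pose B := (\max_(t : n.-tuple J) absz (alt_after t n)).+1.
have hB (t : n.-tuple J) : (absz (alt_after t n) < B)%N by rewrite ltnS leq_bigmax.
pose K := (B + size (meander jump_poly c n))%N.
rewrite (@horner_coef_wide _ K) ?leq_addl // /Mcoef1.
rewrite (eq_bigr (fun k : 'I_K => \sum_(t : n.-tuple J | is_meander p t)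
   if alt_after t n == (k : nat)%:Z then path_weight p t else 0)); last first.
  move=> k _; rewrite expr1n mulr1 -mcoef_meander /mcoef.
  by rewrite big_mkcondr.
rewrite exchange_big /=; apply: eq_bigr => t ht.
have a0 := is_meander_alt_ge0 ht; rewrite size_tuple in a0.
have hk : (absz (alt_after t n) < K)%N by apply: leq_trans (hB t) (leq_addr _ _).
rewrite (bigD1 (Ordinal hk)) //= gez0_abs // eqxx big1 ?addr0 // => i hi.
case: eqP => // e; exfalso; move: hi; rewrite -val_eqE /= e.
by rewrite absz_nat eqxx.
Qed.

End MeanderCounting.

(** * The jump law tilted at the saddle point *)

Section Tilting.
Variable R : realType.
Variables (c d : nat) (p : int -> R) (tau : R).
Hypothesis c_gt0 : (0 < c)%N.
Hypothesis p_ge0 : forall j : 'I_(c + d).+1, 0 <= p (@jumpv c d j).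
Hypothesis p_bottom : p (- c%:Z) != 0.
Hypothesis p_top : p d%:Z != 0.
Hypothesis p_aper : aperiodic c d p.
Hypothesis tau_gt0 : 0 < tau.
Hypothesis tau_crit : Pder c d p tau = 0.

Let A := jump_poly c d p.

Lemma jump_poly_ge0 j : 0 <= A`_j.
Proof.
rewrite /A coef_poly; case: ltnP => // hj.
exact: (p_ge0 (Ordinal hj)).
Qed.

Lemma jump_poly_bottom : 0 < A`_0.
Proof.
have h := jump_poly_ge0 0; rewrite lt_neqAle h andbT eq_sym.
by rewrite /A coef_poly /= sub0r.
Qed.

Lemma jump_poly_top : A`_(c + d) = p d%:Z.
Proof. by rewrite /A coef_poly ltnSn PoszD addrAC subrr add0r. Qed.

Lemma size_jump_poly : size A = (c + d).+1.
Proof.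
apply/eqP; rewrite eqn_leq size_poly /= ltnNge; apply/negP => h.
by move: p_top; rewrite -jump_poly_top nth_default // eqxx.
Qed.

Lemma expr_jumpv (u : R) (j : 'I_(c + d).+1) : u != 0 -> u ^ jumpv j = u ^+ j / u ^+ c.
Proof. by move=> u0; rewrite /jumpv expfzDr // -exprnP exprnN. Qed.

Lemma PvalE u : u != 0 -> Pval c d p u = A.[u] / u ^+ c.
Proof.
move=> u0; rewrite horner_poly mulr_suml; apply: eq_bigr => j _.
by rewrite expr_jumpv // mulrA.
Qed.

Lemma jump_poly_tau_gt0 : 0 < A.[tau].
Proof.
apply: lt_le_trans (coef_le_horner 0 jump_poly_ge0 (ltW tau_gt0)).
by rewrite expr0 mulr1 jump_poly_bottom.
Qed.

Let P0 := Pval c d p tau.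

Lemma Pval_gt0 : 0 < P0.
Proof. by rewrite /P0 PvalE ?gt_eqF // divr_gt0 ?exprn_gt0 // jump_poly_tau_gt0. Qed.

(** The saddle-point equation P'(tau) = 0, multiplied by tau^(c+1): the tilted law has zero
    drift. *)
Lemma tilt_moment1 : \sum_(j < (c + d).+1) (j%:R - c%:R) * (A`_j * tau ^+ j) = 0.
Proof.
have t0 : tau != 0 by rewrite gt_eqF.
have tc0 : tau ^+ c != 0 by rewrite expf_neq0.
transitivity (tau ^+ c * tau * Pder c d p tau); last by rewrite tau_crit mulr0.
rewrite /Pder mulr_sumr; apply: eq_bigr => j _.
rewrite jump_polyE expfzDr // expr_jumpv // exprN1 /jumpv rmorphB /= -!pmulrn.
by field; rewrite t0 tc0.
Qed.

Lemma tilt_moment2 : \sum_(j < (c + d).+1) (j%:R - c%:R) * (j%:R - c%:R - 1) * (A`_j * tau ^+ j) =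
  tau ^+ c * (tau ^+ 2 * Pder2 c d p tau).
Proof.
have t0 : tau != 0 by rewrite gt_eqF.
have tc0 : tau ^+ c != 0 by rewrite expf_neq0.
rewrite /Pder2 !mulr_sumr; apply: eq_bigr => j _.
have e2 : tau ^ (jumpv j - 2) = tau ^+ j / tau ^+ c / tau ^+ 2.
  by rewrite expfzDr // expr_jumpv.
rewrite jump_polyE e2 /jumpv !rmorphB /= -!pmulrn.
by field; rewrite t0 tc0.
Qed.

(** Exponential change of measure: jump i receives probability p_i tau^i / P(tau), with exponents
    still shifted by c. *)
Definition tilted : {poly R} := (A.[tau])^-1 *: \poly_(j < (c + d).+1) (A`_j * tau ^+ j).

Definition tilted_var : R := tau ^+ 2 * Pder2 c d p tau / P0.

Lemma tilted_coef j : tilted`_j = A`_j * tau ^+ j / A.[tau].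
Proof.
rewrite coefZ coef_poly; case: ltnP => hj; first by rewrite mulrC.
by rewrite (nth_default _ (_ : (size A <= j)%N)) ?size_jump_poly // mulr0 mul0r mul0r.
Qed.

Lemma tilted_pow_coef n k :
  (tilted ^+ n)`_(c * n + k) = (1 / P0) ^+ n * tau ^+ k * (A ^+ n)`_(c * n + k).
Proof.
have h m : (tilted ^+ n)`_m = (A.[tau])^-1 ^+ n * (tau ^+ m * (A ^+ n)`_m).
  elim: n m => [|n IH] m.
    by rewrite !expr0 !coef1 mul1r; case: m => [|m]; rewrite ?mulr0 // expr0 mul1r.
  rewrite !exprS !coefM !mulr_sumr; apply: eq_bigr => i _.
  rewrite tilted_coef IH; have im : (i <= m)%N by rewrite -ltnS.
  have -> : tau ^+ m = tau ^+ i * tau ^+ (m - i) by rewrite -exprD subnKC.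
  by ring.
have t0 : tau != 0 by rewrite gt_eqF.
rewrite h /P0 PvalE // div1r invf_div expr_div_n exprVn exprD -exprM.
by field; rewrite expf_neq0 // gt_eqF // jump_poly_tau_gt0.
Qed.

Lemma second_moment_gt0 : 0 < Pder2 c d p tau.
Proof.
have h1 : 0 < \sum_(j < (c + d).+1) (j%:R - c%:R) ^+ 2 * (A`_j * tau ^+ j).
  have h0 : 0 < (c%:R : R) ^+ 2 * (A`_0 * tau ^+ 0).
    by rewrite mulr_gt0 ?exprn_gt0 ?ltr0n // mulr_gt0 ?jump_poly_bottom // expr0.
  apply: lt_le_trans h0 _; rewrite big_ord_recl /= sub0r sqrrN lerDl.
  by apply: sumr_ge0 => i _; rewrite mulr_ge0 ?sqr_ge0 // mulr_ge0 ?jump_poly_ge0 // exprn_ge0 // ltW.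
have e : \sum_(j < (c + d).+1) (j%:R - c%:R) ^+ 2 * (A`_j * tau ^+ j) = tau ^+ c * (tau ^+ 2 * Pder2 c d p tau).
  rewrite -tilt_moment2 -[RHS]addr0 -[X in _ = _ + X]tilt_moment1 -big_split /=.
  by apply: eq_bigr => j _; ring.
move: h1; rewrite e pmulr_rgt0 ?exprn_gt0 // pmulr_rgt0 ?exprn_gt0 //.
Qed.

Lemma tilted_walk : centred_walk tilted c tilted_var.
Proof.
have At := jump_poly_tau_gt0.
have t0 : tau != 0 by rewrite gt_eqF.
have sumA : \sum_(j < (c + d).+1) A`_j * tau ^+ j = A.[tau].
  by rewrite horner_coef size_jump_poly.
have m1 : \sum_(j < (c + d).+1) j%:R * (A`_j * tau ^+ j) = c%:R * A.[tau].
  rewrite -sumA mulr_sumr; apply/eqP; rewrite -subr_eq0 -sumrB.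
  apply/eqP; rewrite -[RHS]tilt_moment1; apply: eq_bigr => j _; ring.
have sz : (size tilted <= (c + d).+1)%N.
  by apply: leq_trans (size_scale_leq _ _) (size_poly _ _).
have d1 : (deriv tilted).[1] = \sum_(j < (c + d).+1) j%:R * tilted`_j.
  rewrite (@horner_coef_wide _ (c + d)); last first.
    apply: leq_trans (size_poly _ _) _; move: sz; clear; lia.
  rewrite [RHS]big_ord_recl /= mul0r add0r; apply: eq_bigr => j _.
  by rewrite expr1n mulr1 coef_deriv mulr_natl.
have d2 : (deriv (deriv tilted)).[1] = \sum_(j < (c + d).+1) (j%:R * (j%:R - 1)) * tilted`_j.
  have dd k : (deriv (deriv tilted))`_k = (k.+2%:R * k.+1%:R) * tilted`_k.+2.
    by rewrite !coef_deriv -mulrnA -[LHS]mulr_natl natrM.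
  have [m em] : exists m, (c + d).+1 = m.+2.
    by exists (c + d).-1; rewrite prednK // addn_gt0 c_gt0.
  rewrite (@horner_coef_wide _ m); last first.
    have h1 : (size (deriv tilted) <= (size tilted).-1)%N by apply: size_poly.
    have h2 : (size (deriv (deriv tilted)) <= (size (deriv tilted)).-1)%N by apply: size_poly.
    by move: h1 h2 sz; rewrite em; clear; lia.
  rewrite em big_ord_recl /= mul0r mul0r add0r big_ord_recl /= subrr mulr0 mul0r add0r.
  apply: eq_bigr => k _; rewrite expr1n mulr1 dd /bump /= !add1n.
  have -> : k.+1%:R = k.+2%:R - 1 :> R by rewrite -[k.+2%:R]natr1 addrK.
  by [].
split.
- by move=> j; rewrite tilted_coef divr_ge0 ?(ltW At) // mulr_ge0 ?jump_poly_ge0 // exprn_ge0 // ltW.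
- rewrite (horner_coef_wide _ sz) (eq_bigr (fun j : 'I_(c + d).+1 => A`_j * tau ^+ j / A.[tau])); last first.
    by move=> j _; rewrite expr1n mulr1 tilted_coef.
  by rewrite -mulr_suml sumA mulfV // gt_eqF.
- rewrite d1 (eq_bigr (fun j : 'I_(c + d).+1 => j%:R * (A`_j * tau ^+ j) / A.[tau])); last first.
    by move=> j _; rewrite tilted_coef mulrA.
  by rewrite -mulr_suml m1 mulfK // gt_eqF.
- rewrite d2 (eq_bigr (fun j : 'I_(c + d).+1 => (j%:R * (j%:R - 1)) * (A`_j * tau ^+ j) / A.[tau])); last first.
    by move=> j _; rewrite tilted_coef mulrA.
  rewrite -mulr_suml.
  have -> : \sum_(j < (c + d).+1) j%:R * (j%:R - 1) * (A`_j * tau ^+ j) =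
     tau ^+ c * (tau ^+ 2 * Pder2 c d p tau) + c%:R * (c%:R - 1) * A.[tau].
    transitivity (\sum_(j < (c + d).+1) (j%:R - c%:R) * (j%:R - c%:R - 1) * (A`_j * tau ^+ j) +
      c%:R * (c%:R - 1) * A.[tau] + 2 * c%:R * \sum_(j < (c + d).+1) (j%:R - c%:R) * (A`_j * tau ^+ j)).
      by rewrite -sumA !mulr_sumr -!big_split /=; apply: eq_bigr => j _; ring.
    by rewrite tilt_moment1 mulr0 addr0 tilt_moment2.
  rewrite /tilted_var /P0 PvalE //; field.
  by rewrite expf_neq0 // gt_eqF.
- by rewrite divr_gt0 ?Pval_gt0 // mulr_gt0 ?exprn_gt0 // second_moment_gt0.
- by [].
- by rewrite tilted_coef divr_gt0 // mulr_gt0 ?jump_poly_bottom // expr0.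
(* m = 0 would force c + d = 0, as the top jump has nonzero weight; m >= 2 contradicts aperiodicity
   with b = -c. *)
- move=> m hm.
  have hd (j : 'I_(c + d).+1) : p (jumpv j) != 0 -> (m %| j)%N.
    move=> hj; apply: hm; rewrite tilted_coef /A jump_polyE.
    by rewrite !mulf_neq0 ?invr_eq0 ?expf_neq0 // gt_eqF.
  case: m hm hd => [|[|m]] hm hd //; exfalso.
    have := hd ord_max; rewrite /= dvd0n /jumpv /= PoszD addrAC subrr add0r => /(_ p_top).
    by rewrite addn_eq0 (gtn_eqF c_gt0).
  apply: p_aper; exists (- c%:Z), m.+2; split => // j hj.
  by rewrite /jumpv opprK subrK; apply: hd.
Qed.

End Tilting.

(** * Large roots *)

Section ComplexLimits.
Variable R : realType.
Local Notation cr a := ((a : R)%:C)%C.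
Local Notation pC := (map_poly (real_complex R)).

Definition ccvg (f : nat -> R[i]) (l : R[i]) : Prop :=
  (fun n => cnorm (f n - l)) @ \oo --> (0 : R).

Lemma ccvg_cst l : ccvg (fun=> l) l.
Proof. by apply: cvg_ext (cvg_cst 0) => n; rewrite subrr cnorm0. Qed.

Lemma ccvgD f g a b : ccvg f a -> ccvg g b -> ccvg (fun n => f n + g n) (a + b).
Proof.
move=> ha hb; have := seqD ha hb; rewrite addr0 => h; apply: cvg_squeeze0 h => n.
rewrite ger0_norm ?cnorm_ge0 //.
have -> : f n + g n - (a + b) = (f n - a) + (g n - b) by ring.
exact: cnormD.
Qed.

Lemma ccvgM f g a b : ccvg f a -> ccvg g b -> ccvg (fun n => f n * g n) (a * b).
Proof.
move=> ha hb.
have h : (fun n => cnorm (f n - a) * cnorm (g n - b) + (cnorm b * cnorm (f n - a) + cnorm a * cnorm (g n - b))) @ \oo -->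
    0 * 0 + (cnorm b * 0 + cnorm a * 0).
  by apply: seqD; [exact: seqM|apply: seqD; exact: seqZ].
rewrite !mulr0 !addr0 in h; apply: cvg_squeeze0 h => n.
rewrite ger0_norm ?cnorm_ge0 // -!cnormM.
have -> : f n * g n - a * b = (f n - a) * (g n - b) + (b * (f n - a) + a * (g n - b)) by ring.
apply: le_trans (cnormD _ _) _; rewrite lerD2l; exact: cnormD.
Qed.

Lemma ccvg_real (f : nat -> R) (l : R) : f @ \oo --> l -> ccvg (fun n => cr (f n)) (cr l).
Proof.
move=> h; apply: eps_cvg => e e0; have [N hN] := cvg_eps h e0.
exists N => n /hN; rewrite subr0 -rmorphB cnorm_real normr_id; exact.
Qed.

Lemma ccvg_uniq f a b : ccvg f a -> ccvg f b -> a = b.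
Proof.
move=> ha hb; apply/eqP; rewrite -subr_eq0; apply/eqP; apply: cnorm_eq0.
have h := seqD ha hb; rewrite addr0 in h.
apply/eqP; rewrite eq_le cnorm_ge0 andbT.
apply: (cvg_le (u := fun=> cnorm (a - b)) _ (cvg_cst _) h) => n.
have -> : a - b = (f n - b) - (f n - a) by ring.
by rewrite [leRHS]addrC; apply: cnormB.
Qed.

Lemma ccvg_sum (F : nat -> nat -> R[i]) (l : nat -> R[i]) K :
  (forall i, (i < K)%N -> ccvg (F i) (l i)) ->
  ccvg (fun n => \sum_(i < K) F i n) (\sum_(i < K) l i).
Proof.
elim: K => [|K IH] h.
  rewrite big_ord0; apply: cvg_ext (ccvg_cst 0) => n; by rewrite big_ord0.
rewrite big_ord_recr /=.
have h2 : ccvg (fun n => \sum_(i < K) F i n + F K n) (\sum_(i < K) l i + l K).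
  by apply: ccvgD; [apply: IH => i iK; apply: h; apply: ltnW|apply: h].
by apply: cvg_ext h2 => n; rewrite big_ord_recr.
Qed.

Definition pcvg (P : nat -> {poly R[i]}) (Q : {poly R[i]}) : Prop :=
  forall k, ccvg (fun n => (P n)`_k) Q`_k.

Lemma pcvgM P1 P2 Q1 Q2 : pcvg P1 Q1 -> pcvg P2 Q2 ->
  pcvg (fun n => P1 n * P2 n) (Q1 * Q2).
Proof.
move=> h1 h2 k; rewrite coefM.
have h := @ccvg_sum (fun i n => (P1 n)`_i * (P2 n)`_(k - i)) (fun i => Q1`_i * Q2`_(k - i)) k.+1.
apply: cvg_ext (h _) => [n|i _]; first by rewrite coefM.
exact: ccvgM.
Qed.

Lemma pcvg_prod I (r : seq I) (P : I -> nat -> {poly R[i]}) (Q : I -> {poly R[i]}) :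
  (forall i, pcvg (P i) (Q i)) ->
  pcvg (fun n => \prod_(i <- r) P i n) (\prod_(i <- r) Q i).
Proof.
move=> h; elim: r => [|i r IH] k.
  rewrite big_nil; apply: cvg_ext (ccvg_cst _) => n; by rewrite big_nil.
rewrite big_cons; apply: cvg_ext (pcvgM (h i) IH k) => n; by rewrite big_cons.
Qed.

Lemma pcvg_polyC f a : ccvg f a -> pcvg (fun n => (f n)%:P) a%:P.
Proof.
move=> h k; rewrite coefC; case: k => [|k] /=; first by apply: cvg_ext h => n; rewrite coefC.
by apply: cvg_ext (ccvg_cst 0) => n; rewrite coefC.
Qed.

Lemma pcvg_XsubC f a : ccvg f a -> pcvg (fun n => 'X - (f n)%:P) ('X - a%:P).
Proof.
move=> h k; have h1 : ccvg (fun n => ('X : {poly R[i]})`_k + (-1) * ((f n)%:P)`_k) ('X`_k + (-1) * (a%:P)`_k).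
  by apply: ccvgD; [exact: ccvg_cst|apply: ccvgM; [exact: ccvg_cst|exact: pcvg_polyC]].
by rewrite coefB -mulN1r; apply: cvg_ext h1 => n; rewrite coefB -[- _`_k]mulN1r.
Qed.

Lemma poly_eq_horner (P Q : {poly R[i]}) : (forall u, P.[u] = Q.[u]) -> P = Q.
Proof.
move=> h; apply/eqP; rewrite -subr_eq0; apply/negPn/negP => nz.
pose rs := [seq (n%:R : R[i]) | n <- iota 0 (size (P - Q))].
have u : uniq rs by rewrite map_inj_uniq ?iota_uniq // => m n /eqP; rewrite eqr_nat => /eqP.
have al : all (root (P - Q)) rs.
  by apply/allP => x _; rewrite /root hornerD hornerN h subrr.
by have := max_poly_roots nz al u; rewrite size_map size_iota ltnn.
Qed.

(* If the complex polynomial T is the formal inverse of a real series, its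
   coefficients are real. *)
Lemma real_formal_inverse (T : {poly R[i]}) (s : nat -> R) : s 0%N != 0 ->
  (forall k, conv (fun i => T`_i) (fun i => cr (s i)) k = delta0 _ k) ->
  exists2 Tr : {poly R}, T = pC Tr & forall k, conv (fun i => Tr`_i) s k = delta0 _ k.
Proof.
move=> s0 h.
have hre k : complex.Re (conv (fun i => T`_i) (fun i => cr (s i)) k) = conv (fun i => complex.Re T`_i) s k.
  rewrite /conv (raddf_sum (@complex.Re R : Rcomplex R -> R)); apply: eq_bigr => i _ /=.
  by case: (T`_i) => x y /=; rewrite mulr0 subr0.
have him k : complex.Im (conv (fun i => T`_i) (fun i => cr (s i)) k) = conv (fun i => complex.Im T`_i) s k.
  rewrite /conv (raddf_sum (@complex.Im R : Rcomplex R -> R)); apply: eq_bigr => i _ /=.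
  by case: (T`_i) => x y /=; rewrite mulr0 add0r.
have im0 : forall k, complex.Im T`_k = 0.
  apply: (@conv_eq0 R s _ s0) => k; rewrite convC -him h /delta0.
  by case: k => [|k] /=.
have rek i : T`_i = cr (complex.Re T`_i).
  by move: (im0 i); case: (T`_i) => x y /= ->.
pose Tr : {poly R} := \poly_(i < size T) complex.Re T`_i.
have Tri i : Tr`_i = complex.Re T`_i.
  by rewrite coef_poly; case: ltnP => // hi; rewrite nth_default.
exists Tr; first by apply/polyP => i; rewrite coef_map /= Tri -rek.
move=> k; have -> : (fun i => Tr`_i) = (fun i => complex.Re T`_i) by apply/funext.
by rewrite -hre h /delta0; case: k.
Qed.

Lemma conv_poly_sums (P : {poly R}) (y : nat -> R) (u Y : R) :
  sums_to (fun k => y k * u ^+ k) Y ->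
  sums_to (fun k => conv (fun i => P`_i) y k * u ^+ k) (P.[u] * Y).
Proof.
move=> hY; rewrite horner_coef mulr_suml.
have h : (fun N => \sum_(i < size P) (P`_i * u ^+ i) * \sum_(j < N - i) y j * u ^+ j) @ \oo -->
   \sum_(i < size P) (P`_i * u ^+ i) * Y.
  apply: (@cvg_ord_sum R (fun i N => (P`_i * u ^+ i) * \sum_(j < N - i) y j * u ^+ j)
     (fun i => P`_i * u ^+ i * Y)) => i _.
  apply: seqZ; apply: eps_cvg => e e0; have [N hN] := cvg_eps hY e0.
  by exists (N + i)%N => n nN; apply: hN; lia.
apply: (@cvg_eventually_eq _ _ _ _ (size P) _ h) => N hN.
transitivity (\sum_(n < N) conv (fun i => P`_i * u ^+ i) (fun j => y j * u ^+ j) n).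
  rewrite conv_sum (@ord_sum_splitP R (fun i => P`_i * u ^+ i * \sum_(j < N - i) y j * u ^+ j) _ _ hN).
  rewrite [X in _ = _ + X]big1 ?addr0 // => i _.
  by rewrite nth_default ?leq_addr // !mul0r.
apply: eq_bigr => n _; rewrite /conv mulr_suml; apply: eq_bigr => i _.
have im : (i <= n)%N by rewrite -ltnS.
have -> : u ^+ n = u ^+ i * u ^+ (n - i) by rewrite -exprD subnKC.
by ring.
Qed.

Lemma sums_delta0 (u : R) : sums_to (fun k => delta0 R k * u ^+ k) 1.
Proof.
apply: (@cvg_eventually_eq _ (fun=> 1) _ _ 1); last exact: cvg_cst.
by case=> // n _; rewrite big_ord_recl big1 ?addr0 /delta0 ?mul1r ?expr0 // => i _; rewrite mul0r.
Qed.

(** Each S_m is at most S by positivity, while a finite number of terms already brings it near S. *)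
Lemma abel_limit (y : nat -> R) (x : nat -> R) S (Sm : nat -> R) :
  (forall n, 0 <= y n) -> (forall m, 0 <= x m <= 1) -> x @ \oo --> (1 : R) ->
  sums_to y S -> (forall m, sums_to (fun n => x m ^+ n * y n) (Sm m)) ->
  Sm @ \oo --> S.
Proof.
move=> y0 x01 hx hS hSm; apply: eps_cvg => e e0.
have e2 : 0 < e / 2 by rewrite divr_gt0.
have [N hN] := cvg_eps hS e2; have hN1 := hN N (leqnn _).
have hpoly : (fun m => \sum_(n < N) x m ^+ n * y n) @ \oo --> \sum_(n < N) y n.
  apply: (@cvg_ord_sum R (fun n m => x m ^+ n * y n) y) => n _.
  rewrite -[X in _ --> X]mul1r; apply: seqM; last exact: cvg_cst.
  elim: n => [|n IH]; first by apply: cvg_cst.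
  by rewrite -[X in _ --> X]mul1r; apply: cvg_ext (seqM hx IH) => m; rewrite exprS.
have [N2 h2] := cvg_eps hpoly e2.
exists N2 => m hm; have := h2 m hm.
have xy n : 0 <= x m ^+ n * y n <= y n.
  case/andP: (x01 m) => a1 a2; rewrite mulr_ge0 ?exprn_ge0 //=.
  by rewrite ler_piMl // exprn_ile1.
have t1 : \sum_(n < N) x m ^+ n * y n <= Sm m.
  by apply: (sums_ge N _ (hSm m)) => n; case/andP: (xy n).
have t2 : Sm m <= S.
  by apply: (cvg_le _ (hSm m) hS) => n; apply: ler_sum => i _; case/andP: (xy i).
move: hN1; rewrite !ler_norml => /andP[? ?] /andP[? ?]; apply/andP; split; lra.
Qed.

End ComplexLimits.

Section IntermediateValue.
Variable R : realType.

Lemma ivt_eps_delta (g : R -> R) (a b v : R) : a <= b ->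
  (forall x e, a <= x <= b -> 0 < e -> exists2 del, 0 < del &
     forall y, a <= y <= b -> `|x - y| < del -> `|g x - g y| <= e) ->
  Num.min (g a) (g b) <= v <= Num.max (g a) (g b) ->
  exists2 x, a <= x <= b & g x = v.
Proof.
move=> ab hg hv.
(* Clamping to [a, b] extends g to a continuous function on the whole line. *)
pose cl t := Num.max a (Num.min b t).
have clab t : a <= cl t <= b by rewrite /cl le_max lexx ge_max ab ge_min lexx.
have cl_id t : a <= t <= b -> cl t = t.
  by move=> /andP[h1 h2]; rewrite /cl (min_idPr h2) (max_idPr h1).
have cl_lip t t' : `|cl t - cl t'| <= `|t - t'|.
  have h1 := ler_norm (t - t'); have h2 := ler_norm (- (t - t')); rewrite normrN in h2.
  rewrite ler_norml /cl /Num.max /Num.min.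
  by case: (ltP b t) => ?; case: (ltP b t') => ?; case: ltP => ?; case: ltP => ?;
    apply/andP; split; lra.
pose f t := g (cl t).
have fc : continuous f.
  move=> t; apply/cvgrPdist_le => e e0.
  have [del del0 hdel] := hg (cl t) e (clab t) e0.
  apply/nbhs_ballP; exists del => // t' ht'.
  apply: hdel => //; apply: le_lt_trans (cl_lip t t') _; exact: ht'.
have [|x hx ex] := @IVT R f a b v ab (continuous_subspaceT fc).
  by rewrite /f !cl_id // ?lexx ?ab // andbT.
exists (cl x) => //.
Qed.

End IntermediateValue.

Section LargeRoots.
Variable R : realType.
Local Notation cr a := ((a : R)%:C)%C.
Local Notation pC := (map_poly (real_complex R)).

Variables (c d : nat) (p : int -> R) (tau : R) (v : 'I_d -> R -> R[i]).
Hypothesis c_gt0 : (0 < c)%N.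
Hypothesis p_ge0 : forall j : 'I_(c + d).+1, 0 <= p (@jumpv c d j).
Hypothesis p_bottom : p (- c%:Z) != 0.
Hypothesis p_top : p d%:Z != 0.
Hypothesis tau_gt0 : 0 < tau.

Let A := jump_poly c d p.
Let rho := 1 / Pval c d p tau.
Hypothesis roots : large_roots c p rho v.

Let A_ge0 := jump_poly_ge0 p_ge0.
Let A0_gt0 := jump_poly_bottom p_ge0 p_bottom.

Lemma rho_gt0 : 0 < rho.
Proof. by rewrite divr_gt0 // (Pval_gt0 p_ge0 p_bottom tau_gt0). Qed.

Lemma rho_tau : rho * A.[tau] = tau ^+ c.
Proof.
rewrite /rho (PvalE c d p (u := tau)) ?gt_eqF // div1r invf_div mulfVK //.
by rewrite gt_eqF // (jump_poly_tau_gt0 p_ge0 p_bottom tau_gt0).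
Qed.

Lemma subcritical_lt_rho z : z < rho -> z * A.[tau] < tau ^+ c.
Proof.
move=> h; rewrite -rho_tau ltr_pM2r //.
exact: (jump_poly_tau_gt0 p_ge0 p_bottom tau_gt0).
Qed.

Lemma kernel_polyE z u : kernel_poly c d p z u = (pC (kernel A c z)).[u].
Proof.
rewrite /kernel rmorphB /= map_polyXn map_polyZ hornerD hornerN hornerZ hornerXn.
congr (_ - _ * _); rewrite (@horner_coef_wide _ (c + d).+1); last first.
  by rewrite size_map_poly size_poly.
by apply: eq_bigr => j _; rewrite coef_map /= jump_polyE.
Qed.

Definition rootV z : {poly R[i]} := \prod_(l < d) ('X - (v l z)%:P).

Lemma horner_rootV z u : (rootV z).[u] = \prod_(l < d) (u - v l z).
Proof. by rewrite horner_prod; apply: eq_bigr => l _; rewrite hornerXsubC. Qed.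

Lemma kernel_split z : 0 < z <= rho -> exists2 Sm : {poly R[i]}, Sm \is monic /\ size Sm = c.+1 &
  pC (kernel A c z) = (- cr (z * p d%:Z))%:P * rootV z * Sm.
Proof.
move=> hz; case: roots => h _ _; have [s hs] := h z hz.
exists (\prod_(i < c) ('X - (s i)%:P)).
  split; first by apply: monic_prod => i _; apply: monicXsubC.
  by rewrite size_prod_XsubC /index_enum -enumT size_enum_ord.
apply: poly_eq_horner => u; rewrite -kernel_polyE hs !hornerM hornerC horner_rootV.
by congr (_ * _); rewrite horner_prod; apply: eq_bigr => i _; rewrite hornerXsubC.
Qed.

Lemma root_kernel z l : 0 < z <= rho -> (pC (kernel A c z)).[v l z] = 0.
Proof.
move=> hz; have [Sm _ ->] := kernel_split hz.
by rewrite !hornerM horner_rootV (bigD1 l) //= subrr mul0r mulr0 mul0r.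
Qed.

Lemma kernel_no_root z u : 0 < z < rho -> cnorm u = tau -> (pC (kernel A c z)).[u] != 0.
Proof.
move=> /andP[z0 zr] hu; apply/eqP => h.
have e : u ^+ c = cr z * (pC A).[u].
  apply/eqP; rewrite -subr_eq0 -h /kernel rmorphB /= map_polyXn map_polyZ.
  by rewrite hornerD hornerN hornerZ hornerXn.
have h2 : tau ^+ c <= z * A.[tau].
  rewrite -hu -cnormX e cnormM cnorm_real (gtr0_norm z0); apply: ler_wpM2l; first exact: ltW.
  exact: cnorm_pC_horner.
by have := subcritical_lt_rho zr; rewrite ltNge h2.
Qed.

(** |v_l| is continuous and unbounded near 0, so to fall to tau or below it would have to take the
    value tau, where the kernel has no root for z < rho. *)
Lemma large_root_outside z l : 0 < z < rho -> tau < cnorm (v l z).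
Proof.
move=> /andP[z0 zr]; rewrite ltNge; apply/negP => hle.
case: roots => _ hcont hinf.
have [del del0 hdel] := hinf l tau.
pose z2 := Num.min z (del / 2).
have z20 : 0 < z2 by rewrite lt_min z0 divr_gt0.
have z2z : z2 <= z by rewrite ge_min lexx.
have z2d : z2 < del.
  by apply: le_lt_trans (_ : del / 2 < del); [rewrite ge_min lexx orbT|rewrite gtr_pMr //; lra].
have hz2 : tau < cnorm (v l z2).
  apply: hdel; first by rewrite z20.
  by apply: le_trans z2z (ltW zr).
have inr x : z2 <= x <= z -> 0 < x <= rho.
  move=> /andP[x1 x2]; rewrite (lt_le_trans z20 x1) /=; exact: le_trans x2 (ltW zr).
have [||x hx ex] := @ivt_eps_delta R (fun t => cnorm (v l t)) z2 z tau z2z.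
- move=> x e hx e0; have [de de0 hde] := hcont l x (inr x hx) e e0.
  exists de => // y hy hxy; have h := ltW (hde y (inr y hy) hxy).
  have h1 := cnorm_le_dist (v l x) (v l y); have h2 := cnorm_le_dist (v l y) (v l x).
  rewrite (cnorm_distC (v l y)) in h2.
  rewrite ler_norml; apply/andP; split; lra.
- by rewrite ge_min hle orbT le_max (ltW hz2).
have hx2 : 0 < x < rho.
  case/andP: hx => x1 x2; rewrite (lt_le_trans z20 x1) /=; exact: le_lt_trans x2 zr.
have := kernel_no_root hx2 ex; rewrite root_kernel ?eqxx //.
by case/andP: hx2 => -> /ltW ->.
Qed.

(** Shown below to be the inverse of M(z,u) as a power series in u. *)
Definition rootT z : {poly R[i]} := (- cr (z * p d%:Z))%:P * rootV z.

Lemma rootT_coef_neq0 z : 0 < z -> - cr (z * p d%:Z) != 0 :> R[i].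
Proof. by move=> z0; rewrite oppr_eq0 fmorph_eq0 mulf_neq0 // gt_eqF. Qed.

Lemma rootT_series_lt z s : 0 < z < rho ->
  (forall k, sums_to (fun n => z ^+ n * (meander A c n)`_k) (s k)) ->
  forall k, conv (fun i => (rootT z)`_i) (fun i => cr (s i)) k = delta0 _ k.
Proof.
move=> hz hs k; case/andP: (hz) => z0 zr.
have hz' : 0 < z <= rho by rewrite z0 ltW.
have [Sm [Sm1 Sm2] e] := kernel_split hz'.
apply: (@root_series R A c A_ge0 A0_gt0 c_gt0 z tau z0 tau_gt0 (subcritical_lt_rho zr) s hs (rootV z) Sm _
  (rootT_coef_neq0 z0) _ Sm1 Sm2 _ e).
  by apply: monic_prod => i _; apply: monicXsubC.
move=> u; rewrite /root horner_rootV => /prodf_eq0[l _]; rewrite subr_eq0 => /eqP ->.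
exact: large_root_outside.
Qed.

(** At z = rho the strict inequality at tau is lost, so the identity is passed to the limit along z
    = x_m rho: the v_l are continuous and the meander series follow by [abel_limit]. *)
Lemma rootT_series z s : 0 < z <= rho ->
  (forall k, sums_to (fun n => z ^+ n * (meander A c n)`_k) (s k)) ->
  forall k, conv (fun i => (rootT z)`_i) (fun i => cr (s i)) k = delta0 _ k.
Proof.
move=> /andP[z0]; rewrite le_eqVlt => /orP[/eqP er|zr] hs; last first.
  by apply: rootT_series_lt => //; rewrite z0.
subst z.
pose x (m : nat) : R := 1 - (m.+2%:R)^-1.
have x01 m : 0 < x m < 1.
  have h0 : 0 < (m.+2%:R : R)^-1 by rewrite invr_gt0.
  have h1 : (m.+2%:R : R)^-1 <= 2^-1 by rewrite lef_pV2 ?posrE // ler_nat.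
  rewrite /x; move: (_^-1) h0 h1 => t h0 h1; apply/andP; split; last lra.
  by rewrite subr_gt0; apply: le_lt_trans h1 _; rewrite invf_lt1 // ltr1n.
have x1 : x @ \oo --> (1 : R).
  rewrite -[X in _ --> X]subr0; apply: seqB; first exact: cvg_cst.
  by apply: (@cvg_reindex R (@harmonic R) 0 (fun n => n.+1)); [|exact: cvg_harmonic].
have y0 k n : 0 <= rho ^+ n * (meander A c n)`_k.
  by rewrite mulr_ge0 ?exprn_ge0 ?(ltW rho_gt0) // meander_ge0.
have hsm m k : exists S, sums_to (fun n => (x m) ^+ n * (rho ^+ n * (meander A c n)`_k)) S.
  have [n|S hS _] := @sums_comp R (fun n => (x m) ^+ n * (rho ^+ n * (meander A c n)`_k)) _ (s k) _ (hs k).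
    case/andP: (x01 m) => a1 a2; rewrite mulr_ge0 ?exprn_ge0 ?(ltW a1) //=.
    by rewrite ler_piMl // exprn_ile1 ?ltW.
  by exists S.
pose sm m k : R := sval (cid (hsm m k)).
have hsmk m k : sums_to (fun n => (x m) ^+ n * (rho ^+ n * (meander A c n)`_k)) (sm m k).
  exact: (svalP (cid (hsm m k))).
have slim k : (sm ^~ k) @ \oo --> s k.
  apply: (@abel_limit R (fun n => rho ^+ n * (meander A c n)`_k) x) => //.
  by move=> m; case/andP: (x01 m) => a1 a2; rewrite !ltW.
have hz m : 0 < x m * rho < rho.
  case/andP: (x01 m) => a1 a2; rewrite mulr_gt0 ?rho_gt0 //= gtr_pMl ?rho_gt0 //.
have hconv m k : conv (fun i => (rootT (x m * rho))`_i) (fun i => cr (sm m i)) k = delta0 _ k.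
  apply: (rootT_series_lt (hz m)) => j; apply: cvg_ext (hsmk m j) => N.
  by apply: eq_bigr => i _; rewrite [(x m * rho) ^+ i]exprMn mulrA.
have hxr : (fun m => x m * rho) @ \oo --> rho.
  by rewrite -[X in _ --> X]mul1r; apply: seqM; [exact: x1|exact: cvg_cst].
have vlim l : ccvg (fun m => v l (x m * rho)) (v l rho).
  case: roots => _ hcont _; apply: eps_cvg => e e0.
  have hr : 0 < rho <= rho by rewrite rho_gt0 lexx.
  have [del del0 hdel] := hcont l rho hr e e0.
  have d2 : 0 < del / 2 by rewrite divr_gt0.
  have [N hN] := cvg_eps hxr d2; exists N => m /hN h.
  rewrite subr0 ger0_norm ?cnorm_ge0 // cnorm_distC; apply: ltW; apply: hdel.
    by case/andP: (hz m) => -> /ltW ->.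
  by rewrite distrC; apply: le_lt_trans h _; lra.
have Tlim : pcvg (fun m => rootT (x m * rho)) (rootT rho).
  apply: pcvgM.
    apply: (@pcvg_polyC R (fun m => - cr (x m * rho * p d%:Z))).
    have h : (fun m => - (x m * rho * p d%:Z)) @ \oo --> - (rho * p d%:Z).
      have := seqZ (a := - p d%:Z) hxr; rewrite mulNr [p _ * _]mulrC => h'.
      by apply: cvg_ext h' => m; rewrite mulNr mulrC.
    by have := ccvg_real h; rewrite rmorphN => h'; apply: cvg_ext h' => m; rewrite rmorphN.
  apply: (@pcvg_prod R _ (index_enum 'I_d) (fun l m => 'X - (v l (x m * rho))%:P) (fun l => 'X - (v l rho)%:P)) => l.
  exact: pcvg_XsubC.
move=> k.
have h := @ccvg_sum R (fun i m => (rootT (x m * rho))`_i * cr (sm m (k - i)%N))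
   (fun i => (rootT rho)`_i * cr (s (k - i)%N)) k.+1.
apply: (@ccvg_uniq R (fun=> delta0 _ k) (conv (fun i => (rootT rho)`_i) (fun i => cr (s i)) k)); last exact: ccvg_cst.
apply: cvg_ext (h _) => [m|i _]; first by rewrite -(hconv m).
by apply: ccvgM; [apply: Tlim|apply: ccvg_real; apply: slim].
Qed.

(** T M = 1 at u and at 1, so M(u)/M(1) = T(1)/T(u) and the leading coefficient cancels. T has real
    coefficients because its inverse has. *)
Lemma root_product z s (S1 : R) : 0 < z <= rho ->
  (forall k, sums_to (fun n => z ^+ n * (meander A c n)`_k) (s k)) ->
  sums_to s S1 -> forall u Mu, sums_to (fun k => s k * u ^+ k) Mu ->
  cr (Mu / S1) = root_prod v z u.
Proof.
move=> hz hs hS1 u Mu hMu.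
have z0 : 0 < z by case/andP: hz.
have s0 : s 0%N != 0.
  by rewrite gt_eqF //; apply: lt_le_trans (s0_ge1 A_ge0 z0 hs).
have hT := rootT_series hz hs.
have [Tr eT hTr] := real_formal_inverse s0 hT.
have ev x X : sums_to (fun k => s k * x ^+ k) X -> Tr.[x] * X = 1.
  move=> hX; have h1 := conv_poly_sums (P := Tr) hX.
  have h2 : sums_to (fun k => conv (fun i => Tr`_i) s k * x ^+ k) 1.
    by apply: cvg_ext (sums_delta0 x) => n; apply: eq_bigr => i _; rewrite hTr.
  exact: (cvg_uniq h1 h2).
have e1 := ev u Mu hMu.
have hS1' : sums_to (fun k => s k * 1 ^+ k) S1.
  by apply: cvg_ext hS1 => n; apply: eq_bigr => i _; rewrite expr1n mulr1.
have e2 := ev 1 S1 hS1'.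
have T1 : cr Tr.[1] = - cr (z * p d%:Z) * \prod_(l < d) (1 - v l z).
  have := congr1 (fun q : {poly R[i]} => q.[1]) eT; rewrite /rootT hornerM hornerC horner_rootV.
  by move=> ->; rewrite -[1 in RHS](rmorph1 (real_complex R)) horner_map.
have Tu : cr Tr.[u] = - cr (z * p d%:Z) * \prod_(l < d) (cr u - v l z).
  have := congr1 (fun q : {poly R[i]} => q.[cr u]) eT; rewrite /rootT hornerM hornerC horner_rootV.
  by move=> ->; rewrite horner_map.
have b0 := rootT_coef_neq0 z0.
have Tu0 : Tr.[u] != 0 by apply/eqP => h; move/eqP: e1; rewrite h mul0r eq_sym oner_eq0.
have S10 : S1 != 0 by apply/eqP => h; move/eqP: e2; rewrite h mulr0 eq_sym oner_eq0.
have -> : Mu / S1 = Tr.[1] / Tr.[u].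
  have -> : Mu = (Tr.[u])^-1 by apply: (mulfI Tu0); rewrite e1 mulfV.
  have -> : Tr.[1] = S1^-1 by apply: (mulIf S10); rewrite e2 mulVf.
  by rewrite mulrC.
rewrite /root_prod prodf_div rmorphM fmorphV /= T1 Tu.
rewrite invfM mulrACA mulfV // mul1r.
by [].
Qed.

End LargeRoots.

(** * Critical renewal sequences *)

Section Quotients.
Variable R : realType.
Implicit Types (x y a : nat -> R).

Lemma cvg_sub_reindex y (Y : R) k : y @ \oo --> Y -> (fun n => y (n - k)%N) @ \oo --> Y.
Proof.
move=> hy; apply: eps_cvg => e e0; have [N hN] := cvg_eps hy e0.
exists (N + k)%N => n hn; apply: hN.
by move: hn; clear; lia.
Qed.

Lemma conv_cvg u y (U Y : R) : u @ \oo --> U -> (forall n, 0 <= y n) -> sums_to y Y ->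
  conv u y @ \oo --> U * Y.
Proof.
move=> hu y0 hY; have [K K0 hK] := cvg_bounded hu.
have h := @tannery R (fun n k => y k * u (n - k)%N) (fun k => U * y k) (fun k => K * y k)
  (K * Y) (U * Y) (fun n => n.+1).
apply: cvg_ext (h _ _ _ _ _) => [n|k|n k|||n].
- by rewrite convC.
- by rewrite mulrC; apply: seqZ; apply: cvg_sub_reindex.
- by rewrite normrM (ger0_norm (y0 k)) mulrC ler_wpM2r.
- exact: sumsZ.
- exact: sumsZ.
- exact: leqnSn.
Qed.

(** Mertens' theorem: absolute convergence of one factor is enough. *)
Lemma sums_conv_abs x y (b X Y : R) : sums_to (fun n => `|x n|) b -> sums_to x X ->
  sums_to y Y -> sums_to (conv x y) (X * Y).
Proof.
move=> hb hX hY; have [K K0 hK] := cvg_bounded hY.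
have h := @tannery R (fun n k => x k * \sum_(j < n - k) y j) (fun k => Y * x k)
  (fun k => K * `|x k|) (K * b) (Y * X) id.
rewrite mulrC; apply: cvg_ext (h _ _ _ _ _) => [n|k|n k|||n //].
- by rewrite conv_sum.
- rewrite mulrC; apply: seqZ; exact: (cvg_sub_reindex (y := fun n => \sum_(j < n) y j)).
- by rewrite normrM mulrC ler_wpM2r.
- exact: sumsZ.
- exact: sumsZ.
Qed.

(** The common factor a stands for sqrt(n) u_n, known only to stay away from 0; it cancels without
    having a limit. *)
Lemma cvg_ratio a x y (c X Y : R) N : 0 < c -> (forall n, (N <= n)%N -> c <= a n) ->
  (fun n => y n - a n * Y) @ \oo --> (0 : R) -> (fun n => x n - a n * X) @ \oo --> (0 : R) ->
  X != 0 -> (fun n => y n / x n) @ \oo --> Y / X.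
Proof.
move=> c0 ha hy hx X0.
have aux z Z : (fun n => z n - a n * Z) @ \oo --> (0 : R) -> (fun n => z n / a n) @ \oo --> Z.
  move=> h; apply: eps_cvg => e e0.
  have [N1 hN1] := cvg_eps h (mulr_gt0 e0 c0).
  exists (maxn N N1) => n; rewrite geq_max => /andP[h1 h2].
  have an : 0 < a n := lt_le_trans c0 (ha n h1).
  have -> : z n / a n - Z = (z n - a n * Z) / a n by rewrite mulrBl mulrAC mulfV ?gt_eqF // mul1r.
  rewrite normrM normfV (gtr0_norm an) ler_pdivrMr //.
  apply: le_trans (_ : e * c <= _); first by have := hN1 n h2; rewrite subr0.
  by apply: ler_wpM2l; [exact: ltW|exact: ha].
apply: (@cvg_eventually_eq _ (fun n => (y n / a n) * (x n / a n)^-1) _ _ N).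
  move=> n hn; have an : a n != 0 by rewrite gt_eqF // (lt_le_trans c0 (ha n hn)).
  by rewrite invf_div mulrA mulfVK.
by apply: seqM; [exact: aux|apply: seqV => //; exact: aux].
Qed.

Lemma decay3_shift (f : nat -> R) (l : R) : decay3 (fun n => f n.+1) l -> decay3 f l.
Proof.
move=> h; have [B B0 hB] := decay3_bound h.
suff hs : (fun n => rt R n.+1 ^+ 3 * f n.+1) @ \oo --> l.
  apply: eps_cvg => e e0; have [N hN] := cvg_eps hs e0.
  by exists N.+1 => -[//|n] hn; apply: hN.
have hd : (fun n => (rt R n.+1 ^+ 3 - rt R n ^+ 3) * f n.+1) @ \oo --> (0 : R).
  apply: cvg_squeeze0 (@rtVZ_cvg0 R (12 * B)) => n.
  have r0 := rt_gt0 R n; have r1 := rt_ge1 R n; have st := rt_step R n.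
  have rm := rt_le R (leqnSn n).
  have h1 : 0 <= rt R n.+1 ^+ 3 - rt R n ^+ 3 <= 12 * rt R n ^+ 2.
    move: (rt R n) (rt R n.+1) r0 r1 st rm => a b r0 r1 st rm.
    have -> : b ^+ 3 - a ^+ 3 = (b - a) * (b ^+ 2 + a * b + a ^+ 2) by ring.
    have b2 : b <= 2 * a by lra.
    have q : 0 <= b ^+ 2 + a * b + a ^+ 2 <= 12 * a ^+ 2 by apply/andP; split; nra.
    case/andP: q => q1 q2; apply/andP; split; first by rewrite mulr_ge0 // subr_ge0.
    by apply: le_trans q2; apply: ler_piMl => //; lra.
  case/andP: h1 => h1 h2; rewrite normrM (ger0_norm h1).
  apply: le_trans (ler_pM h1 (normr_ge0 _) h2 (hB n)) _.
  rewrite le_eqVlt; apply/orP; left; apply/eqP; have r2 := rt_neq0 R n; field.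
  exact: r2.
have := seqD h hd; rewrite addr0; apply: cvg_ext => n.
by rewrite -mulrDl addrC subrK.
Qed.

End Quotients.

Section CriticalIncrements.
Variable R : realType.
Variables (f u : nat -> R) (n0 : nat) (l : R).
Hypothesis f0 : f 0%N = 0.
Hypothesis f_ge0 : forall n, 0 <= f n.
Hypothesis u_eq : forall n, u n = delta0 R n + conv f u n.
Hypothesis f_sum1 : sums_to f 1.
Hypothesis f_gt0 : forall n, (n0 <= n)%N -> 0 < f n.
Hypothesis l_gt0 : 0 < l.
Hypothesis f_decay : decay3 f l.

Let u_ge0 := renewal_ge0 f0 f_ge0 u_eq.

Lemma uinc_sqrt_bound : exists2 C, 0 <= C & forall n, `|uinc u n| <= C / rt R n.
Proof.
have [C C0 hC] := renewal_upper f0 f_ge0 u_eq f_sum1 l_gt0 f_decay.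
exists C => // n; have h1 := hC n; have h2 := hC n.+1.
have h3 : C / rt R n.+1 <= C / rt R n.
  by apply: ler_wpM2l => //; rewrite lef_pV2 ?posrE ?rt_gt0 // rt_le.
have a0 := u_ge0 n; have a1 := u_ge0 n.+1.
by rewrite ler_norml /uinc; move: (C / _) (C / _) h1 h2 h3 => t1 t2 *; apply/andP; split; lra.
Qed.

Lemma rt_steps n j : rt R (n + j) - rt R n <= j%:R.
Proof.
elim: j => [|j IH]; first by rewrite addn0 subrr.
by have := rt_step R (n + j); rewrite addnS -[j.+1%:R]natr1; lra.
Qed.

(** Over a window of fixed length [rt] is nearly constant, so the sum is close to rt n (u(n+L) -
    u(n)), of size at most C whatever L is. The error is below 1 for large n. *)
Lemma sqrt_increments_window C L : 0 <= C -> (forall n, `|uinc u n| <= C / rt R n) ->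
  (forall n, u n <= C / rt R n) ->
  exists N, forall n, (N <= n)%N ->
    `|\sum_(j < L) rt R (n + j) * uinc u (n + j)| <= C + 1.
Proof.
move=> C0 hC hu.
have [N hN] := cvg_eps (@rtVZ_cvg0 R (L%:R * (L%:R * C))) ltr01.
exists N => n /hN; rewrite subr0 => hn.
have hn1 := le_trans (ler_norm _) hn.
have -> : \sum_(j < L) rt R (n + j) * uinc u (n + j) =
    \sum_(j < L) (rt R (n + j) - rt R n) * uinc u (n + j) + rt R n * (u (n + L)%N - u n).
  rewrite -(sum_uinc u n L) mulr_sumr -big_split; apply: eq_bigr => j _.
  by rewrite /= -mulrDl subrK.
rewrite addrC; apply: le_trans (ler_normD _ _) _; apply: lerD.
  rewrite normrM (gtr0_norm (rt_gt0 R n)) mulrC -ler_pdivlMr ?rt_gt0 //.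
  have h1 := hu n; have h2 := hu (n + L)%N; have a0 := u_ge0 n; have a1 := u_ge0 (n + L)%N.
  have h3 : C / rt R (n + L) <= C / rt R n.
    by apply: ler_wpM2l => //; rewrite lef_pV2 ?posrE ?rt_gt0 // rt_le // leq_addr.
  by rewrite ler_norml; move: (C / _) (C / _) h1 h2 h3 => t1 t2 *; apply/andP; split; lra.
apply: le_trans (ler_norm_sum _ _ _) _; apply: le_trans hn1.
apply: le_trans (_ : \sum_(j < L) L%:R * (C / rt R n) <= _); last first.
  by rewrite sumr_const card_ord -[leLHS]mulr_natl !mulrA.
apply: ler_sum => j _; rewrite normrM; apply: ler_pM => //.
  rewrite ger0_norm ?subr_ge0 ?rt_le ?leq_addr //.
  by apply: le_trans (rt_steps n j) _; rewrite ler_nat ltnW.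
apply: le_trans (hC _) _; apply: ler_wpM2l => //.
by rewrite lef_pV2 ?posrE ?rt_gt0 // rt_le // leq_addr.
Qed.

Lemma sqrt_increments_tail C B K n : 0 <= C -> (forall n, `|uinc u n| <= C / rt R n) ->
  0 <= B -> (forall n, `|f n| <= B / rt R n ^+ 3) -> (K <= n)%N ->
  `|\sum_(i < n.+1 - K) f (K + i)%N * uinc u (n - (K + i))%N| <=
     B / rt R K ^+ 3 * (C * (2 * rt R n.+1)).
Proof.
move=> C0 hC B0 hB Kn; apply: le_trans (ler_norm_sum _ _ _) _.
have q0 : 0 <= B / rt R K ^+ 3 by rewrite divr_ge0 // exprn_ge0 // rt_ge0.
apply: le_trans (_ : \sum_(i < n.+1 - K) B / rt R K ^+ 3 * (C / rt R (n - (K + i))) <= _).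
  apply: ler_sum => i _; rewrite normrM; apply: ler_pM => //.
  apply: le_trans (hB _) _; apply: ler_wpM2l => //.
  rewrite lef_pV2 ?posrE ?exprn_gt0 ?rt_gt0 //.
  by apply: lerXn2r; rewrite ?nnegrE ?rt_ge0 // rt_le // leq_addr.
rewrite -mulr_sumr; apply: ler_wpM2l => //; rewrite -mulr_sumr; apply: ler_wpM2l => //.
rewrite (reindex_inj rev_ord_inj) /=.
rewrite (eq_bigr (fun i : 'I_(n.+1 - K) => (rt R i)^-1)); last first.
  by move=> i _; congr (rt R _)^-1; have := ltn_ord i; clear -Kn; lia.
apply: le_trans (sum_rtV R _) _; apply: ler_wpM2l => //.
by rewrite rt_le // leq_subr.
Qed.

(** a_n = sqrt(n) times the increment nearly satisfies the averaging equation, with three errors: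
    the forcing term f(n+1), the replacement of rt n by rt (n - j) for j < K, and the tail j >= K. K
    is a fixed fraction of n, which makes the tail O(1/n) before scaling. *)
Lemma renewal_sqrt_increments : (fun n => rt R n * (u n.+1 - u n)) @ \oo --> (0 : R).
Proof.
have [C1 C10 hC1] := uinc_sqrt_bound.
have [C2 C20 hC2] := renewal_upper f0 f_ge0 u_eq f_sum1 l_gt0 f_decay.
pose C := C1 + C2; have C0 : 0 <= C by rewrite addr_ge0.
have hCe n : `|uinc u n| <= C / rt R n.
  by apply: le_trans (hC1 n) _; rewrite ler_wpM2r ?invr_ge0 ?rt_ge0 // lerDl.
have hCu n : u n <= C / rt R n.
  by apply: le_trans (hC2 n) _; rewrite ler_wpM2r ?invr_ge0 ?rt_ge0 // lerDr.
have [B B0 hB] := decay3_bound f_decay.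
pose a n := rt R n * uinc u n.
have ab n : `|a n| <= C.
  by rewrite /a normrM (gtr0_norm (rt_gt0 R n)) mulrC -ler_pdivlMr ?rt_gt0.
apply: (@averaging_cvg0 R f a C (C + 1) n0) => //.
- exact: f_sum_le1 f_ge0 f_sum1.
- move=> e M e0.
  (* This ratio makes the relative change of [rt] over j < K at most e/(3(C+1)). Doubling L0 below
     also gives K + M <= n. *)
  have lam : 1 < 1 + e / 3 / (C + 1).
    by rewrite ltrDl divr_gt0 ?divr_gt0 // ltr_wpDl.
  have [L0 L00 hL0] := rt_ratio lam.
  pose L := (2 * L0)%N.
  have e3 : 0 < e / 3 by rewrite divr_gt0.
  have [N1 hN1] := cvg_eps (@rtVZ_cvg0 R (B)) e3.
  pose D := B * (C * (4 * (2 * L%:R) ^+ 3)).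
  have [N2 hN2] := cvg_eps (@rtVZ_cvg0 R (D)) e3.
  exists (maxn (maxn N1 N2) (maxn 1 (L * M))) => n; rewrite !geq_max => /andP[/andP[n1 n2] /andP[n3 n4]].
  pose K := (n %/ L)%N; exists K.
  have L2 : (2 <= L)%N by clear -L00; rewrite /L; lia.
  have KL : (K * L <= n)%N := leq_trunc_div n L.
  have KL2 : (n < K.+1 * L)%N by rewrite ltn_ceil //; clear -L2; lia.
  have MK : (M <= K)%N by rewrite leq_divRL 1?mulnC //; clear -L2; lia.
  have KM : (K + M <= n)%N by clear -KL L2 MK; nia.
  split=> //.
  have Kn : (K <= n)%N by apply: leq_trans KM; rewrite leq_addr.
  have -> : a n - \sum_(j < K) f j * a (n - j)%N =
      rt R n * f n.+1 + \sum_(j < K) f j * ((rt R n - rt R (n - j)) * uinc u (n - j)%N)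
      + rt R n * \sum_(i < n.+1 - K) f (K + i)%N * uinc u (n - (K + i))%N.
    rewrite /a (uinc_eq f0 u_eq n3) /conv (@ord_sum_splitP _ (fun i => f i * uinc u (n - i)%N) K n.+1) ?(leqW Kn) //.
    have -> : \sum_(j < K) f j * ((rt R n - rt R (n - j)) * uinc u (n - j)%N) =
        rt R n * (\sum_(j < K) f j * uinc u (n - j)%N) -
        \sum_(j < K) f j * (rt R (n - j)%N * uinc u (n - j)%N).
      by rewrite mulr_sumr -sumrB; apply: eq_bigr => j _ /=; ring.
    by ring.
  have [k1 k2 k3] : [/\ `|rt R n * f n.+1| <= e / 3,
    `|\sum_(j < K) f j * ((rt R n - rt R (n - j)) * uinc u (n - j)%N)| <= e / 3 &
    `|rt R n * \sum_(i < n.+1 - K) f (K + i)%N * uinc u (n - (K + i))%N| <= e / 3]; last first.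
    apply: le_trans (ler_normD _ _) _; apply: le_trans (lerD (ler_normD _ _) (lexx _)) _.
    by move: `|_| `|_| `|_| k1 k2 k3 => *; lra.
  split.
  + apply: le_trans (le_trans (ler_norm _) _); last by have := hN1 n n1; rewrite subr0; exact.
    rewrite normrM (gtr0_norm (rt_gt0 R n)).
    have r0 := rt_gt0 R n; have r1 := rt_ge1 R n.
    apply: le_trans (_ : rt R n * (B / rt R n ^+ 3) <= _).
      apply: ler_wpM2l; first exact: ltW.
      apply: le_trans (hB _) _; apply: ler_wpM2l => //.
      rewrite lef_pV2 ?posrE ?exprn_gt0 ?rt_gt0 //.
      by apply: lerXn2r; rewrite ?nnegrE ?rt_ge0 // rt_le.
    rewrite mulrCA; apply: ler_wpM2l => //.
    rewrite exprSr invfM mulrCA mulfV ?rt_neq0 // mulr1.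
    by rewrite lef_pV2 ?posrE ?exprn_gt0 ?rt_gt0 // expr2 ler_peMl // ltW.
  + apply: le_trans (ler_norm_sum _ _ _) _.
    apply: le_trans (_ : \sum_(j < K) f j * (e / 3) <= _); last first.
      rewrite -mulr_suml -[leRHS]mul1r; apply: ler_wpM2r; first exact: ltW.
      exact: f_sum_le1 f_ge0 f_sum1 K.
    apply: ler_sum => j _; rewrite normrM (ger0_norm (f_ge0 _)); apply: ler_wpM2l => //.
    have hj : (L0 * j <= n)%N by have := ltn_ord j; clear -KL; rewrite /L in KL *; nia.
    have hr := hL0 n j hj.
    rewrite normrM ger0_norm ?subr_ge0 ?rt_le ?leq_subr //.
    apply: le_trans (_ : (e / 3 / (C + 1) * rt R (n - j)) * `|uinc u (n - j)| <= _).
      by apply: ler_wpM2r => //; move: hr; rewrite mulrDl mul1r; lra.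
    have -> : e / 3 / (C + 1) * rt R (n - j) * `|uinc u (n - j)| = e / 3 * (`|a (n - j)%N| / (C + 1)).
      rewrite /a normrM (gtr0_norm (rt_gt0 R _)) -!mulrA; congr (_ * (_ * _)); by rewrite mulrC -mulrA.
    apply: ler_piMr; first exact: ltW.
    by rewrite ler_pdivrMr ?ltr_wpDl // mul1r; apply: le_trans (ab _) _; rewrite lerDl.
  + rewrite normrM (gtr0_norm (rt_gt0 R n)).
    have h := sqrt_increments_tail C0 hCe B0 hB Kn.
    apply: le_trans (ler_wpM2l (rt_ge0 R n) h) _.
    apply: le_trans (le_trans (ler_norm _) _); last by have := hN2 n n2; rewrite subr0; exact.
    have rK0 := rt_gt0 R K; have rn := rt_gt0 R n.
    have rn1 : rt R n.+1 <= 2 * rt R n by have := rt_step R n; have := rt_ge1 R n; lra.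
    have rK : rt R n <= 2 * L%:R * rt R K.
      apply: le_trans (rt_large R (L := L) (i := K.+1) _) _; first by rewrite mulnC.
      rewrite -mulrA mulrCA; apply: ler_wpM2l; first exact: ler0n.
      by have := rt_step R K; have := rt_ge1 R K; lra.
    rewrite /D.
    have -> : rt R n * (B / rt R K ^+ 3 * (C * (2 * rt R n.+1))) =
       B * (C * (2 * (rt R n * rt R n.+1 / rt R K ^+ 3))) by field; exact: rt_neq0.
    have -> : B * (C * (4 * (2 * L%:R) ^+ 3)) / rt R n =
       B * (C * (2 * (2 * (2 * L%:R) ^+ 3 / rt R n))) by ring.
    do 3 (apply: ler_wpM2l => //).
    rewrite ler_pdivrMr ?exprn_gt0 // mulrAC ler_pdivlMr //.
    apply: le_trans (_ : 2 * rt R n ^+ 3 <= _).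
      have -> : 2 * rt R n ^+ 3 = rt R n * (2 * rt R n) * rt R n by ring.
      by apply: ler_wpM2r; [exact: ltW|apply: ler_wpM2l; first exact: ltW].
    have -> : 2 * (2 * L%:R) ^+ 3 * rt R K ^+ 3 = 2 * (2 * L%:R * rt R K) ^+ 3 by ring.
    apply: ler_wpM2l => //; apply: lerXn2r; rewrite ?nnegrE ?rt_ge0 //.
    by rewrite !mulr_ge0 ?rt_ge0.
- move=> L; apply: sqrt_increments_window => //.
Qed.

End CriticalIncrements.

(** * Drift and summability *)

Section RealPowers.
Variable R : realType.

Lemma expr_sub_itv (t : R) j : 0 <= t <= 1 ->
  1 - j%:R * t <= (1 - t) ^+ j <= 1 - j%:R * t + j%:R ^+ 2 * t ^+ 2.
Proof.
move=> /andP[t0 t1]; elim: j => [|j /andP[h1 h2]].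
  by rewrite expr0 mul0r subr0 expr0n /= mul0r addr0 lexx.
have j0 : 0 <= j%:R :> R := ler0n _ _.
rewrite exprS -[j.+1%:R]natr1; move: ((1 - t) ^+ j) (j%:R : R) h1 h2 j0 => y x h1 h2 j0.
have h3 : (1 - t) * (1 - x * t) <= (1 - t) * y by apply: ler_wpM2l => //; lra.
have h4 : (1 - t) * y <= (1 - t) * (1 - x * t + x ^+ 2 * t ^+ 2).
  by apply: ler_wpM2l => //; lra.
by apply/andP; split; nra.
Qed.

(** Bernoulli's inequality for the exponent j - c of either sign, multiplied by x^c to stay among
    natural powers. *)
Lemma bernoulli_shifted (x : R) j c : 0 <= x ->
  x ^+ c * (1 + (j%:R - c%:R) * (x - 1)) <= x ^+ j.
Proof.
move=> x0; have [jc|cj] := leqP c j.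
  rewrite -(subnKC jc); move: (j - c)%N => k; rewrite natrD addrAC subrr add0r exprD.
  apply: ler_wpM2l; first exact: exprn_ge0.
  elim: k => [|k IH]; first by rewrite mul0r addr0.
  have k0 : 0 <= k%:R :> R := ler0n _ _.
  rewrite exprS -[k.+1%:R]natr1; have := ler_wpM2l x0 IH; have := mulr_ge0 k0 (sqr_ge0 (x - 1)).
  by move: (x ^+ k) (k%:R : R) k0 => y w; lra.
rewrite -(subnKC (ltnW cj)); move: (c - j)%N => k; rewrite natrD exprD -mulrA.
apply: ler_piMr; first exact: exprn_ge0.
have -> : j%:R - (j%:R + k%:R) = - k%:R :> R by ring.
elim: k => [|k IH]; first by rewrite oppr0 mul0r addr0 mulr1.
apply: le_trans IH; rewrite exprSr -mulrA; apply: ler_wpM2l; first exact: exprn_ge0.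
have k0 : 0 <= k%:R :> R := ler0n _ _.
rewrite -[k.+1%:R]natr1; have := mulr_ge0 (addr_ge0 k0 ler01) (sqr_ge0 (x - 1)).
by move: (k%:R : R) k0 => w; lra.
Qed.

Lemma sums_ord (F : nat -> nat -> R) (l : nat -> R) K : (forall k, (k < K)%N -> sums_to (F k) (l k)) ->
  sums_to (fun n => \sum_(k < K) F k n) (\sum_(k < K) l k).
Proof.
move=> h; apply: cvg_ext (cvg_ord_sum (F := fun k N => \sum_(i < N) F k i) h) => N.
by rewrite exchange_big.
Qed.

End RealPowers.

Section Drift.
Variable R : realType.
Variables (A : {poly R}) (c N0 : nat) (rho tau : R).
Hypothesis A_ge0 : forall j, 0 <= A`_j.
Hypothesis A0_gt0 : 0 < A`_0.
Hypothesis c_gt0 : (0 < c)%N.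
Hypothesis size_A : (size A <= N0)%N.
Hypothesis tau_gt0 : 0 < tau.
Hypothesis rho_gt0 : 0 < rho.
Hypothesis rhoA_tau : rho * A.[tau] = tau ^+ c.
Hypothesis saddle : \sum_(j < N0) (j%:R - c%:R) * (A`_j * tau ^+ j) = 0.

(* tau minimises P on the positive reals: Bernoulli's inequality for tau^(c - j). *)
Lemma saddle_minimal : 1 <= rho * A.[1].
Proof.
have tc : 0 < tau ^+ c by rewrite exprn_gt0.
suff h : A.[tau] <= A.[1] * tau ^+ c.
  rewrite -(ler_pM2r tc) mul1r -[leLHS]rhoA_tau -mulrA; apply: ler_wpM2l => //; exact: ltW.
rewrite -ler_pdivrMr // -exprVn !(horner_coef_wide _ size_A) mulrC.
have hx : 0 <= tau^-1 by rewrite invr_ge0 ltW.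
have h (j : 'I_N0) : tau^-1 ^+ c * (A`_j * tau ^+ j + (tau^-1 - 1) * ((j%:R - c%:R) * (A`_j * tau ^+ j))) <= A`_j * 1 ^+ j.
  have -> : A`_j * 1 ^+ j = A`_j * tau ^+ j * tau^-1 ^+ j.
    by rewrite -mulrA -exprMn mulfV ?gt_eqF.
  have -> : tau^-1 ^+ c * (A`_j * tau ^+ j + (tau^-1 - 1) * ((j%:R - c%:R) * (A`_j * tau ^+ j))) =
    A`_j * tau ^+ j * (tau^-1 ^+ c * (1 + (j%:R - c%:R) * (tau^-1 - 1))) by ring.
  by apply: ler_wpM2l; [rewrite mulr_ge0 ?exprn_ge0 ?(ltW tau_gt0)|exact: bernoulli_shifted].
apply: le_trans (ler_sum _ (fun j _ => h j)).
by rewrite -mulr_sumr big_split /= -mulr_sumr saddle mulr0 addr0.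
Qed.

Let m n k := (meander A c n)`_k.
Let m_ge0 n k : 0 <= m n k := meander_ge0 c A_ge0 n k.

(** At z = rho and u = tau the kernel vanishes, so the kernel equation bounds the low parts by
    tau^c; for k < c they contain A_0 M_k u^k. *)
Lemma coef_sums_below k : (k < c)%N -> exists S, sums_to (fun n => rho ^+ n * m n k) S.
Proof.
move=> kc.
have w0 n : 0 <= rho ^+ n * m n k by rewrite mulr_ge0 ?exprn_ge0 ?(ltW rho_gt0).
have b0 : 0 < rho * A`_0 * tau ^+ k by rewrite !mulr_gt0 ?exprn_gt0.
apply: (@sums_bounded R _ (tau ^+ c / (rho * A`_0 * tau ^+ k))) => // N.
rewrite ler_pdivlMr //.
have := congr1 (fun P : {poly R} => P.[tau]) (kernel_partial A c rho N).
rewrite hornerM /kernel !(hornerD, hornerN, hornerZ, hornerM, hornerXn) rhoA_tau subrr mul0r => h.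
have h1 : rho * (\sum_(n < N) rho ^+ n *: lowpart A c n).[tau] <= tau ^+ c.
  have h2 : 0 <= rho ^+ N * (tau ^+ c * (meander A c N).[tau]).
    apply: mulr_ge0; first by rewrite exprn_ge0 ?ltW.
    apply: mulr_ge0; first by rewrite exprn_ge0 ?ltW.
    by apply: horner_ge0 (ltW tau_gt0); exact: meander_ge0.
  by move: (rho * _) (rho ^+ N * _) h h2 => x y h h2; lra.
apply: le_trans h1; rewrite horner_sum mulr_suml mulr_sumr; apply: ler_sum => n _.
rewrite hornerZ.
have -> : rho ^+ n * m n k * (rho * A`_0 * tau ^+ k) = rho * (rho ^+ n * (A`_0 * m n k * tau ^+ k)) by ring.
apply: ler_wpM2l; first exact: ltW.
apply: ler_wpM2l; first by rewrite exprn_ge0 ?ltW.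
apply: le_trans (coef_le_horner k (lowpart_ge0 c A_ge0 n) (ltW tau_gt0)).
apply: ler_wpM2r; first by rewrite exprn_ge0 ?ltW.
rewrite coef_take_poly kc coefM big_ord_recl subn0 lerDl.
by apply: sumr_ge0 => i _; apply: mulr_ge0 => //; exact: m_ge0.
Qed.

Lemma coef_sums_low z k : 0 < z <= rho -> (k <= c)%N -> exists S, sums_to (fun n => z ^+ n * m n k) S.
Proof.
move=> /andP[z0 zr] kc.
suff [S hS] : exists S, sums_to (fun n => rho ^+ n * m n k) S.
  have [n|X hX _] := sums_comp (x := fun n => z ^+ n * m n k) _ hS; last by exists X.
  rewrite mulr_ge0 ?exprn_ge0 ?(ltW z0) //=; apply: ler_wpM2r => //.
  by apply: lerXn2r; rewrite ?nnegrE ?(ltW z0) ?(ltW rho_gt0).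
move: kc; rewrite leq_eqVlt => /orP[/eqP ->|]; last exact: coef_sums_below.
(* A jump of -c leads from altitude c to 0, so A_0 m_(n,c) <= m_(n+1,0), and k = 0 is already
   settled. *)
have [S hS] := coef_sums_below c_gt0.
have b0 : 0 < rho * A`_0 by rewrite mulr_gt0.
have hS' := sumsZ (a := (rho * A`_0)^-1) (sums_unshift hS).
have [n|X hX _] := sums_comp (x := fun n => rho ^+ n * m n c) _ hS'; last by exists X.
rewrite mulr_ge0 ?exprn_ge0 ?(ltW rho_gt0) //= [leRHS]mulrC ler_pdivlMr //.
have -> : rho ^+ n * m n c * (rho * A`_0) = rho ^+ n.+1 * (A`_0 * m n c) by rewrite exprSr; ring.
apply: ler_wpM2l; first by rewrite exprn_ge0 ?ltW.
rewrite /m /= coef_drop_poly add0n coefM big_ord_recl subn0 lerDl.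
by apply: sumr_ge0 => i _; apply: mulr_ge0 => //; exact: m_ge0.
Qed.

Lemma series_coefs z S : 0 < z -> sums_to (fun n => z ^+ n * (meander A c n).[1]) S ->
  exists2 s, forall k, sums_to (fun n => z ^+ n * m n k) (s k) & sums_to s S.
Proof.
move=> z0 hS.
have w0 n k : 0 <= z ^+ n * m n k by rewrite mulr_ge0 ?exprn_ge0 ?(ltW z0).
have tr n K : \sum_(k < K) z ^+ n * m n k <= z ^+ n * (meander A c n).[1].
  rewrite -mulr_sumr; apply: ler_wpM2l; first by rewrite exprn_ge0 ?(ltW z0).
  apply: le_trans (horner_coef_trunc K (meander_ge0 c A_ge0 n) ler01).
  by rewrite le_eqVlt; apply/orP; left; apply/eqP; apply: eq_bigr => k _; rewrite expr1n mulr1.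
have ex k : exists s, sums_to (fun n => z ^+ n * m n k) s.
  have [n|X hX _] := sums_comp (x := fun n => z ^+ n * m n k) _ hS; last by exists X.
  rewrite w0 /=; apply: le_trans (tr n k.+1); rewrite big_ord_recr /= lerDr.
  by apply: sumr_ge0.
pose s k := sval (cid (ex k)); have hs k : sums_to (fun n => z ^+ n * m n k) (s k).
  exact: (svalP (cid (ex k))).
have s0 k : 0 <= s k := sums_ge0 (w0 ^~ k) (hs k).
have t0 n : 0 <= z ^+ n * (meander A c n).[1].
  by rewrite mulr_ge0 ?exprn_ge0 ?(ltW z0) // horner_ge0 // => j; exact: m_ge0.
have up N : \sum_(k < N) s k <= S.
  have h := sums_ord (F := fun k n => z ^+ n * m n k) (K := N) (fun k _ => hs k).
  apply: sums_le h => M.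
  by apply: le_trans (sums_ge M t0 hS); apply: ler_sum => i _; exact: tr.
have [S1 hS1] := sums_bounded s0 up.
exists s => //; suff -> : S = S1 by [].
apply/eqP; rewrite eq_le (sums_le up hS1) andbT.
apply: sums_le hS => N.
pose K := \max_(n < N) size (meander A c n).
apply: le_trans (sums_ge K s0 hS1).
rewrite (eq_bigr (fun n : 'I_N => \sum_(k < K) z ^+ n * m n k)); last first.
  move=> n _; rewrite -mulr_sumr (@horner_coef_wide _ K); last exact: leq_bigmax.
  by congr (_ * _); apply: eq_bigr => k _; rewrite expr1n mulr1.
rewrite exchange_big; apply: ler_sum => k _; exact: (sums_ge N (w0 ^~ k) (hs k)).
Qed.

Lemma kernel_numer_horner z s (u Mu : R) : 0 < z ->
  (forall k, sums_to (fun n => z ^+ n * m n k) (s k)) ->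
  sums_to (fun k => s k * u ^+ k) Mu ->
  (kernel A c z).[u] * Mu = u ^+ c - z * (lowlim A c s).[u].
Proof.
move=> z0 hs hM; have h1 := conv_poly_sums (P := kernel A c z) hM.
have h2 : sums_to (fun k => conv (fun i => (kernel A c z)`_i) s k * u ^+ k) (numer A c z s).[u].
  apply: (@cvg_eventually_eq R (fun=> (numer A c z s).[u]) _ _ (size (numer A c z s))).
    move=> N hN; rewrite (horner_coef_wide _ hN); apply: eq_bigr => k _.
    by rewrite (kernel_series hs).
  exact: cvg_cst.
rewrite (cvg_uniq h1 h2) /numer.
by rewrite !(hornerD, hornerN, hornerZ, hornerXn).
Qed.

(* Otherwise z1 = 1/P(1) <= z and K vanishes at u = 1 for z = z1; the identity
   K(u) M(u) = numer u <= - u^(c-1) (1 - u) on ]0, 1[ then contradicts K(tau) >= 0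
   if tau < 1, and the double zero of K at 1 if tau = 1. *)
Lemma drift_bound z S : tau <= 1 -> 0 < z <= rho ->
  sums_to (fun n => z ^+ n * (meander A c n).[1]) S -> z * A.[1] < 1.
Proof.
move=> tau1 /andP[z0 zr] hS; rewrite ltNge; apply/negP => zA.
have A1 : 0 < A.[1] by have := lt_le_trans ltr01 zA; rewrite pmulr_rgt0.
pose y := A.[1]^-1; have y0 : 0 < y by rewrite invr_gt0.
have yz : y <= z by rewrite /y -[leLHS]div1r ler_pdivrMr.
have yA : y * A.[1] = 1 by rewrite mulVf // gt_eqF.
have [n|S' hS' _] := sums_comp (x := fun n => y ^+ n * (meander A c n).[1]) _ hS.
  have h : 0 <= (meander A c n).[1] by apply: horner_ge0 => // j; exact: m_ge0.
  rewrite mulr_ge0 ?exprn_ge0 ?(ltW y0) //=; apply: ler_wpM2r => //.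
  by apply: lerXn2r; rewrite ?nnegrE ?(ltW y0) ?(ltW z0).
have [s hs hs1] := series_coefs y0 hS'.
have s0 := s_ge0 A_ge0 y0 hs; have s01 := s0_ge1 A_ge0 y0 hs.
have l0 := lowlim_ge0 A_ge0 y0 hs.
have Ke u : (kernel A c y).[u] = u ^+ c - y * A.[u] by rewrite !(hornerD, hornerN, hornerZ, hornerXn).
have hs1' : sums_to (fun k => s k * 1 ^+ k) S'.
  by apply: cvg_ext hs1 => N; apply: eq_bigr => k _; rewrite expr1n mulr1.
have low1 : y * (lowlim A c s).[1] = 1.
  have := kernel_numer_horner y0 hs hs1'; rewrite Ke expr1n yA subrr mul0r.
  by move/eqP; rewrite eq_sym subr_eq0 => /eqP.
(* [lowlim] has degree below c and y lowlim(1) = 1, hence y lowlim(u) >= u^(c-1) on ]0, 1[. *)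
have key u : 0 < u < 1 -> exists Mu, [/\ 1 <= Mu, Mu <= S' &
    (u ^+ c - y * A.[u]) * Mu <= - (u ^+ c.-1 * (1 - u))].
  move=> /andP[u0 u1].
  have su k : 0 <= s k * u ^+ k <= s k.
    rewrite mulr_ge0 ?exprn_ge0 ?(ltW u0) //=; apply: ler_piMr => //.
    by rewrite exprn_ile1 ?(ltW u0) ?(ltW u1).
  have [Mu hMu MuS] := sums_comp su hs1; exists Mu; split=> //.
    apply: le_trans s01 _; apply: le_trans (sums_ge 1 _ hMu); last by move=> k; case/andP: (su k).
    by rewrite big_ord1 expr0 mulr1.
  rewrite -Ke (kernel_numer_horner y0 hs hMu).
  have h : u ^+ c.-1 <= y * (lowlim A c s).[u].
    rewrite -[leLHS]mul1r -low1 -mulrA; apply: ler_wpM2l; first exact: ltW.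
    rewrite !(horner_coef_wide _ (size_lowlim A c s)) mulr_suml; apply: ler_sum => k _.
    rewrite expr1n mulr1; apply: ler_wpM2l => //.
    apply: ler_wiXn2l; rewrite ?(ltW u0) ?(ltW u1) //.
    by have := ltn_ord k; clear; lia.
  have -> : u ^+ c = u ^+ c.-1 * u by rewrite -exprSr prednK.
  by move: (y * _) (u ^+ _) h => a b h; lra.
move: tau1; rewrite le_eqVlt => /orP[/eqP t1|t1]; last first.
  have tt : 0 < tau < 1 by rewrite tau_gt0.
  have [Mu [M1 _ h]] := key tau tt.
  have h1 : 0 <= tau ^+ c - y * A.[tau].
    rewrite subr_ge0 -rhoA_tau; apply: ler_wpM2r; last exact: le_trans yz zr.
    exact: horner_ge0 (ltW tau_gt0).
  have h2 : 0 < tau ^+ c.-1 * (1 - tau) by rewrite mulr_gt0 ?exprn_gt0 // subr_gt0.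
  have h3 := mulr_ge0 h1 (le_trans ler01 M1).
  by have := le_trans h3 h; rewrite oppr_ge0 leNgt h2.
(* The constant of a lower bound K(1 - t) >= -D t^2: with tau = 1 the terms of order 0 and 1
   cancel. *)
pose D := c%:R ^+ 2 + y * \sum_(j < N0) A`_j * j%:R ^+ 2.
have D0 : 0 <= D.
  apply: addr_ge0; first by rewrite exprn_ge0.
  by apply: mulr_ge0; [exact: ltW|apply: sumr_ge0 => j _; rewrite mulr_ge0 // exprn_ge0].
have Klow t : 0 <= t <= 1 -> - (D * t ^+ 2) <= (1 - t) ^+ c - y * A.[1 - t].
  move=> ht.
  have e1 : c%:R * A.[1] = \sum_(j < N0) j%:R * A`_j.
    have := saddle; rewrite t1 (horner_coef_wide _ size_A) => h; apply/eqP.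
    rewrite -subr_eq0 mulr_sumr -sumrB -oppr_eq0 -sumrN -[X in _ == X]h; apply/eqP.
    by apply: eq_bigr => j _; rewrite expr1n; ring.
  have h1 : A.[1 - t] <= A.[1] - t * (c%:R * A.[1]) + t ^+ 2 * \sum_(j < N0) A`_j * j%:R ^+ 2.
    rewrite e1 !(horner_coef_wide _ size_A) !mulr_sumr -sumrN -!big_split /=; apply: ler_sum => j _.
    have /andP[_ h] := expr_sub_itv j ht.
    apply: le_trans (ler_wpM2l (A_ge0 j) h) _; rewrite le_eqVlt; apply/orP; left; apply/eqP.
    by rewrite expr1n; ring.
  have /andP[h2 _] := expr_sub_itv c ht.
  have h3 := ler_wpM2l (ltW y0) h1.
  have e2 : y * (A.[1] - t * (c%:R * A.[1]) + t ^+ 2 * \sum_(j < N0) A`_j * j%:R ^+ 2) =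
     1 - c%:R * t + t ^+ 2 * (y * \sum_(j < N0) A`_j * j%:R ^+ 2).
    set q := \sum_(j < N0) _.
    transitivity (y * A.[1] - c%:R * t * (y * A.[1]) + t ^+ 2 * (y * q)); first by ring.
    by rewrite yA mulr1.
  rewrite e2 in h3; rewrite /D; have c2 : 0 <= c%:R ^+ 2 * t ^+ 2 by rewrite mulr_ge0 ?sqr_ge0.
  move: (y * \sum_(j < N0) _) (y * A.[1 - t]) ((1 - t) ^+ c) h2 h3 c2 => a b e h2 h3 c2.
  by lra.
have S0 : 1 <= S'.
  have half : 0 < (2^-1 : R) < 1 by apply/andP; split; lra.
  by have [Mu [M1 M2 _]] := key _ half; exact: le_trans M2.
(* Gives 1 - c t = D S' t + t, so (1 - t)^(c-1) >= 1 - (c-1) t exceeds D S' t. *)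
pose t := (c%:R + D * S' + 1)^-1.
have den : 1 < c%:R + D * S' + 1.
  rewrite ltrDr ltr_wpDr // ?ltr0n // mulr_ge0 //; exact: le_trans ler01 S0.
have t0 : 0 < t by rewrite invr_gt0; apply: lt_trans den.
have t1' : t < 1 by rewrite invf_lt1 //; apply: lt_trans den.
have tD : t * (c%:R + D * S' + 1) = 1 by rewrite mulVf // gt_eqF //; apply: lt_trans den.
have u01 : 0 < 1 - t < 1 by apply/andP; split; lra.
have [Mu [M1 M2 h]] := key _ u01.
have t01 : 0 <= t <= 1 by rewrite !ltW.
have h1 := Klow t t01.
have /andP[h2 _] := expr_sub_itv c.-1 t01.
have c1 : (c.-1%:R : R) <= c%:R by rewrite ler_nat leq_pred.
have h3 : - (D * t ^+ 2) * S' <= ((1 - t) ^+ c - y * A.[1 - t]) * Mu.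
  have M0 : 0 <= Mu := le_trans ler01 M1.
  apply: le_trans (ler_wpM2r M0 h1); rewrite !mulNr lerN2; apply: ler_wpM2l => //.
  by rewrite mulr_ge0 // sqr_ge0.
have h4 := le_trans h3 h.
have h5 : (1 - t) ^+ c.-1 * t <= D * S' * t ^+ 2.
  by move: h4; rewrite opprB addrCA subrr addr0 mulNr lerN2 mulrAC.
have h6 : (1 - t) ^+ c.-1 <= D * S' * t.
  by rewrite -(ler_pM2r t0) -[leRHS]mulrA.
have h7 := ler_wpM2r (ltW t0) c1.
move: ((1 - t) ^+ c.-1) h6 h2 => a h6 h2.
have : t * (c%:R + D * S' + 1) = c%:R * t + D * S' * t + t by ring.
by rewrite tD; move: (c%:R * t) (c.-1%:R * t) (D * S' * t) h6 h7 h2 => *; lra.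
Qed.

End Drift.

(** * Catastrophes *)

Section CatastropheSeries.
Variable R : realType.
Variables (c d : nat) (p : int -> R) (q tau : R).
Hypothesis c_gt0 : (0 < c)%N.
Hypothesis p_ge0 : forall j : 'I_(c + d).+1, 0 <= p (@jumpv c d j).
Hypothesis p_bottom : p (- c%:Z) != 0.
Hypothesis p_top : p d%:Z != 0.
Hypothesis p_aper : aperiodic c d p.
Hypothesis q_gt0 : 0 < q.
Hypothesis tau_gt0 : 0 < tau.
Hypothesis tau_crit : Pder c d p tau = 0.

Let A := jump_poly c d p.
Let rho := 1 / Pval c d p tau.
Let m n k := (meander A c n)`_k.
Let M n := (meander A c n).[1].

Let A_ge0 := jump_poly_ge0 p_ge0.
Let m_ge0 n k : 0 <= m n k := meander_ge0 c A_ge0 n k.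
Let rho0 : 0 < rho := rho_gt0 p_ge0 p_bottom tau_gt0.

(* Indicator of the altitudes at which no catastrophe is allowed. *)
Definition exempt (k : nat) : R := if (k == 0%N) || (p (- k%:Z) != 0) then 1 else 0.

Lemma exempt_itv k : 0 <= exempt k <= 1.
Proof. by rewrite /exempt; case: ifP; rewrite ?lexx ?ler01. Qed.

Lemma QcoefS n : Qcoef c d p q n.+1 = q * (M n - \sum_(k < c.+1) exempt k * m n k).
Proof.
rewrite /= Mcoef1_meander mcoef_meander big_ord_recl /exempt eqxx mul1r -addrA -opprD.
congr (_ * (_ - (_ + _))).
rewrite big_add1 big_mkord big_mkcond; apply: eq_bigr => i _.
by rewrite mcoef_meander /=; case: ifP; rewrite ?mul1r ?mul0r.
Qed.

Lemma total_ge_partial n K : \sum_(k < K) m n k <= M n.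
Proof.
apply: le_trans (horner_coef_trunc K (meander_ge0 c A_ge0 n) ler01).
by rewrite le_eqVlt; apply/orP; left; apply/eqP; apply: eq_bigr => k _; rewrite expr1n mulr1.
Qed.

Lemma exempt_le n : 0 <= \sum_(k < c.+1) exempt k * m n k <= \sum_(k < c.+1) m n k.
Proof.
apply/andP; split; first by apply: sumr_ge0 => k _; case/andP: (exempt_itv k) => h _; apply: mulr_ge0.
by apply: ler_sum => k _; case/andP: (exempt_itv k) => _ h; apply: ler_piMl.
Qed.

(** Altitude c + 1 is out of reach of every jump to 0, so its whole mass feeds Q. *)
Lemma Qcoef_lower n : q * m n c.+1 <= Qcoef c d p q n.+1.
Proof.
rewrite QcoefS; apply: ler_wpM2l; first exact: ltW.
have := total_ge_partial n c.+2; rewrite big_ord_recr /=.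
by case/andP: (exempt_le n) => _; move: (\sum_(k < _) _) (\sum_(k < _) _) (m n _) (M n) => *; lra.
Qed.

Lemma Qcoef_ge0 n : 0 <= Qcoef c d p q n.
Proof.
case: n => // n; apply: le_trans (Qcoef_lower n).
by apply: mulr_ge0; [exact: ltW|exact: m_ge0].
Qed.

Lemma total_le_Qcoef n : M n <= q^-1 * Qcoef c d p q n.+1 + \sum_(k < c.+1) m n k.
Proof.
rewrite QcoefS mulKf ?gt_eqF //.
by case/andP: (exempt_le n) => _; move: (\sum_(k < _) _) (\sum_(k < _) _) (M n) => *; lra.
Qed.

(** M is bounded by Q/(q z) plus the M_k with k <= c, which converge on (0, rho] in any case. *)
Lemma Q_sums_total z l : 0 < z <= rho -> Q_sums c d p q z l ->
  exists S, sums_to (fun n => z ^+ n * M n) S.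
Proof.
move=> hz hQ; case/andP: (hz) => z0 zr.
have ex k : (k < c.+1)%N -> exists s, sums_to (fun n => z ^+ n * m n k) s.
  rewrite ltnS => kc; apply: (coef_sums_low A_ge0 _ c_gt0 tau_gt0 rho0 _ hz kc).
    exact: jump_poly_bottom p_ge0 p_bottom.
  exact: rho_tau.
pose s k := if pselect (k < c.+1)%N is left h then sval (cid (ex k h)) else 0.
have hs k : (k < c.+1)%N -> sums_to (fun n => z ^+ n * m n k) (s k).
  by rewrite /s; case: pselect => // h _; exact: (svalP (cid (ex k h))).
have h1 := sums_ord hs.
have h2 : sums_to (fun n => Qcoef c d p q n * z ^+ n) l by exact: hQ.
have h3 := sumsD (sumsZ (a := (q * z)^-1) (sums_unshift h2)) h1.
have [n|X hX _] := sums_comp (x := fun n => z ^+ n * M n) _ h3; last by exists X.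
apply/andP; split.
  by rewrite mulr_ge0 ?exprn_ge0 ?(ltW z0) // horner_ge0 // => j; exact: m_ge0.
have -> : (q * z)^-1 * (Qcoef c d p q n.+1 * z ^+ n.+1) + \sum_(k < c.+1) z ^+ n * m n k =
    z ^+ n * (q^-1 * Qcoef c d p q n.+1 + \sum_(k < c.+1) m n k).
  rewrite -mulr_sumr mulrDr; congr (_ + _); rewrite exprSr; move: (Qcoef _ _ _ _ _) => Q.
  by field; rewrite !gt_eqF.
by apply: ler_wpM2l; [rewrite exprn_ge0 ?(ltW z0)|exact: total_le_Qcoef].
Qed.

(** Among the nonnegative terms of Spitzer's identity, the one with the empty meander is the
    coefficient of P^n itself. *)
Lemma meander_coef_lower n k : (0 < n)%N -> (A ^+ n)`_(c * n + k) <= n%:R * m n k.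
Proof.
move=> n0; have := theta_meander_coef A c 1 k n; rewrite /theta expr1n mul1r => ->.
rewrite big_ord_recr /= subnn -[leLHS]add0r; apply: lerD.
  apply: sumr_ge0 => i _; apply: sumr_ge0 => j _.
  by rewrite !expr1n !mul1r; apply: mulr_ge0; [exact: posW_ge0|exact: meander_ge0].
rewrite /conv big_ord_recr /= subnn expr1n !mul1r coef1 eqxx mulr1 posWE // lerDr.
apply: sumr_ge0 => j _.
by rewrite !expr1n !mul1r; apply: mulr_ge0; [exact: posW_ge0|exact: meander_ge0].
Qed.

Let walk := tilted_walk c_gt0 p_ge0 p_bottom p_top p_aper tau_gt0 tau_crit.

Lemma tilted_step n k : (tilted c d p tau ^+ n)`_(c * n + k) = rho ^+ n * tau ^+ k * (A ^+ n)`_(c * n + k).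
Proof. by rewrite tilted_pow_coef. Qed.

(** The local limit theorem at k = c + 1 makes the free walk weight positive for large n; it passes
    to meanders and then to Q. *)
Lemma Qcoef_gt0 : exists N, forall n, (N <= n)%N -> 0 < Qcoef c d p q n.
Proof.
have [b b0 hb] := cbin_limit R.
have hl := local_limit walk c.+1 hb.
have v0 := walk_var_gt0 walk.
have l0 : 0 < b / Num.sqrt (2 * tilted_var c d p tau).
  by rewrite divr_gt0 // sqrtr_gt0 mulr_gt0.
have l2 : 0 < b / Num.sqrt (2 * tilted_var c d p tau) / 2 by rewrite divr_gt0.
have [N hN] := cvg_eps hl l2.
exists N.+2 => -[//|n] hn; apply: lt_le_trans (Qcoef_lower n).
rewrite mulr_gt0 // -(pmulr_rgt0 (x := n%:R)) ?ltr0n; last by clear -hn; lia.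
apply: lt_le_trans (meander_coef_lower _ _); last by clear -hn; lia.
have h := hN n (ltnW (hn : (N < n)%N)).
have h1 : 0 < rt R n * (tilted c d p tau ^+ n)`_(c * n + c.+1).
  have := ler_norm (- (rt R n * (tilted c d p tau ^+ n)`_(c * n + c.+1) - b / Num.sqrt (2 * tilted_var c d p tau))).
  rewrite normrN => h2; have h3 := le_trans h2 h.
  by move: (rt R n * _) (b / _) h3 l2 => x y; lra.
rewrite pmulr_rgt0 ?rt_gt0 // tilted_step pmulr_rgt0 // in h1.
by rewrite mulr_gt0 ?exprn_gt0.
Qed.

Section Scaled.
Variable z : R.
Hypothesis z_gt0 : 0 < z.

(** Where Q(z) = 1 this is a law of return times, and [Dz] is its renewal sequence. *)
Definition Qz n : R := Qcoef c d p q n * z ^+ n.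
Definition Dz n : R := Dcoef c d p q n * z ^+ n.

Lemma Dcoef_renew n : Dcoef c d p q n = renew (Qcoef c d p q) n.
Proof.
rewrite /Dcoef /renew; suff -> : Dseq c d p q n = renew_seq (Qcoef c d p q) n by [].
by elim: n => //= n ->.
Qed.

Lemma scale_conv (f g : nat -> R) n :
  conv f g n * z ^+ n = conv (fun i => f i * z ^+ i) (fun i => g i * z ^+ i) n.
Proof.
rewrite /conv mulr_suml; apply: eq_bigr => i _.
have hi : (i <= n)%N by rewrite -ltnS.
by rewrite mulrACA -exprD subnKC.
Qed.

Lemma Qz0 : Qz 0 = 0. Proof. by rewrite /Qz mul0r. Qed.

Lemma Qz_ge0 n : 0 <= Qz n.
Proof. by rewrite mulr_ge0 ?Qcoef_ge0 // exprn_ge0 ?(ltW z_gt0). Qed.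

Lemma Qz_gt0 : exists N, forall n, (N <= n)%N -> 0 < Qz n.
Proof.
have [N hN] := Qcoef_gt0; exists N => n /hN h.
by rewrite mulr_gt0 // exprn_gt0.
Qed.

Lemma Dz_eq n : Dz n = delta0 R n + conv Qz Dz n.
Proof.
rewrite /Dz Dcoef_renew renew_eq // mulrDl scale_conv; congr (_ + _).
  by case: n => [|n]; rewrite /delta0 ?expr0 ?mulr1 ?mul0r.
by apply: eq_conv => i _ //; rewrite Dcoef_renew.
Qed.

(** The factor z^n cancels in the quotient, so any z > 0 may be used to normalise. *)
Lemma prob_X_scaled n k : prob_X c d p q n k =
  conv Dz (fun i => z ^+ i * m i k) n / conv Dz (fun i => z ^+ i * M i) n.
Proof.
have zn : z ^+ n != 0 by rewrite expf_neq0 // gt_eqF.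
have e1 : conv Dz (fun i => z ^+ i * m i k) n = Fcoef c d p q n k * z ^+ n.
  have -> : Fcoef c d p q n k = conv (Dcoef c d p q) (fun i => mcoef c d p i k) n by [].
  rewrite scale_conv.
  by apply: eq_conv => i _ //; rewrite mcoef_meander mulrC.
have e2 : conv Dz (fun i => z ^+ i * M i) n = Fcoef1 c d p q n * z ^+ n.
  have -> : Fcoef1 c d p q n = conv (Dcoef c d p q) (Mcoef1 c d p) n by [].
  rewrite scale_conv.
  by apply: eq_conv => i _ //; rewrite Mcoef1_meander mulrC.
by rewrite e1 e2 invfM mulrACA mulfV // mulr1.
Qed.

End Scaled.

Section AtSingularity.
Variables (b S : R) (s : nat -> R).
Hypothesis tau_gt1 : 1 < tau.
Hypothesis b_gt0 : 0 < b.
Hypothesis b_limit : (fun n => rt R n * cbin R n) @ \oo --> b.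
Hypothesis S_sum : sums_to (fun n => rho ^+ n * M n) S.
Hypothesis s_sums : forall k, sums_to (fun n => rho ^+ n * m n k) (s k).

(** The local limit constant of the tilted walk. The next three are the n^(-3/2) constants that it
    produces, at z = rho, for the total mass, for altitude k and for Q. *)
Definition saddle_const : R := b / Num.sqrt (2 * tilted_var c d p tau).
Definition mass_const : R := saddle_const / (1 - tau^-1) * S.
Definition coef_const k : R := \sum_(i < k.+1) saddle_const * tau ^- i * s (k - i)%N.
Definition Q_const : R := rho * q * (mass_const - \sum_(k < c.+1) exempt k * coef_const k).

Lemma saddle_const_gt0 : 0 < saddle_const.
Proof. by rewrite divr_gt0 // sqrtr_gt0 mulr_gt0 // (walk_var_gt0 walk). Qed.

Lemma walk_limit k :
  (fun n => rt R n * (rho ^+ n * tau ^+ k * (A ^+ n)`_(c * n + k))) @ \oo --> saddle_const.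
Proof.
by apply: cvg_ext (local_limit walk k b_limit) => n; rewrite tilted_step.
Qed.

Lemma walk_bound : exists H, forall n k,
  `|rho ^+ n * tau ^+ k * (A ^+ n)`_(c * n + k)| <= H / rt R n.
Proof.
have [H _ hH] := local_limit_bound walk; exists H => n k.
by rewrite -tilted_step.
Qed.

Lemma mass_decay3 : decay3 (fun n => rho ^+ n * M n) mass_const.
Proof.
have [H hH] := walk_bound.
exact: (meander_total_decay3 A_ge0 rho0 tau_gt1 hH walk_limit S_sum).
Qed.

Lemma coef_decay3 k : decay3 (fun n => rho ^+ n * m n k) (coef_const k).
Proof.
have [H hH] := walk_bound.
exact: (meander_coef_decay3 A_ge0 rho0 tau_gt1 hH walk_limit S_sum s_sums).
Qed.

Lemma Qz_decay3 : decay3 (Qz rho) Q_const.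
Proof.
apply: decay3_shift.
have hs : decay3 (fun n => \sum_(k < c.+1) exempt k * (rho ^+ n * m n k)) (\sum_(k < c.+1) exempt k * coef_const k).
  rewrite /decay3; have h (k : nat) : (k < c.+1)%N ->
      (fun n => exempt k * (rt R n ^+ 3 * (rho ^+ n * m n k))) @ \oo --> exempt k * coef_const k.
    by move=> _; apply: seqZ; exact: coef_decay3.
  apply: cvg_ext (cvg_ord_sum (F := fun k n => exempt k * (rt R n ^+ 3 * (rho ^+ n * m n k))) h) => n.
  by rewrite mulr_sumr; apply: eq_bigr => k _; rewrite mulrCA.
have := seqZ (a := rho * q) (seqB mass_decay3 hs); apply: cvg_ext => n.
rewrite /Qz QcoefS [rho ^+ n.+1]exprSr.
have -> : \sum_(k < c.+1) exempt k * (rho ^+ n * m n k) = rho ^+ n * \sum_(k < c.+1) exempt k * m n k.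
  by rewrite mulr_sumr; apply: eq_bigr => k _; rewrite mulrCA.
by move: (\sum_(k < _) _) (M n) (rt R n) (rho ^+ n) => x y w g; ring.
Qed.

(** By [Qcoef_lower] it dominates the constant of altitude c + 1, whose last summand is positive
    since s_0 >= 1. *)
Lemma Q_const_gt0 : 0 < Q_const.
Proof.
have s1 := s0_ge1 A_ge0 rho0 s_sums; have s0 := s_ge0 A_ge0 rho0 s_sums.
have a0 : 0 < coef_const c.+1.
  rewrite /coef_const big_ord_recr /= subnn ltr_wpDl //.
    apply: sumr_ge0 => i _; apply: mulr_ge0 => //.
    by rewrite mulr_ge0 ?(ltW saddle_const_gt0) // invr_ge0 exprn_ge0 ?(ltW tau_gt0).
  apply: mulr_gt0; last exact: lt_le_trans ltr01 s1.
  by rewrite mulr_gt0 ?saddle_const_gt0 // invr_gt0 exprn_gt0.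
apply: (@lt_le_trans _ _ (rho * q * coef_const c.+1)); first by apply: mulr_gt0 a0; exact: mulr_gt0.
have h1 : (fun n => rt R n.+1 ^+ 3 * Qz rho n.+1) @ \oo --> Q_const.
  exact: (@cvg_reindex R (fun n => rt R n ^+ 3 * Qz rho n) Q_const (fun n => n.+1) (fun n => leqnSn n) Qz_decay3).
have h2 := seqZ (a := rho * q) (coef_decay3 (k := c.+1)).
apply: cvg_le h2 h1 => n.
have -> : rho * q * (rt R n ^+ 3 * (rho ^+ n * m n c.+1)) = rt R n ^+ 3 * (q * m n c.+1 * rho ^+ n.+1).
  by rewrite [rho ^+ n.+1]exprSr; ring.
apply: ler_pM.
- by rewrite exprn_ge0 ?rt_ge0.
- apply: mulr_ge0; last by rewrite exprn_ge0 ?(ltW rho0).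
  by apply: mulr_ge0; [exact: ltW|exact: m_ge0].
- by apply: lerXn2r; rewrite ?nnegrE ?rt_ge0 // rt_le.
- by apply: ler_wpM2r; [rewrite exprn_ge0 ?(ltW rho0)|exact: Qcoef_lower].
Qed.

End AtSingularity.

End CatastropheSeries.

(** * The limit laws *)

Section PowerSeriesContinuity.
Variable R : realType.

Lemma partial_sums_lipschitz (a : nat -> R) (r : R) N : 0 <= r ->
  exists2 L, 0 <= L & forall x y, 0 <= x <= r -> 0 <= y <= r ->
    `|\sum_(n < N) a n * x ^+ n - \sum_(n < N) a n * y ^+ n| <= L * `|x - y|.
Proof.
move=> r0.
have pw n : exists2 L, 0 <= L & forall x y, 0 <= x <= r -> 0 <= y <= r ->
    `|x ^+ n - y ^+ n| <= L * `|x - y|.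
  elim: n => [|n [L L0 hL]]; first by exists 0 => // x y _ _; rewrite !expr0 subrr normr0 mul0r.
  exists (r * L + r ^+ n); first by rewrite addr_ge0 ?mulr_ge0 ?exprn_ge0.
  move=> x y hx hy; have -> : x ^+ n.+1 - y ^+ n.+1 = x * (x ^+ n - y ^+ n) + y ^+ n * (x - y).
    by rewrite !exprS; ring.
  case/andP: (hx) => x0 xr; case/andP: (hy) => y0 yr.
  apply: le_trans (ler_normD _ _) _; rewrite !normrM mulrDl; apply: lerD.
    rewrite -mulrA; apply: ler_pM => //; first by rewrite ger0_norm.
    exact: hL.
  apply: ler_wpM2r => //; rewrite ger0_norm ?exprn_ge0 //.
  by apply: lerXn2r; rewrite ?nnegrE.
elim: N => [|N [L L0 hL]].
  by exists 0 => // x y _ _; rewrite !big_ord0 subrr normr0 mul0r.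
have [L' L'0 hL'] := pw N.
exists (L + `|a N| * L'); first by rewrite addr_ge0 ?mulr_ge0.
move=> x y hx hy; rewrite !big_ord_recr /= opprD addrACA -mulrBr.
apply: le_trans (ler_normD _ _) _; rewrite mulrDl; apply: lerD; first exact: hL.
by rewrite normrM -mulrA; apply: ler_wpM2l => //; exact: hL'.
Qed.

(** With nonnegative coefficients the tails on [0, r] are controlled by the tail at r, so the sum is
    continuous up to r. *)
Lemma power_series_ivt (a : nat -> R) (r l v : R) : 0 < r -> (forall n, 0 <= a n) ->
  a 0%N = 0 -> sums_to (fun n => a n * r ^+ n) l -> 0 < v <= l ->
  exists2 x, 0 < x <= r & sums_to (fun n => a n * x ^+ n) v.
Proof.
move=> r0 a0 a00 hl /andP[v0 vl].
have t0 x n : 0 <= x <= r -> 0 <= a n * x ^+ n <= a n * r ^+ n.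
  move=> /andP[x0 xr]; rewrite mulr_ge0 ?exprn_ge0 //=; apply: ler_wpM2l => //.
  by apply: lerXn2r; rewrite ?nnegrE // ltW.
have ex x : exists g, 0 <= x <= r -> sums_to (fun n => a n * x ^+ n) g.
  have [hx|hx] := boolP (0 <= x <= r); last by exists 0.
  have [n|g hg _] := sums_comp (x := fun n => a n * x ^+ n) _ hl; last by exists g.
  exact: t0.
pose g x := sval (cid (ex x)).
have hg x : 0 <= x <= r -> sums_to (fun n => a n * x ^+ n) (g x) := svalP (cid (ex x)).
have zr : 0 <= (0 : R) <= r by rewrite lexx ltW.
have rr : 0 <= r <= r by rewrite lexx ltW.
have g0 : g 0 = 0.
  apply: (cvg_uniq (hg 0 zr)); apply: (@cvg_ext R (fun=> 0)); last exact: cvg_cst.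
  by move=> n; rewrite big1 // => -[[|i] hi] _ /=; rewrite ?a00 ?mul0r // expr0n mulr0.
have gr : g r = l := cvg_uniq (hg r rr) hl.
have [||x hx gx] := @ivt_eps_delta R g 0 r v (ltW r0).
- move=> x e hx e0.
  have nn n : 0 <= a n * r ^+ n by case/andP: (t0 r n rr).
  have e3 : 0 < e / 3 by rewrite divr_gt0.
  have [N hN] := sums_small nn hl e3.
  have tail y : 0 <= y <= r -> 0 <= g y - \sum_(n < N) a n * y ^+ n <= e / 3.
    move=> hy; have nny n : 0 <= a n * y ^+ n by case/andP: (t0 y n hy).
    rewrite subr_ge0 (sums_ge N nny (hg y hy)) /=.
    apply: sums_le (sums_tail (n := N) nny (hg y hy)) => M.
    apply: le_trans (hN N M (leqnn N)); apply: ler_sum => i _.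
    by case/andP: (t0 y (N + i)%N hy).
  have [L L0 hL] := partial_sums_lipschitz a N (ltW r0).
  exists (e / 3 / (L + 1)); first by rewrite divr_gt0 // ltr_wpDl.
  move=> y hy hxy; have h := hL x y hx hy.
  have h2 : L * `|x - y| <= e / 3.
    apply: le_trans (_ : (L + 1) * `|x - y| <= _); first by apply: ler_wpM2r; rewrite ?lerDl.
    by rewrite mulrC -ler_pdivlMr ?ltr_wpDl // ltW.
  have /andP[tx0 tx1] := tail x hx; have /andP[ty0 ty1] := tail y hy.
  have /andP[d1 d2] : - (e / 3) <= \sum_(n < N) a n * x ^+ n - \sum_(n < N) a n * y ^+ n <= e / 3.
    by rewrite -ler_norml; exact: le_trans h h2.
  rewrite ler_norml; apply/andP; split; lra.
- by rewrite g0 gr ge_min (ltW v0) /= le_max vl orbT.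
exists x; last by rewrite -gx; exact: hg.
case/andP: hx => x0 ->; rewrite andbT lt_neqAle x0 andbT.
by apply/eqP => h; move: v0; rewrite -gx -h g0 ltxx.
Qed.

End PowerSeriesContinuity.

Section LimitLaw.
Variable R : realType.
Variables (c d : nat) (p : int -> R) (q tau : R) (v : 'I_d -> R -> R[i]).
Hypothesis c_gt0 : (0 < c)%N.
Hypothesis p_ge0 : forall j : 'I_(c + d).+1, 0 <= p (@jumpv c d j).
Hypothesis p_bottom : p (- c%:Z) != 0.
Hypothesis p_top : p d%:Z != 0.
Hypothesis p_aper : aperiodic c d p.
Hypothesis q_gt0 : 0 < q.
Hypothesis tau_gt0 : 0 < tau.
Hypothesis tau_crit : Pder c d p tau = 0.
Let rho := 1 / Pval c d p tau.
Hypothesis roots : large_roots c p rho v.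

Let A := jump_poly c d p.
Let m n k := (meander A c n)`_k.
Let M n := (meander A c n).[1].
Let A_ge0 := jump_poly_ge0 p_ge0.
Let m_ge0 n k : 0 <= m n k := meander_ge0 c A_ge0 n k.
Let M_ge0 n : 0 <= M n. Proof. by apply: horner_ge0 => // j; exact: m_ge0. Qed.
Let rho_gt0' : 0 < rho := rho_gt0 p_ge0 p_bottom tau_gt0.

Let size_A : (size A <= (c + d).+1)%N. Proof. by rewrite size_jump_poly. Qed.
Let saddle : \sum_(j < (c + d).+1) (j%:R - c%:R) * (A`_j * tau ^+ j) = 0.
Proof. exact: tilt_moment1. Qed.

Lemma total_drift z S : 0 < z <= rho -> sums_to (fun n => z ^+ n * M n) S ->
  tau <= 1 -> z * A.[1] < 1.
Proof.
move=> hz hS t1; apply: (drift_bound A_ge0 c_gt0 size_A tau_gt0 _ saddle t1 hz hS).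
exact: rho_tau.
Qed.

(** For tau <= 1, [drift_bound] would give rho P(1) < 1, whereas tau minimises P and rho P(1) >=
    1. *)
Lemma saddle_gt1 S : sums_to (fun n => rho ^+ n * M n) S -> 1 < tau.
Proof.
move=> hS; rewrite ltNge; apply/negP => t1.
have hr : 0 < rho <= rho by rewrite rho_gt0' lexx.
have := total_drift hr hS t1; rewrite ltNge => /negP; apply.
have rt' : rho * A.[tau] = tau ^+ c by exact: rho_tau.
exact: saddle_minimal A_ge0 size_A tau_gt0 rho_gt0' rt' saddle.
Qed.

Lemma series_total_ge1 z S : 0 < z -> sums_to (fun n => z ^+ n * M n) S -> 1 <= S.
Proof.
move=> z0 hS.
have nn n : 0 <= z ^+ n * M n by rewrite mulr_ge0 ?exprn_ge0 ?(ltW z0).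
apply: le_trans (sums_ge 1 nn hS).
by rewrite big_ord1 expr0 mul1r /M /= hornerC.
Qed.

Lemma coef_series_sums (s : nat -> R) S u : (forall k, 0 <= s k) -> sums_to s S -> `|u| < 1 ->
  exists Mu, sums_to (fun k => s k * u ^+ k) Mu.
Proof.
move=> s0 hS hu; apply: (sums_abs (b := s)) hS => k.
rewrite normrM (ger0_norm (s0 k)) normrX; apply: ler_piMr => //.
by rewrite exprn_ile1 // ltW.
Qed.

Section Pole.
Variables (z S : R) (s : nat -> R).
Hypothesis z_itv : 0 < z <= rho.
Hypothesis Q1 : Q_sums c d p q z 1.
Hypothesis S_sum : sums_to (fun n => z ^+ n * M n) S.
Hypothesis s_sums : forall k, sums_to (fun n => z ^+ n * m n k) (s k).
Hypothesis s_total : sums_to s S.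

Let z0 : 0 < z. Proof. by case/andP: z_itv. Qed.
Let u := Dz c d p q z.
Let f := Qz c d p q z.
Let f0 : f 0%N = 0 := Qz0 c d p q z.
Let f_ge0 n : 0 <= f n := Qz_ge0 p_ge0 q_gt0 z0 n.
Let u_eq n : u n = delta0 R n + conv f u n := Dz_eq c d p q z n.
Let S_ge1 := series_total_ge1 z0 S_sum.

(** Geometric tails give the return time a finite mean mu. By the renewal theorem both convolutions
    converge, and mu cancels in the quotient. *)
Lemma pole_subcritical_limit theta k : 0 <= theta < 1 -> (forall n, z ^+ n * M n <= theta ^+ n) ->
  prob_X c d p q ^~ k @ \oo --> s k / S.
Proof.
move=> ht hb; case/andP: (ht) => t0 t1.
have [N hN] := Qz_gt0 c_gt0 p_ge0 p_bottom p_top p_aper q_gt0 tau_gt0 tau_crit z0.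
have f1 : sums_to f 1 by exact: Q1.
have fb n : f n.+1 <= z * q * theta ^+ n.
  rewrite /f /Qz QcoefS exprSr.
  apply: le_trans (_ : z * q * (z ^+ n * M n) <= _); last first.
    by apply: ler_wpM2l => //; rewrite mulr_ge0 // ltW.
  have -> : z * q * (z ^+ n * M n) = q * M n * (z ^+ n * z) by ring.
  apply: ler_wpM2r; first by rewrite mulr_ge0 ?exprn_ge0 ?(ltW z0).
  apply: ler_wpM2l; first exact: ltW.
  by rewrite gerBl; case/andP: (exempt_le p_ge0 n).
have tb n : 0 <= ftail f n <= z * q / (1 - theta) * theta ^+ n.
  rewrite ftail_ge0 //=; apply: sums_le (sums_tail (n := n.+1) f_ge0 f1) => K.
  apply: le_trans (_ : \sum_(i < K) z * q * theta ^+ n * theta ^+ i <= _).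
    by apply: ler_sum => i _; rewrite addSn; apply: le_trans (fb _) _; rewrite exprD mulrA.
  rewrite -mulr_sumr -[leRHS]mulrA [_^-1 * _]mulrC mulrA; apply: ler_wpM2l.
    by rewrite !mulr_ge0 ?exprn_ge0 // ltW.
  by apply: sums_ge (sums_geometric ht) => i; rewrite exprn_ge0.
have [mu hmu _] := sums_comp tb (sumsZ (a := z * q / (1 - theta)) (sums_geometric ht)).
have hu := renewal_theorem f0 f_ge0 u_eq f1 hN hmu.
have tail_ge0 n : 0 <= ftail f n by case/andP: (tb n).
have mu1 : 1 <= mu.
  by apply: le_trans (sums_ge 1 tail_ge0 hmu); rewrite big_ord1 ftail0.
have mu0 : 0 < mu := lt_le_trans ltr01 mu1.
have S0 : 0 < S := lt_le_trans ltr01 S_ge1.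
have h1 := conv_cvg hu (fun n => mulr_ge0 (exprn_ge0 n (ltW z0)) (m_ge0 n k)) (s_sums (k := k)).
have h2 := conv_cvg hu (fun n => mulr_ge0 (exprn_ge0 n (ltW z0)) (M_ge0 n)) S_sum.
have h3 : mu^-1 * S != 0 by rewrite mulf_neq0 ?invr_eq0 ?gt_eqF.
have := seqM h1 (seqV h3 h2).
have -> : mu^-1 * s k * (mu^-1 * S)^-1 = s k / S by field; rewrite !gt_eqF.
by apply: cvg_ext => n; rewrite (prob_X_scaled c d p q z0).
Qed.

(** Numerator and denominator are u_n times s_k and S up to o(n^(-1/2)), and sqrt(n) u_n stays above
    a positive constant. *)
Lemma pole_critical_limit k : z = rho -> prob_X c d p q ^~ k @ \oo --> s k / S.
Proof.
move=> zr.
have hS : sums_to (fun n => rho ^+ n * M n) S by rewrite -zr.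
have hs j : sums_to (fun n => rho ^+ n * m n j) (s j) by rewrite -zr.
have t1 := saddle_gt1 hS.
have [b b0 hb] := cbin_limit R.
have [N hN] := Qz_gt0 c_gt0 p_ge0 p_bottom p_top p_aper q_gt0 tau_gt0 tau_crit z0.
have f1 : sums_to f 1 by exact: Q1.
have fd : decay3 f (Q_const c d p q tau b S s).
  by rewrite /f zr; exact: (Qz_decay3 c_gt0 p_ge0 p_bottom p_top p_aper tau_gt0 tau_crit t1 hb hS hs).
have l0 : 0 < Q_const c d p q tau b S s.
  exact: (Q_const_gt0 c_gt0 p_ge0 p_bottom p_top p_aper q_gt0 tau_gt0 tau_crit t1 b0 hb hS hs).
have [C C0 hC] := renewal_upper f0 f_ge0 u_eq f1 l0 fd.
have [c0 c00 [N1 hc0]] := renewal_lower f0 f_ge0 u_eq f1 l0 fd.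
have inc := renewal_sqrt_increments f0 f_ge0 u_eq f1 hN l0 fd.
have ub n : `|u n| <= C / rt R n by rewrite ger0_norm // (renewal_ge0 f0 f_ge0 u_eq).
have lim y Y a : (forall n, 0 <= y n) -> decay3 y a -> sums_to y Y ->
    (fun n => rt R n * conv u y n - rt R n * u n * Y) @ \oo --> (0 : R).
  move=> y0 yd yY; have [B _ hB] := decay3_bound_ge0 y0 yd.
  exact: (conv_sqrt_decay ub inc hB yY).
have h1 := lim _ _ _ (fun n => mulr_ge0 (exprn_ge0 n (ltW rho_gt0')) (m_ge0 n k))
  (coef_decay3 c_gt0 p_ge0 p_bottom p_top p_aper tau_gt0 tau_crit t1 hb hS hs (k := k)) (hs k).
have h2 := lim _ _ _ (fun n => mulr_ge0 (exprn_ge0 n (ltW rho_gt0')) (M_ge0 n))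
  (mass_decay3 c_gt0 p_ge0 p_bottom p_top p_aper tau_gt0 tau_crit t1 hb hS) hS.
have S0 : S != 0 by rewrite gt_eqF // (lt_le_trans ltr01 S_ge1).
have ha n : (N1 <= n)%N -> c0 <= rt R n * u n.
  by move=> /hc0 h; rewrite mulrC -ler_pdivrMr ?rt_gt0.
have := cvg_ratio c00 ha h1 h2 S0; apply: cvg_ext => n.
by rewrite invfM mulrACA mulfV ?rt_neq0 // mul1r (prob_X_scaled c d p q rho_gt0') /u zr.
Qed.

Lemma pole_limit k : prob_X c d p q ^~ k @ \oo --> s k / S.
Proof.
case/andP: (z_itv) => _; rewrite le_eqVlt => /orP[/eqP|zr]; first exact: pole_critical_limit.
(* It remains to find t >= 1 with z P(t) < 1: t = 1 by the drift bound if tau <= 1, and t = tau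
   otherwise. *)
have sub_at t : 0 < t -> (forall n, M n <= (meander A c n).[t]) -> z * A.[t] < t ^+ c ->
    prob_X c d p q ^~ k @ \oo --> s k / S.
  move=> t0 hM hsub; apply: (@pole_subcritical_limit (z * A.[t] / t ^+ c)).
    exact: theta0_itv.
  move=> n; apply: le_trans (meander_tau_le c A_ge0 z0 t0 n).
  by apply: ler_wpM2l; [rewrite exprn_ge0 ?(ltW z0)|exact: hM].
have [t1|t1] := leP tau 1.
  apply: (sub_at 1) => //; rewrite expr1n; exact: total_drift z_itv S_sum t1.
apply: (sub_at tau) => //; last exact: subcritical_lt_rho.
move=> n; rewrite /M !horner_coef; apply: ler_sum => i _; apply: ler_wpM2l; first exact: m_ge0.
by rewrite expr1n exprn_ege1 // ltW.
Qed.

Lemma root_prod_taylor : taylor_coefs (fun k => s k / S) (root_prod v z).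
Proof.
exists 1; first exact: ltr01.
move=> x hx; have s0 := s_ge0 A_ge0 z0 s_sums.
have [Mu hMu] := coef_series_sums s0 s_total hx.
exists (Mu / S); split.
  have := sumsZ (a := S^-1) hMu; rewrite mulrC; apply: cvg_ext => N.
  by apply: eq_bigr => k _; rewrite mulrA [S^-1 * _]mulrC.
exact: (root_product c_gt0 p_ge0 p_bottom p_top tau_gt0 roots z_itv s_sums s_total hMu).
Qed.

End Pole.

End LimitLaw.

(** * The law when Q(rho) < 1 *)

Section SubcriticalLaw.
Variable R : realType.
Variables (c d : nat) (p : int -> R) (q tau : R) (v : 'I_d -> R -> R[i]).
Hypothesis c_gt0 : (0 < c)%N.
Hypothesis p_ge0 : forall j : 'I_(c + d).+1, 0 <= p (@jumpv c d j).
Hypothesis p_bottom : p (- c%:Z) != 0.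
Hypothesis p_top : p d%:Z != 0.
Hypothesis p_aper : aperiodic c d p.
Hypothesis q_gt0 : 0 < q.
Hypothesis tau_gt0 : 0 < tau.
Hypothesis tau_crit : Pder c d p tau = 0.
Let rho := 1 / Pval c d p tau.
Hypothesis roots : large_roots c p rho v.

Let m n k := (meander (jump_poly c d p) c n)`_k.
Let M n := (meander (jump_poly c d p) c n).[1].
Let A_ge0 := jump_poly_ge0 p_ge0.
Let m_ge0 n k : 0 <= m n k := meander_ge0 c A_ge0 n k.
Let M_ge0 n : 0 <= M n. Proof. by apply: horner_ge0 => // j; exact: m_ge0. Qed.
Let rho_gt0' : 0 < rho := rho_gt0 p_ge0 p_bottom tau_gt0.
Let rho_itv : 0 < rho <= rho. Proof. by rewrite rho_gt0' lexx. Qed.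

(** If Q(rho) >= 1, continuity from Q(0) = 0 produces a point of (0, rho] where Q = 1. *)
Lemma no_rho0_lt1 phi : Q_sums c d p q rho phi -> no_rho0 c d p q rho -> phi < 1.
Proof.
move=> hphi hno; rewrite ltNge; apply/negP => phi1.
have hv : 0 < (1 : R) <= phi by rewrite ltr01.
have Q0 : Qcoef c d p q 0 = 0 by [].
have [x hx hQ] := power_series_ivt rho_gt0' (Qcoef_ge0 p_ge0 q_gt0) Q0 hphi hv.
by apply: hno; exists x.
Qed.

(** Origin of C: b cancels, and the variance tau^2 P''(tau)/P(tau) under the square root leaves
    sqrt(2 P(tau)/P''(tau)) once multiplied by tau. *)
Lemma saddle_constE b : 0 < b -> 2 * saddle_const c d p tau b / b * tau =
  Num.sqrt (2 * Pval c d p tau / Pder2 c d p tau).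
Proof.
move=> b0; rewrite /saddle_const /tilted_var.
have P0 := Pval_gt0 p_ge0 p_bottom tau_gt0.
have P2 := second_moment_gt0 c_gt0 p_ge0 p_bottom tau_gt0 tau_crit.
move: (Pval c d p tau) (Pder2 c d p tau) P0 P2 => x y x0 y0.
have e1 : Num.sqrt (2 * (tau ^+ 2 * y / x)) = tau * Num.sqrt (2 * y / x).
  have -> : 2 * (tau ^+ 2 * y / x) = tau ^+ 2 * (2 * y / x) by ring.
  by rewrite sqrtrM ?sqr_ge0 // sqrtr_sqr (gtr0_norm tau_gt0).
have q0 : 0 < Num.sqrt (2 * y / x) by rewrite sqrtr_gt0 divr_gt0 // mulr_gt0.
have e2 : Num.sqrt (2 * x / y) * Num.sqrt (2 * y / x) = 2.
  rewrite -sqrtrM; last by rewrite divr_ge0 ?mulr_ge0 // ltW.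
  have -> : 2 * x / y * (2 * y / x) = 2 ^+ 2 by field; rewrite !gt_eqF.
  by rewrite sqrtr_sqr ger0_norm.
rewrite e1; apply: (mulIf (x := Num.sqrt (2 * y / x))); first by rewrite gt_eqF.
by rewrite e2; field; rewrite !gt_eqF.
Qed.

Lemma geometric_signed (a t : R) : `|t| < 1 -> sums_to (fun n => a * t ^+ n) (a / (1 - t)).
Proof.
move=> ht; have := @cvg_geometric_series R a t ht; apply: cvg_ext => n.
by rewrite /series /= big_mkord.
Qed.

Section NoPole.
Variables (b phi eta S : R) (s : nat -> R).
Hypothesis tau_gt1 : 1 < tau.
Hypothesis b_gt0 : 0 < b.
Hypothesis b_limit : (fun n => rt R n * cbin R n) @ \oo --> b.
Hypothesis S_sum : sums_to (fun n => rho ^+ n * M n) S.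
Hypothesis s_sums : forall k, sums_to (fun n => rho ^+ n * m n k) (s k).
Hypothesis s_total : sums_to s S.
Hypothesis phi_lt1 : phi < 1.
Hypothesis eta_sing : is_eta c d p q rho phi eta.

Let u := Dz c d p q rho.
Let f := Qz c d p q rho.
Let f0 : f 0%N = 0 := Qz0 c d p q rho.
Let f_ge0 n : 0 <= f n := Qz_ge0 p_ge0 q_gt0 rho_gt0' n.
Let u_eq n : u n = delta0 R n + conv f u n := Dz_eq c d p q rho n.
Let f_sum : sums_to f phi. Proof. by case: eta_sing. Qed.

Let l := Q_const c d p q tau b S s.
Let k0 := saddle_const c d p tau b.
Let D := (1 - phi)^-1.
Let a k := coef_const c d p tau b s k.

Let f_decay : decay3 f l.
Proof. exact: (Qz_decay3 c_gt0 p_ge0 p_bottom p_top p_aper tau_gt0 tau_crit tau_gt1 b_limit S_sum s_sums). Qed.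

Let l_gt0 : 0 < l.
Proof. exact: (Q_const_gt0 c_gt0 p_ge0 p_bottom p_top p_aper q_gt0 tau_gt0 tau_crit tau_gt1 b_gt0 b_limit S_sum s_sums). Qed.

Let D_gt0 : 0 < D. Proof. by rewrite invr_gt0 subr_gt0. Qed.

Let S_gt0 : 0 < S.
Proof. exact: lt_le_trans ltr01 (series_total_ge1 p_ge0 rho_gt0' S_sum). Qed.

Let k0_gt0 : 0 < k0.
Proof. exact: (saddle_const_gt0 c_gt0 p_ge0 p_bottom p_top p_aper tau_gt0 tau_crit b_gt0). Qed.

(** The substitution z = rho x brings the singularity to 1, where the coefficients of Q have
    n^(-3/2) constant l. *)
Lemma eta_value : eta = 2 * l / b.
Proof.
apply: (sqrt_singularity_unique f_ge0 f_decay f_sum b_gt0 b_limit).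
case: eta_sing => _ [K [del [del0 h]]]; exists K, (del / rho); split; first by rewrite divr_gt0.
move=> x /andP[x1 x2].
have hz : rho - del < rho * x < rho.
  rewrite gtr_pMr // x2 andbT; rewrite ltrBlDl in x1.
  by move: x1; rewrite -(ltr_pM2l rho_gt0') mulr1 mulrDr mulrCA mulfV ?gt_eqF // mulr1; lra.
have [Qx [hQ hb]] := h _ hz; exists Qx; split.
  by apply: cvg_ext hQ => N; apply: eq_bigr => i _; rewrite /f /Qz [(rho * x) ^+ i]exprMn mulrA.
by move: hb; rewrite [rho * x]mulrC mulfK ?gt_eqF.
Qed.

(** Product rule of [decay3_conv]: the renewal sequence has constant l D^2 and sum D, the meander
    masses have constant [mass_const] and sum S. *)
Definition limit_mass : R := l * D ^+ 2 * S + mass_const c d p tau b S * D.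
Definition limit_law k : R := (l * D ^+ 2 * s k + a k * D) / limit_mass.

Lemma mass_factor x Mu : x < tau ->
  l * D ^+ 2 * Mu + k0 / (1 - x / tau) * Mu * D =
  b / 2 * D * Mu * (eta * D + Num.sqrt (2 * Pval c d p tau / Pder2 c d p tau) / (tau - x)).
Proof.
move=> hx; rewrite -(saddle_constE b_gt0) -/k0 eta_value.
have tx : tau - x != 0 by rewrite gt_eqF // subr_gt0.
by field; rewrite tx !gt_eqF.
Qed.

Lemma limit_massE : limit_mass = b / 2 * D * S *
  (eta * D + Num.sqrt (2 * Pval c d p tau / Pder2 c d p tau) / (tau - 1)).
Proof. by rewrite -mass_factor // /limit_mass /mass_const div1r. Qed.

Lemma limit_mass_gt0 : 0 < limit_mass.
Proof.
rewrite /limit_mass; apply: ltr_wpDr; last first.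
  by apply: mulr_gt0 => //; apply: mulr_gt0 => //; rewrite exprn_gt0.
rewrite /mass_const; apply: mulr_ge0; last exact: ltW.
apply: mulr_ge0; last exact: ltW.
by rewrite divr_ge0 ?(ltW k0_gt0) // subr_ge0 invf_le1 // ltW.
Qed.

Lemma limit_law_cvg k : prob_X c d p q ^~ k @ \oo --> limit_law k.
Proof.
have hu := renewal_decay3 f0 f_ge0 u_eq f_sum phi_lt1 f_decay.
have hU := renewal_bounded_sub f0 f_ge0 u_eq f_sum phi_lt1.
have u0 := renewal_ge0 f0 f_ge0 u_eq.
have h1 := decay3_conv u0 (fun n => mulr_ge0 (exprn_ge0 n (ltW rho_gt0')) (m_ge0 n k)) hu
  (coef_decay3 c_gt0 p_ge0 p_bottom p_top p_aper tau_gt0 tau_crit tau_gt1 b_limit S_sum s_sums (k := k))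
  hU (s_sums (k := k)).
have h2 := decay3_conv u0 (fun n => mulr_ge0 (exprn_ge0 n (ltW rho_gt0')) (M_ge0 n)) hu
  (mass_decay3 c_gt0 p_ge0 p_bottom p_top p_aper tau_gt0 tau_crit tau_gt1 b_limit S_sum)
  hU S_sum.
rewrite -exprVn -/D -/(mass_const c d p tau b S) -/limit_mass in h2.
rewrite -exprVn -/D -/(a k) in h1.
have := seqM h1 (seqV (lt0r_neq0 limit_mass_gt0) h2); apply: cvg_ext => n.
rewrite invfM mulrACA mulfV ?mul1r ?(prob_X_scaled c d p q rho_gt0') //.
by rewrite expf_neq0 // rt_neq0.
Qed.

(** [coef_const] is the Cauchy product of k0 tau^(-i) with s, which gives the factor k0/(1 -
    x/tau). *)
Lemma coef_const_series x Mu : `|x| < 1 -> sums_to (fun k => s k * x ^+ k) Mu ->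
  sums_to (fun k => a k * x ^+ k) (k0 / (1 - x / tau) * Mu).
Proof.
move=> hx hMu.
have ht : `|x / tau| < 1.
  rewrite normrM normfV (gtr0_norm tau_gt0) ltr_pdivrMr // mul1r; exact: lt_trans tau_gt1.
have hg := geometric_signed (a := k0) ht.
have hn : sums_to (fun n => `|k0 * (x / tau) ^+ n|) (k0 / (1 - `|x / tau|)).
  have := @geometric_signed k0 `|x / tau|; rewrite normr_id => /(_ ht); apply: cvg_ext => N.
  by apply: eq_bigr => i _; rewrite (normrM k0) (gtr0_norm k0_gt0) (normrX _ (x / tau)).
have := sums_conv_abs hn hg hMu; apply: cvg_ext => N; apply: eq_bigr => k _.
rewrite /a /coef_const mulr_suml; apply: eq_bigr => i _.
have hi : (i <= k)%N by rewrite -ltnS.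
have -> : x ^+ k = x ^+ i * x ^+ (k - i) by rewrite -exprD subnKC.
by rewrite exprMn exprVn /k0; ring.
Qed.

Lemma limit_law_taylor : taylor_coefs limit_law (fun x : R =>
  (((eta * D + Num.sqrt (2 * Pval c d p tau / Pder2 c d p tau) / (tau - x)) /
    (eta * D + Num.sqrt (2 * Pval c d p tau / Pder2 c d p tau) / (tau - 1)))%:C)%C * root_prod v rho x).
Proof.
exists 1; first exact: ltr01.
move=> x hx; have s0 := s_ge0 A_ge0 rho_gt0' s_sums.
have [Mu hMu] := coef_series_sums s0 s_total hx.
have xt : x < tau by apply: le_lt_trans (ler_norm x) _; exact: lt_trans tau_gt1.
have ha := coef_const_series hx hMu.
exists ((l * D ^+ 2 * Mu + k0 / (1 - x / tau) * Mu * D) / limit_mass); split.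
  have := sumsZ (a := limit_mass^-1) (sumsD (sumsZ (a := l * D ^+ 2) hMu) (sumsZ (a := D) ha)).
  have -> : limit_mass^-1 * (l * D ^+ 2 * Mu + D * (k0 / (1 - x / tau) * Mu)) =
      (l * D ^+ 2 * Mu + k0 / (1 - x / tau) * Mu * D) / limit_mass.
    by rewrite mulrC [D * _]mulrC.
  apply: cvg_ext => N; apply: eq_bigr => k _.
  by rewrite /limit_law; ring.
rewrite -(root_product c_gt0 p_ge0 p_bottom p_top tau_gt0 roots rho_itv s_sums s_total hMu).
rewrite -rmorphM; congr (_%:C)%C.
rewrite (mass_factor _ xt) limit_massE.
set E := _ + _ / (tau - x); set E1 := _ + _ / (tau - 1).
have E10 : E1 != 0.
  by apply/eqP => h; have := limit_mass_gt0; rewrite limit_massE -/E1 h mulr0 ltxx.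
by field; rewrite E10 !gt_eqF.
Qed.

End NoPole.

End SubcriticalLaw.

Theorem theorem4p16 (R : realType) (c d : nat) (p : int -> R) (q : R)
  (tau : R) (v : 'I_d -> R -> R[i]) :
  (1 <= c)%N -> (1 <= d)%N ->
  (forall j : 'I_(c + d).+1, 0 <= p (@jumpv c d j)) ->
  p (- c%:Z) != 0 -> p d%:Z != 0 ->
  aperiodic c d p ->
  0 < q ->
  is_tau c d p tau ->
  let rho := 1 / Pval c d p tau in
  @large_roots R c d p rho v ->
  (* case rho0 <= rho exists *)
  (forall rho0 : R, is_rho0 c d p q rho rho0 ->
     exists w : nat -> R,
       (forall k, prob_X c d p q ^~ k @ \oo --> w k) /\
       taylor_coefs w (root_prod v rho0)) /\
  (* case rho0 does not exist *)
  (no_rho0 c d p q rho ->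
   forall Qrho eta : R, is_eta c d p q rho Qrho eta ->
     let Drho := 1 / (1 - Qrho) in
     let C := Num.sqrt (2 * Pval c d p tau / Pder2 c d p tau) in
     exists w : nat -> R,
       (forall k, prob_X c d p q ^~ k @ \oo --> w k) /\
       taylor_coefs w (fun u : R =>
         (((eta * Drho + C / (tau - u)) / (eta * Drho + C / (tau - 1)))%:C)%C
           * root_prod v rho u)).
Proof.
move=> c1 d1 p0 pc pd aper q0 [t0 tcrit _] rho hroots; split.
  move=> rho0 [hr hQ _].
  have [S hS] := Q_sums_total c1 p0 pc q0 t0 hr hQ.
  have rho00 : 0 < rho0 by case/andP: hr.
  have [s hs hsS] := series_coefs (jump_poly_ge0 p0) rho00 hS.
  exists (fun k => s k / S); split; last exact: (root_prod_taylor c1 p0 pc pd t0 hroots hr hs hsS).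
  by move=> k; exact: (pole_limit c1 p0 pc pd aper q0 t0 tcrit hr hQ hS hs (k := k)).
move=> hno Qrho eta heta Drho C.
have r0 : 0 < rho := rho_gt0 p0 pc t0.
have hr : 0 < rho <= rho by rewrite r0 lexx.
(* [is_eta] carries the convergence of Q at rho, hence that of M(rho,1), which in turn forces tau >
   1. *)
have hQ : Q_sums c d p q rho Qrho by case: heta.
have [S hS] := Q_sums_total c1 p0 pc q0 t0 hr hQ.
have [s hs hsS] := series_coefs (jump_poly_ge0 p0) r0 hS.
have t1 := saddle_gt1 c1 p0 pc pd t0 tcrit hS.
have phi1 := no_rho0_lt1 p0 pc q0 t0 hQ hno.
have [b b0 hb] := cbin_limit R.
exists (limit_law c d p q tau b Qrho S s); split.
  by move=> k; exact: (limit_law_cvg c1 p0 pc pd aper q0 t0 tcrit t1 b0 hb hS hs phi1 heta (k := k)).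
have -> : Drho = (1 - Qrho)^-1 by rewrite /Drho [LHS]div1r.
have := (limit_law_taylor c1 p0 pc pd aper q0 t0 tcrit hroots t1 b0 hb hS hs hsS phi1 heta); exact.
Qed.
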